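(* If $P$ satisfies SYM, BAL, POS and MIN, then for all $d>0$, $$\mathrm{corr}^\star(d)=\mathrm{corr}^*(d)=\lim_{\ell\to\infty}\limsup_{n\to\infty}\frac1n\sum_{y\in V_n}\sum_{s\in\Omega}\mathbb E\Big[\big|\langle\mathbf 1\{\boldsymbol\sigma(y)=s\}\mid\nabla_{\ell}(\mathbb G^*,y)\rangle_{\mathbb G^*}(\boldsymbol\sigma^* )-1/q\big|\,\Big|\,\mathfrak S\Big].$$
   Context: Setting: $\Omega$ finite, $q=|\Omega|$, $k\geq2$; weight functions $\psi:\Omega^k\to(0,2)$; $\psi^\theta(\sigma_1,\ldots,\sigma_k)=\psi(\sigma_{\theta(1)},\ldots,\sigma_{\theta(k)})$; $\Psi$ a measurable set of weight functions (in $\mathbb R^{\Omega^k}$) closed under all $\psi\mapsto\psi^\theta$; $P$ a probability distribution on $\Psi$, $\boldsymbol\psi\sim P$, $\xi=q^{-k}\sum_\sigma\mathbb E[\boldsymbol\psi(\sigma)]$. Standing assumption: $\mathbb E[\ln^8(1-\max_\tau|1-\boldsymbol\psi(\tau)|)]<\infty$, $\mathbb E[\max_\tau\boldsymbol\psi(\tau)^{-4}]<\infty$, $\sum_\tau\mathbb E[(\boldsymbol\psi(\tau)-\xi)^2]>0$. Factor graphs: variable nodes $V$, constraint nodes $F$, ordered neighbourhoods $\partial a\in V^k$, weights $\psi_a$; distances in the bipartite graph; Gibbs measure $\mu_G(\sigma)\propto\prod_a\psi_a(\sigma(\partial_1a),\ldots,\sigma(\partial_ka))$ with expectation $\langle\cdot\rangle_G$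 over $\boldsymbol\sigma\sim\mu_G$. For a variable node $y$, $\nabla_\ell(G,y)$ is the $\sigma$-algebra generated by $\boldsymbol\sigma(z)$ for variable nodes $z$ at distance at least $2\ell$ from $y$; $\langle\mathbf 1\{\boldsymbol\sigma(y)=s\}\mid\nabla_\ell(\mathbb G^*,y)\rangle_{\mathbb G^*}(\boldsymbol\sigma^* )$ denotes the $\mu_{\mathbb G^*}$-conditional probability that $\boldsymbol\sigma(y)=s$ given that $\boldsymbol\sigma(z)=\boldsymbol\sigma^*(z)$ for all variable nodes $z$ at distance at least $2\ell$ from $y$. Teacher–student model: for $\sigma\in\Omega^{V_n}$, $V_n=\{x_1,\ldots,x_n\}$, $\mathbb G^*(n,m,\sigma)$ has $m$ constraint nodes whose pairs $(\partial a_j,\psi_{a_j})$ are independent with $\Pr[\partial a_j=(y_1,\ldots,y_k),\psi_{a_j}\in\mathcal A]=\mathbb E[\mathbf 1\{\boldsymbol\psi\in\mathcal A\}\boldsymbol\psi(\sigma(y_1),\ldots,\sigma(y_k))]/\sum_{z_1,\ldots,z_k\in V_n}\mathbb E[\boldsymbol\psi(\sigma(z_1),\ldots,\sigma(z_k))]$. The ground truth $\boldsymbol\sigma^*$ is uniform on $\Omega^{V_n}$, $\boldsymbol m\sim\mathrm{Po}(dn/k)$ independent, and $\mathbb G^*=\mathbb G^*(n,\boldsymbol m,\boldsymbol\sigma^* )$. $\mathfrak S$: each constraint node has $k$ distinct neighbours and no two constraint nodes share a neighbour set. $\mathrm{corr}^*(d)=\lim_{\ell\to\infty}\limsup_{n\to\infty}\frac1n\sum_{y\in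 V_n}\sum_{s\in\Omega}\mathbb E|\Pr[\boldsymbol\sigma^*(y)=s\mid\nabla^*_\ell(\mathbb G^*,\boldsymbol\sigma^*,y)]-1/q|$, where $\nabla^*_\ell(\mathbb G^*,\boldsymbol\sigma^*,y)$ is the $\sigma$-algebra generated by $\mathbb G^*$ and the variables $\boldsymbol\sigma^*(z)$, $z$ at distance at least $2\ell$ from $y$. Tree: $\mathbb T(d,P)$ is the multi-type Galton–Watson tree with root variable node $r$, each variable node having $\mathrm{Po}(d)$ constraint-node children with independent weights from $P$, each constraint node having $k-1$ variable-node children; $\mathbb T^\ell(d,P)$ deletes all nodes at distance $>2\ell$ from $r$. $\mathrm{corr}^\star(d)=\lim_{\ell\to\infty}\sum_{s\in\Omega}\mathbb E\langle|\langle\mathbf 1\{\boldsymbol\sigma(r)=s\}\mid\nabla_\ell(\mathbb T^\ell(d,P),r)\rangle_{\mathbb T^\ell(d,P)}-1/q|\rangle_{\mathbb T^\ell(d,P)}$. Conditions: SYM: $\sum_\tau\mathbf 1\{\tau_i=\omega\}\psi(\tau)=q^{k-1}\xi$ for all $i,\omega,\psi\in\Psi$, and $P$ invariant under every $\psi\mapsto\psi^\theta$. BAL: $\mu\in\mathcal P(\Omega)\mapsto\sum_\tau\mathbb E[\boldsymbol\psi(\tau)]\prod_i\mu(\tau_i)$ concave, maximized at uniform. MIN: among distributions $\rho$ on $\Omega^2$ with uniform marginals, $\rho\mapsto\sum_{\sigma,\tau\in\Omega^k}\mathbb E[\boldsymbol\psi(\sigma)\boldsymbol\psi(\tau)]\prod_i\rho(\sigma_i,\tau_i)$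 has the uniform distribution as unique global minimizer. POS: for all $\pi,\pi'$ probability measures on $\mathcal P(\Omega)$ with uniform mean, $\vec\rho_i\sim\pi$, $\vec\rho'_i\sim\pi'$, $\boldsymbol\psi\sim P$ independent, $\Lambda(x)=x\ln x$: $\mathbb E[\Lambda(\sum_\tau\boldsymbol\psi(\tau)\prod_{i}\vec\rho_i(\tau_i))+(k-1)\Lambda(\sum_\tau\boldsymbol\psi(\tau)\prod_{i}\vec\rho'_i(\tau_i))-k\Lambda(\sum_\tau\boldsymbol\psi(\tau)\vec\rho_1(\tau_1)\prod_{i\geq2}\vec\rho'_i(\tau_i))]\geq0$. *)

(* Defs.v *)
From HB Require Import structures.
From mathcomp Require Import all_boot all_order all_algebra all_fingroup.
From mathcomp Require Import all_classical all_reals all_analysis.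
From mathcomp Require Import measurable_realfun.

Set Implicit Arguments.
Unset Strict Implicit.
Unset Printing Implicit Defensive.

Import Order.TTheory GRing.Theory Num.Theory.
Import numFieldNormedType.Exports.

Local Open Scope classical_set_scope.
Local Open Scope ring_scope.

(* Nonempty finite sets; the base point only serves to make the sample spaces
   below (pointed) measurable types. *)
#[short(type="finPointedType")]
HB.structure Definition FinPointed := {T of Finite T & Pointed T}.

HB.instance Definition _ (I : finType) (T : pointedType) :=
  isPointed.Build {ffun I -> T} [ffun=> point].
HB.instance Definition _ (I : finType) (T : finPointedType) :=
  @isMeasurable.Build default_measure_display {ffun I -> T}
    discrete_measurable discrete_measurable0
    discrete_measurableC discrete_measurableU.
HB.instance Definition _ (n : nat) := isPointed.Build 'I_n.+1 ord0.

(* Generators of the coarsest sigma-algebra making every coordinate ev _ i Borel. *)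
Definition coord_sets (R : realType) (T I : Type) (ev : T -> I -> R) :
    set (set T) :=
  [set A | exists i (B : set R), measurable B /\ A = [set t | B (ev t i)]].

Section iid.
Context d (T : measurableType d) (R : realType).

Definition cons_pair n (x : T * n.-tuple T) : n.+1.-tuple T := cons_tuple x.1 x.2.

Lemma measurable_cons_pair n : measurable_fun setT (@cons_pair n).
Proof. exact: (measurable_cons measurable_fst measurable_snd). Qed.

HB.instance Definition _ n :=
  isMeasurableFun.Build _ _ _ _ (@cons_pair n) (@measurable_cons_pair n).

(* The n-fold product measure. *)
Fixpoint iid (mu : probability T R) n : probability (n.-tuple T) R :=
  if n is m.+1 then distribution (mu \x iid mu m)%E (@cons_pair m)
  else \d_([tuple] : 0.-tuple T).

End iid.

Definition measure_seq_display : measure_display -> measure_display.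
Proof. exact. Qed.

Section measurable_seq.
Context d (T : measurableType d).

Definition seq_measurable : set (set (seq T)) :=
  [set A | forall n, measurable [set t : n.-tuple T | A (tval t)]].

Let seq_measurable0 : seq_measurable set0.
Proof. by move=> n; exact: measurable0. Qed.

Let seq_measurableC A : seq_measurable A -> seq_measurable (~` A).
Proof. by move=> mA n; exact: measurableC (mA n). Qed.

Let seq_measurableU (F : (set (seq T))^nat) :
  (forall i, seq_measurable (F i)) -> seq_measurable (\bigcup_i F i).
Proof. by move=> mF n; apply: bigcupT_measurable => i; exact: mF. Qed.

HB.instance Definition _ := isPointed.Build (seq T) [::].
HB.instance Definition _ := @isMeasurable.Build (measure_seq_display d) (seq T)
  seq_measurable seq_measurable0 seq_measurableC seq_measurableU.

End measurable_seq.

Section poisson_iid.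
Context d (T : measurableType d) (R : realType).
Variables (rate : R) (mu : probability T R).
Local Open Scope ereal_scope.

(* The law of (X_1, ..., X_N) with N ~ Po(rate) and X_1, X_2, ... i.i.d. of law
   mu, independent of N. *)
Definition poisson_iid (A : set (seq T)) : \bar R :=
  \int[poisson_prob rate 0%N]_n iid mu n [set t | A (tval t)].

Let poisson_iid0 : poisson_iid set0 = 0.
Proof. by rewrite /poisson_iid integral0_eq// => n _; exact: measure0. Qed.

Let poisson_iid_ge0 A : 0 <= poisson_iid A.
Proof. by apply: integral_ge0 => n _; exact: measure_ge0. Qed.

Let poisson_iid_sigma_additive : semi_sigma_additive poisson_iid.
Proof.
move=> F mF tF mUF.
rewrite [X in _ --> X](_ : _ = \sum_(n <oo) poisson_iid (F n)).
  apply/cvg_closeP; split; last by rewrite closeE.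
  by apply: is_cvg_nneseries => *; exact: poisson_iid_ge0.
rewrite -integral_nneseries//.
apply: eq_integral => n _; apply/esym/cvg_lim => //=.
apply: (@measure_semi_sigma_additive _ _ _ (iid mu n)
         (fun i => [set t : n.-tuple T | F i (tval t)])) => [i||].
- exact: mF.
- by apply/trivIsetP => i j _ _ ij; move/trivIsetP : tF => /(_ i j I I ij) Fij;
    apply/seteqP; split => // t [Fi Fj]; have : (F i `&` F j) (tval t) by [];
    rewrite Fij.
- exact: (mUF n).
Qed.

HB.instance Definition _ := isMeasure.Build _ _ _ poisson_iid
  poisson_iid0 poisson_iid_ge0 poisson_iid_sigma_additive.

Let poisson_iid_setT : poisson_iid setT = 1.
Proof.
rewrite /poisson_iid (eq_integral (cst 1)); last first.
  by move=> n _ /=; exact: probability_setT.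
by rewrite integral_cst// mul1e; exact: probability_setT.
Qed.

HB.instance Definition _ :=
  Measure_isProbability.Build _ _ _ poisson_iid poisson_iid_setT.

End poisson_iid.

Section weight.
Variables (R : realType) (Omega : finType) (k : nat).

Record weight := Weight {
  weight_fun :> {ffun {ffun 'I_k -> Omega} -> R} ;
  weight_bounds : [forall tau, 0 < weight_fun tau < 2] }.

HB.instance Definition _ := [isSub for weight_fun].
HB.instance Definition _ := [Choice of weight by <:].


Lemma weight_one_bounds :
  [forall tau, 0 < ([ffun=> 1] : {ffun {ffun 'I_k -> Omega} -> R}) tau < 2].
Proof. by apply/forallP => tau; rewrite ffunE ltr01 ltr1n. Qed.

HB.instance Definition _ := isPointed.Build weight (Weight weight_one_bounds).
HB.instance Definition _ := Measurable.copy weight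
  (g_sigma_algebraType (coord_sets (fun (psi : weight) tau => psi tau))).

Lemma measurable_weight_eval tau : measurable_fun setT (fun psi : weight => psi tau).
Proof.
move=> _ B mB; rewrite setTI; apply: sub_sigma_algebra.
by exists tau, B.
Qed.

Lemma weight_gt0 (psi : weight) tau : 0 < psi tau.
Proof. by have /forallP/(_ tau)/andP[] := weight_bounds psi. Qed.

Lemma weight_lt2 (psi : weight) tau : psi tau < 2.
Proof. by have /forallP/(_ tau)/andP[] := weight_bounds psi. Qed.

Definition local_spins (V : finType) (s : {ffun V -> Omega})
    (y : {ffun 'I_k -> V}) : {ffun 'I_k -> Omega} := [ffun i => s (y i)].

Lemma perm_weight_bounds (theta : {perm 'I_k}) (psi : weight) :
  [forall tau, 0 < ([ffun tau : {ffun 'I_k -> Omega} =>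
     psi (local_spins tau (finfun theta))] :
     {ffun {ffun 'I_k -> Omega} -> R}) tau < 2].
Proof. by apply/forallP => tau; rewrite ffunE weight_gt0 weight_lt2. Qed.

Definition perm_weight theta psi := Weight (perm_weight_bounds theta psi).

End weight.

Section distr.
Variable R : realType.

Record distr (T : finType) := Distr {
  distr_fun :> {ffun T -> R} ;
  distrP : [forall x, 0 <= distr_fun x] && (\sum_x distr_fun x == 1) }.

HB.instance Definition _ (T : finType) := [isSub for @distr_fun T].
HB.instance Definition _ (T : finType) := [Choice of distr T by <:].

Lemma dirac_distr_subproof (T : finPointedType) :
  let f := [ffun x : T => (x == point)%:R : R] in
  [forall x, 0 <= f x] && (\sum_x f x == 1).
Proof.
apply/andP; split; first by apply/forallP => x; rewrite ffunE ler0n.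
rewrite (bigD1 point)//= big1 ?addr0 ?ffunE ?eqxx// => x /negbTE xp.
by rewrite ffunE xp.
Qed.

HB.instance Definition _ (T : finPointedType) :=
  isPointed.Build (distr T) (Distr (dirac_distr_subproof T)).
HB.instance Definition _ (T : finPointedType) := Measurable.copy (distr T)
  (g_sigma_algebraType (coord_sets (fun (mu : distr T) x => mu x))).

End distr.

Section constraint_law.
Variables (R : realType) (Omega : finPointedType) (k : nat).
Variable P : probability (weight R Omega k) R.
Variables (n : nat) (sigma : {ffun 'I_n.+1 -> Omega}).
Local Open Scope ereal_scope.

Definition constraint_mass (A : set ({ffun 'I_k -> 'I_n.+1} * weight R Omega k))
    : \bar R :=
  \sum_(y : {ffun 'I_k -> 'I_n.+1})
     \int[P]_(psi in [set psi | A (y, psi)]) (psi (local_spins sigma y))%:E.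

(* The joint law of (neighbourhood, weight) of one constraint node given sigma. *)
Definition constraint_law (A : set ({ffun 'I_k -> 'I_n.+1} * weight R Omega k))
    : \bar R :=
  ((fine (constraint_mass setT))^-1)%:E * constraint_mass A.

Let eval_ge0 (tau : {ffun 'I_k -> Omega}) (psi : weight R Omega k) : 0 <= (psi tau)%:E.
Proof. by rewrite lee_fin ltW ?weight_gt0. Qed.

Let meval (tau : {ffun 'I_k -> Omega}) D :
  measurable_fun D (EFin \o (fun psi : weight R Omega k => psi tau)).
Proof.
apply: measurable_funTS; apply/measurable_EFinP.
exact: measurable_weight_eval.
Qed.

Let mass0 : constraint_mass set0 = 0.
Proof. by rewrite /constraint_mass big1// => y _; rewrite integral_set0. Qed.

Let mass_ge0 A : 0 <= constraint_mass A.
Proof. by apply: sume_ge0 => y _; apply: integral_ge0. Qed.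

Let mass_bigcup F : (forall i, measurable (F i)) -> trivIset setT F ->
  constraint_mass (\bigcup_i F i) = \sum_(i <oo) constraint_mass (F i).
Proof.
move=> mF tF; rewrite nneseries_sum; last first.
  by move=> y i _; apply: integral_ge0.
apply: eq_bigr => y _.
rewrite -(@ge0_integral_bigcup _ _ _ P (fun i => [set psi | F i (y, psi)]))//.
- by move=> i; rewrite -[X in measurable X]setTI; exact: pair1_measurable.
- exact: meval.
- apply/trivIsetP => i j _ _ ij; move/trivIsetP : tF => /(_ i j I I ij) Fij.
  apply/seteqP; split => // psi [Fi Fj].
  by have : (F i `&` F j) (y, psi) by []; rewrite Fij.
Qed.

Let mass_fin : (fine (constraint_mass setT))%:E = constraint_mass setT.
Proof.
rewrite fineK// ge0_fin_numE//; apply: lte_sum_pinfty => y _.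
apply: (@le_lt_trans _ _ (\int[P]_psi (cst 2%:E psi))).
  apply: ge0_le_integral; [exact: measurableT|by []|exact: meval| |].
    exact: measurable_cst.
  by move=> psi _ /=; rewrite lee_fin ltW ?weight_lt2.
rewrite integral_cst; last exact: measurableT.
by rewrite [X in _ * X](probability_setT P) mule1 ltry.
Qed.

Let mass_gt0 : 0 < constraint_mass setT.
Proof.
rewrite lt0e mass_ge0 andbT; apply/eqP => m0.
pose y : {ffun 'I_k -> 'I_n.+1} := [ffun=> ord0].
have int0 : \int[P]_psi (psi (local_spins sigma y))%:E = 0.
  apply/eqP; rewrite eq_le integral_ge0 ?andbT//.
  rewrite -[leRHS]m0 /constraint_mass (bigD1 y)//=.
  by rewrite leeDl// sume_ge0// => z _; exact: integral_ge0.
have : \int[P]_psi `|(psi (local_spins sigma y))%:E| = 0.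
  by rewrite -[RHS]int0; apply: eq_integral => psi _; rewrite gee0_abs.
move/(ae_eq_integral_abs P measurableT (@meval _ setT)).1 => [N [mN PN0 NT]].
have NE : N = setT.
  apply/seteqP; split => // psi _; apply: NT => /= /(_ Logic.I) [] /eqP.
  by rewrite gt_eqF// weight_gt0.
by move: PN0; rewrite NE [LHS](probability_setT P) => /eqP; rewrite onee_eq0.
Qed.

Let law0 : constraint_law set0 = 0.
Proof. by rewrite /constraint_law mass0 mule0. Qed.

Let law_ge0 A : 0 <= constraint_law A.
Proof. by apply: mule_ge0 => //; rewrite lee_fin invr_ge0 fine_ge0. Qed.

Let law_sigma_additive : semi_sigma_additive constraint_law.
Proof.
move=> F mF tF mUF.
rewrite /constraint_law mass_bigcup// -nneseriesZl//.
apply/cvg_closeP; split; last by rewrite closeE.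
by apply: is_cvg_nneseries => *; exact: law_ge0.
Qed.

HB.instance Definition _ := isMeasure.Build _ _ _ constraint_law
  law0 law_ge0 law_sigma_additive.

Let law_setT : constraint_law setT = 1.
Proof.
by rewrite /constraint_law -[X in _ * X]mass_fin -EFinM mulVf// gt_eqF// -lte_fin mass_fin.
Qed.

HB.instance Definition _ :=
  Measure_isProbability.Build _ _ _ constraint_law law_setT.

End constraint_law.

Section teacher_law.
Variables (R : realType) (Omega : finPointedType) (k : nat).
Variables (P : probability (weight R Omega k) R) (d : R) (n : nat).
Local Open Scope ereal_scope.

(* The joint law of the ground truth and of the list of (neighbourhood, weight)
   pairs of the constraint nodes, for n.+1 variable nodes. *)
Definition teacher_law
    (A : set ({ffun 'I_n.+1 -> Omega} *
              seq ({ffun 'I_k -> 'I_n.+1} * weight R Omega k))) : \bar R :=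
  \sum_(sigma : {ffun 'I_n.+1 -> Omega})
    (#|{ffun 'I_n.+1 -> Omega}|%:R^-1)%:E *
    poisson_iid (d * n.+1%:R / k%:R) (constraint_law P sigma)
      [set g | A (sigma, g)].

Let c_ge0 : (0 <= #|{ffun 'I_n.+1 -> Omega}|%:R^-1 :> R)%R.
Proof. by rewrite invr_ge0. Qed.

Let teacher0 : teacher_law set0 = 0.
Proof. by rewrite /teacher_law big1// => sigma _; rewrite measure0 mule0. Qed.

Let teacher_ge0 A : 0 <= teacher_law A.
Proof. by apply: sume_ge0 => sigma _; apply: mule_ge0. Qed.

Let teacher_sigma_additive : semi_sigma_additive teacher_law.
Proof.
move=> F mF tF mUF.
rewrite [X in _ --> X](_ : _ = \sum_(i <oo) teacher_law (F i)).
  apply/cvg_closeP; split; last by rewrite closeE.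
  by apply: is_cvg_nneseries => *; exact: teacher_ge0.
rewrite nneseries_sum; last by move=> sigma i _; apply: mule_ge0.
apply: eq_bigr => sigma _; rewrite nneseriesZl//; congr *%E.
apply/esym/cvg_lim => //=.
apply: (@measure_semi_sigma_additive _ _ _
  (poisson_iid (d * n.+1%:R / k%:R) (constraint_law P sigma))
  (fun i => [set g | F i (sigma, g)])) => [i||].
- by rewrite -[X in measurable X]setTI; exact: pair1_measurable.
- apply/trivIsetP => i j _ _ ij; move/trivIsetP : tF => /(_ i j I I ij) Fij.
  apply/seteqP; split => // g [Fi Fj].
  by have : (F i `&` F j) (sigma, g) by []; rewrite Fij.
- apply: bigcupT_measurable => i.
  by rewrite -[X in measurable X]setTI; exact: pair1_measurable.
Qed.

HB.instance Definition _ := isMeasure.Build _ _ _ teacher_law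
  teacher0 teacher_ge0 teacher_sigma_additive.

Let teacher_setT : teacher_law setT = 1.
Proof.
rewrite /teacher_law (eq_bigr (fun=> (#|{ffun 'I_n.+1 -> Omega}|%:R^-1)%:E)).
  rewrite sumEFin sumr_const; congr EFin.
  rewrite -[LHS]mulr_natr mulVf// pnatr_eq0 -lt0n.
  by apply/card_gt0P; exists point.
move=> sigma _; rewrite -[RHS]mule1; congr *%E; exact: probability_setT.
Qed.

HB.instance Definition _ :=
  Measure_isProbability.Build _ _ _ teacher_law teacher_setT.

End teacher_law.
Arguments teacher_law {R Omega k} P d n A.

Section factor_graph.
Variables (R : realType) (Omega : finType) (k : nat).

Record factor_graph := FactorGraph {
  fg_var : finType ;
  fg_con : finType ;
  fg_nbr : fg_con -> {ffun 'I_k -> fg_var} ;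
  fg_weight : fg_con -> weight R Omega k }.

Variable G : factor_graph.
Implicit Types (y z : fg_var G) (sigma tau : {ffun fg_var G -> Omega}).

Definition fg_adj : rel (fg_var G + fg_con G) := fun u v =>
  match u, v with
  | inl x, inr a | inr a, inl x => [exists i, fg_nbr a i == x]
  | _, _ => false
  end.

(* dist(y, z) >= r, which includes the case of disconnected y and z. *)
Definition fg_dist_ge y z (r : nat) : bool :=
  [forall m : 'I_r, ~~ [exists p : m.-tuple (fg_var G + fg_con G)%type,
    path fg_adj (inl y) p && (last (inl y) p == inl z)]].

Definition fg_simple : Prop :=
  (forall a : fg_con G, injective (fg_nbr a)) /\
  (forall a b : fg_con G, a != b ->
     [set fg_nbr a i | i : 'I_k]%SET != [set fg_nbr b i | i : 'I_k]%SET).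

Definition gibbs_weight sigma : R :=
  \prod_(a : fg_con G) fg_weight a (local_spins sigma (fg_nbr a)).

Definition gibbs sigma : R :=
  gibbs_weight sigma / \sum_(tau : {ffun fg_var G -> Omega}) gibbs_weight tau.

Definition gibbs_mean (f : {ffun fg_var G -> Omega} -> R) : R :=
  \sum_sigma gibbs sigma * f sigma.

Definition agree_far l y tau sigma : bool :=
  [forall z, fg_dist_ge y z (2 * l) ==> (sigma z == tau z)].

(* The Gibbs probability that sigma(y) = s given that sigma coincides with tau
   at distance at least 2l from y. *)
Definition gibbs_cond l y (s : Omega) tau : R :=
  (\sum_(sigma | agree_far l y tau sigma && (sigma y == s)) gibbs sigma) /
  (\sum_(sigma | agree_far l y tau sigma) gibbs sigma).

End factor_graph.

Section tree.
Variables (R : realType) (Omega : finType) (k : nat).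
Notation weight := (weight R Omega k).

(* A tree of height l.+1 is the list, over the constraint-node children of the
   root, of their weight and of the k.-1 trees of height l below them. *)
Fixpoint tree_type (l : nat) : {disp : measure_display & measurableType disp} :=
  if l is l'.+1 then
    existT (fun disp => measurableType disp) _
      (seq (weight * k.-1.-tuple (projT2 (tree_type l'))) : measurableType _)
  else existT (fun disp => measurableType disp) _ (unit : measurableType _).

Definition tree l : measurableType _ := projT2 (tree_type l).

Section tree_law.
Variables (P : probability weight R) (d : R).

(* The law of T^l(d, P), the Galton-Watson tree cut after l generations of
   variable nodes. *)
Fixpoint tree_law (l : nat) : probability (tree l) R :=
  if l is l'.+1 return probability (tree l) R then
    poisson_iid d (P \x iid (tree_law l') k.-1)%E
  else \d_tt.

End tree_law.

Definition subtree l (t : seq (weight * k.-1.-tuple (tree l)))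
  (i : 'I_(size t)) (j : 'I_k.-1) : tree l := tnth (tnth (in_tuple t) i).2 j.

Fixpoint tree_var (l : nat) : tree l -> finType :=
  if l is l'.+1 return tree l -> finType then
    fun t : seq (weight * k.-1.-tuple (tree l')) =>
      option {i : 'I_(size t) & {j : 'I_k.-1 & tree_var (subtree i j)}}
  else fun=> unit.

Fixpoint tree_con (l : nat) : tree l -> finType :=
  if l is l'.+1 return tree l -> finType then
    fun t : seq (weight * k.-1.-tuple (tree l')) =>
      ('I_(size t) +
       {i : 'I_(size t) & {j : 'I_k.-1 & tree_con (subtree i j)}})%type
  else fun=> void.

Definition tree_root (l : nat) : forall t : tree l, tree_var t :=
  if l is l'.+1 return forall t : tree l, tree_var t then fun=> None
  else fun=> tt.

(* The parent comes first in the neighbourhood of a constraint node, which is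
   immaterial when P is invariant under permutations of the arguments. *)
Definition child_slot (p : 'I_k) : option 'I_k.-1 :=
  if val p == 0%N then None else insub (val p).-1.

Fixpoint tree_nbr (l : nat) :
    forall t : tree l, tree_con t -> {ffun 'I_k -> tree_var t} :=
  if l is l'.+1 return forall t : tree l, tree_con t -> {ffun 'I_k -> tree_var t}
  then fun t a =>
    match a with
    | inl i => [ffun p =>
        if child_slot p is Some j
        then Some (existT _ i (existT _ j (tree_root _))) else None]
    | inr (existT i (existT j b)) => [ffun p =>
        Some (existT _ i (existT _ j (tree_nbr b p)))]
    end
  else fun t a => match a with end.

Fixpoint tree_weight (l : nat) : forall t : tree l, tree_con t -> weight :=
  if l is l'.+1 return forall t : tree l, tree_con t -> weight then
    fun (t : seq (weight * k.-1.-tuple (tree l'))) a =>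
    match a with
    | inl i => (tnth (in_tuple t) i).1
    | inr (existT i (existT j b)) => tree_weight b
    end
  else fun t a => match a with end.

Definition tree_graph l (t : tree l) : factor_graph R Omega k :=
  FactorGraph (@tree_nbr l t) (@tree_weight l t).

End tree.

Section conditional_probability.
Context d (T : measurableType d) (R : realType) (mu : probability T R).
Local Open Scope ereal_scope.

Definition is_cond_prob (F : set (set T)) (A : set T) (X : T -> R) : Prop :=
  [/\ forall B : set R, measurable B -> F (X @^-1` B),
      mu.-integrable setT (EFin \o X) &
      forall B, F B -> \int[mu]_(x in B) (X x)%:E = mu (A `&` B)].

(* Some version of the conditional probability of A given the sigma-algebra F;
   one exists by is_cond_prob_cond_prob below. *)
Definition cond_prob (F : set (set T)) (A : set T) : T -> R :=
  xget (cst 0%R) (is_cond_prob F A).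

Section existence.
Variables (G : set (set T)) (A : set T).
Hypotheses (Gm : G `<=` measurable) (mA : measurable A).

Let S := g_sigma_algebraType G.
Let h : T -> S := fun x => x.

Let sGm B : <<s G >> B -> measurable B.
Proof. by move: B; apply: smallest_sub => //; exact: sigma_algebra_measurable. Qed.

Let mh : measurable_fun setT h.
Proof. by move=> _ B mB; rewrite setTI; exact: sGm. Qed.

HB.instance Definition _ := isMeasurableFun.Build _ _ _ _ h mh.

Let m0 : probability S R := distribution mu h.

Let nu : set S -> \bar R := fun B => mu (A `&` B).

Let nu0 : nu set0 = 0. Proof. by rewrite /nu setI0 measure0. Qed.

Let nu_ge0 B : 0 <= nu B. Proof. exact: measure_ge0. Qed.

Let nu_sigma_additive : semi_sigma_additive nu.
Proof.
move=> F mF tF mUF; rewrite /nu setI_bigcupr.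
apply: measure_semi_sigma_additive => [i||].
- by apply: measurableI => //; exact: sGm (mF i).
- exact: trivIset_setIl.
- by apply: bigcupT_measurable => i; apply: measurableI => //; exact: sGm (mF i).
Qed.

HB.instance Definition _ := isMeasure.Build _ _ _ nu nu0 nu_ge0 nu_sigma_additive.

Let nu_setT : nu setT <= 1.
Proof. by rewrite /nu setIT probability_le1. Qed.

HB.instance Definition _ := Measure_isSubProbability.Build _ _ _ nu nu_setT.

Let nu_dom : charge_of_finite_measure nu `<< m0.
Proof.
apply/null_content_dominatesP => B mB m0B.
apply/eqP; rewrite eq_le measure_ge0 andbT -[leRHS]m0B.
by apply: le_measure; rewrite ?inE; [apply: measurableI|exact: sGm|];
  [|exact: sGm|exact: subIsetr].
Qed.

Lemma is_cond_prob_cond_prob : is_cond_prob <<s G >> A (cond_prob <<s G >> A).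
Proof.
apply: (@xgetPex _ (cst 0%R) (is_cond_prob <<s G >> A)).
pose f := Radon_Nikodym (charge_of_finite_measure nu) m0.
have ff x : f x \is a fin_num by exact: Radon_Nikodym_fin_num.
have fi : m0.-integrable setT f by exact: Radon_Nikodym_integrable.
have mf : measurable_fun setT f by exact: measurable_int fi.
pose X : T -> R := fun x => fine (f x).
have XE : EFin \o X = f by apply/funext => x /=; rewrite fineK.
have Xi : mu.-integrable setT (EFin \o X).
  rewrite XE; apply/integrableP; split.
    exact: (measurableT_comp mf mh).
  have /integrableP[_] := fi.
  by rewrite ge0_integral_pushforward//; exact: measurableT_comp.
exists X; split => //.
- move=> B mB.
  have : measurable_fun setT (fine \o f) by exact: measurableT_comp.
  by move=> /(_ measurableT B mB); rewrite setTI.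
- move=> B mB; have mB' : measurable (B : set S) by [].
  have nuB : mu (A `&` B) = \int[m0]_(x in B) f x.
    exact: (Radon_Nikodym_integral nu_dom mB').
  rewrite [RHS]nuB integral_pushforward//.
    by apply: eq_integral => x _; rewrite -XE.
  apply: (@integrableS _ _ _ mu setT) => //; first exact: sGm.
  by move: Xi; rewrite XE.
Qed.

End existence.
End conditional_probability.

Definition cond_mean d (T : measurableType d) (R : realType)
    (mu : probability T R) (A : set T) (f : T -> R) : \bar R :=
  (((fine (mu A))^-1)%:E * \int[mu]_(x in A) (f x)%:E)%E.

Section conditions.
Variables (R : realType) (Omega : finPointedType) (k : nat).
Notation weight := (weight R Omega k).
Notation q := (#|Omega|%:R : R).
Variable P : probability weight R.

Definition xi : R := q ^- k * \sum_tau \int[P]_psi psi tau.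

Definition moment_assumptions : Prop :=
  [/\ (\int[P]_psi
         (ln (1 - \big[Num.max/0]_tau `|1 - psi tau|) ^+ 8)%:E < +oo)%E,
      (\int[P]_psi (\big[Num.max/0]_tau psi tau ^- 4)%:E < +oo)%E &
      0 < \sum_tau \int[P]_psi (psi tau - xi) ^+ 2].

Definition SYM (Psi : set weight) : Prop :=
  (forall (i : 'I_k) (omega : Omega) (psi : weight), Psi psi ->
     \sum_(tau : {ffun 'I_k -> Omega} | tau i == omega) psi tau
     = q ^+ k.-1 * xi) /\
  (forall (theta : {perm 'I_k}) (A : set weight), measurable A ->
     P (perm_weight theta @^-1` A) = P A).

Definition bal_fun (mu : Omega -> R) : R :=
  \sum_tau (\int[P]_psi psi tau) * \prod_i mu (tau i).

Definition BAL : Prop :=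
  (forall (mu nu : distr R Omega) (t : R), 0 <= t <= 1 ->
     t * bal_fun mu + (1 - t) * bal_fun nu
     <= bal_fun (fun omega => t * mu omega + (1 - t) * nu omega)) /\
  (forall mu : distr R Omega, bal_fun mu <= bal_fun (fun=> q^-1)).

Definition min_fun (rho : Omega * Omega -> R) : R :=
  \sum_sigma \sum_tau
    (\int[P]_psi (psi sigma * psi tau)) * \prod_i rho (sigma i, tau i).

Definition uniform_marginals (rho : distr R (Omega * Omega)%type) : Prop :=
  (forall s, \sum_t rho (s, t) = q^-1) /\ (forall t, \sum_s rho (s, t) = q^-1).

Definition MIN : Prop :=
  forall rho : distr R (Omega * Omega)%type, uniform_marginals rho ->
    min_fun (fun=> q ^- 2) <= min_fun rho /\
    (min_fun rho = min_fun (fun=> q ^- 2) -> forall x, rho x = q ^- 2).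

Definition uniform_mean (pi : probability (distr R Omega) R) : Prop :=
  forall omega, \int[pi]_rho rho omega = q^-1.

Definition Lambda (x : R) : R := x * ln x.

Definition POS : Prop :=
  forall pi pi' : probability (distr R Omega) R,
    uniform_mean pi -> uniform_mean pi' ->
    (0 <= \int[P \x (iid pi k \x iid pi' k)]_x
      let psi := x.1 in let rho := tnth x.2.1 in let rho' := tnth x.2.2 in
      (Lambda (\sum_tau psi tau * \prod_i rho i (tau i))
       + (k.-1)%:R * Lambda (\sum_tau psi tau * \prod_i rho' i (tau i))
       - k%:R * Lambda (\sum_tau psi tau *
           \prod_(i < k) (if val i == 0%N then rho i else rho' i) (tau i)))%:E)%E.

End conditions.

Section correlations.
Variables (R : realType) (Omega : finPointedType) (k : nat).
Notation weight := (weight R Omega k).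
Notation q := (#|Omega|%:R : R).
Variables (P : probability weight R) (d : R).

(* corr_tree is the limit over the trees T^l(d, P), corr_teacher the one for the
   teacher-student model; n stands for n.+1 variable nodes. *)
Definition tree_corr (l : nat) : \bar R :=
  (\sum_(s : Omega) \int[tree_law P d l]_t
     (gibbs_mean (fun sigma : {ffun fg_var (tree_graph t) -> Omega} =>
        `|gibbs_cond l (tree_root t : fg_var (tree_graph t)) s sigma - q^-1|))%:E)%E.

Definition corr_tree : \bar R := limn tree_corr.

Definition list_graph n (g : seq ({ffun 'I_k -> 'I_n.+1} * weight)) :
    factor_graph R Omega k :=
  FactorGraph (fun a => (tnth (in_tuple g) a).1)
              (fun a => (tnth (in_tuple g) a).2).

Notation sample n := ({ffun 'I_n.+1 -> Omega} *
                      seq ({ffun 'I_k -> 'I_n.+1} * weight))%type.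

(* The sigma-algebra generated by the graph and by the spins at distance at
   least 2l from y in that graph. *)
Definition nabla_star n (l : nat) (y : 'I_n.+1) : set (set (sample n)) :=
  <<s [set A : set (sample n) | exists2 B, measurable B & A = snd @^-1` B] `|`
      [set A : set (sample n) | exists (z : 'I_n.+1) (omega : Omega), A =
         [set x : sample n | @fg_dist_ge _ _ _ (list_graph x.2) y z (2 * l) /\
                  x.1 z = omega]] >>.

Definition teacher_corr (l n : nat) : \bar R :=
  ((n.+1%:R^-1)%:E * \sum_(y < n.+1) \sum_(s : Omega)
     \int[teacher_law P d n]_x
       `|cond_prob (teacher_law P d n) (nabla_star l y)
           [set x : sample n | x.1 y = s] x - q^-1|%:E)%E.

Definition corr_teacher : \bar R :=
  limn (fun l => limn_esup (teacher_corr l)).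

Definition simple_event n : set (sample n) :=
  [set x | fg_simple (list_graph x.2)].
Arguments simple_event : clear implicits.

Definition teacher_gibbs_corr (l n : nat) : \bar R :=
  ((n.+1%:R^-1)%:E * \sum_(y < n.+1) \sum_(s : Omega)
     cond_mean (teacher_law P d n) (simple_event n) (fun x =>
       `|@gibbs_cond _ _ _ (list_graph x.2) l y s x.1 - q^-1|%R))%E.

End correlations.

(* Main.v *)
Require Import Defs.
From HB Require Import structures.
From mathcomp Require Import all_boot all_order all_algebra all_fingroup.
From mathcomp Require Import all_classical all_reals all_analysis.
From mathcomp Require Import measurable_realfun.
From mathcomp Require Import ring lra.

Set Implicit Arguments.
Unset Strict Implicit.
Unset Printing Implicit Defensive.

Import Order.TTheory GRing.Theory Num.Theory.
Import numFieldNormedType.Exports.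

Local Open Scope classical_set_scope.
Local Open Scope ring_scope.

(** Given the spins sigma, the constraints of the teacher-student graph form a
    Poisson process, so the constraints meeting a given vertex are independent of
    the others. Exploring the graph around y vertex by vertex, one finds with high
    probability a tree on fresh vertices. When sigma is balanced, SYM makes the
    law of a revealed constraint, weighted by psi(sigma), close to the law of one
    step of the broadcast process on the Galton-Watson tree, and the Gibbs
    conditional probability at y is a function of the message received at the
    root. Hence, for fixed l, the graph average of |<1{sigma(y) = s} | nabla_l> - 1/q|
    tends to the tree average T(l). This survives conditioning on a simple graph,
    which has probability bounded away from 0 and is almost independent of a
    bounded neighbourhood.

    By Bayes' rule, the conditional probability of sigma*(y) = s given the graph
    and the far spins is a ratio of sums of likelihoods. The likelihood of sigma
    is its Gibbs weight times a normalisation power, which hardly depends on the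
    spins inside a bounded ball; so this probability is close to the Gibbs one,
    and corr* has the same limit T(l) as n grows. Conditioning on less information
    decreases the mean deviation, so T(l) is nonincreasing and converges as l
    grows. *)

(** * Positive functionals as integrals *)

(** No coupling of graph and tree is constructed. Tree-like explorations form an inductive
    predicate, and the expectation over the Poisson process of constraints is bounded from below by
    the contribution of these explorations alone. For this to hold exactly at finite n, the tree
    process is replaced by a sub-probability one: each Poisson weight is multiplied by a power of
    some theta < 1 and cut off at D, and theta absorbs the errors of order 1/n as well as the
    imbalance of sigma. The lower bound, applied to a function f with values in [0, 1] and to 1 - f,
    yields both bounds up to the missing mass, which vanishes as theta tends to 1 and D to infinity.

    The recursive processes are written as functionals F |-> E[F] on nonnegative measurable
    functions: these compose freely, and a composite of integrals is again an integral.

    The constant kappa = 1/(q^(k-1) xi) comes from SYM: given the spin of one neighbour, kappa psi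
    sums to 1 over the spins of the others. So psi itself becomes a transition kernel, and Gibbs
    sampling on a tree becomes a broadcast from the root. *)

Section positive_functional.
Context d (A : measurableType d) (R : realType).
Local Open Scope ereal_scope.

Definition nnmeas (F : A -> \bar R) := measurable_fun setT F /\ forall x, 0 <= F x.

(** The equation is asked only of nonnegative measurable functions, so a formula without meaning
    elsewhere may still qualify. Finiteness of the measure makes Tonelli's theorem available. *)
Definition is_integral (L : (A -> \bar R) -> \bar R) :=
  exists mu : {finite_measure set A -> \bar R},
    forall F, nnmeas F -> L F = \int[mu]_x F x.

Lemma nnmeas_cst (c : \bar R) : 0 <= c -> nnmeas (cst c).
Proof. by move=> c0; split. Qed.

Lemma nnmeasD F G : nnmeas F -> nnmeas G -> nnmeas (fun x => F x + G x).
Proof.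
by move=> [mF F0] [mG G0]; split=> [|x]; [exact: emeasurable_funD|exact: adde_ge0].
Qed.

Lemma nnmeasM F G : nnmeas F -> nnmeas G -> nnmeas (fun x => F x * G x).
Proof.
by move=> [mF F0] [mG G0]; split=> [|x]; [exact: emeasurable_funM|exact: mule_ge0].
Qed.

Lemma nnmeasZ (c : \bar R) F : 0 <= c -> nnmeas F -> nnmeas (fun x => c * F x).
Proof. by move=> c0; apply: nnmeasM; exact: nnmeas_cst. Qed.

Lemma nnmeas_series (F : nat -> A -> \bar R) : (forall i, nnmeas (F i)) ->
  nnmeas (fun x => \sum_(i <oo) F i x).
Proof.
move=> mF; split=> [|x]; last by apply: nneseries_ge0 => i _ _; apply: (mF i).2.
apply: ge0_emeasurable_sum => [i x _ _|i _]; [exact: (mF i).2|exact: (mF i).1].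
Qed.

Lemma nnmeas_sum I (r : seq I) (Q : pred I) (F : I -> A -> \bar R) :
  (forall i, nnmeas (F i)) -> nnmeas (fun x => \sum_(i <- r | Q i) F i x).
Proof.
move=> mF; split=> [|x]; last by apply: sume_ge0 => i _; apply: (mF i).2.
elim: r => [|i r IH].
  by rewrite (_ : (fun=> _) = cst 0)//; apply/funext => x; rewrite big_nil.
rewrite (_ : (fun=> _) = fun x => if Q i then F i x + \sum_(i <- r | Q i) F i x
    else \sum_(i <- r | Q i) F i x); last by apply/funext => x; rewrite big_cons.
by case: (Q i) => //; apply: emeasurable_funD => //; exact: (mF i).1.
Qed.

Section intro.
Variable L : (A -> \bar R) -> \bar R.
Hypothesis L_ge0 : forall F, nnmeas F -> 0 <= L F.
Hypothesis L_series : forall F : nat -> A -> \bar R, (forall i, nnmeas (F i)) ->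
  L (fun x => \sum_(i <oo) F i x) = \sum_(i <oo) L (F i).
Hypothesis L_scale : forall (c : R) F, (0 <= c)%R -> nnmeas F ->
  L (fun x => c%:E * F x) = c%:E * L F.
Hypothesis L_fin : L (cst 1) < +oo.

Let L0 : L (cst 0) = 0.
Proof.
rewrite -[RHS](mul0e (L (cst 1))) -L_scale//.
by congr L; apply/funext => x; rewrite mul0e.
Qed.

Let L_add F G : nnmeas F -> nnmeas G -> L (fun x => F x + G x) = L F + L G.
Proof.
(* Finite additivity is countable additivity for a sequence padded with zeros. *)
move=> mF mG; pose H i := if i is 0%N then F else if i is 1%N then G else cst 0.
have mH i : nnmeas (H i) by case: i => [|[|i]]//=; exact: nnmeas_cst.
have E (f : (A -> \bar R) -> \bar R) : (forall i, 0 <= f (H i)) -> f (cst 0) = 0 ->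
    \sum_(i <oo) f (H i) = f F + f G.
  move=> f0 fc; rewrite (nneseries_split 0 2)// eseries0 ?adde0; last first.
    by move=> [|[|i]].
  by rewrite /= big_nat_recr//= big_nat1.
rewrite -(E L _ L0); last by move=> i; exact: L_ge0. 
rewrite -L_series//; congr L; apply/funext => x.
by rewrite (E (fun f => f x))// => i; exact: (mH i).2.
Qed.

Let mu (B : set A) : \bar R := L (fun x => (\1_B x)%:E).

Let mI (B : set A) : measurable B -> nnmeas (fun x => (\1_B x)%:E : \bar R).
Proof. by move=> mB; split=> [|x]; [exact/measurable_EFinP|rewrite lee_fin]. Qed.

Let mu0 : mu set0 = 0.
Proof. by rewrite -L0; congr L; apply/funext => x; rewrite indic0. Qed.

(* Outside the measurable sets L may be negative. *)
Let nu (B : set A) : \bar R := if pselect (measurable B) then mu B else 0.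

Let nu0 : nu set0 = 0.
Proof. by rewrite /nu; case: pselect => //; rewrite mu0. Qed.

Let nu_ge0 B : 0 <= nu B.
Proof. by rewrite /nu; case: pselect => // mB; exact/L_ge0/mI. Qed.

Let nuE B : measurable B -> nu B = mu B.
Proof. by rewrite /nu; case: pselect. Qed.

Let nu_sigma_additive : semi_sigma_additive nu.
Proof.
move=> F mF tF mUF.
rewrite nuE// /mu [X in _ --> X](_ : _ = \sum_(i <oo) nu (F i)).
  apply/cvg_closeP; split; last by rewrite closeE.
  by apply: is_cvg_nneseries => *; exact: nu_ge0.
rewrite (eq_eseriesr (g := fun i => L (fun x => (\1_(F i) x)%:E))); last first.
  by move=> i _; rewrite nuE.
rewrite -L_series; last by move=> i; exact: mI.
congr L; apply/funext => x; rewrite indicE.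
case: (pselect ((\bigcup_n F n) x)) => [[i _ Fix]|nF].
  rewrite mem_set; last by exists i.
  rewrite (@nneseriesD1 _ _ i)//.
  rewrite eseries0 ?adde0 ?indicE ?mem_set// => j _ /andP[_ ji].
  rewrite indicE memNset// => Fjx.
  by move/trivIsetP : tF => /(_ j i I I ji); apply/eqP/set0P; exists x.
rewrite memNset// eseries0// => i _ _; rewrite indicE memNset// => Fi.
by apply: nF; exists i.
Qed.

HB.instance Definition _ := isMeasure.Build _ _ _ nu nu0 nu_ge0 nu_sigma_additive.

Let nu_fin : fin_num_fun nu.
Proof.
move=> B mB; rewrite ge0_fin_numE//; apply: le_lt_trans L_fin.
have -> : cst 1 = (fun x => (\1_B x)%:E + (\1_(~` B) x)%:E) :> (A -> \bar R).
  apply/funext => x; rewrite /= !indicE in_setC.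
  by case: (x \in B); rewrite ?adde0 ?add0e.
rewrite L_add; [|exact: mI|exact/mI/measurableC].
by rewrite nuE// leeDl// L_ge0//; exact/mI/measurableC.
Qed.

HB.instance Definition _ := Measure_isFinite.Build _ _ _ nu nu_fin.

Import HBNNSimple.

Let L_sum (I : Type) (r : seq I) (F : I -> A -> \bar R) : (forall i, nnmeas (F i)) ->
  L (fun x => \sum_(i <- r) F i x) = \sum_(i <- r) L (F i).
Proof.
move=> mF; elim: r => [|i r IH].
  by rewrite big_nil -[RHS]L0; congr L; apply/funext => x; rewrite big_nil.
rewrite big_cons -IH -L_add//; last exact: nnmeas_sum.
by congr L; apply/funext => x; rewrite big_cons.
Qed.

Let L_nnsfun (h : {nnsfun A >-> R}) :
  L (fun x => (h x)%:E) = \int[nu]_x (h x)%:E.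
Proof.
have E : (fun x => (h x)%:E) = (fun x => \sum_(y <- finmap.enum_fset (fset_set (range h)))
    (`|y|%:E * (\1_(h @^-1` [set y]) x)%:E)).
  apply/funext => x; rewrite fimfunE fsbig_finite//= -sumEFin.
  rewrite big_seq [RHS]big_seq; apply: eq_bigr => y.
  rewrite in_fset_set// inE => -[z _ <-].
  by rewrite ger0_norm ?EFinM.
have mh y : nnmeas (fun x => (\1_(h @^-1` [set y]) x)%:E : \bar R).
  by apply: mI; exact: measurable_sfunP.
have mh' y : nnmeas (fun x => `|y|%:E * (\1_(h @^-1` [set y]) x)%:E : \bar R).
  by apply: nnmeasZ => //; rewrite lee_fin.
rewrite E L_sum// (@ge0_integral_sum _ _ _ nu _ measurableT _ _ (fun y => (mh' y).1)
  (fun y x _ => (mh' y).2 x)).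
apply: eq_bigr => y _; rewrite L_scale// (ge0_integralZl nu)//; last exact: (mh y).1.
have mhy : measurable (h @^-1` [set y]) by exact: measurable_sfunP.
by congr *%E; rewrite (@integral_indic _ _ _ nu _ measurableT _ mhy) setIT; exact/esym/nuE.
Qed.

(** [L] agrees with integration on simple functions, and a nonnegative [F] is the series of the
    increments of its increasing simple approximations. Countable additivity of [L] thus replaces a
    monotone convergence theorem for [L]. *)
Lemma is_integral_intro : is_integral L.
Proof.
exists nu => F [mF F0].
pose h := nnsfun_approx measurableT mF.
have hF x : (h n x)%:E @[n --> \oo] --> F x by exact: cvg_nnsfun_approx.
have ndh x m n : (m <= n)%N -> (h m x <= h n x)%R.
  by move=> mn; exact/lefP/nd_nnsfun_approx.
pose f i x : \bar R := if i is j.+1 then (h j.+1 x - h j x)%:E else (h 0%N x)%:E.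
have mf i : nnmeas (f i).
  case: i => [|i]; split => [|x] //=; rewrite ?lee_fin ?subr_ge0 ?ndh//.
  - exact/measurable_EFinP.
  - exact/measurable_EFinP/measurable_funB.
have hE n x : \sum_(i < n.+1) f i x = (h n x)%:E.
  elim: n => [|n IH]; first by rewrite big_ord1.
  by rewrite big_ord_recr/= IH -EFinD addrC subrK.
have LF : L F = \sum_(i <oo) L (f i).
  rewrite -L_series//; congr L; apply/funext => x; apply/esym/cvg_lim => //.
  rewrite -cvg_shiftS/=; rewrite (_ : (fun n => _) = fun n => (h n x)%:E) //.
  by apply/funext => n /=; rewrite big_mkord hE.
have Lh n : \sum_(i < n.+1) L (f i) = \int[nu]_x (h n x)%:E.
  rewrite -L_nnsfun -(L_sum _ (F := fun i : 'I_n.+1 => f i))//.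
  by congr L; apply/funext => x; rewrite hE.
rewrite LF; apply/cvg_lim => //; rewrite -cvg_shiftS/=.
rewrite (_ : (fun n => _) = fun n => \int[nu]_x (h n x)%:E); last first.
  by apply/funext => n /=; rewrite big_mkord Lh.
rewrite (_ : \int[nu]_x F x = \int[nu]_x (limn (fun n => (h n x)%:E))); last first.
  by apply: eq_integral => x _; apply/esym/cvg_lim => //; exact: hF.
apply: cvg_monotone_convergence => //.
- by move=> n; exact/measurable_EFinP.
- by move=> n x _; rewrite lee_fin; exact: fun_ge0.
- by move=> x _ m n mn; rewrite lee_fin; exact: ndh.
Qed.

End intro.

End positive_functional.

Lemma nnmeas_comp d d' (A : measurableType d) (B : measurableType d') (R : realType)
    (F : B -> \bar R) (h : A -> B) :
  measurable_fun setT h -> nnmeas F -> nnmeas (F \o h).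
Proof. by move=> mh [mF F0]; split=> [|x]; [exact: measurableT_comp|exact: F0]. Qed.

Lemma measurable_pairl d d' (A : measurableType d) (B : measurableType d') (b : B) :
  measurable_fun setT (fun a : A => (b, a)).
Proof. exact: measurable_fun_pair. Qed.

Lemma measurable_pairr d d' (A : measurableType d) (B : measurableType d') (b : B) :
  measurable_fun setT (fun a : A => (a, b)).
Proof. exact: measurable_fun_pair. Qed.

Section elimination.
Context d (A : measurableType d) (R : realType) (L : (A -> \bar R) -> \bar R).
Hypothesis HL : is_integral L.
Local Open Scope ereal_scope.

Lemma il_ge0 F : nnmeas F -> 0 <= L F.
Proof. by move=> mF; case: HL => mu ->//; apply: integral_ge0 => x _; exact: mF.2. Qed.

Lemma il_fin : L (cst 1) < +oo.
Proof.
case: HL => mu ->; last by apply: nnmeas_cst.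
by rewrite integral_cst// mul1e -ge0_fin_numE// fin_num_measure.
Qed.

Lemma ilD F G : nnmeas F -> nnmeas G -> L (fun x => F x + G x) = L F + L G.
Proof.
move=> mF mG; have mFG := nnmeasD mF mG; case: HL => mu E; rewrite !E//.
by rewrite ge0_integralD//; [move=> x _; exact: mF.2|exact: mF.1|move=> x _; exact: mG.2|exact: mG.1].
Qed.

Lemma ilZ (c : \bar R) F : 0 <= c -> nnmeas F -> L (fun x => c * F x) = c * L F.
Proof.
move=> c0 mF; have mcF := nnmeasZ c0 mF; case: HL => mu E; rewrite !E//.
by rewrite ge0_integralZl//; [exact: mF.1|move=> x _; exact: mF.2].
Qed.

Lemma il_le F G : nnmeas F -> nnmeas G -> (forall x, F x <= G x) -> L F <= L G.
Proof.
move=> mF mG FG; case: HL => mu E; rewrite !E//.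
by apply: ge0_le_integral => //; [move=> x _; exact: mF.2|exact: mF.1|exact: mG.1].
Qed.

Lemma il_series (F : nat -> A -> \bar R) : (forall i, nnmeas (F i)) ->
  L (fun x => \sum_(i <oo) F i x) = \sum_(i <oo) L (F i).
Proof.
move=> mF; have mS := nnmeas_series mF; case: HL => mu E; rewrite E//.
rewrite integral_nneseries//; [|by move=> i; exact: (mF i).1|by move=> i x _; exact: (mF i).2].
by apply: eq_eseriesr => i _; rewrite E.
Qed.

Lemma il_sum I (r : seq I) (Q : pred I) (F : I -> A -> \bar R) :
  (forall i, nnmeas (F i)) ->
  L (fun x => \sum_(i <- r | Q i) F i x) = \sum_(i <- r | Q i) L (F i).
Proof.
move=> mF; elim: r => [|i r IH].
  rewrite big_nil -[RHS](mul0e (L (cst 1))) -ilZ//.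
  by congr L; apply/funext => x; rewrite big_nil mul0e.
rewrite big_cons; case: ifPn => Qi.
  rewrite -IH -ilD//; last exact: nnmeas_sum.
  by congr L; apply/funext => x; rewrite big_cons Qi.
by rewrite -IH; congr L; apply/funext => x; rewrite big_cons (negbTE Qi).
Qed.

Lemma il_cst (c : \bar R) : 0 <= c -> L (cst c) = c * L (cst 1).
Proof. by move=> c0; rewrite -ilZ//; congr L; apply/funext => x /=; rewrite mule1. Qed.

Lemma il_meas d' (B : measurableType d') (F : B * A -> \bar R) :
  nnmeas F -> nnmeas (fun b => L (fun a => F (b, a))).
Proof.
move=> mF.
have mb b : nnmeas (fun a => F (b, a)) by apply: (nnmeas_comp (measurable_pairl b)).
split=> [|b]; last exact/il_ge0.
case: HL => mu E.
rewrite (_ : (fun b => _) = fubini_F mu F).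
  exact: (measurable_fun_fubini_tonelli_F (m2 := mu) F mF.1 mF.2).
by apply/funext => b; rewrite E.
Qed.

Lemma il_meas2 d' (B : measurableType d') (F : B -> A -> \bar R) :
  nnmeas (fun x : B * A => F x.1 x.2) -> nnmeas (fun b => L (F b)).
Proof. exact: il_meas. Qed.

End elimination.

Section closure.
Context d d' (A : measurableType d) (B : measurableType d') (R : realType).
Variables (L : (A -> \bar R) -> \bar R) (L' : (B -> \bar R) -> \bar R).
Hypotheses (HL : is_integral L) (HL' : is_integral L').
Local Open Scope ereal_scope.

Lemma il_comm (F : A -> B -> \bar R) : nnmeas (fun x : A * B => F x.1 x.2) ->
  L (fun a => L' (F a)) = L' (fun b => L (fun a => F a b)).
Proof.
move=> mF.
have m1 : nnmeas (fun a => L' (F a)) by exact: il_meas2.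
have m2 : nnmeas (fun b => L (fun a => F a b)).
  apply: (il_meas2 HL (F := fun b a => F a b)).
  have msw : measurable_fun setT (fun x : B * A => (x.2, x.1)) by exact: measurable_fun_pair.
  exact: (nnmeas_comp msw mF).
have ma a : nnmeas (F a) by apply: (nnmeas_comp (measurable_pairl a) mF).
have mb b : nnmeas (F ^~ b) by apply: (nnmeas_comp (measurable_pairr b) mF).
case: HL => mu E; case: HL' => mu' E'; rewrite E// E'//.
under eq_integral do rewrite E'//.
under [RHS]eq_integral do rewrite E//.
exact: (fubini_tonelli (m1 := mu) (m2 := mu') (fun x => F x.1 x.2) mF.1 mF.2).
Qed.

(** The measure behind this functional is the image under [h] of a product measure. Iterated, it
    shows that the recursively defined laws below are integrals. *)
Lemma il_comp d'' (C : measurableType d'') (h : A * B -> C) : measurable_fun setT h ->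
  is_integral (fun F => L (fun a => L' (fun b => F (h (a, b))))).
Proof.
move=> mh.
have m1 (F : C -> \bar R) : nnmeas F -> nnmeas (fun x : A * B => F (h x)).
  by move=> mF; apply: (nnmeas_comp mh mF).
have m2 (F : C -> \bar R) a : nnmeas F -> nnmeas (fun b => F (h (a, b))).
  by move=> mF; apply: (nnmeas_comp (measurable_pairl a) (m1 _ mF)).
have m3 (F : C -> \bar R) : nnmeas F -> nnmeas (fun a => L' (fun b => F (h (a, b)))).
  by move=> mF; apply: (il_meas HL' (m1 _ mF)).
apply: is_integral_intro => [F mF|F mF|c F c0 mF|].
- exact/(il_ge0 HL)/m3.
- rewrite -(il_series HL); last by move=> i; exact/m3.
  by congr L; apply/funext => a; rewrite -(il_series HL')// => i; exact/m2.
- rewrite -(ilZ HL)//; last exact/m3.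
  by congr L; apply/funext => a; rewrite -(ilZ HL')//; exact/m2.
- rewrite (_ : (fun a => _) = cst (L' (cst 1)))//.
  rewrite (il_cst HL); last exact: (il_ge0 HL' (nnmeas_cst _ lee01)).
  apply: lte_mul_pinfty; [exact: (il_ge0 HL' (nnmeas_cst _ lee01))| |exact: il_fin HL].
  by rewrite ge0_fin_numE ?il_fin//; exact: (il_ge0 HL' (nnmeas_cst _ lee01)).
Qed.

Lemma il_map (h : A -> B) : measurable_fun setT h -> is_integral (fun F => L (F \o h)).
Proof.
move=> mh; have m1 (F : B -> \bar R) : nnmeas F -> nnmeas (F \o h).
  exact: nnmeas_comp.
apply: is_integral_intro => [F mF|F mF|c F c0 mF|].
- exact/(il_ge0 HL)/m1.
- by rewrite -(il_series HL)// => i; exact: m1.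
- by rewrite -(ilZ HL)//; exact: m1.
- exact: (il_fin HL).
Qed.

(** The bound [c] keeps the measure of density [w] finite. *)
Lemma il_dens (w : A -> \bar R) (c : R) : nnmeas w -> (forall x, w x <= c%:E) ->
  is_integral (fun F => L (fun a => w a * F a)).
Proof.
move=> mw wc; apply: is_integral_intro => [F mF|F mF|a F a0 mF|].
- exact/(il_ge0 HL)/nnmeasM.
- rewrite -(il_series HL); last by move=> i; exact: nnmeasM.
  congr L; apply/funext => x.
  rewrite (_ : w x = (fine (w x))%:E); last first.
    by rewrite fineK// ge0_fin_numE; [exact: le_lt_trans (wc x) (ltry _)|exact: mw.2].
  by rewrite nneseriesZl// => i _; exact: (mF i).2.
- by rewrite -(ilZ HL)//; [congr L; apply/funext => x; rewrite muleCA|exact: nnmeasM].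
- apply: (@le_lt_trans _ _ (L (cst `|c|%:E))).
    apply: (il_le HL); [exact/nnmeasM/nnmeas_cst|exact: nnmeas_cst|move=> x].
    by rewrite mule1 (le_trans (wc x))// lee_fin ler_norm.
  rewrite (il_cst HL)// lte_mul_pinfty//; exact: il_fin HL.
Qed.

Lemma il_scale (c : R) : (0 <= c)%R -> is_integral (fun F => c%:E * L F).
Proof.
move=> c0; apply: is_integral_intro => [F mF|F mF|a F a0 mF|].
- by rewrite mule_ge0// (il_ge0 HL).
- by rewrite (il_series HL)// nneseriesZl// => i _; exact: (il_ge0 HL).
- by rewrite (ilZ HL)// muleCA.
- by rewrite lte_mul_pinfty//; exact: il_fin HL.
Qed.

End closure.

Section closure_sum.
Context d (A : measurableType d) (R : realType).
Local Open Scope ereal_scope.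

Lemma il_dirac (a : A) : is_integral (fun F : A -> \bar R => F a).
Proof.
apply: is_integral_intro => [F mF|//|//|]; first exact: mF.2.
by rewrite ltry.
Qed.

Lemma il_prob (P : probability A R) : is_integral (fun F => \int[P]_x F x).
Proof. by exists P. Qed.

Lemma il_bigsum I (r : seq I) (Q : pred I) (L : I -> (A -> \bar R) -> \bar R) :
  (forall i, is_integral (L i)) -> is_integral (fun F => \sum_(i <- r | Q i) L i F).
Proof.
move=> HL; apply: is_integral_intro => [F mF|F mF|a F a0 mF|].
- by apply: sume_ge0 => i _; exact: (il_ge0 (HL i)).
- rewrite nneseries_sum; last by move=> i j _; exact: (il_ge0 (HL i)).
  by apply: eq_bigr => i _; rewrite (il_series (HL i)).
- rewrite ge0_sume_distrr; last by move=> i _; exact: (il_ge0 (HL i)).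
  by apply: eq_bigr => i _; rewrite (ilZ (HL i)).
- by apply: lte_sum_pinfty => i _; exact: (il_fin (HL i)).
Qed.

Lemma il_nneseries (L : nat -> (A -> \bar R) -> \bar R) :
  (forall i, is_integral (L i)) -> \sum_(i <oo) L i (cst 1) < +oo ->
  is_integral (fun F => \sum_(i <oo) L i F).
Proof.
move=> HL fin; apply: is_integral_intro => [F mF|F mF|a F a0 mF|//].
- by apply: nneseries_ge0 => i _ _; exact: (il_ge0 (HL i)).
- rewrite nneseries_interchange; last by move=> i j; exact: (il_ge0 (HL j)).
  by apply: eq_eseriesr => i _; rewrite (il_series (HL i)).
- rewrite -nneseriesZl; last by move=> i _; exact: (il_ge0 (HL i)).
  by apply: eq_eseriesr => i _; rewrite (ilZ (HL i)).
Qed.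

End closure_sum.

(** * Messages and the broadcast process *)

Section seq_measurability.
Context d (T : measurableType d).

Lemma measurable_seqI (A : set (seq T)) :
  (forall n, measurable [set t : n.-tuple T | A (tval t)]) -> measurable A.
Proof. exact. Qed.

Lemma measurable_seq_size n : measurable [set s : seq T | size s = n].
Proof.
move=> m; have [<-|mn] := eqVneq m n.
  by rewrite (_ : [set _ | _] = setT)//; apply/seteqP; split=> // t _ /=; rewrite size_tuple.
rewrite (_ : [set _ | _] = set0)//; apply/seteqP; split=> // t /=.
by rewrite size_tuple => /eqP; rewrite (negbTE mn).
Qed.

(** A total left inverse of [tval] at length [n]; sequences of another length go to a constant
    tuple, which keeps the map measurable on all sequences. *)
Definition seq_to_tuple n (s : seq T) : n.-tuple T := insubd [tuple of nseq n point] s.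

Lemma seq_to_tupleK n s : size s = n -> tval (seq_to_tuple n s) = s.
Proof. by move=> sn; rewrite /seq_to_tuple insubdK// unfold_in; apply/eqP. Qed.

Lemma measurable_seq_to_tuple n : measurable_fun setT (@seq_to_tuple n).
Proof.
move=> _ B mB; rewrite setTI; apply: measurable_seqI => m.
have [mn|mn] := eqVneq m n.
  subst m; rewrite (_ : [set _ | _] = B)//; apply/seteqP.
  have E (t : n.-tuple T) : seq_to_tuple n (tval t) = t.
    by apply/val_inj; rewrite /= seq_to_tupleK ?size_tuple.
  by split=> t /=; rewrite E.
have E (t : m.-tuple T) : seq_to_tuple n (tval t) = [tuple of nseq n point].
  rewrite /seq_to_tuple /insubd; case: insubP => //= u.
  by rewrite size_tuple (negbTE mn).
have [Bp|Bp] := pselect (B [tuple of nseq n point]).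
  by rewrite (_ : [set _ | _] = setT)//; apply/seteqP; split=> t //=; rewrite E.
by rewrite (_ : [set _ | _] = set0)//; apply/seteqP; split=> t //=; rewrite E.
Qed.

(** The sigma-algebra on sequences is defined length by length, that of a product with [X] is not.
    Pulling back along [seq_to_tuple] reduces the product to one fixed length at a time. *)
Lemma measurable_prod_seq d' d'' (X : measurableType d') (Y : measurableType d'')
    (f : X * seq T -> Y) :
  (forall n, measurable_fun setT (fun x : X * n.-tuple T => f (x.1, tval x.2))) ->
  measurable_fun setT f.
Proof.
move=> mf _ B mB; rewrite setTI.
have -> : f @^-1` B = \bigcup_n ((snd @^-1` [set s : seq T | size s = n]) `&`
    ((fun x : X * seq T => f (x.1, tval (seq_to_tuple n x.2))) @^-1` B)).
  apply/seteqP; split=> [[x s] /= Bf|[x s] [n _ [/= sn]]].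
    by exists (size s) => //; split=> //=; rewrite seq_to_tupleK.
  by rewrite seq_to_tupleK.
apply: bigcup_measurable => n _; apply: measurableI.
  by rewrite -[X in measurable X]setTI; apply: measurable_snd => //; exact: measurable_seq_size.
have mg : measurable_fun setT (fun x : X * seq T => (x.1, seq_to_tuple n x.2)).
  apply: measurable_fun_pair => //.
  have msnd : measurable_fun setT (snd : X * seq T -> seq T) by [].
  move=> _ C mC; have := measurable_seq_to_tuple measurableT mC.
  by rewrite setTI => /(msnd measurableT).
by have := measurableT_comp (mf n) mg; move/(_ measurableT _ mB); rewrite setTI.
Qed.

Lemma measurable_seq_fun d' (Y : measurableType d') (f : seq T -> Y) :
  (forall n, measurable_fun setT (fun t : n.-tuple T => f (tval t))) ->
  measurable_fun setT f.
Proof. by move=> mf _ B mB; rewrite setTI; apply: measurable_seqI => n; have := mf n measurableT B mB; rewrite setTI. Qed.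

Lemma measurable_tuple_seq n : measurable_fun setT (fun t : n.-tuple T => tval t : seq T).
Proof. by move=> _ B mB; rewrite setTI; exact: mB. Qed.

End seq_measurability.

Section seq_operations.
Context d (T : measurableType d).

Lemma measurable_seq_cons : measurable_fun setT (fun x : T * seq T => x.1 :: x.2).
Proof.
apply: measurable_prod_seq => n.
rewrite (_ : (fun _ => _) = (fun t => tval t : seq T) \o
  (fun x : T * n.-tuple T => [tuple of x.1 :: x.2]))//.
apply: (measurableT_comp (@measurable_tuple_seq _ _ _)).
exact: (measurable_cons measurable_fst measurable_snd).
Qed.

Lemma measurable_fun_cons d' (X : measurableType d') (f : X -> T) (g : X -> seq T) :
  measurable_fun setT f -> measurable_fun setT g ->
  measurable_fun setT (fun x => f x :: g x).
Proof.
move=> mf mg.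
by have := measurableT_comp measurable_seq_cons (measurable_fun_pair mf mg).
Qed.

Lemma measurable_seq_cat : measurable_fun setT (fun x : seq T * seq T => x.1 ++ x.2).
Proof.
apply: measurable_prod_seq => n /=.
rewrite (_ : (fun _ => _) = (fun x : n.-tuple T * seq T => x.2 ++ tval x.1) \o (fun x => (x.2, x.1)))//.
apply: measurableT_comp; last exact: measurable_fun_pair.
apply: measurable_prod_seq => m /=.
rewrite (_ : (fun _ => _) = (fun t => tval t : seq T) \o
  (fun x : n.-tuple T * m.-tuple T => [tuple of x.2 ++ x.1]))//.
apply: (measurableT_comp (@measurable_tuple_seq _ _ _)).
apply/measurable_fun_tnthP => i; case: (split_ordP i) => j ->.
  rewrite (_ : _ \o _ = fun x : n.-tuple T * m.-tuple T => tnth x.2 j).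
    exact: (measurableT_comp (measurable_tnth j)).
  by apply/funext => x /=; rewrite tnth_lshift.
rewrite (_ : _ \o _ = fun x : n.-tuple T * m.-tuple T => tnth x.1 j).
  exact: (measurableT_comp (measurable_tnth j)).
by apply/funext => x /=; rewrite tnth_rshift.
Qed.

Lemma measurable_fun_cat d' (X : measurableType d') (f g : X -> seq T) :
  measurable_fun setT f -> measurable_fun setT g ->
  measurable_fun setT (fun x => f x ++ g x).
Proof.
move=> mf mg.
by have := measurableT_comp measurable_seq_cat (measurable_fun_pair mf mg).
Qed.

Lemma measurable_seq_nth (x0 : T) i : measurable_fun setT (fun s : seq T => nth x0 s i).
Proof.
apply: measurable_seq_fun => n; have [lin|lni] := ltnP i n.
  rewrite (_ : (fun _ => _) = fun t : n.-tuple T => tnth t (Ordinal lin)).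
    exact: measurable_tnth.
  by apply/funext => t; rewrite (tnth_nth x0).
rewrite (_ : (fun _ => _) = cst x0); first exact: measurable_cst.
by apply/funext => t; rewrite nth_default ?size_tuple.
Qed.

Lemma measurable_seq_prod (R : realType) (h : T -> R) : measurable_fun setT h ->
  measurable_fun setT (fun s : seq T => \prod_(a <- s) h a).
Proof.
move=> mh; apply: measurable_seq_fun => n.
rewrite (_ : (fun _ => _) = (fun t : n.-tuple T => \prod_(i <- enum 'I_n) h (tnth t i))).
  by apply: measurable_prod => i _; exact: (measurableT_comp mh (measurable_tnth i)).
by apply/funext => t; rewrite big_tuple big_enum.
Qed.

(** [phi] is arbitrary: at a fixed length, [map h] takes finitely many values, each on a measurable
    set. This covers every quantity that depends on the neighbourhoods of the constraints but not on
    their weights. *)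
Lemma measurable_seq_discrete d' (Y : measurableType d') (D : finType) (h : T -> D) (phi : seq D -> Y) :
  (forall u, measurable [set a | h a = u]) ->
  measurable_fun setT (fun s : seq T => phi (map h s)).
Proof.
move=> mh; apply: measurable_seq_fun => n _ B mB; rewrite setTI.
have -> : (fun t : n.-tuple T => phi (map h t)) @^-1` B =
    \bigcup_(u in [set u : n.-tuple D | B (phi (tval u))])
      \bigcap_(i in [set: 'I_n]) ((fun t : n.-tuple T => tnth t i) @^-1` [set a | h a = tnth u i]).
  apply/seteqP; split=> [t /= Bt|t [u /= Bu ut]].
    exists [tuple of map h t] => //= i _ /=; by rewrite tnth_map.
  suff -> : map h t = tval u by [].
  rewrite (_ : u = [tuple of map h t])//.
  by apply: eq_from_tnth => i; rewrite tnth_map; exact/esym/(ut i).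
apply: fin_bigcup_measurable => [|u _].
  by apply: (@sub_finite_set _ _ setT) => //; exact: finite_finset.
apply: fin_bigcap_measurable => [|i _]; first exact: finite_finset.
by rewrite -[X in measurable X]setTI; apply: measurable_tnth => //; exact: mh.
Qed.

End seq_operations.

Lemma measurable_finprod d d' d'' (D : measurableType d) (X : measurableType d')
    (Y : measurableType d'') (f : D * X -> Y) :
  finite_set [set: D] -> (forall B : set D, measurable B) ->
  (forall u, measurable_fun setT (fun x => f (u, x))) -> measurable_fun setT f.
Proof.
move=> fD mD mf _ B mB; rewrite setTI.
have -> : f @^-1` B = \bigcup_(u in [set: D]) ([set u] `*` ((fun x => f (u, x)) @^-1` B)).
  apply/seteqP; split=> [[u x] /= Bf|[u x] [v _ [/= -> //]]].
  by exists u.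
apply: fin_bigcup_measurable => // u _; apply: measurableX => //.
by rewrite -[X in measurable X]setTI; exact: mf.
Qed.

Section messages.
Variables (R : realType) (Omega : finPointedType) (K : nat).

(** A message is an unnormalised likelihood of the spin at a vertex given the observations below it.
    Tuples of reals are used because they carry the product sigma-algebra. *)
Definition msg : measurableType _ := (#|Omega|.-tuple R : measurableType _).
Definition mval (M : msg) (s : Omega) : R := tnth (M : #|Omega|.-tuple R) (enum_rank s).
Definition mk_msg (f : Omega -> R) : msg := [tuple f (enum_val i) | i < #|Omega|].

Lemma mvalK f s : mval (mk_msg f) s = f s.
Proof. by rewrite /mval tnth_mktuple enum_rankK. Qed.

Lemma measurable_mval s : measurable_fun setT (mval ^~ s).
Proof. exact: measurable_tnth. Qed.

Lemma measurable_mk_msg d (X : measurableType d) (f : X -> Omega -> R) :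
  (forall s, measurable_fun setT (f ^~ s)) ->
  measurable_fun setT (fun x => mk_msg (f x)).
Proof.
move=> mf; apply/measurable_fun_tnthP => i.
rewrite (_ : _ \o _ = f ^~ (enum_val i)); first exact: mf.
by apply/funext => x /=; rewrite tnth_mktuple.
Qed.

Definition fcons (V : Type) (x : V) (c : {ffun 'I_K -> V}) : {ffun 'I_K.+1 -> V} :=
  [ffun i => oapp c x (unlift ord0 i)].

Definition flist (V : Type) (c : {ffun 'I_K -> V}) : seq V := [seq c i | i <- enum 'I_K].

Definition one_msg : msg := mk_msg (fun=> 1).
Definition ind_msg (omega : Omega) : msg := mk_msg (fun s => (s == omega)%:R).
Definition mul_msg (M N : msg) : msg := mk_msg (fun s => mval M s * mval N s).
(* The message sent by a constraint node to its first variable node when the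
   other ones send the messages ms. *)
Definition con_msg (psi : weight R Omega K.+1) (ms : seq msg) : msg :=
  mk_msg (fun s => \sum_(tau : {ffun 'I_K -> Omega})
    psi (fcons s tau) * \prod_(i < K) mval (nth one_msg ms i) (tau i)).

Lemma measurable_extend_msg :
  measurable_fun setT (fun x : weight R Omega K.+1 * (seq msg * msg) =>
    mul_msg (con_msg x.1 x.2.1) x.2.2).
Proof.
apply: measurable_mk_msg => s /=; apply: measurable_funM; last first.
  by apply: (measurableT_comp (measurable_mval s)); exact: measurableT_comp.
rewrite (_ : (fun _ => _) = (fun x : weight R Omega K.+1 * (seq msg * msg) =>
   \sum_(tau : {ffun 'I_K -> Omega})
    x.1 (fcons s tau) * \prod_(i < K) mval (nth one_msg x.2.1 i) (tau i))); last first.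
  by apply/funext => x; rewrite mvalK.
apply: measurable_sum => tau; apply: measurable_funM.
  exact: (measurableT_comp (measurable_weight_eval (fcons s tau))).
apply: measurable_prod => i _; apply: (measurableT_comp (measurable_mval _)).
apply: (measurableT_comp (measurable_seq_nth one_msg i)).
exact: measurableT_comp.
Qed.

Lemma measurable_fun_extend d (X : measurableType d) (f : X -> weight R Omega K.+1)
    (g : X -> seq msg) (h : X -> msg) :
  measurable_fun setT f -> measurable_fun setT g -> measurable_fun setT h ->
  measurable_fun setT (fun x => mul_msg (con_msg (f x) (g x)) (h x)).
Proof.
move=> mf mg mh; have := measurableT_comp measurable_extend_msg
  (measurable_fun_pair mf (measurable_fun_pair mg mh)).
exact.
Qed.

End messages.
Arguments one_msg {R Omega}.
Arguments ind_msg {R Omega} omega.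

Section broadcast.
Variables (R : realType) (Omega : finPointedType) (K : nat).
Variables (P : probability (weight R Omega K.+1) R) (kappa : R).
Notation msg := (msg R Omega).
Implicit Types F : msg -> \bar R.
Local Open Scope ereal_scope.

Section step.
Variable T : Omega -> (msg -> \bar R) -> \bar R.

(** The vertex children of one constraint node have the spins [ws] and send independent messages,
    [T w] being the law of a message from a vertex of spin [w]. *)
Fixpoint kids (ws : seq Omega) (F : seq msg -> \bar R) : \bar R :=
  if ws is w :: ws' then T w (fun m => kids ws' (fun ms => F (m :: ms)))
  else F [::].

(** A vertex of spin [omega] with [j] constraint nodes below: each of them draws its weight and the
    spins of its other neighbours with joint density [kappa * psi], and the messages are
    multiplied. *)
Fixpoint branch j omega F : \bar R :=
  if j is j'.+1 then
    \sum_(tau : {ffun 'I_K -> Omega}) \int[P]_psi ((kappa * psi (fcons omega tau))%:E *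
      kids (flist tau) (fun ms => branch j' omega
        (fun M => F (mul_msg (con_msg psi ms) M))))
  else F one_msg.

End step.

(* The expectation of F at the message received by the root, whose spin is
   omega, when the spins are broadcast down the tree and the spins at depth l
   are observed; w is the law of the number of constraint-node children. *)
Fixpoint bcast (w : nat -> R) l omega F : \bar R :=
  if l is l'.+1 then \sum_(j <oo) (w j)%:E * branch (bcast w l') j omega F
  else F (ind_msg omega).

(** The total mass of [bcast] at depth [l], whatever the root spin ([bcast_mass]): [j] constraint
    nodes have [K * j] vertex children in all. It is below 1 when [w] is a truncated law. *)
Fixpoint bmass (w : nat -> R) l : R :=
  if l is l'.+1 then fine (\sum_(j <oo) (w j * bmass w l' ^+ (K * j))%:E) else 1%R.

Hypothesis kappa_ge0 : (0 <= kappa)%R.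

Lemma weight_dens (omega : Omega) (tau : {ffun 'I_K -> Omega}) :
  nnmeas (fun psi : weight R Omega K.+1 => (kappa * psi (fcons omega tau))%:E) /\
  forall psi : weight R Omega K.+1, (kappa * psi (fcons omega tau))%:E <= (kappa * 2)%:E.
Proof.
split; first split=> [|psi].
- apply/measurable_EFinP/measurable_funM => //; exact: measurable_weight_eval.
- by rewrite lee_fin mulr_ge0// ltW// weight_gt0.
- by move=> psi; rewrite lee_fin ler_wpM2l// ltW// weight_lt2.
Qed.

Section step_theory.
Variable T : Omega -> (msg -> \bar R) -> \bar R.
Hypothesis HT : forall omega, is_integral (T omega).

Lemma il_kids ws : is_integral (kids T ws).
Proof.
elim: ws => [|w ws IH]; first exact: il_dirac.
exact: (il_comp (HT w) IH (@measurable_seq_cons _ msg)).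
Qed.

Lemma il_branch_tau j omega tau : is_integral (branch T j omega) ->
  is_integral (fun F => \int[P]_psi ((kappa * psi (fcons omega tau))%:E *
      kids T (flist tau) (fun ms => branch T j omega
        (fun M => F (mul_msg (con_msg psi ms) M))))).
Proof.
move=> IH; have [mw wc] := weight_dens omega tau.
exact: (il_comp (il_dens (il_prob P) mw wc)
  (il_comp (il_kids (flist tau)) IH (h := fun x => x) (@measurable_id _ _ _))
  (@measurable_extend_msg R Omega K)).
Qed.

Lemma il_branch j omega : is_integral (branch T j omega).
Proof.
elim: j => [|j IH]; first exact: il_dirac.
by apply: il_bigsum => tau; exact: il_branch_tau.
Qed.

Hypothesis normal : forall omega, \sum_(tau : {ffun 'I_K -> Omega})
  \int[P]_psi (kappa * psi (fcons omega tau))%:E = 1.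

Variable a : R.
Hypothesis Ta : forall omega, T omega (cst 1) = a%:E.

Lemma kids_mass ws : kids T ws (cst 1) = (a ^+ size ws)%:E.
Proof.
elim: ws => //= w ws IH.
have a0 : (0 <= a)%R by rewrite -lee_fin -(Ta point); apply: (il_ge0 (HT _)); exact: nnmeas_cst.
rewrite (_ : (fun _ => _) = cst (a ^+ size ws)%:E); last first.
  by apply/funext => m; rewrite -IH.
by rewrite (il_cst (HT w)) ?lee_fin ?exprn_ge0// Ta exprSr -EFinM.
Qed.

Lemma branch_mass j omega : branch T j omega (cst 1) = (a ^+ (K * j))%:E.
Proof.
elim: j => [|j IH]; first by rewrite muln0 expr0.
rewrite /= (_ : \sum_(tau : {ffun 'I_K -> Omega}) _ =
  \sum_(tau : {ffun 'I_K -> Omega}) (a ^+ (K * j.+1))%:E *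
    \int[P]_psi (kappa * psi (fcons omega tau))%:E).
  rewrite -ge0_sume_distrr ?normal ?mule1// => tau _.
  by apply: (il_ge0 (il_prob P)); exact: (weight_dens omega tau).1.
apply: eq_bigr => tau _; have [mw _] := weight_dens omega tau.
have a0 : (0 <= a)%R by rewrite -lee_fin -(Ta point); apply: (il_ge0 (HT _)); exact: nnmeas_cst.
rewrite -(ilZ (il_prob P)) ?lee_fin ?exprn_ge0//.
congr integral; apply/funext => psi; rewrite muleC; congr (_ * _).
rewrite (_ : (fun _ => _) = cst (a ^+ (K * j))%:E); last first.
  by apply/funext => ms; rewrite -IH.
rewrite (il_cst (il_kids _)) ?lee_fin ?exprn_ge0// kids_mass.
by rewrite -EFinM -exprD /flist size_map size_enum_ord mulnS addnC.
Qed.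

End step_theory.

Section monotone.
Variables T T' : Omega -> (msg -> \bar R) -> \bar R.
Hypotheses (HT : forall omega, is_integral (T omega)) (HT' : forall omega, is_integral (T' omega)).
Hypothesis TT' : forall omega F, nnmeas F -> T omega F <= T' omega F.

Lemma kids_le ws (F : seq msg -> \bar R) : nnmeas F -> kids T ws F <= kids T' ws F.
Proof.
elim: ws F => [//|w ws IH] F mF /=.
have mc : nnmeas (fun x : msg * seq msg => F (x.1 :: x.2)).
  exact: nnmeas_comp (@measurable_seq_cons _ msg) mF.
have mk U : (forall omega, is_integral (U omega)) ->
    nnmeas (fun m => kids U ws (fun ms => F (m :: ms))).
  by move=> HU; apply: (il_meas (il_kids HU ws) mc).
apply: (@le_trans _ _ (T w (fun m => kids T' ws (fun ms => F (m :: ms))))).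
  apply: (il_le (HT w)); [exact: mk|exact: mk|move=> m; apply: IH].
  exact: (nnmeas_comp (measurable_pairl m) mc).
exact/TT'/mk.
Qed.

Lemma branch_le j omega F : nnmeas F -> branch T j omega F <= branch T' j omega F.
Proof.
elim: j F => [//|j IH] F mF /=; apply: lee_sum => tau _.
have [mw _] := weight_dens omega tau.
have mF3 : nnmeas (fun x : (weight R Omega K.+1 * seq msg) * msg =>
    F (mul_msg (con_msg x.1.1 x.1.2) x.2)).
  apply: (nnmeas_comp (h := fun x : (weight R Omega K.+1 * seq msg) * msg =>
    (x.1.1, (x.1.2, x.2))) _ (nnmeas_comp (@measurable_extend_msg R Omega K) mF)).
  by apply: measurable_fun_pair; [|apply: measurable_fun_pair => //]; exact: measurableT_comp.
have mb U : (forall omega, is_integral (U omega)) ->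
   nnmeas (fun x : weight R Omega K.+1 * seq msg => branch U j omega
     (fun M => F (mul_msg (con_msg x.1 x.2) M))).
  by move=> HU; exact: (il_meas (il_branch HU j omega) mF3).
have mk U U' : (forall omega, is_integral (U omega)) -> (forall omega, is_integral (U' omega)) ->
   nnmeas (fun psi : weight R Omega K.+1 => (kappa * psi (fcons omega tau))%:E * kids U' (flist tau)
     (fun ms => branch U j omega (fun M => F (mul_msg (con_msg psi ms) M)))).
  move=> HU HU'; apply: nnmeasM => //.
  exact: (il_meas (il_kids HU' _) (mb U HU)).
apply: (il_le (il_prob P)); [exact: mk|exact: mk|move=> psi].
apply: lee_wpmul2l; first exact: mw.2.
have mbp U : (forall omega, is_integral (U omega)) ->
  nnmeas (fun ms => branch U j omega (fun M => F (mul_msg (con_msg psi ms) M))).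
  by move=> HU; exact: (nnmeas_comp (measurable_pairl psi) (mb U HU)).
apply: (@le_trans _ _ (kids T (flist tau) (fun ms => branch T' j omega
   (fun M => F (mul_msg (con_msg psi ms) M))))); last exact/kids_le/mbp.
apply: (il_le (il_kids HT _)); [exact: mbp|exact: mbp|move=> ms; apply: IH].
exact: (nnmeas_comp (measurable_pairl (psi, ms)) mF3).
Qed.

End monotone.

Hypothesis normal : forall omega, \sum_(tau : {ffun 'I_K -> Omega})
  \int[P]_psi (kappa * psi (fcons omega tau))%:E = 1.

Section law.
Variable w : nat -> R.
Hypotheses (w_ge0 : forall j, (0 <= w j)%R) (w_le1 : \sum_(j <oo) (w j)%:E <= 1).

(** The three facts need one induction: the series over [j] has finite mass only because the mass
    one level below is known and at most 1. *)
Lemma bcast_props l :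
  [/\ (0 <= bmass w l <= 1)%R, forall omega, is_integral (bcast w l omega) &
      forall omega, bcast w l omega (cst 1) = (bmass w l)%:E].
Proof.
elim: l => [|l [/andP[b0 b1] IHi IHm]].
  by split=> //=; [rewrite ler01 lexx|move=> omega; exact: il_dirac].
have t0 j : 0 <= (w j * bmass w l ^+ (K * j))%:E.
  by rewrite lee_fin mulr_ge0// exprn_ge0.
have s1 : \sum_(j <oo) (w j * bmass w l ^+ (K * j))%:E <= 1.
  apply: le_trans w_le1; apply: lee_nneseries => // j _.
  by rewrite lee_fin -[leRHS]mulr1 ler_wpM2l// exprn_ile1.
have sf : \sum_(j <oo) (w j * bmass w l ^+ (K * j))%:E \is a fin_num.
  rewrite ge0_fin_numE; last exact: nneseries_ge0.
  exact: le_lt_trans s1 (ltry _).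
have E omega : \sum_(j <oo) (w j)%:E * branch (bcast w l) j omega (cst 1) =
    \sum_(j <oo) (w j * bmass w l ^+ (K * j))%:E.
  by apply: eq_eseriesr => j _; rewrite (branch_mass IHi normal IHm).
split=> [|omega|omega]; rewrite /=.
- by rewrite -!lee_fin fineK// s1 nneseries_ge0.
- apply: (il_nneseries (L := fun j F => (w j)%:E * branch (bcast w l) j omega F)).
    by move=> j; apply: il_scale => //; exact: il_branch.
  by rewrite /= E; exact: le_lt_trans s1 (ltry _).
- by rewrite E fineK.
Qed.

Lemma il_bcast l omega : is_integral (bcast w l omega).
Proof. by have [_ + _] := bcast_props l; apply. Qed.

Lemma bcast_mass l omega : bcast w l omega (cst 1) = (bmass w l)%:E.
Proof. by have [_ _ +] := bcast_props l; apply. Qed.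

Lemma bmass01 l : (0 <= bmass w l <= 1)%R.
Proof. by have [] := bcast_props l. Qed.

Lemma bcast_compl l omega (f : msg -> R) : measurable_fun setT f ->
  (forall m, (0 <= f m <= 1)%R) ->
  bcast w l omega (fun m => (f m)%:E) + bcast w l omega (fun m => (1 - f m)%:E) =
  (bmass w l)%:E.
Proof.
move=> mf f01; rewrite -(bcast_mass l omega) -(ilD (il_bcast l omega)).
- by congr bcast; apply/funext => m /=; rewrite -EFinD addrC subrK.
- by split=> [|m]; [exact/measurable_EFinP|rewrite lee_fin; case/andP: (f01 m)].
- split=> [|m]; last by rewrite lee_fin subr_ge0; case/andP: (f01 m).
  by apply/measurable_EFinP; exact: measurable_funB.
Qed.

End law.

Lemma bcast_le (w w' : nat -> R) l omega F :
  (forall j, (0 <= w j <= w' j)%R) -> \sum_(j <oo) (w' j)%:E <= 1 -> nnmeas F ->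
  bcast w l omega F <= bcast w' l omega F.
Proof.
move=> ww' w'1 mF.
have w0 j : (0 <= w j)%R by case/andP: (ww' j).
have w'0 j : (0 <= w' j)%R by apply: le_trans (w0 j) _; case/andP: (ww' j).
have w1 : \sum_(j <oo) (w j)%:E <= 1.
  by apply: le_trans w'1; apply: lee_nneseries => // j _; rewrite lee_fin; case/andP: (ww' j).
elim: l omega F mF => [//|l IH] omega F mF /=.
have Hw := il_bcast w0 w1 l; have Hw' := il_bcast w'0 w'1 l.
apply: lee_nneseries => j _.
  by move=> _; rewrite mule_ge0 ?lee_fin//; exact: (il_ge0 (il_branch Hw j omega)).
apply: (@le_trans _ _ ((w' j)%:E * branch (bcast w l) j omega F)).
  apply: lee_wpmul2r; first exact: (il_ge0 (il_branch Hw j omega)).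
  by rewrite lee_fin; case/andP: (ww' j).
by apply: lee_wpmul2l; rewrite ?lee_fin//; exact: branch_le.
Qed.

(** Monotonicity applied to [1 - f]: the total masses are known, so a lower bound for the complement
    is an upper bound for [f], at the cost of the mass that [w] misses. *)
Lemma bcast_approx (w w' : nat -> R) l omega (f : msg -> R) :
  (forall j, (0 <= w j <= w' j)%R) -> \sum_(j <oo) (w' j)%:E <= 1 ->
  measurable_fun setT f -> (forall m, (0 <= f m <= 1)%R) ->
  bcast w' l omega (fun m => (f m)%:E) <=
  bcast w l omega (fun m => (f m)%:E) + (1 - bmass w l)%:E.
Proof.
move=> ww' w'1 mf f01.
have w0 j : (0 <= w j)%R by case/andP: (ww' j).
have w'0 j : (0 <= w' j)%R by apply: le_trans (w0 j) _; case/andP: (ww' j).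
have w1 : \sum_(j <oo) (w j)%:E <= 1.
  by apply: le_trans w'1; apply: lee_nneseries => // j _; rewrite lee_fin; case/andP: (ww' j).
have mf1 : nnmeas (fun m => (1 - f m)%:E).
  split=> [|m]; last by rewrite lee_fin subr_ge0; case/andP: (f01 m).
  by apply/measurable_EFinP; exact: measurable_funB.
have mf0 : nnmeas (fun m => (f m)%:E).
  by split=> [|m]; [exact/measurable_EFinP|rewrite lee_fin; case/andP: (f01 m)].
have c := bcast_compl w0 w1 l omega mf f01.
have c' := bcast_compl w'0 w'1 l omega mf f01.
have le := bcast_le l omega ww' w'1 mf1.
have /andP[_ b1] := bmass01 w'0 w'1 l.
have p0 := il_ge0 (il_bcast w0 w1 l omega) mf0.
have p1 := il_ge0 (il_bcast w0 w1 l omega) mf1.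
have p0' := il_ge0 (il_bcast w'0 w'1 l omega) mf0.
have p1' := il_ge0 (il_bcast w'0 w'1 l omega) mf1.
move: (bcast w l omega _) (bcast w l omega _) (bcast w' l omega _) (bcast w' l omega _)
  c c' le p0 p1 p0' p1' => [x| |] [y| |] [x'| |] [y'| |] //=.
move=> [c] [c']; rewrite !lee_fin => *; lra.
Qed.

End broadcast.

(** * Integration against i.i.d. and Poisson laws, and kernels *)

Lemma is_integral_eq d (A : measurableType d) (R : realType)
    (L L' : (A -> \bar R) -> \bar R) : is_integral L -> is_integral L' ->
  (forall B, measurable B -> L (fun x => (\1_B x)%:E) = L' (fun x => (\1_B x)%:E)) ->
  forall F, nnmeas F -> L F = L' F.
Proof.
move=> [mu E] [mu' E'] LL' F mF; rewrite E// E'//.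
apply: eq_measure_integral => B mB _.
have mI : nnmeas (fun x => (\1_B x)%:E : \bar R).
  by split=> [|x]; [exact/measurable_EFinP|rewrite lee_fin].
have := LL' B mB; rewrite E// E'//.
by rewrite !integral_indic// !setIT.
Qed.

Section integral_iid.
Context d (T : measurableType d) (R : realType).
Local Open Scope ereal_scope.

Lemma integral_iid0 (mu : probability T R) (F : 0.-tuple T -> \bar R) : nnmeas F ->
  \int[iid mu 0]_t F t = F [tuple].
Proof.
by move=> mF; rewrite /= integral_dirac ?diracT ?mul1e//; exact: mF.1.
Qed.

Lemma integral_iidS (mu : probability T R) n (F : n.+1.-tuple T -> \bar R) : nnmeas F ->
  \int[iid mu n.+1]_t F t = \int[mu]_x \int[iid mu n]_t F (cons_tuple x t).
Proof.
move=> mF /=.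
rewrite ge0_integral_distribution; [|exact: mF.1|exact: mF.2].
rewrite (fubini_tonelli1 (m1 := mu) (m2 := iid mu n) (F \o @cons_pair _ _ n))//.
- by apply: measurableT_comp; [exact: mF.1|exact: measurable_cons_pair].
- by move=> x; exact: mF.2.
Qed.

Lemma poisson_pmf_sum1 (rate : R) : (0 < rate)%R ->
  \sum_(j <oo) (poisson_pmf rate j)%:E = 1.
Proof.
move=> r0; have : poisson_prob rate 0%N [set: nat] = 1 by exact: probability_setT.
rewrite /poisson_prob r0.
move=> E; transitivity (\esum_(i in [set: nat]) (poisson_pmf rate i)%:E); last exact: E.
by apply: nneseries_esumT => j; rewrite lee_fin; exact: poisson_pmf_ge0.
Qed.

Lemma integral_poisson_prob (rate : R) (f : nat -> \bar R) : (0 < rate)%R ->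
  (forall n, 0 <= f n) ->
  \int[poisson_prob rate 0%N]_n f n = \sum_(n <oo) (poisson_pmf rate n)%:E * f n.
Proof.
move=> r0 f0.
have mf : nnmeas f by split=> // _ B mB.
apply: (is_integral_eq (L := fun f => \int[poisson_prob rate 0%N]_n f n)
  (L' := fun f => \sum_(n <oo) (poisson_pmf rate n)%:E * f n)) mf.
- exact: il_prob.
- apply: (il_nneseries (L := fun n f => (poisson_pmf rate n)%:E * f n)).
    by move=> n; apply: il_scale; [exact: il_dirac|exact: poisson_pmf_ge0].
  by under eq_eseriesr do rewrite mule1; rewrite poisson_pmf_sum1// ltry.
- move=> B mB; transitivity (poisson_prob rate 0 B).
    by rewrite integral_indic// setIT.
  rewrite /poisson_prob r0.
  rewrite esum_mkcond -nneseries_esumT; last first.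
    by move=> n; case: ifP => // _; rewrite lee_fin poisson_pmf_ge0.
  apply: eq_eseriesr => n _; rewrite indicE.
  by case: (n \in B); rewrite ?mule1 ?mule0.
Qed.

Lemma integral_poisson_iid (rate : R) (mu : probability T R) (F : seq T -> \bar R) :
  (0 < rate)%R -> nnmeas F ->
  \int[poisson_iid rate mu]_s F s =
  \sum_(j <oo) (poisson_pmf rate j)%:E * \int[iid mu j]_t F (tval t).
Proof.
move=> r0 mF.
apply: (is_integral_eq (L := fun F => \int[poisson_iid rate mu]_s F s)
  (L' := fun F => \sum_(j <oo) (poisson_pmf rate j)%:E * \int[iid mu j]_t F (tval t))) mF.
- exact: il_prob.
- apply: (il_nneseries (L := fun j F => (poisson_pmf rate j)%:E * \int[iid mu j]_t F (tval t))).
    move=> j; apply: il_scale; last exact: poisson_pmf_ge0.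
    exact: (il_map (il_prob (iid mu j)) (@measurable_tuple_seq _ T j)).
  rewrite (eq_eseriesr (g := fun j => (poisson_pmf rate j)%:E)).
    by rewrite poisson_pmf_sum1// ltry.
  move=> j _; rewrite (integral_cst (iid mu j))// [X in _ * (_ * X)](probability_setT (iid mu j)).
  by rewrite !mule1.
- move=> B mB; transitivity (poisson_iid rate mu B).
    by rewrite integral_indic// setIT.
  rewrite /poisson_iid.
  rewrite integral_poisson_prob//; last by move=> n; exact: (@measure_ge0 _ _ _ (iid mu n)).
  apply: eq_eseriesr => j _; congr (_ * _).
  rewrite (_ : (fun t : j.-tuple T => (\1_B (tval t))%:E) =
    (fun t => (\1_[set t : j.-tuple T | B (tval t)] t)%:E)).
    by rewrite (integral_indic (iid mu j))// ?setIT//; exact: mB.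
  by apply/funext => t; rewrite !indicE; congr (_%:R)%:E; apply/idP/idP; rewrite !inE.
Qed.

End integral_iid.

Section kernel_functional.
Context d d' (X : measurableType d) (A : measurableType d') (R : realType).
Local Open Scope ereal_scope.

(** The extra parameter in [B] makes the notion stable under composition: the inductive steps
    integrate functions that still depend on variables drawn earlier. *)
Definition is_kernel (H : X -> (A -> \bar R) -> \bar R) :=
  (forall x, is_integral (H x)) /\
  forall d'' (B : measurableType d'') (G : B * A -> \bar R), nnmeas G ->
    nnmeas (fun bx : B * X => H bx.2 (fun a => G (bx.1, a))).

Lemma kernel_meas (H : X -> (A -> \bar R) -> \bar R) F : is_kernel H -> nnmeas F ->
  nnmeas (fun x => H x F).
Proof.
move=> [_ KH] mF.
have := KH _ unit _ (nnmeas_comp (measurable_snd : measurable_fun setT (snd : unit * A -> A)) mF).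
exact: (nnmeas_comp (measurable_pairl tt)).
Qed.

End kernel_functional.

(** * The broadcast on a fixed tree *)

Section quenched.
Variables (R : realType) (Omega : finPointedType) (K : nat) (kappa : R).
Notation weight := (weight R Omega K.+1).
Notation msg := (msg R Omega).
Implicit Types F : msg -> \bar R.
Local Open Scope ereal_scope.
Hypothesis kappa_ge0 : (0 <= kappa)%R.

Section step.
Context d (X : measurableType d) (H : X -> Omega -> (msg -> \bar R) -> \bar R).

(** [qkids], [qbranch] and [quenched] are [kids], [branch] and [bcast] with the tree and its weights
    frozen, so that only spins are summed. Lists of different lengths fall under the default case
    and do not arise from a tree. *)
Fixpoint qkids (ts : seq X) (ws : seq Omega) (F : seq msg -> \bar R) : \bar R :=
  match ts, ws with
  | t :: ts', w :: ws' => H t w (fun m => qkids ts' ws' (fun ms => F (m :: ms)))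
  | _, _ => F [::]
  end.

Fixpoint qbranch (t : seq (weight * K.-tuple X)) omega F : \bar R :=
  if t is (psi, ts) :: t' then
    \sum_(tau : {ffun 'I_K -> Omega}) (kappa * psi (fcons omega tau))%:E *
      qkids ts (flist tau) (fun ms => qbranch t' omega
        (fun M => F (mul_msg (con_msg psi ms) M)))
  else F one_msg.

Hypothesis KH : forall omega, is_kernel (fun x => H x omega).

Lemma qkids_kernel n (ws : seq Omega) :
  is_kernel (fun ts : n.-tuple X => qkids ts ws).
Proof.
elim: n ws => [|n IH] ws.
  split=> [ts|d'' B G mG]; first by rewrite tuple0 /=; exact: il_dirac.
  rewrite (_ : (fun _ => _) = fun bx : B * 0.-tuple X => G (bx.1, [::])).
    by apply: (nnmeas_comp _ mG) => /=; apply: measurable_fun_pair.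
  by apply/funext => -[b ts]; rewrite /= tuple0.
case: ws => [|w ws].
  split=> [ts|d'' B G mG]; first by case/tupleP: ts => t ts /=; exact: il_dirac.
  rewrite (_ : (fun _ => _) = fun bx : B * n.+1.-tuple X => G (bx.1, [::])).
    by apply: (nnmeas_comp _ mG) => /=; apply: measurable_fun_pair.
  by apply/funext => -[b ts]; case/tupleP: ts.
have [IH1 IH2] := IH ws.
split=> [ts|d'' B G mG].
  case/tupleP: ts => t ts /=.
  exact: (il_comp ((KH w).1 t) (IH1 ts) (@measurable_seq_cons _ msg)).
have mG1 : nnmeas (fun x : (B * msg) * seq msg => G (x.1.1, x.1.2 :: x.2)).
  apply: (nnmeas_comp _ mG); apply: measurable_fun_pair; first exact: measurableT_comp.
  by apply: measurable_fun_cons => //; exact: measurableT_comp.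
have m1 := IH2 _ _ _ mG1.
have mG2 : nnmeas (fun x : (B * n.-tuple X) * msg =>
    qkids x.1.2 ws (fun ms => G (x.1.1, x.2 :: ms))).
  apply: (nnmeas_comp (h := fun x : (B * n.-tuple X) * msg => ((x.1.1, x.2), x.1.2)) _ m1).
  apply: measurable_fun_pair; last exact: measurableT_comp.
  by apply: measurable_fun_pair => //; exact: measurableT_comp.
have m2 := (KH w).2 _ _ _ mG2.
rewrite (_ : (fun _ => _) = (fun bx : (B * n.-tuple X) * X => H bx.2 w (fun a =>
    qkids bx.1.2 ws (fun ms => G (bx.1.1, a :: ms)))) \o
  (fun x : B * n.+1.-tuple X => ((x.1, [tuple of behead x.2]), thead x.2))).
  apply: nnmeas_comp m2; apply: measurable_fun_pair => //.
    apply: measurable_fun_pair => //.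
    by apply: (measurableT_comp (@measurable_behead _ X n)).
  by apply: (measurableT_comp (@measurable_tnth _ X _ ord0)).
by apply/funext => -[b ts] /=; case/tupleP: ts => t ts; rewrite theadE.
Qed.

Lemma qbranch_kernel n omega :
  is_kernel (fun t : n.-tuple (weight * K.-tuple X)%type => qbranch t omega).
Proof.
elim: n => [|n [IH1 IH2]].
  split=> [ts|d'' B G mG]; first by rewrite tuple0 /=; exact: il_dirac.
  rewrite (_ : (fun _ => _) = fun bx : B * 0.-tuple _ => G (bx.1, one_msg)).
    by apply: (nnmeas_comp _ mG) => /=; apply: measurable_fun_pair.
  by apply/funext => -[b ts]; rewrite /= tuple0.
split=> [ts|d'' B G mG].
  case/tupleP: ts => -[psi ts] t /=.
  apply: il_bigsum => tau; apply: il_scale; last by rewrite mulr_ge0// ltW// weight_gt0.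
  apply: (il_comp ((qkids_kernel _ (flist tau)).1 ts) (IH1 t)
    (h := fun x => mul_msg (con_msg psi x.1) x.2)).
  exact: (measurableT_comp (@measurable_extend_msg R Omega K) (measurable_pairl psi)).
rewrite (_ : (fun _ => _) = fun bx : B * n.+1.-tuple (weight * K.-tuple X)%type =>
   \sum_(tau : {ffun 'I_K -> Omega}) (kappa * (thead bx.2).1 (fcons omega tau))%:E *
      qkids (thead bx.2).2 (flist tau) (fun ms => qbranch [tuple of behead bx.2] omega
        (fun M => G (bx.1, mul_msg (con_msg (thead bx.2).1 ms) M)))); last first.
  by apply/funext => -[b ts] /=; case/tupleP: ts => -[psi ts] t; rewrite theadE.
apply: nnmeas_sum => tau.
have mth : measurable_fun setT (fun bx : B * n.+1.-tuple (weight * K.-tuple X)%type => thead bx.2).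
  exact: (measurableT_comp (@measurable_tnth _ _ _ ord0) measurable_snd).
have mth1 := measurableT_comp (@measurable_fst _ _ weight (K.-tuple X)) mth.
have mth2 := measurableT_comp (@measurable_snd _ _ weight (K.-tuple X)) mth.
apply: nnmeasM.
  apply: (nnmeas_comp (F := fun psi : weight => (kappa * psi (fcons omega tau))%:E) mth1).
  split=> [|psi]; last by rewrite lee_fin mulr_ge0// ltW// weight_gt0.
  by apply/measurable_EFinP/measurable_funM => //; exact: measurable_weight_eval.
pose B1 : measurableType _ := ((B * weight) * seq msg)%type.
have mG1 : nnmeas (fun x : B1 * msg => G (x.1.1.1, mul_msg (con_msg x.1.1.2 x.1.2) x.2)).
  apply: (nnmeas_comp _ mG); apply: measurable_fun_pair.
    by apply: measurableT_comp => //; exact: measurableT_comp.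
  apply: measurable_fun_extend => //; last exact: measurableT_comp.
  by apply: measurableT_comp => //; exact: measurableT_comp.
have m1 := IH2 _ _ _ mG1.
pose B2 : measurableType _ := ((B * weight) * n.-tuple (weight * K.-tuple X)%type)%type.
have mG2 : nnmeas (fun x : B2 * seq msg => qbranch x.1.2 omega
   (fun M => G (x.1.1.1, mul_msg (con_msg x.1.1.2 x.2) M))).
  apply: (nnmeas_comp (h := fun x : B2 * seq msg => ((x.1.1, x.2), x.1.2)) _ m1).
  apply: measurable_fun_pair; last exact: measurableT_comp.
  by apply: measurable_fun_pair => //; exact: measurableT_comp.
have m2 := (qkids_kernel K (flist tau)).2 _ _ _ mG2.
apply: (nnmeas_comp (h := fun bx : B * n.+1.-tuple (weight * K.-tuple X)%type =>
  (((bx.1, (thead bx.2).1), [tuple of behead bx.2]), (thead bx.2).2)) _ m2).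
apply: measurable_fun_pair => //; apply: measurable_fun_pair.
  exact: measurable_fun_pair.
exact: (measurableT_comp (@measurable_behead _ _ n) measurable_snd).
Qed.

Variables (P : probability weight R) (mu : probability X R).
Variable T : Omega -> (msg -> \bar R) -> \bar R.
Hypothesis HT : forall omega F, nnmeas F -> \int[mu]_x H x omega F = T omega F.

Lemma integral_qkids n (ws : seq Omega) (F : seq msg -> \bar R) : size ws = n -> nnmeas F ->
  \int[iid mu n]_ts qkids ts ws F = kids T ws F.
Proof.
elim: n ws F => [|n IH] ws F.
  move=> /size0nil -> mF; rewrite integral_iid0//.
  exact: (kernel_meas (qkids_kernel 0 [::]) mF).
case: ws => // w ws [sw] mF; rewrite integral_iidS; last first.
  exact: (kernel_meas (qkids_kernel n.+1 (w :: ws)) mF).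
have mc : nnmeas (fun x : msg * seq msg => F (x.1 :: x.2)).
  exact: nnmeas_comp (@measurable_seq_cons _ msg) mF.
have mq := (qkids_kernel n ws).2 _ _ _ mc.
have E m : \int[iid mu n]_ts qkids ts ws (fun ms => F (m :: ms)) =
    kids T ws (fun ms => F (m :: ms)).
  by apply: IH => //; exact: (nnmeas_comp (measurable_pairl m) mc).
rewrite /= -HT; last first.
  rewrite (_ : (fun m => _) = fun m =>
    \int[iid mu n]_ts qkids ts ws (fun ms => F (m :: ms))); last exact/funext.
  exact: (il_meas (il_prob (iid mu n)) mq).
congr integral; apply/funext => x.
rewrite (il_comm (il_prob (iid mu n)) ((KH w).1 x)
  (F := fun ts m => qkids (tval ts) ws (fun ms => F (m :: ms)))); last first.
  apply: (nnmeas_comp (h := fun x : n.-tuple X * msg => (x.2, x.1)) _ mq).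
  exact: measurable_fun_pair.
by congr (H x w _); apply/funext => m; rewrite E.
Qed.

Lemma integral_qbranch n omega F : nnmeas F ->
  \int[iid (P \x iid mu K)%E n]_t qbranch t omega F = branch P kappa T n omega F.
Proof.
elim: n F => [|n IH] F mF.
  by rewrite integral_iid0//; exact: (kernel_meas (qbranch_kernel 0 omega) mF).
rewrite integral_iidS; last exact: (kernel_meas (qbranch_kernel n.+1 omega) mF).
pose B1 : measurableType _ := (weight * seq msg)%type.
have mF1 : nnmeas (fun x : B1 * msg => F (mul_msg (con_msg x.1.1 x.1.2) x.2)).
  apply: (nnmeas_comp _ mF).
  by apply: measurable_fun_extend => //; exact: measurableT_comp.
have m1 := (qbranch_kernel n omega).2 _ _ _ mF1.
have m1' (psi : weight) : nnmeas (fun x : n.-tuple (weight * K.-tuple X)%type * seq msg =>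
    qbranch x.1 omega (fun M => F (mul_msg (con_msg psi x.2) M))).
  apply: (nnmeas_comp (h := fun x : n.-tuple (weight * K.-tuple X)%type * seq msg =>
    ((psi, x.2), x.1)) _ m1).
  by apply: measurable_fun_pair => //; exact: measurable_fun_pair.
have E (psi : weight) ms : \int[iid (P \x iid mu K)%E n]_t
    qbranch t omega (fun M => F (mul_msg (con_msg psi ms) M)) =
    branch P kappa T n omega (fun M => F (mul_msg (con_msg psi ms) M)).
  by apply: IH; exact: (nnmeas_comp (measurable_pairl (psi, ms)) mF1).
have m2 : nnmeas (fun x : B1 => branch P kappa T n omega
    (fun M => F (mul_msg (con_msg x.1 x.2) M))).
  rewrite (_ : (fun m => _) = fun x : B1 => \int[iid (P \x iid mu K)%E n]_t
    qbranch t omega (fun M => F (mul_msg (con_msg x.1 x.2) M))); last first.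
    by apply/funext => x; rewrite E.
  exact: (il_meas (il_prob (iid (P \x iid mu K)%E n)) m1).
have m3 (tau : {ffun 'I_K -> Omega}) : nnmeas (fun x : weight * K.-tuple X => qkids x.2 (flist tau)
    (fun ms => branch P kappa T n omega (fun M => F (mul_msg (con_msg x.1 ms) M)))).
  exact: ((qkids_kernel K (flist tau)).2 _ _ _ m2).
have mw (tau : {ffun 'I_K -> Omega}) := (weight_dens kappa_ge0 omega tau).1.
have m4 (tau : {ffun 'I_K -> Omega}) : nnmeas (fun x : weight * K.-tuple X => (kappa * x.1 (fcons omega tau))%:E *
    qkids x.2 (flist tau)
    (fun ms => branch P kappa T n omega (fun M => F (mul_msg (con_msg x.1 ms) M)))).
  by apply: nnmeasM => //; exact: (nnmeas_comp measurable_fst (mw tau)).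
transitivity (\int[(P \x iid mu K)%E]_x \sum_(tau : {ffun 'I_K -> Omega})
   ((kappa * x.1 (fcons omega tau))%:E * qkids x.2 (flist tau)
    (fun ms => branch P kappa T n omega (fun M => F (mul_msg (con_msg x.1 ms) M))))).
  congr integral; apply/funext => -[psi ts]; rewrite [LHS]/=.
  have mk tau : nnmeas (fun t : n.-tuple (weight * K.-tuple X)%type =>
      qkids ts (flist tau) (fun ms => qbranch t omega
        (fun M => F (mul_msg (con_msg psi ms) M)))).
    exact: (il_meas ((qkids_kernel K (flist tau)).1 ts) (m1' psi)).
  rewrite (il_sum (il_prob (iid (P \x iid mu K)%E n))); last first.
    by move=> tau; apply: nnmeasZ => //; exact: (mw tau).2.
  apply: eq_bigr => tau _.
  rewrite (ilZ (il_prob (iid (P \x iid mu K)%E n)))//; last exact: (mw tau).2.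
  congr (_ * _).
  rewrite (il_comm (il_prob (iid (P \x iid mu K)%E n)) ((qkids_kernel K (flist tau)).1 ts)
   (F := fun t ms => qbranch (tval t) omega (fun M => F (mul_msg (con_msg psi ms) M))))//.
  by congr (qkids _ _ _); apply/funext => ms; rewrite E.
rewrite (il_sum (il_prob (P \x iid mu K)%E))//; apply: eq_bigr => tau _.
rewrite (fubini_tonelli1 (m1 := P) (m2 := iid mu K) _ (m4 tau).1 (m4 tau).2).
congr integral; apply/funext => psi; rewrite /fubini_F.
have m5 : nnmeas (fun ms => branch P kappa T n omega
    (fun M => F (mul_msg (con_msg psi ms) M))).
  exact: (nnmeas_comp (measurable_pairl psi) m2).
transitivity ((kappa * psi (fcons omega tau))%:E * \int[iid mu K]_ts qkids ts (flist tau)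
    (fun ms => branch P kappa T n omega (fun M => F (mul_msg (con_msg psi ms) M)))); last first.
  by rewrite integral_qkids// /flist size_map size_enum_ord.
have Z := ilZ (il_prob (iid mu K)) ((mw tau).2 psi)
  (nnmeas_comp (measurable_pairl psi) (m3 tau)).
by rewrite -[RHS]Z; congr integral.
Qed.

End step.

Fixpoint quenched l : tree R Omega K.+1 l -> Omega -> (msg -> \bar R) -> \bar R :=
  if l is l'.+1 return tree R Omega K.+1 l -> Omega -> (msg -> \bar R) -> \bar R
  then fun t => qbranch (@quenched l') t else fun _ omega F => F (ind_msg omega).

Lemma quenched_kernel l omega : is_kernel (fun t => @quenched l t omega).
Proof.
elim: l omega => [|l IH] omega.
  split=> [t|d'' B G mG]; first exact: il_dirac.
  by apply: (nnmeas_comp _ mG) => /=; apply: measurable_fun_pair.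
split=> [t|d'' B G mG]; first exact: ((qbranch_kernel IH (size t) omega).1 (in_tuple t)).
split=> [|x]; last first.
  have mG1 : nnmeas (fun a => G (x.1, a)) by exact: (nnmeas_comp (measurable_pairl x.1) mG).
  exact: (il_ge0 ((qbranch_kernel IH (size x.2) omega).1 (in_tuple x.2)) mG1).
apply: measurable_prod_seq => n.
exact: ((qbranch_kernel IH n omega).2 _ _ _ mG).1.
Qed.

Variables (P : probability weight R) (dd : R).
Hypothesis d_gt0 : (0 < dd)%R.

Lemma integral_quenched l omega F : nnmeas F ->
  \int[tree_law P dd l]_t quenched t omega F = bcast P kappa (poisson_pmf dd) l omega F.
Proof.
elim: l omega F => [|l IH] omega F mF.
  by rewrite /= integral_dirac ?diracT ?mul1e.
have mq : nnmeas (fun t => @quenched l.+1 t omega F).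
  exact: (kernel_meas (quenched_kernel l.+1 omega) mF).
rewrite [LHS](integral_poisson_iid (P \x iid (tree_law P dd l) K)%E d_gt0 mq).
apply: eq_eseriesr => j _; congr (_ * _).
exact: (integral_qbranch (quenched_kernel l) P IH).
Qed.

End quenched.

(** * Graphs as lists of constraints and their exploration *)

Section graph_lists.
Variables (R : realType) (Omega : finPointedType) (K : nat) (V : finType).
Notation weight := (weight R Omega K.+1).
Notation con := ({ffun 'I_K.+1 -> V} * weight)%type.
Implicit Types (g : seq con) (x y z : V) (tau : {ffun V -> Omega}).

Definition touch (y : {ffun 'I_K.+1 -> V}) x := [exists i, y i == x].

Definition wprod g tau : R := \prod_(a <- g) a.2 (local_spins tau a.1).

Definition step (g : seq {ffun 'I_K.+1 -> V}) x y := has (fun a => touch a x && touch a y) g.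

(* z is at distance less than 2l from y. *)
Fixpoint inball (g : seq {ffun 'I_K.+1 -> V}) l y z :=
  if l is l'.+1 then (y == z) || [exists z', step g y z' && inball g l' z' z] else false.

Lemma wprod_gt0 g tau : 0 < wprod g tau.
Proof. by apply: prodr_gt0 => a _; exact: weight_gt0. Qed.

Lemma wprod_cat g g' tau : wprod (g ++ g') tau = wprod g tau * wprod g' tau.
Proof. by rewrite /wprod big_cat. Qed.

Lemma near_le (g : seq {ffun 'I_K.+1 -> V}) l l' y z : (l <= l')%N -> inball g l y z -> inball g l' y z.
Proof.
elim: l l' y => [//|l IH] [//|l'] y; rewrite ltnS => ll' /= /orP[->//|/existsP[z' /andP[s n]]].
by apply/orP; right; apply/existsP; exists z'; rewrite s (IH l').
Qed.

Lemma near_step (g : seq {ffun 'I_K.+1 -> V}) l y z' z : step g y z' -> inball g l z' z -> inball g l.+1 y z.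
Proof. by move=> s n /=; apply/orP; right; apply/existsP; exists z'; rewrite s. Qed.

End graph_lists.

Section presentation.
Variables (R : realType) (Omega : finPointedType) (K : nat) (G : factor_graph R Omega K.+1).
Notation V := (fg_var G).
Notation con := ({ffun 'I_K.+1 -> V} * weight R Omega K.+1)%type.

(** Conditional Gibbs probabilities see a graph only through its Gibbs weights and through which
    variable nodes share a constraint. A list of constraints with the same two data may replace the
    graph; trees and teacher-student graphs both have one. *)
Definition presents (g : seq con) :=
  (forall tau : {ffun V -> Omega}, gibbs_weight tau = wprod g tau) /\
  (forall x y, step (map fst g) x y =
     [exists a : fg_con G, touch (fg_nbr a) x && touch (fg_nbr a) y]).

Variable g : seq con.
Hypothesis pg : presents g.

Lemma dist_near (y z : V) l : fg_dist_ge y z (2 * l) = ~~ inball (map fst g) l y z.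
Proof.
(* A path between variable nodes alternates between the two kinds of nodes, so each unfolding of
   [inball] consumes two of its edges. *)
have E l' y' : (exists2 p : seq (V + fg_con G), (size p < 2 * l')%N &
    path (@fg_adj _ _ _ G) (inl y') p && (last (inl y') p == inl z)) <->
    inball (map fst g) l' y' z.
  elim: l' y' => [|l' IH] y'; first by split=> // -[p]; rewrite muln0 ltn0.
  split=> [[[|[x|a] [|[z'|b] p]]]|/=] //=.
  - by move=> _ /eqP[->]; rewrite eqxx.
  - by move=> _ /andP[_ /eqP].
  - move=> sp /andP[/and3P[ay az' pp] lp]; apply/orP; right; apply/existsP; exists z'.
    rewrite pg.2; apply/andP; split; first by apply/existsP; exists a; apply/andP.
    apply/IH; exists p; last by apply/andP.
    by move: sp; rewrite mulnS !ltnS.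
  - by rewrite andbF.
  - move=> /orP[/eqP->|/existsP[z' /andP[]]]; first by exists [::]; rewrite //= eqxx.
    rewrite pg.2 => /existsP[a /andP[ay az']] /IH[p sp /andP[pp lp]].
    exists [:: inr a, inl z' & p]; first by rewrite /= mulnS !ltnS.
    by apply/andP; split=> //; apply/and3P.
apply/forallP/idP => [H|H m].
  apply/negP => /E[p sp pp]; have := H (Ordinal sp); apply/negP; rewrite negbK.
  by apply/existsP; exists (in_tuple p).
apply/negP => /existsP[p pp]; apply/negP: H; rewrite negbK; apply/E.
by exists (tval p); rewrite ?size_tuple.
Qed.

Definition far_eq l (y : V) (sigma tau : {ffun V -> Omega}) :=
  [forall z, ~~ inball (map fst g) l y z ==> (tau z == sigma z)].

Lemma gibbs_condE l (y : V) s (sigma : {ffun V -> Omega}) :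
  gibbs_cond l y s sigma =
  (\sum_(tau | far_eq l y sigma tau && (tau y == s)) wprod g tau) /
  (\sum_(tau | far_eq l y sigma tau) wprod g tau).
Proof.
have aE tau : agree_far l y sigma tau = far_eq l y sigma tau.
  by apply: eq_forallb => z; rewrite dist_near.
have Z0 : \sum_(tau : {ffun V -> Omega}) gibbs_weight tau != 0.
  apply: lt0r_neq0; rewrite (bigD1 sigma)//= ltr_pwDl//; first by rewrite pg.1 wprod_gt0.
  by apply: sumr_ge0 => tau _; rewrite pg.1 ltW// wprod_gt0.
rewrite /gibbs_cond /gibbs -!mulr_suml invfM invrK mulrACA mulVf// mulr1.
congr (_ / _).
  by apply: eq_big => [tau|tau _]; rewrite ?aE ?pg.1.
by apply: eq_big => [tau|tau _]; rewrite ?aE ?pg.1.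
Qed.

End presentation.

(** * Summation over spins, vertex by vertex *)

Section iterated_sums.
Variables (R : realType) (Omega : finType) (V : finType).
Implicit Types (tau sigma : {ffun V -> Omega}) (f h : {ffun V -> Omega} -> R) (us : seq V).

Definition upd tau x w : {ffun V -> Omega} := [ffun z => if z == x then w else tau z].

(** The sum over the spins at [us], all other spins being those of [tau]. Nested sums follow the
    recursion of an exploration; [isum_sum] returns to a plain sum over assignments. *)
Fixpoint isum us f tau : R :=
  if us is u :: us' then \sum_w isum us' f (upd tau u w) else f tau.

Definition depends (A : seq V) f :=
  forall sigma tau, {in A, sigma =1 tau} -> f sigma = f tau.

Lemma eq_isum us f h tau : (forall sigma, (forall z, z \notin us -> sigma z = tau z) ->
  f sigma = h sigma) -> isum us f tau = isum us h tau.
Proof.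
elim: us tau => [|u us IH] tau fh /=; first exact: fh.
apply: eq_bigr => w _; apply: IH => sigma st; apply: fh => z.
by rewrite inE negb_or => /andP[zu zus]; rewrite st// ffunE (negbTE zu).
Qed.

Lemma isum_sum us f tau : uniq us ->
  isum us f tau = \sum_(sigma : {ffun V -> Omega} | [forall z, (z \notin us) ==> (sigma z == tau z)]) f sigma.
Proof.
elim: us tau => [|u us IH] tau /=.
  move=> _; rewrite (big_pred1 tau)// => sigma; apply/forallP/eqP => [H|-> z//].
  by apply/ffunP => z; apply/eqP.
case/andP => uus Uus.
rewrite [RHS](partition_big (fun sigma : {ffun V -> Omega} => sigma u) xpredT)//=.
apply: eq_bigr => w _; rewrite IH//; apply: eq_bigl => sigma.
apply/forallP/andP => [H|[/forallP H /eqP su] z].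
  split; last by have := H u; rewrite uus ffunE eqxx.
  apply/forallP => z; apply/implyP; rewrite inE negb_or => /andP[zu zus].
  by have := H z; rewrite zus ffunE (negbTE zu).
apply/implyP => zus; rewrite ffunE; have [->|zu] := eqVneq z u; first by rewrite su.
by have := H z; rewrite inE negb_or zu zus.
Qed.

Lemma isum_cat us vs f tau : isum (us ++ vs) f tau = isum us (isum vs f) tau.
Proof. by elim: us tau => //= u us IH tau; apply: eq_bigr => w _. Qed.

Lemma depends_isum A us f : depends A f -> depends A (isum us f).
Proof.
move=> fA; elim: us => //= u us IH sigma tau st; apply: eq_bigr => w _.
by apply: IH => z zA; rewrite !ffunE st.
Qed.

Lemma depends_sub A B f : {subset A <= B} -> depends A f -> depends B f.
Proof. by move=> AB fA sigma tau st; apply: fA => z zA; apply/st/AB. Qed.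

Lemma isum_mull A us f h tau : depends A f -> (forall u, u \in us -> u \notin A) ->
  isum us (fun sigma => f sigma * h sigma) tau = f tau * isum us h tau.
Proof.
move=> fA; elim: us tau => //= u us IH tau uA.
rewrite mulr_sumr; apply: eq_bigr => w _.
rewrite IH => [|v vus]; last by apply: uA; rewrite inE vus orbT.
congr (_ * _); apply: fA => z zA; rewrite ffunE; case: eqP => // zu.
by have := uA u; rewrite inE eqxx -zu zA => /(_ isT).
Qed.

(** Sums over vertices that the other factor does not see can be separated. This is how the tree
    structure enters the Gibbs weights. *)
Lemma isum_mul A B us vs f h tau : depends A f -> depends B h ->
  (forall u, u \in us -> u \notin B) -> (forall v, v \in vs -> v \notin A) ->
  isum (us ++ vs) (fun sigma => f sigma * h sigma) tau = isum us f tau * isum vs h tau.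
Proof.
move=> fA hB uB vA; rewrite isum_cat.
transitivity (isum us (fun sigma => isum vs h sigma * f sigma) tau).
  by apply: eq_isum => sigma _; rewrite (isum_mull _ _ fA)// mulrC.
by rewrite (isum_mull _ _ (depends_isum vs hB))// mulrC.
Qed.

Lemma isum_exchange (I : finType) us (F : I -> {ffun V -> Omega} -> R) tau :
  isum us (fun sigma => \sum_i F i sigma) tau = \sum_i isum us (F i) tau.
Proof.
by elim: us tau => //= u us IH tau; rewrite exchange_big; apply: eq_bigr => w _; rewrite IH.
Qed.

End iterated_sums.

(** * Tree-like explorations of a graph *)

Section exploration.
Variables (R : realType) (Omega : finPointedType) (K : nat) (V : finType).
Notation weight := (weight R Omega K.+1).
Notation con := ({ffun 'I_K.+1 -> V} * weight)%type.
Notation msg := (msg R Omega).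
Variables (dg : pred nat) (sigma : {ffun V -> Omega}).
Implicit Types (x : V) (W A xs : seq V) (E : seq con) (N : seq (V * nat)) (m M : msg).

(** In a graph the explored vertex [x] may occupy any slot [p] of a constraint. Permuting the weight
    along with the neighbourhood keeps the Gibbs factor equal to that of the constraint with [x] in
    front ([local_con_at]). *)
Definition con_at (p : 'I_K.+1) x (c : {ffun 'I_K -> V}) (psi : weight) : con :=
  ([ffun i => fcons x c (tperm ord0 p i)], perm_weight (tperm ord0 p) psi).

(* expl l x W E N A m: exploring x to depth l, W being the vertices seen before,
   reveals the constraints E, which form a tree on fresh vertices A; N lists the
   vertices at depth < l with their remaining depth, and m is the message at x.
   The numbers of constraints explored below a vertex satisfy dg. *)
Inductive expl : nat -> V -> seq V -> seq con -> seq (V * nat) -> seq V -> msg -> Prop :=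
| expl0 x W : expl 0 x W [::] [::] [::] (ind_msg (sigma x))
| explS l j x W E N A M : dg j -> explb l j x W E N A M ->
    expl l.+1 x W E ((x, l.+1) :: N) A M
with explb : nat -> nat -> V -> seq V -> seq con -> seq (V * nat) -> seq V -> msg -> Prop :=
| explb0 l x W : explb l 0 x W [::] [::] [::] one_msg
| explbS l j x W p c psi E1 N1 A1 ms E2 N2 A2 M :
    uniq (flist c) -> (forall z, z \in flist c -> z \notin W) ->
    expls l (flist c) (flist c ++ W) E1 N1 A1 ms ->
    explb l j x (A1 ++ flist c ++ W) E2 N2 A2 M ->
    explb l j.+1 x W (con_at p x c psi :: E1 ++ E2) (N1 ++ N2) (flist c ++ A1 ++ A2)
      (mul_msg (con_msg psi ms) M)
with expls : nat -> seq V -> seq V -> seq con -> seq (V * nat) -> seq V -> seq msg -> Prop :=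
| expls0 l W : expls l [::] W [::] [::] [::] [::]
| explsS l x xs W E1 N1 A1 m E2 N2 A2 ms :
    expl l x W E1 N1 A1 m -> expls l xs (A1 ++ W) E2 N2 A2 ms ->
    expls l (x :: xs) W (E1 ++ E2) (N1 ++ N2) (A1 ++ A2) (m :: ms).

(** Bounds the number of fresh vertices when each vertex has fewer than [D] constraints below it. *)
Fixpoint ball_bound D l : nat := if l is l'.+1 then (D * (K + K * ball_bound D l'))%N else 0.

Lemma local_con_at (tau : {ffun V -> Omega}) p x c psi :
  (con_at p x c psi).2 (local_spins tau (con_at p x c psi).1) =
  psi (fcons (tau x) [ffun i => tau (c i)]).
Proof.
rewrite /= ffunE; congr (psi _); apply/ffunP => i; rewrite !ffunE tpermK /fcons.
by case: unliftP => [j|] _ //=; rewrite ?ffunE.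
Qed.

Lemma mem_flist (U : eqType) (c : {ffun 'I_K -> U}) z :
  reflect (exists i, z = c i) (z \in flist c).
Proof.
apply: (iffP mapP) => [[i _ ->]|[i ->]]; first by exists i.
by exists i; rewrite ?mem_enum.
Qed.

Lemma touch_con_at p x c psi z :
  touch (con_at p x c psi).1 z = (z == x) || (z \in flist c).
Proof.
apply/existsP/orP => [[i]|].
  rewrite !ffunE; case: unliftP => [j|] _ /=; last by rewrite eq_sym; left.
  by move=> /eqP<-; right; apply/mem_flist; exists j.
case=> [/eqP->|/mem_flist[j ->]].
  by exists (tperm ord0 p ord0); rewrite !ffunE tpermK unlift_none.
by exists (tperm ord0 p (lift ord0 j)); rewrite !ffunE tpermK liftK.
Qed.

End exploration.

Scheme expl_mut := Minimality for expl Sort Prop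
with explb_mut := Minimality for explb Sort Prop
with expls_mut := Minimality for expls Sort Prop.
Combined Scheme expl_ind3 from expl_mut, explb_mut, expls_mut.

Section exploration_theory.
Variables (R : realType) (Omega : finPointedType) (K : nat) (V : finType).
Notation weight := (weight R Omega K.+1).
Notation con := ({ffun 'I_K.+1 -> V} * weight)%type.
Notation msg := (msg R Omega).
Variables (dg : pred nat) (sigma : {ffun V -> Omega}).
Implicit Types (x : V) (W A xs : seq V) (E : seq con) (N : seq (V * nat)) (m M : msg).
Notation expl := (@expl R Omega K V dg sigma).
Notation explb := (@explb R Omega K V dg sigma).
Notation expls := (@expls R Omega K V dg sigma).
Notation ball_bound := (ball_bound K).
Definition dg_bound D := forall j, dg j -> (j < D)%N.

Definition fresh W A := uniq A /\ forall z, z \in A -> z \notin W.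
Definition inside (S : seq V) E := forall a, a \in E -> forall z, touch a.1 z -> z \in S.
Definition levels (S : seq V) l N :=
  uniq (map fst N) /\ forall z r, (z, r) \in N -> z \in S /\ (0 < r <= l)%N.

Let hit (S : seq V) N z : z \in map fst N -> (forall u r, (u, r) \in N -> u \in S) -> z \in S.
Proof. by move=> /mapP[[u r] uN ->] h; exact: h uN. Qed.

(** The invariants are proved together because they feed each other: freshness of the vertices of
    one branch is what makes it disjoint from the branches explored before it. *)
Lemma expl_supp :
  (forall l x W E N A m, expl l x W E N A m -> x \in W ->
     [/\ fresh W A, inside (x :: A) E, levels (x :: A) l N,
         forall D, dg_bound D -> (size A <= ball_bound D l)%N & (0 < l)%N -> (x, l) \in N]) /\
  (forall l j x W E N A m, explb l j x W E N A m -> x \in W ->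
     [/\ fresh W A, inside (x :: A) E, levels A l N &
         forall D, dg_bound D -> (size A <= j * (K + K * ball_bound D l))%N]) /\
  (forall l xs W E N A ms, expls l xs W E N A ms -> uniq xs -> {subset xs <= W} ->
     [/\ fresh W A, inside (xs ++ A) E, levels (xs ++ A) l N,
         forall D, dg_bound D -> (size A <= size xs * ball_bound D l)%N &
         (0 < l)%N -> forall x, x \in xs -> (x, l) \in N]).
Proof.
apply: expl_ind3 => [x W xW|l j x W E N A M jD H IH xW|l x W xW|
  l j x W p c psi E1 N1 A1 ms E2 N2 A2 M Uc cW _ IH1 _ IH2 xW|l W|
  l x xs W E1 N1 A1 m E2 N2 A2 ms _ IH1 _ IH2 /= /andP[xxs Uxs] xsW].
- by split.
- have [[uA fA] iE [uN lN] sA] := IH xW; split=> //; last by rewrite inE eqxx.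
    split=> [|z r] /=.
      rewrite uN andbT; apply/negP => /hit /(_ (fun u r uN => (lN u r uN).1)).
      by move/fA; rewrite xW.
    rewrite inE => /orP[/eqP[-> ->]|/lN[zA /andP[r0 rl]]]; first by rewrite mem_head ltnS leqnn.
    by rewrite inE zA orbT r0 ltnW.
  by move=> D dD; apply: leq_trans (sA D dD) _; rewrite /= leq_mul2r ltnW ?dD ?orbT.
- by split.
- have cs : {subset flist c <= flist c ++ W} by move=> z; rewrite mem_cat => ->.
  have [[uA1 fA1] iE1 [uN1 lN1] sA1 _] := IH1 Uc cs.
  have xW' : x \in A1 ++ flist c ++ W by rewrite !mem_cat xW !orbT.
  have [[uA2 fA2] iE2 [uN2 lN2] sA2] := IH2 xW'.
  split.
  + split=> [|z].
      rewrite cat_uniq Uc cat_uniq uA1 uA2 andbT/=; apply/andP; split.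
        apply/hasPn => z; rewrite mem_cat => /orP[/fA1|/fA2]; rewrite !mem_cat !negb_or.
          by case/andP.
        by case/and3P.
      by apply/hasPn => z /fA2; rewrite !mem_cat !negb_or => /andP[].
    rewrite !mem_cat => /or3P[/cW//|/fA1|/fA2]; rewrite !mem_cat !negb_or.
      by case/andP.
    by case/and3P.
  + move=> a; rewrite inE => /orP[/eqP->|].
      by move=> z; rewrite touch_con_at !inE !mem_cat => /orP[->//|->]; rewrite !orbT.
    rewrite mem_cat => /orP[/iE1 H|/iE2 H] z /H; rewrite !inE !mem_cat.
      by case/orP=> ->; rewrite !orbT.
    by case/orP=> ->; rewrite ?orbT.
  + split=> [|z r].
      rewrite map_cat cat_uniq uN1 uN2 andbT/=; apply/hasPn => z.
      move=> /hit /(_ (fun u r uN => (lN2 u r uN).1)) /fA2; rewrite !mem_cat !negb_or.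
      case/and3P => zA1 zc _; apply/negP => /hit /(_ (fun u r uN => (lN1 u r uN).1)).
      by rewrite mem_cat (negbTE zA1) (negbTE zc).
    rewrite [(z, r) \in _]mem_cat => /orP[/lN1[]|/lN2[]]; rewrite !mem_cat; last by move=> -> ->; rewrite !orbT.
    by case/orP=> -> ->; rewrite ?orbT.
  + move=> D dD; rewrite !size_cat mulSn addnA leq_add ?sA2//.
    by move: (sA1 D dD); rewrite /flist size_map size_enum_ord leq_add2l.
- by move=> _ _; split.
- have xW : x \in W by apply: xsW; rewrite mem_head.
  have [[uA1 fA1] iE1 [uN1 lN1] sA1 r1] := IH1 xW.
  have xsW' : {subset xs <= A1 ++ W}.
    by move=> z zxs; rewrite mem_cat xsW ?orbT// inE zxs orbT.
  have [[uA2 fA2] iE2 [uN2 lN2] sA2 r2] := IH2 Uxs xsW'.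
  split.
  + split=> [|z].
      rewrite cat_uniq uA1 uA2 andbT/=; apply/hasPn => z /fA2.
      by rewrite mem_cat negb_or => /andP[].
    by rewrite mem_cat => /orP[/fA1//|/fA2]; rewrite mem_cat negb_or => /andP[].
  + move=> a; rewrite mem_cat => /orP[/iE1 H|/iE2 H] z /H; rewrite !inE !mem_cat.
      by case/orP=> ->; rewrite ?orbT.
    by case/orP=> ->; rewrite ?orbT.
  + split=> [|z r].
      rewrite map_cat cat_uniq uN1 uN2 andbT/=; apply/hasPn => z.
      move=> /hit /(_ (fun u r uN => (lN2 u r uN).1)); rewrite mem_cat => zS.
      apply/negP => /hit /(_ (fun u r uN => (lN1 u r uN).1)); rewrite inE.
      case/orP => [/eqP zx|zA1]; case/orP: zS => [zxs|/fA2].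
      * by move: xxs; rewrite -zx zxs.
      * by rewrite mem_cat zx xW orbT.
      * by have := fA1 _ zA1; rewrite xsW// inE zxs orbT.
      * by rewrite mem_cat zA1.
    rewrite mem_cat => /orP[/lN1[]|/lN2[]]; rewrite !inE !mem_cat.
      by case/orP=> -> ->; rewrite ?orbT.
    by case/orP=> -> ->; rewrite ?orbT.
  + by move=> D dD; rewrite size_cat /= mulSn leq_add ?sA1 ?sA2.
  + move=> l0 z; rewrite inE mem_cat => /orP[/eqP->|zxs]; first by rewrite r1.
    by rewrite r2// orbT.
Qed.

(** Crossing a constraint lowers the remaining depth by at most one. Vertices at full depth are not
    listed in [N], which is the reason for the alternative [r = 0]. *)
Definition graded E N := forall z r a z', (z, r.+1) \in N -> a \in E ->
  touch a.1 z -> touch a.1 z' -> r = 0%N \/ exists2 r', (r <= r')%N & (z', r') \in N.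

Lemma expl_graded :
  (forall l x W E N A m, expl l x W E N A m -> x \in W -> graded E N) /\
  (forall l j x W E N A m, explb l j x W E N A m -> x \in W ->
     graded E ((x, l.+1) :: N)) /\
  (forall l xs W E N A ms, expls l xs W E N A ms -> uniq xs -> {subset xs <= W} ->
     graded E N).
Proof.
have [S1 [S2 S3]] := expl_supp.
apply: expl_ind3 => [x W xW|l j x W E N A M jD H IH xW|l x W xW|
  l j x W p c psi E1 N1 A1 ms E2 N2 A2 M Uc cW H1 IH1 H2 IH2 xW|l W|
  l x xs W E1 N1 A1 m E2 N2 A2 ms H1 IH1 H2 IH2 /= /andP[xxs Uxs] xsW] //.
- exact: IH.
- have cs : {subset flist c <= flist c ++ W} by move=> z; rewrite mem_cat => ->.
  have [[uA1 fA1] iE1 [uN1 lN1] _ r1] := S3 _ _ _ _ _ _ _ H1 Uc cs.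
  have xW' : x \in A1 ++ flist c ++ W by rewrite !mem_cat xW !orbT.
  have [[uA2 fA2] iE2 [uN2 lN2] _] := S2 _ _ _ _ _ _ _ _ H2 xW'.
  have xc : x \notin flist c by apply/negP => /cW; rewrite xW.
  have xA1 : x \notin A1 by apply/negP => /fA1; rewrite mem_cat xW orbT.
  have xA2 : x \notin A2 by apply/negP => /fA2; rewrite xW'.
  have dis z : z \in A2 -> (z \notin A1) && (z \notin flist c).
    by move/fA2; rewrite !mem_cat !negb_or => /and3P[-> -> _].
  have up z r : (z, r) \in N1 -> (z, r) \in (x, l.+1) :: N1 ++ N2.
    by rewrite inE mem_cat => ->; rewrite orbT.
  move=> z r a z'; rewrite [a \in _]inE => zN /orP[/eqP->|].
    rewrite !touch_con_at => /orP[/eqP zx|zc].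
      subst z; have rl : r = l.
        move: zN; rewrite inE mem_cat => /orP[/eqP[]//|/orP[/lN1[]|/lN2[]]].
          by rewrite mem_cat (negbTE xc) (negbTE xA1).
        by rewrite (negbTE xA2).
      move=> /orP[/eqP->|zc']; first by right; exists l.+1; rewrite ?rl ?mem_head.
      case: (posnP l) => [l0|l0]; first by left; rewrite rl.
      by right; exists l; rewrite ?rl// up// r1.
    have rl : (r < l)%N.
      move: zN; rewrite inE mem_cat => /orP[/eqP[zx]|/orP[/lN1[_ /andP[]]//|/lN2[zA2]]].
        by move: xc; rewrite -zx zc.
      by have /andP[_] := dis _ zA2; rewrite zc.
    move=> /orP[/eqP->|zc']; right; first by exists l.+1; rewrite ?mem_head// ltnW// ltnW.
    by exists l; [exact: ltnW|apply/up/r1 => //; exact: leq_ltn_trans rl].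
  rewrite mem_cat => /orP[aE|aE] tz tz'.
    have zS := iE1 _ aE _ tz.
    have zN1 : (z, r.+1) \in N1.
      move: zN; rewrite inE mem_cat => /orP[/eqP[zx]|/orP[//|/lN2[/dis/andP[za zc]]]].
        by move: zS; rewrite zx mem_cat (negbTE xc) (negbTE xA1).
      by move: zS; rewrite mem_cat (negbTE za) (negbTE zc).
    have [->|[r' rr' h]] := IH1 Uc cs _ _ _ _ zN1 aE tz tz'; first by left.
    by right; exists r' => //; exact: up.
  have zS := iE2 _ aE _ tz.
  have zN2 : (z, r.+1) \in (x, l.+1) :: N2.
    move: zN; rewrite !inE mem_cat => /orP[->//|/orP[/lN1[h _]|->]]; last by rewrite orbT.
    move: zS; rewrite inE => /orP[/eqP zx|/dis/andP[za zc]].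
      by move: h; rewrite zx mem_cat (negbTE xc) (negbTE xA1).
    by move: h; rewrite mem_cat (negbTE za) (negbTE zc).
  have [->|[r' rr' h]] := IH2 xW' _ _ _ _ zN2 aE tz tz'; first by left.
  right; exists r' => //; move: h; rewrite !inE mem_cat => /orP[->//|->].
  by rewrite !orbT.
- have xW : x \in W by apply: xsW; rewrite mem_head.
  have [[uA1 fA1] iE1 [uN1 lN1] sA1 r1] := S1 _ _ _ _ _ _ _ H1 xW.
  have xsW' : {subset xs <= A1 ++ W}.
    by move=> z zxs; rewrite mem_cat xsW ?orbT// inE zxs orbT.
  have [[uA2 fA2] iE2 [uN2 lN2] sA2 r2] := S3 _ _ _ _ _ _ _ H2 Uxs xsW'.
  have dis z : z \in x :: A1 -> z \notin xs ++ A2.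
    rewrite inE mem_cat => /orP[/eqP->|zA1]; rewrite negb_or ?xxs; apply/andP; split=> //.
    - by apply/negP => /fA2; rewrite mem_cat xW orbT.
    - by apply/negP => zxs; have := fA1 _ zA1; rewrite xsW// inE zxs orbT.
    - by apply/negP => /fA2; rewrite mem_cat zA1.
  move=> z r a z'; rewrite !mem_cat => zN /orP[aE|aE] tz tz'.
    have zS := dis _ (iE1 _ aE _ tz).
    have zN1 : (z, r.+1) \in N1.
      by case/orP: zN => // /lN2[]; rewrite (negbTE zS).
    have [->|[r' rr' h]] := IH1 xW _ _ _ _ zN1 aE tz tz'; first by left.
    by right; exists r' => //; rewrite mem_cat h.
  have zS := iE2 _ aE _ tz.
  have zN2 : (z, r.+1) \in N2.
    by case/orP: zN => // /lN1[/dis]; rewrite zS.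
  have [->|[r' rr' h]] := IH2 Uxs xsW' _ _ _ _ zN2 aE tz tz'; first by left.
  by right; exists r' => //; rewrite mem_cat h orbT.
Qed.

Let step_in (g : seq {ffun 'I_K.+1 -> V}) (a : con) x z :
  a.1 \in g -> touch a.1 x -> touch a.1 z -> step g x z.
Proof. by move=> ag ax az; apply/hasP; exists a.1 => //; rewrite ax az. Qed.

Lemma expl_near (g : seq {ffun 'I_K.+1 -> V}) :
  (forall l x W E N A m, expl l x W E N A m -> {subset map fst E <= g} ->
     forall z, z \in map fst N -> inball g l x z) /\
  (forall l j x W E N A m, explb l j x W E N A m -> {subset map fst E <= g} ->
     forall z, z \in map fst N -> inball g l.+1 x z) /\
  (forall l xs W E N A ms, expls l xs W E N A ms -> {subset map fst E <= g} ->
     forall z, z \in map fst N -> exists2 x, x \in xs & inball g l x z).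
Proof.
apply: expl_ind3 => [x W _|l j x W E N A M jD H IH Eg z|l x W _|
  l j x W p c psi E1 N1 A1 ms E2 N2 A2 M Uc cW H1 IH1 H2 IH2 Eg z|l W|
  l x xs W E1 N1 A1 m E2 N2 A2 ms H1 IH1 H2 IH2 Eg z] //.
- rewrite /= inE => /orP[/eqP->|zN]; first by rewrite eqxx.
  exact: (IH Eg).
- have Eg1 : {subset map fst E1 <= g}.
    by move=> a aE; apply: Eg; rewrite /= inE map_cat mem_cat aE orbT.
  have Eg2 : {subset map fst E2 <= g}.
    by move=> a aE; apply: Eg; rewrite /= inE map_cat mem_cat aE !orbT.
  rewrite map_cat mem_cat => /orP[/(IH1 Eg1)[u uc nz]|]; last exact: IH2.
  apply: (near_step _ nz); apply: (@step_in _ (con_at p x c psi)).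
  + by apply: Eg; rewrite /= mem_head.
  + by rewrite touch_con_at eqxx.
  + by rewrite touch_con_at uc orbT.
- have Eg1 : {subset map fst E1 <= g}.
    by move=> a aE; apply: Eg; rewrite /= map_cat mem_cat aE.
  have Eg2 : {subset map fst E2 <= g}.
    by move=> a aE; apply: Eg; rewrite /= map_cat mem_cat aE !orbT.
  rewrite map_cat mem_cat => /orP[/(IH1 Eg1) nz|/(IH2 Eg2)[u uc nz]].
    by exists x; rewrite ?mem_head.
  by exists u => //; rewrite inE uc orbT.
Qed.

(** The explored ball is the true ball: a walk that starts in [N] can use only constraints of [E],
    since the others avoid [N], and by [graded] it cannot leave [N] before the remaining depth is
    used up. *)
Lemma expl_near_iff (g' : seq con) l x W E N A m : expl l x W E N A m -> x \in W ->
  (forall a z, a \in g' -> touch a.1 z -> z \notin map fst N) ->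
  forall z, inball (map fst (E ++ g')) l x z = (z \in map fst N).
Proof.
move=> H xW g'N z; apply/idP/idP; last first.
  by apply: ((expl_near _).1 _ _ _ _ _ _ _ H) => a; rewrite map_cat mem_cat => ->.
have gr := expl_graded.1 _ _ _ _ _ _ _ H xW.
have [_ _ _ _ xN] := expl_supp.1 _ _ _ _ _ _ _ H xW.
(* Strengthened to balls around any listed vertex with at least [j] levels left. *)
suff K' j y r : (j <= r)%N -> (y, r) \in N -> inball (map fst (E ++ g')) j y z -> z \in map fst N.
  by case: (posnP l) => [->//|l0]; apply: (K' l x l) => //; exact: xN.
elim: j y r => // j IH y [//|r]; rewrite ltnS => jr yN /= /orP[/eqP<-|].
  by apply/mapP; exists (y, r.+1).
case/existsP => z' /andP[/hasP[a' /mapP[a]]]; rewrite mem_cat => /orP[aE|ag] -> /andP[ay az'].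
  case: (gr _ _ _ _ yN aE ay az') => [r0|[r' rr' zN]].
    by move: jr; rewrite r0 leqn0 => /eqP->.
  exact: (IH _ r') (leq_trans jr rr') zN.
by have := g'N _ _ ag ay; have -> // : y \in map fst N; apply/mapP; exists (y, r.+1).
Qed.

Let wprod_depends S E : inside S E -> depends S (@wprod R Omega K V E).
Proof.
move=> iE s t st; rewrite /wprod big_seq [RHS]big_seq; apply: eq_bigr => a aE.
congr (a.2 _); apply/ffunP => i; rewrite !ffunE; apply/st/(iE _ aE).
by apply/existsP; exists i.
Qed.

Let ind_depends (x : V) (s : Omega) : depends [:: x] (fun tau : {ffun V -> Omega} => (tau x == s)%:R : R).
Proof. by move=> t t' tt'; rewrite tt'// mem_head. Qed.

Let depends_mul S (f h : {ffun V -> Omega} -> R) : depends S f -> depends S h ->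
  depends S (fun tau => f tau * h tau).
Proof. by move=> fS hS t t' tt'; rewrite (fS _ _ tt') (hS _ _ tt'). Qed.

Let mem_zip_fst (T : eqType) (xs : seq V) (ss : seq T) u : u \in zip xs ss -> u.1 \in xs.
Proof.
elim: xs ss => [|x xs IH] [|s ss] //=; rewrite !inE => /orP[/eqP->/=|/IH->].
  by rewrite eqxx.
by rewrite orbT.
Qed.

(** The vertices of [S] not listed in [N] are those at depth exactly [l], whose spins are
    observed. *)
Definition bdry (S : seq V) N (tau : {ffun V -> Omega}) :=
  forall z, z \in S -> z \notin map fst N -> tau z = sigma z.

Lemma expls_size l xs W E N A ms : expls l xs W E N A ms -> size ms = size xs.
Proof.
by elim=> // l' x xs' W' E1 N1 A1 m E2 N2 A2 ms' _ _ /= ->.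
Qed.

(** Belief propagation is exact on trees. The branches live on disjoint fresh vertices, so the sum
    over the unobserved spins factors along the exploration into messages. In the second statement
    the spin of [x] is not summed and the message is read at [tau x]. *)
Lemma expl_isum :
  (forall l x W E N A m, expl l x W E N A m -> x \in W ->
     forall s tau, bdry (x :: A) N tau ->
     isum (map fst N) (fun t => wprod E t * (t x == s)%:R) tau = mval m s) /\
  (forall l j x W E N A M, explb l j x W E N A M -> x \in W ->
     forall tau, bdry A N tau -> isum (map fst N) (wprod E) tau = mval M (tau x)) /\
  (forall l xs W E N A ms, expls l xs W E N A ms -> uniq xs -> {subset xs <= W} ->
     forall (ss : seq Omega) tau, bdry (xs ++ A) N tau -> size ss = size xs ->
     isum (map fst N) (fun t => wprod E t * \prod_(u <- zip xs ss) (t u.1 == u.2)%:R) tau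
       = \prod_(u <- zip ms ss) mval u.1 u.2).
Proof.
have [S1 [S2 S3]] := expl_supp.
have w1 (t : {ffun V -> Omega}) : wprod [::] t = 1 :> R by rewrite /wprod big_nil.
apply: expl_ind3 => [x W xW s tau b|l j x W E N A M jD H IH xW s tau b|l x W xW tau b|
  l j x W p c psi E1 N1 A1 ms E2 N2 A2 M Uc cW H1 IH1 H2 IH2 xW tau b|l W _ _ [|//] tau b _|
  l x xs W E1 N1 A1 m E2 N2 A2 ms H1 IH1 H2 IH2 /= /andP[xxs Uxs] xsW [//|s ss] tau b [sz]].
- by rewrite /= w1 mul1r mvalK (b x) ?mem_head// eq_sym.
- have [[uA fA] iE [uN lN] _] := S2 _ _ _ _ _ _ _ _ H xW.
  have xA : x \notin A by apply/negP => /fA; rewrite xW.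
  have xN : x \notin map fst N.
    by apply: contra xA => /hit /(_ (fun u r uN => (lN u r uN).1)).
  rewrite /= (bigD1 s)//= [X in _ + X]big1 ?addr0 => [|w ws]; last first.
    rewrite (@eq_isum _ _ _ _ _ (fun t => 0 * wprod E t)); last first.
      by move=> t tE; rewrite tE// ffunE eqxx (negbTE ws) mulr0 mul0r.
    by rewrite (@isum_mull _ _ _ [::] _ (fun=> 0)) ?mul0r.
  rewrite (@eq_isum _ _ _ _ _ (wprod E)); last first.
    by move=> t tE; rewrite tE// ffunE eqxx eqxx mulr1.
  rewrite IH// ?ffunE ?eqxx// => z zA zN; rewrite ffunE; case: eqP => [zx|zx].
    by move: xA; rewrite -zx zA.
  by apply: b; rewrite inE ?zA ?orbT//= negb_or zN andbT; exact/eqP.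
- by rewrite /= w1 mvalK.
- have cs : {subset flist c <= flist c ++ W} by move=> z; rewrite mem_cat => ->.
  have [[uA1 fA1] iE1 [uN1 lN1] _ r1] := S3 _ _ _ _ _ _ _ H1 Uc cs.
  have xW' : x \in A1 ++ flist c ++ W by rewrite !mem_cat xW !orbT.
  have [[uA2 fA2] iE2 [uN2 lN2] _] := S2 _ _ _ _ _ _ _ _ H2 xW'.
  have xc : x \notin flist c by apply/negP => /cW; rewrite xW.
  have xA1 : x \notin A1 by apply/negP => /fA1; rewrite mem_cat xW orbT.
  have xA2 : x \notin A2 by apply/negP => /fA2; rewrite xW'.
  have dis z : z \in A2 -> (z \notin A1) && (z \notin flist c).
    by move/fA2; rewrite !mem_cat !negb_or => /and3P[-> -> _].
  have N1s z : z \in map fst N1 -> z \in flist c ++ A1.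
    by move=> /hit /(_ (fun u r uN => (lN1 u r uN).1)).
  have N2s z : z \in map fst N2 -> z \in A2.
    by move=> /hit /(_ (fun u r uN => (lN2 u r uN).1)).
  have b1 : bdry (flist c ++ A1) N1 tau.
    move=> z zS zN; apply: b; first by rewrite !mem_cat; move: zS; rewrite mem_cat => /orP[]->; rewrite ?orbT.
    rewrite map_cat mem_cat negb_or zN; apply/negP => /N2s/dis/andP[za zc].
    by move: zS; rewrite mem_cat (negbTE za) (negbTE zc).
  have b2 : bdry A2 N2 tau.
    move=> z zS zN; apply: b; first by rewrite !mem_cat zS !orbT.
    rewrite map_cat mem_cat negb_or zN andbT; apply/negP => /N1s.
    by have /andP[za zc] := dis _ zS; rewrite mem_cat (negbTE za) (negbTE zc).
  pose f1 (t : {ffun V -> Omega}) := psi (fcons (t x) [ffun i => t (c i)]) * wprod E1 t.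
  rewrite (@eq_isum _ _ _ _ _ (fun t => f1 t * wprod E2 t)); last first.
    by move=> t _; rewrite /wprod big_cons big_cat /= local_con_at mulrA.
  rewrite map_cat (@isum_mul _ _ _ (x :: flist c ++ A1) (x :: A2)); first last.
  - move=> v /N2s vA2; have /andP[va vc] := dis _ vA2.
    rewrite inE mem_cat (negbTE va) (negbTE vc) !orbF; apply/eqP => vx.
    by move: xA2; rewrite -vx vA2.
  - move=> u /N1s; rewrite mem_cat inE => uS; apply/negP => /orP[/eqP ux|/dis/andP[ua uc]].
      by move: uS; rewrite ux (negbTE xc) (negbTE xA1).
    by move: uS; rewrite (negbTE ua) (negbTE uc).
  - exact: wprod_depends.
  - apply: depends_mul; last first.
      apply: depends_sub (wprod_depends iE1) => z zS.
      by rewrite inE zS orbT.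
    move=> t t' tt'; rewrite tt' ?mem_head//; congr (psi (fcons _ _)).
    apply/ffunP => i; rewrite !ffunE tt'// inE mem_cat (_ : c i \in flist c) ?orbT//.
    by apply/mem_flist; exists i.
  rewrite IH2// mvalK; congr (_ * _); rewrite mvalK.
  have xN1 : x \notin map fst N1.
    by apply/negP => /N1s; rewrite mem_cat (negbTE xc) (negbTE xA1).
  (* The spins of the children are made explicit by a sum over [tc] with indicators, the form in
     which the induction hypothesis for [expls] is stated. *)
  rewrite (@eq_isum _ _ _ _ _ (fun t => \sum_(tc : {ffun 'I_K -> Omega})
     (psi (fcons (tau x) tc) * (wprod E1 t *
        \prod_(u <- zip (flist c) (flist tc)) (t u.1 == u.2)%:R)))); last first.
    move=> t tE; rewrite /f1 tE//.
    have zE (tc : {ffun 'I_K -> Omega}) : \prod_(u <- zip (flist c) (flist tc)) (t u.1 == u.2)%:R =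
        \prod_(i < K) (t (c i) == tc i)%:R :> R.
      rewrite /flist; have -> : zip [seq c i | i <- enum 'I_K] [seq tc i | i <- enum 'I_K] =
        [seq (c i, tc i) | i <- enum 'I_K] by elim: (enum 'I_K) => //= i r ->.
      by rewrite big_map big_enum.
    rewrite (bigD1 [ffun i => t (c i)])//= zE big1 ?mulr1; last first.
      by move=> i _; rewrite ffunE eqxx.
    rewrite big1 ?addr0// => tc tcn; rewrite zE.
    have [i ti] : exists i, t (c i) != tc i.
      apply/existsP; rewrite -[X in is_true X]negbK negb_exists; apply: contra tcn => /forallP h.
      by apply/eqP/ffunP => i; rewrite ffunE; have := h i; rewrite negbK => /eqP.
    by rewrite (bigD1 i)//= (negbTE ti) mul0r !mulr0.
  rewrite isum_exchange; apply: eq_bigr => tc _.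
  rewrite (@isum_mull _ _ _ [::] _ (fun=> psi (fcons (tau x) tc)))//; congr (_ * _).
  rewrite IH1//; last by rewrite /flist !size_map.
  have sms : size ms = K by rewrite (expls_size H1) /flist size_map size_enum_ord.
  rewrite (big_nth (one_msg, point)) size_zip sms /flist size_map size_enum_ord minnn big_mkord.
  apply: eq_bigr => i _; rewrite nth_zip; last by rewrite sms size_map size_enum_ord.
  by rewrite /= (nth_map i) ?size_enum_ord// nth_ord_enum.
- by rewrite /= w1 mul1r !big_nil.
- have xW : x \in W by apply: xsW; rewrite mem_head.
  have [[uA1 fA1] iE1 [uN1 lN1] sA1 r1] := S1 _ _ _ _ _ _ _ H1 xW.
  have xsW' : {subset xs <= A1 ++ W}.
    by move=> z zxs; rewrite mem_cat xsW ?orbT// inE zxs orbT.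
  have [[uA2 fA2] iE2 [uN2 lN2] sA2 r2] := S3 _ _ _ _ _ _ _ H2 Uxs xsW'.
  have dis z : z \in x :: A1 -> z \notin xs ++ A2.
    rewrite inE mem_cat => /orP[/eqP->|zA1]; rewrite negb_or ?xxs; apply/andP; split=> //.
    - by apply/negP => /fA2; rewrite mem_cat xW orbT.
    - by apply/negP => zxs; have := fA1 _ zA1; rewrite xsW// inE zxs orbT.
    - by apply/negP => /fA2; rewrite mem_cat zA1.
  have N1s z : z \in map fst N1 -> z \in x :: A1.
    by move=> /hit /(_ (fun u r uN => (lN1 u r uN).1)).
  have N2s z : z \in map fst N2 -> z \in xs ++ A2.
    by move=> /hit /(_ (fun u r uN => (lN2 u r uN).1)).
  rewrite big_cons.
  rewrite (@eq_isum _ _ _ _ _ (fun t => (wprod E1 t * (t x == s)%:R) * (wprod E2 t *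
     \prod_(u <- zip xs ss) (t u.1 == u.2)%:R))); last first.
    by move=> t _; rewrite wprod_cat big_cons mulrACA.
  rewrite map_cat (@isum_mul _ _ _ (x :: A1) (xs ++ A2)); first last.
  - by move=> v /N2s; apply: contraL => /dis.
  - by move=> u /N1s/dis.
  - apply: depends_mul; first exact: wprod_depends.
    move=> t t' tt'; rewrite big_seq [RHS]big_seq; apply: eq_bigr => u uz.
    by rewrite tt'// mem_cat (mem_zip_fst uz).
  - apply: depends_mul; first exact: wprod_depends.
    by apply: depends_sub (@ind_depends x s) => z; rewrite !inE => ->.
  congr (_ * _).
    apply: IH1 => // z zS zN; apply: b.
      by move: zS; rewrite !inE !mem_cat => /orP[]->; rewrite ?orbT.
    rewrite map_cat mem_cat negb_or zN; apply/negP => /N2s.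
    by rewrite (negbTE (dis _ zS)).
  apply: IH2 => // z zS zN; apply: b.
    by move: zS; rewrite !inE !mem_cat => /orP[]->; rewrite ?orbT.
  rewrite map_cat mem_cat negb_or zN andbT; apply/negP => /N1s/dis.
  by rewrite zS.
Qed.

(** An assignment that agrees with [sigma] away from the ball agrees with it on every constraint of
    [g'], so these contribute the constant [wprod g' sigma]; the rest is [expl_isum]. *)
Lemma expl_marginal (g' : seq con) l x E N A m s : expl l x [:: x] E N A m ->
  (forall a z, a \in g' -> touch a.1 z -> z \notin map fst N) ->
  \sum_(tau : {ffun V -> Omega} | [forall z, ~~ inball (map fst (E ++ g')) l x z ==> (tau z == sigma z)]
     && (tau x == s)) wprod (E ++ g') tau = wprod g' sigma * mval m s.
Proof.
move=> H g'N; have xx : x \in [:: x] by rewrite mem_head.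
have [_ _ [uN _] _ _] := expl_supp.1 _ _ _ _ _ _ _ H xx.
have b : bdry (x :: A) N sigma by [].
rewrite -(expl_isum.1 _ _ _ _ _ _ _ H xx s sigma b) isum_sum//.
rewrite mulr_sumr big_mkcondr [LHS]/=; apply: eq_big => [tau|tau tE].
  by apply: eq_forallb => z; rewrite (expl_near_iff H xx g'N).
case: eqP => _; rewrite ?mulr0// mulr1 wprod_cat mulrC; congr (_ * _).
rewrite /wprod big_seq [RHS]big_seq; apply: eq_bigr => a ag; congr (a.2 _).
apply/ffunP => i; rewrite !ffunE; apply/eqP.
have := forallP tE (a.1 i); rewrite (expl_near_iff H xx g'N) => /implyP; apply.
by apply: (g'N a) => //; apply/existsP; exists i.
Qed.

End exploration_theory.

(** The factor of the unexplored constraints cancels, and only the message at [y] remains. *)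
Lemma expl_gibbs_cond (R : realType) (Omega : finPointedType) (K : nat) (dg : pred nat)
    (G : factor_graph R Omega K.+1) (sigma : {ffun fg_var G -> Omega})
    (g g' : seq ({ffun 'I_K.+1 -> fg_var G} * weight R Omega K.+1)) l (y : fg_var G) E N A m s :
  presents g -> g = E ++ g' -> expl dg sigma l y [:: y] E N A m ->
  (forall a z, a \in g' -> touch a.1 z -> z \notin map fst N) ->
  gibbs_cond l y s sigma = mval m s / \sum_s' mval m s'.
Proof.
move=> pg gE H g'N; rewrite (gibbs_condE pg) gE.
rewrite [X in _ / X](partition_big (fun tau : {ffun fg_var G -> Omega} => tau y) xpredT)//=.
under [X in _ / X]eq_bigr do rewrite (expl_marginal _ H g'N).
rewrite (expl_marginal _ H g'N) -mulr_sumr invfM mulrACA mulfV ?mul1r//.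
exact/lt0r_neq0/wprod_gt0.
Qed.

Arguments expl_supp {R Omega K V dg sigma}.

(** * The Galton-Watson tree *)

Section tree_exploration.
Variables (R : realType) (Omega : finPointedType) (K : nat) (V : finType).
Notation weight := (weight R Omega K.+1).
Notation tree := (tree R Omega K.+1).
Notation con := ({ffun 'I_K.+1 -> V} * weight)%type.
Notation msg := (msg R Omega).

Section node.
Variables (l : nat) (t : seq (weight * K.-tuple (tree l))).
Variable e : tree_var (t : tree l.+1) -> V.

Definition node_wt (i : 'I_(size t)) : weight := (tnth (in_tuple t) i).1.
Definition node_sub (i : 'I_(size t)) (j : 'I_K) : tree l := @subtree R Omega K.+1 l t i j.
Definition node_emb i j (v : tree_var (node_sub i j)) : V := e (Some (existT _ i (existT _ j v))).
Definition node_kids i : {ffun 'I_K -> V} := [ffun j => node_emb (tree_root (node_sub i j))].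
End node.

(** The vertex types of the subtrees change with the recursion; embedding all of them in one vertex
    set [V] by [e] gives a common type for constraints and spins. *)
Fixpoint tree_cons l : forall t : tree l, (tree_var t -> V) -> seq con :=
  if l is l'.+1 return forall t : tree l, (tree_var t -> V) -> seq con then
    fun t e => flatten [seq
      con_at ord0 (e (tree_root t)) (node_kids e i) (node_wt i) ::
      flatten [seq tree_cons (node_emb e (i := i) (j := j)) | j <- enum 'I_K]
      | i <- enum 'I_(size (t : seq (weight * K.-tuple (Defs.tree R Omega K.+1 l'))))]
  else fun _ _ => [::].

Fixpoint tree_below l : forall t : tree l, (tree_var t -> V) -> seq V :=
  if l is l'.+1 return forall t : tree l, (tree_var t -> V) -> seq V then
    fun t e => flatten [seq flist (node_kids e i) ++
      flatten [seq tree_below (node_emb e (i := i) (j := j)) | j <- enum 'I_K]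
      | i <- enum 'I_(size (t : seq (weight * K.-tuple (Defs.tree R Omega K.+1 l'))))]
  else fun _ _ => [::].

Fixpoint tree_msg (sigma : {ffun V -> Omega}) l : forall t : tree l, (tree_var t -> V) -> msg :=
  if l is l'.+1 return forall t : tree l, (tree_var t -> V) -> msg then
    fun t e => foldr (fun i M => mul_msg (con_msg (node_wt i)
      [seq tree_msg sigma (node_emb e (i := i) (j := j)) | j <- enum 'I_K]) M) one_msg
      (enum 'I_(size (t : seq (weight * K.-tuple (Defs.tree R Omega K.+1 l')))))
  else fun t e => ind_msg (sigma (e tt)).

Lemma node_emb_inj l (t : tree l.+1) (e : tree_var t -> V) i j :
  injective e -> injective (node_emb e (i := i) (j := j)).
Proof. by move=> ie v w /ie[] /eqP; rewrite !eq_Tagged /= => /eqP. Qed.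

Lemma node_emb_idx l (t : tree l.+1) (e : tree_var t -> V) i j i' j' v v' : injective e ->
  node_emb e (i := i) (j := j) v = node_emb e (i := i') (j := j') v' -> i = i' /\ j = j'.
Proof.
move=> ie /ie; pose f (u : tree_var t) : option ('I_(size t) * 'I_K) :=
  if u is Some w then Some (tag w, tag (tagged w)) else None.
by move=> /(congr1 f)[-> ->].
Qed.

Lemma tree_below_image l (t : tree l) (e : tree_var t -> V) z : z \in tree_below e ->
  exists2 v, v <> tree_root t & z = e v.
Proof.
elim: l t e => [//|l IH] t e /flattenP[s /mapP[i _ ->]].
rewrite mem_cat => /orP[/mem_flist[j ->]|/flattenP[s' /mapP[j _ ->] /IH[v _ ->]]].
  by rewrite ffunE; eexists; [|reflexivity].
by eexists; [|reflexivity].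
Qed.

Lemma tree_below_all l (t : tree l) (e : tree_var t -> V) v : v <> tree_root t ->
  e v \in tree_below e.
Proof.
elim: l t e v => [t e []//|l IH] t e [[i [j v]]|//] _ /=.
apply/flattenP; exists (flist (node_kids e i) ++
  flatten [seq tree_below (node_emb e (i := i) (j := j)) | j <- enum 'I_K]).
  by apply/mapP; exists i; rewrite ?mem_enum.
rewrite mem_cat; have [vr|/eqP vr] := eqVneq v (tree_root _).
  by apply/orP; left; apply/mem_flist; exists j; rewrite ffunE vr.
apply/orP; right; apply/flattenP; exists (tree_below (node_emb e (i := i) (j := j))).
  by apply/mapP; exists j; rewrite ?mem_enum.
exact: (IH _ (node_emb e (i := i) (j := j))).
Qed.

(** A tree is an exploration of itself, with no bound on the degrees. The Gibbs formula for
    explorations therefore applies to the Galton-Watson tree too. *)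
Lemma tree_expl (sigma : {ffun V -> Omega}) l (t : tree l) (e : tree_var t -> V) W :
  injective e -> (forall v, v <> tree_root t -> e v \notin W) ->
  exists N, expl xpredT sigma l (e (tree_root t)) W (tree_cons e) N (tree_below e)
    (tree_msg sigma e).
Proof.
elim: l t e W => [|l IH] t e W ie eW.
  by exists [::]; case: (tree_root t); exact: expl0.
have kids i js W1 : uniq js ->
    (forall j v, j \in js -> v <> tree_root _ -> node_emb e (i := i) (j := j) v \notin W1) ->
    exists N, expls xpredT sigma l [seq node_emb e (tree_root (node_sub i j)) | j <- js] W1
     (flatten [seq tree_cons (node_emb e (i := i) (j := j)) | j <- js]) N
     (flatten [seq tree_below (node_emb e (i := i) (j := j)) | j <- js])
     [seq tree_msg sigma (node_emb e (i := i) (j := j)) | j <- js].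
  elim: js W1 => [|j js IHj] W1 /=; first by exists [::]; exact: expls0.
  case/andP => jjs Ujs jW.
  have [N1 H1] : exists N, expl xpredT sigma l (node_emb e (tree_root (node_sub i j))) W1
     (tree_cons (node_emb e (i := i) (j := j))) N
     (tree_below (node_emb e (i := i) (j := j))) (tree_msg sigma (node_emb e (i := i) (j := j))).
    apply: IH; first exact: node_emb_inj.
    by move=> v vr; apply: jW => //; rewrite mem_head.
  have [|N2 H2] := IHj (tree_below (node_emb e (i := i) (j := j)) ++ W1) Ujs.
    move=> j' v jj' vr; rewrite mem_cat negb_or jW ?inE ?jj' ?orbT// andbT.
    apply/negP => /tree_below_image[v' _ /(node_emb_idx ie)[_ jE]].
    by move: jjs; rewrite -jE jj'.
  by exists (N1 ++ N2); exact: explsS H1 H2.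
have branch rs W1 : uniq rs ->
    (forall i j v, i \in rs -> node_emb e (i := i) (j := j) v \notin W1) ->
    exists N, explb xpredT sigma l (size rs) (e (tree_root t)) W1
     (flatten [seq con_at ord0 (e (tree_root t)) (node_kids e i) (node_wt i) ::
        flatten [seq tree_cons (node_emb e (i := i) (j := j)) | j <- enum 'I_K] | i <- rs]) N
     (flatten [seq flist (node_kids e i) ++
        flatten [seq tree_below (node_emb e (i := i) (j := j)) | j <- enum 'I_K] | i <- rs])
     (foldr (fun i M => mul_msg (con_msg (node_wt i)
      [seq tree_msg sigma (node_emb e (i := i) (j := j)) | j <- enum 'I_K]) M) one_msg rs).
  elim: rs W1 => [|i rs IHi] W1 /=; first by exists [::]; exact: explb0.
  case/andP => irs Uis iW.
  have fE : flist (node_kids e i) = [seq node_emb e (tree_root (node_sub i j)) | j <- enum 'I_K].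
    by apply: eq_map => j; rewrite ffunE.
  have [|N1 H1] := kids i (enum 'I_K) (flist (node_kids e i) ++ W1) (enum_uniq _).
    move=> j v _ vr; rewrite mem_cat negb_or iW ?mem_head// andbT.
    apply/negP => /mem_flist[j']; rewrite ffunE => h.
    have [_ jE] := node_emb_idx ie h; subst j'.
    by move/(node_emb_inj ie): h.
  have [|N2 H2] := IHi (flatten [seq tree_below (node_emb e (i := i) (j := j)) | j <- enum 'I_K] ++
      flist (node_kids e i) ++ W1) Uis.
    move=> i' j' v ii'; rewrite !mem_cat !negb_or (iW i' j') ?inE ?ii' ?orbT// andbT.
    apply/andP; split; apply/negP.
      move=> /flattenP[s /mapP[j _ ->] /tree_below_image[v' _ /(node_emb_idx ie)[iE _]]].
      by move: irs; rewrite -iE ii'.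
    move=> /mem_flist[j]; rewrite ffunE => /(node_emb_idx ie)[iE _].
    by move: irs; rewrite -iE ii'.
  exists (N1 ++ N2); rewrite -catA -cat_cons; apply: (explbS _ _ _ _ _ H2).
  - rewrite fE map_inj_uniq ?enum_uniq// => j j' /(node_emb_idx ie)[].
    by [].
  - by move=> z; rewrite fE => /mapP[j _ ->]; apply: iW; rewrite mem_head.
  - by move: H1; rewrite fE.
have [|N H] := branch (enum 'I_(size (t : seq (weight * K.-tuple (Defs.tree R Omega K.+1 l))))) W (enum_uniq _).
  by move=> i j v _; apply: eW.
by exists ((e (tree_root t), l.+1) :: N); exact: (explS _ H).
Qed.

Lemma tree_cons_eq (sigma tau : {ffun V -> Omega}) l (t : tree l) (e : tree_var t -> V) :
  (forall v, sigma (e v) = tau (e v)) ->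
  wprod (tree_cons e) sigma = wprod (tree_cons e) tau /\
  tree_msg sigma e = tree_msg tau e.
Proof.
elim: l t e => [|l IH] t e st; first by rewrite /wprod !big_nil /= st.
have IH' i j := IH _ (node_emb e (i := i) (j := j)) (fun v => st _).
split; last first.
  rewrite /=; elim: (enum 'I_(size _)) => //= i rs ->; congr (mul_msg (con_msg _ _) _).
  by apply: eq_map => j; exact: (IH' i j).2.
rewrite /wprod /= !big_flatten !big_map; apply: eq_bigr => i _.
rewrite !big_cons !local_con_at; congr (_ * _).
  rewrite st; congr (node_wt i (fcons _ _)).
  by apply/ffunP => j; rewrite !ffunE; exact: st.
by rewrite !big_flatten !big_map; apply: eq_bigr => j _; exact: (IH' i j).1.
Qed.

Lemma isum_kids (c : {ffun 'I_K -> V}) (f : {ffun V -> Omega} -> R) sigma : injective c ->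
  isum (flist c) f sigma = \sum_(tc : {ffun 'I_K -> Omega})
    f [ffun z => if [pick j | c j == z] is Some j then tc j else sigma z].
Proof.
move=> ic; have Uc : uniq (flist c) by rewrite map_inj_uniq ?enum_uniq.
pose su (tc : {ffun 'I_K -> Omega}) : {ffun V -> Omega} :=
  [ffun z => if [pick j | c j == z] is Some j then tc j else sigma z].
have suc tc j : su tc (c j) = tc j.
  rewrite ffunE; case: pickP => [j' /eqP /ic -> //|/(_ j)]; by rewrite eqxx.
rewrite isum_sum// (reindex_onto su (fun s => [ffun j => s (c j)])) /=.
  apply: eq_bigl => tc; rewrite [X in _ && X](_ : _ = true) ?andbT; last first.
    by apply/eqP/ffunP => j; rewrite ffunE suc.
  apply/forallP => z; apply/implyP => zc; rewrite ffunE; case: pickP => // j /eqP jz.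
  by case/mem_flist: zc; exists j.
move=> s /forallP sE; apply/ffunP => z; rewrite ffunE.
case: pickP => [j /eqP <-|h]; first by rewrite ffunE.
have := sE z; case: (boolP (z \in flist c)) => [/mem_flist[j zj]|zc /= /eqP->//].
by have := h j; rewrite zj eqxx.
Qed.

Variable kappa : R.

Let regroup (a b c d e f h : R) :
  a * b * c * d * (e * f * h) = a * (c * e) * (b * (d * f)) * h.
Proof. by ring. Qed.

(** The broadcast on a fixed tree is a sum over the spins below the root with weight the Gibbs
    weight times a power of [kappa]. This links the message recursion to the Gibbs measure of the
    tree. *)
Lemma quenched_isum l (t : tree l) (e : tree_var t -> V) (F : msg -> R)
    (sigma : {ffun V -> Omega}) : injective e ->
  quenched kappa t (sigma (e (tree_root t))) (fun m => (F m)%:E) =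
  (isum (tree_below e) (fun tau => kappa ^+ size (tree_cons e) * wprod (tree_cons e) tau *
     F (tree_msg tau e)) sigma)%:E.
Proof.
elim: l t e F sigma => [|l IH] t e F sigma ie.
  by case: t e ie => e ie /=; rewrite expr0 /wprod big_nil !mul1r.
set T := (t : seq (weight * K.-tuple (Defs.tree R Omega K.+1 l))).
have kids i js (ws : seq Omega) (H : seq msg -> R) (s : {ffun V -> Omega}) : uniq js ->
    ws = [seq s (node_emb e (tree_root (node_sub i j))) | j <- js] ->
    qkids (@quenched R Omega K kappa l) [seq node_sub i j | j <- js] ws (fun ms => (H ms)%:E) =
    (isum (flatten [seq tree_below (node_emb e (i := i) (j := j)) | j <- js])
      (fun tau => kappa ^+ size (flatten [seq tree_cons (node_emb e (i := i) (j := j)) | j <- js]) *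
        wprod (flatten [seq tree_cons (node_emb e (i := i) (j := j)) | j <- js]) tau *
        H [seq tree_msg tau (node_emb e (i := i) (j := j)) | j <- js]) s)%:E.
  elim: js ws H s => [|j js IHj] ws H s /=.
    by move=> _ _; rewrite /= expr0 /wprod big_nil !mul1r.
  case/andP => jjs Ujs -> /=.
  have dis j' v v' : j' \in js -> node_emb e (i := i) (j := j') v <>
      node_emb e (i := i) (j := j) v'.
    by move=> jj' /(node_emb_idx ie)[_ jE]; move: jjs; rewrite -jE jj'.
  pose F1 m := isum (flatten [seq tree_below (node_emb e (i := i) (j := j)) | j <- js])
      (fun tau => kappa ^+ size (flatten [seq tree_cons (node_emb e (i := i) (j := j)) | j <- js]) *
        wprod (flatten [seq tree_cons (node_emb e (i := i) (j := j)) | j <- js]) tau *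
        H (m :: [seq tree_msg tau (node_emb e (i := i) (j := j)) | j <- js])) s.
  rewrite (_ : (fun m => _) = fun m => (F1 m)%:E); last first.
    by apply/funext => m; rewrite (IHj _ (fun ms => H (m :: ms)) s).
  rewrite (IH _ (node_emb e (i := i) (j := j)) F1 s (node_emb_inj ie)); congr EFin.
  rewrite isum_cat; apply: eq_isum => tau tE.
  (* The value for the later subtrees depends on the base point only through the spins at their
     roots, where [tau] agrees with [s]; so the base point may be moved to [tau]. *)
  have -> : F1 (tree_msg tau (node_emb e (i := i) (j := j))) =
     isum (flatten [seq tree_below (node_emb e (i := i) (j := j)) | j <- js])
      (fun tau' => kappa ^+ size (flatten [seq tree_cons (node_emb e (i := i) (j := j)) | j <- js]) *
        wprod (flatten [seq tree_cons (node_emb e (i := i) (j := j)) | j <- js]) tau' *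
        H (tree_msg tau (node_emb e (i := i) (j := j)) ::
          [seq tree_msg tau' (node_emb e (i := i) (j := j)) | j <- js])) tau.
    pose h ms := H (tree_msg tau (node_emb e (i := i) (j := j)) :: ms).
    apply: EFin_inj; apply: etrans (esym (IHj _ h s Ujs erefl)) _.
    apply: etrans _ (IHj _ h tau Ujs erefl); congr qkids.
    apply/eq_in_map => j' jj'; rewrite tE//.
    by apply/negP => /tree_below_image[v _ /dis]; apply.
  rewrite -(@isum_mull _ _ _ [::] _ (fun=> kappa ^+ size (tree_cons (node_emb e (i := i) (j := j))) *
     wprod (tree_cons (node_emb e (i := i) (j := j))) tau))//.
  apply: eq_isum => tau' tE'.
  have [wE mE] : wprod (tree_cons (node_emb e (i := i) (j := j))) tau = wprod (tree_cons (node_emb e (i := i) (j := j))) tau' /\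
      tree_msg tau (node_emb e (i := i) (j := j)) = tree_msg tau' (node_emb e (i := i) (j := j)).
    apply: tree_cons_eq => v; rewrite tE'//.
    by apply/negP => /flattenP[s' /mapP[j' jj' ->] /tree_below_image[v' _ /esym /dis]]; apply.
  by rewrite wE mE size_cat exprD wprod_cat mulrA [X in X * _]mulrACA.
have branch rs (H : msg -> R) (s : {ffun V -> Omega}) : uniq rs -> s (e (tree_root t)) = sigma (e (tree_root t)) ->
    qbranch kappa (@quenched R Omega K kappa l) [seq tnth (in_tuple T) i | i <- rs]
      (sigma (e (tree_root t))) (fun M => (H M)%:E) =
    (isum (flatten [seq flist (node_kids e i) ++
        flatten [seq tree_below (node_emb e (i := i) (j := j)) | j <- enum 'I_K] | i <- rs])
      (fun tau => kappa ^+ size (flatten [seq con_at ord0 (e (tree_root t)) (node_kids e i) (node_wt i) ::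
        flatten [seq tree_cons (node_emb e (i := i) (j := j)) | j <- enum 'I_K] | i <- rs]) *
      wprod (flatten [seq con_at ord0 (e (tree_root t)) (node_kids e i) (node_wt i) ::
        flatten [seq tree_cons (node_emb e (i := i) (j := j)) | j <- enum 'I_K] | i <- rs]) tau *
      H (foldr (fun i M => mul_msg (con_msg (node_wt i)
      [seq tree_msg tau (node_emb e (i := i) (j := j)) | j <- enum 'I_K]) M) one_msg rs)) s)%:E.
  elim: rs H s => [|i rs IHi] H s /=.
    by move=> _ _; rewrite /= expr0 /wprod big_nil !mul1r.
  case/andP => irs Urs sx.
  have dis i' j' j v v' : i' \in rs -> node_emb e (i := i') (j := j') v <>
      node_emb e (i := i) (j := j) v'.
    by move=> ii' /(node_emb_idx ie)[iE _]; move: irs; rewrite -iE ii'.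
  have ik : injective (node_kids e i).
    by move=> j j'; rewrite !ffunE => /(node_emb_idx ie)[].
  case tiE : (tnth (in_tuple T) i) => [psi ts].
  have psiE : psi = node_wt i by rewrite /node_wt -/T tiE.
  have tsE : tval ts = [seq node_sub i j | j <- enum 'I_K].
    rewrite -[LHS]map_tnth_enum; apply: eq_map => j.
    by rewrite /node_sub /subtree -/T tiE.
  set A2 := flatten [seq flist (node_kids e i) ++ _ | i <- rs].
  set E2 := flatten [seq con_at ord0 _ _ _ :: _ | i <- rs].
  set E1 := flatten [seq tree_cons _ | j <- enum 'I_K].
  set A1 := flatten [seq tree_below _ | j <- enum 'I_K].
  pose M2 tau := foldr (fun i M => mul_msg (con_msg (node_wt i)
      [seq tree_msg tau (node_emb e (i := i) (j := j)) | j <- enum 'I_K]) M) one_msg rs.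
  pose M1 tau := [seq tree_msg tau (node_emb e (i := i) (j := j)) | j <- enum 'I_K].
  have xA1 : e (tree_root t) \notin A1.
    by apply/negP => /flattenP[s' /mapP[j _ ->] /tree_below_image[v _ /ie]].
  have xc : e (tree_root t) \notin flist (node_kids e i).
    by apply/negP => /mem_flist[j]; rewrite ffunE => /ie.
  have cA1 j : node_kids e i j \notin A1.
    apply/negP => /flattenP[s' /mapP[j' _ ->] /tree_below_image[v vr]].
    rewrite ffunE => h; have [_ jE] := node_emb_idx ie h; subst j'.
    by apply: vr; move/(node_emb_inj ie): h.
  have A2s z : z \in A2 -> exists i' j v, i' \in rs /\ z = node_emb e (i := i') (j := j) v.
    move=> /flattenP[s' /mapP[i' ii' ->]]; rewrite mem_cat.
    case/orP => [/mem_flist[j ->]|/flattenP[s'' /mapP[j _ ->] /tree_below_image[v _ ->]]].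
      by exists i', j, (tree_root _); rewrite ffunE.
    by exists i', j, v.
  rewrite -psiE -catA isum_cat isum_kids// -sumEFin; apply: eq_bigr => tc _.
  set s1 : {ffun V -> Omega} := [ffun z => _].
  have s1c j : s1 (node_kids e i j) = tc j.
    by rewrite ffunE; case: pickP => [j' /eqP /ik -> //|/(_ j)]; rewrite eqxx.
  have s1x : s1 (e (tree_root t)) = sigma (e (tree_root t)).
    rewrite ffunE; case: pickP => // j /eqP h; move: xc; rewrite -h.
    by move/negP; case; apply/mem_flist; exists j.
  pose F1 ms := isum A2 (fun tau => kappa ^+ size E2 * wprod E2 tau *
     H (mul_msg (con_msg psi ms) (M2 tau))) s.
  rewrite (_ : (fun ms => _) = fun ms => (F1 ms)%:E); last first.
    by apply/funext => ms; rewrite (IHi (fun M => H (mul_msg (con_msg psi ms) M)) s Urs sx).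
  rewrite tsE (kids i (enum 'I_K) (flist tc) F1 s1 (enum_uniq _)); last first.
    by rewrite /flist; apply: eq_map => j; rewrite -s1c; congr (s1 _); rewrite ffunE.
  rewrite -EFinM; congr EFin; rewrite -/E1 -/A1.
  rewrite -(@isum_mull _ _ _ [::] _ (fun=> kappa * psi (fcons (sigma (e (tree_root t))) tc)))//.
  rewrite isum_cat; apply: eq_isum => tau tE.
  have tx : tau (e (tree_root t)) = sigma (e (tree_root t)) by rewrite tE.
  (* The later branches depend on the base point only through the spin at the root of [t], so the
     base point may be moved from [s] to [tau]. *)
  have -> : F1 (M1 tau) = isum A2 (fun tau' => kappa ^+ size E2 * wprod E2 tau' *
     H (mul_msg (con_msg psi (M1 tau)) (M2 tau'))) tau.
    pose h M := H (mul_msg (con_msg psi (M1 tau)) M).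
    apply: EFin_inj; apply: etrans (esym (IHi h s Urs sx)) _.
    exact: (IHi h tau Urs tx).
  rewrite !mulrA -(@isum_mull _ _ _ [::] _ (fun=> kappa *
     psi (fcons (sigma (e (tree_root t))) tc) * kappa ^+ size E1 * wprod E1 tau))//.
  apply: eq_isum => tau' tE'.
  have sub z : (forall i' j v, i' \in rs -> node_emb e (i := i') (j := j) v <> z) -> tau' z = tau z.
    move=> h; rewrite tE'//; apply/negP => /A2s[i' [j [v [ii' zE]]]].
    exact: (h i' j v ii' (esym zE)).
  have [wE mE] : wprod E1 tau = wprod E1 tau' /\ M1 tau = M1 tau'.
    have h j := @tree_cons_eq tau tau' _ _ (node_emb e (i := i) (j := j))
      (fun v => esym (sub _ (fun i' j' v' ii' => dis _ _ _ _ _ ii'))).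
    split; last by apply: eq_map => j; exact: (h j).2.
    by rewrite /wprod !big_flatten !big_map; apply: eq_bigr => j _; exact: (h j).1.
  have wc : wprod (con_at ord0 (e (tree_root t)) (node_kids e i) psi :: E1 ++ E2) tau' =
      psi (fcons (sigma (e (tree_root t))) tc) * (wprod E1 tau' * wprod E2 tau').
    rewrite -wprod_cat {1}/wprod big_cons local_con_at; congr (psi (fcons _ _) * _).
      by rewrite sub// => i' j v _ /ie.
    apply/ffunP => j; rewrite ffunE sub; first by rewrite tE ?s1c.
    by move=> i' j' v ii'; rewrite ffunE; exact: dis.
  rewrite mE wE; apply: etrans (regroup _ _ _ _ _ _ _) _.
  by rewrite -wc size_cat exprS exprD.
have := branch (enum 'I_(size T)) F sigma (enum_uniq _) erefl.
by rewrite (_ : [seq tnth _ _ | _ <- _] = T)// -[RHS](map_tnth_enum (in_tuple T)).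
Qed.

End tree_exploration.

(** Inversion is continuous off 0, and the single point 0, where it takes the value 0, is
    measurable. *)
Lemma measurable_invr (R : realType) : measurable_fun setT (@GRing.inv R).
Proof.
have -> : [set: R] = [set 0] `|` ~` [set 0] by rewrite setUv.
apply/measurable_funU => //; first exact: measurableC.
split; first exact: measurable_fun_set1.
apply: open_continuous_measurable_fun.
  by apply: closed_openC; first [exact: closed_eq|exact: closed1|exact: accessible_closed_set1].
by move=> x /set_mem x0; apply: inv_continuous; apply/eqP.
Qed.

(** * The Gibbs measure of a tree *)

Section tree_gibbs.
Variables (R : realType) (Omega : finPointedType) (K : nat).
Notation weight := (weight R Omega K.+1).
Notation tree := (tree R Omega K.+1).
Notation msg := (msg R Omega).
Notation q := (#|Omega|%:R : R).

Lemma perm_weight_id (psi : weight) : perm_weight (tperm ord0 ord0) psi = psi.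
Proof.
apply/val_inj/ffunP => tau /=; rewrite ffunE; congr (psi _).
by apply/ffunP => p; rewrite !ffunE tperm1 perm1.
Qed.

Lemma child_slot_lift (j : 'I_K) : @child_slot K.+1 (lift ord0 j) = Some j.
Proof. by rewrite /child_slot /= -[RHS](valK j) /=; congr insub; rewrite add0n. Qed.

(** Stated for any commutative law, as it is needed for the product of the weights and for the
    disjunction that defines adjacency. *)
Lemma big_tree_cons (V : finType) (T : Type) (idx : T) (op : Monoid.com_law idx) l (t : tree l)
    (e : tree_var t -> V) (F : {ffun 'I_K.+1 -> V} * weight -> T) :
  \big[op/idx]_(a : tree_con t) F ([ffun p => e (tree_nbr a p)], tree_weight a) =
  \big[op/idx]_(a <- tree_cons e) F a.
Proof.
elim: l t e => [|l IH] t e.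
  by rewrite big_nil big_pred0// => -[].
rewrite [LHS]big_sumType /= big_flatten big_map big_enum.
rewrite [X in op _ X](_ : _ = \big[op/idx]_(i < size t) \big[op/idx]_(j < K)
    \big[op/idx]_(a <- tree_cons (node_emb e (i := i) (j := j))) F a).
  rewrite -big_split; apply: eq_bigr => i _.
  rewrite big_cons big_flatten big_map big_enum; congr (op (F _) _).
  congr (_, _).
    apply/ffunP => p; rewrite !ffunE tperm1 perm1.
    by case: unliftP => [j|] -> //=; rewrite child_slot_lift ffunE.
  exact/esym/perm_weight_id.
under [RHS]eq_bigr => i _ do under eq_bigr => j _ do rewrite -IH.
under [RHS]eq_bigr => i _ do rewrite (@sig_big_dep _ _ op _ _ xpredT (fun j : 'I_K => xpredT)
  (fun j a => F ([ffun p => node_emb e (i := i) (j := j) (tree_nbr a p)], tree_weight a))) /=.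
rewrite (@sig_big_dep _ _ op _ _ xpredT (fun i : 'I_(size t) => xpredT)
  (fun i (u : {j : 'I_K & tree_con (@subtree R Omega K.+1 l t i j)}) =>
   F ([ffun p => node_emb e (i := i) (j := tag u) (tree_nbr (tagged u) p)],
      tree_weight (tagged u)))) /=.
apply: eq_bigr => -[i [j a]] _ /=; congr (F (_, _)).
by apply/ffunP => p; rewrite !ffunE.
Qed.

Lemma tree_presents l (t : tree l) :
  @presents R Omega K (tree_graph t) (tree_cons (fun v : tree_var t => v)).
Proof.
have E (a : tree_con t) : [ffun p => tree_nbr a p] = tree_nbr a.
  by apply/ffunP => p; rewrite ffunE.
split=> [tau|x y].
  rewrite /wprod /gibbs_weight /= -(big_tree_cons *%R (fun v : tree_var t => v)
     (fun a => a.2 (local_spins tau a.1))).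
  by apply: eq_bigr => a _; rewrite /= E.
rewrite /step has_map -big_has /= -(big_tree_cons orb (fun v : tree_var t => v)
  (fun a => touch a.1 x && touch a.1 y)) big_orE.
by apply: eq_existsb => a; rewrite /= E.
Qed.

(** The minimum with 1 makes [bias] a function into [0, 1] on all messages, including meaningless
    ones; it is inactive where the ratio is a Gibbs probability ([bias_gibbs_cond]). *)
Definition bias (s : Omega) (m : msg) : R :=
  Num.min 1 `|mval m s / (\sum_s' mval m s') - q^-1|.

Lemma measurable_bias s : measurable_fun setT (bias s).
Proof.
apply: measurable_minr => //; apply: measurableT_comp => //; apply: measurable_funB => //.
apply: measurable_funM; first exact: measurable_mval.
rewrite (_ : (fun m => _) = (@GRing.inv R) \o (fun m : msg => \sum_s' mval m s'))//.
apply: measurableT_comp; first exact: measurable_invr.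
by apply: measurable_sum => s'; exact: measurable_mval.
Qed.

Lemma bias01 s m : 0 <= bias s m <= 1.
Proof. by rewrite /bias le_min ler01 normr_ge0 ge_min lexx. Qed.

Lemma gibbs_cond01 (G : factor_graph R Omega K.+1) l (y : fg_var G) s
    (sigma : {ffun fg_var G -> Omega}) : 0 <= gibbs_cond l y s sigma <= 1.
Proof.
have g0 (tau : {ffun fg_var G -> Omega}) : 0 <= gibbs tau.
  have w0 (t : {ffun fg_var G -> Omega}) : 0 <= gibbs_weight t.
    by apply: prodr_ge0 => a _; rewrite ltW// weight_gt0.
  by apply: divr_ge0 => //; apply: sumr_ge0.
have le : \sum_(tau | agree_far l y sigma tau && (tau y == s)) gibbs tau <=
    \sum_(tau | agree_far l y sigma tau) gibbs tau.
  rewrite big_mkcondr; apply: ler_sum => tau _; by case: ifP.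
have N0 : 0 <= \sum_(tau | agree_far l y sigma tau && (tau y == s)) gibbs tau.
  exact: sumr_ge0.
have D0 : 0 <= \sum_(tau | agree_far l y sigma tau) gibbs tau by exact: sumr_ge0.
rewrite /gibbs_cond divr_ge0//=; have [->|D1] := eqVneq (\sum_(tau | agree_far l y sigma tau) gibbs tau) 0.
  by rewrite invr0 mulr0 ler01.
by rewrite ler_pdivrMr ?mul1r// lt_neqAle eq_sym D1.
Qed.

Lemma q_ge1 : 1 <= q.
Proof. by rewrite ler1n; apply/card_gt0P; exists point. Qed.

Lemma bias_gibbs_cond (G : factor_graph R Omega K.+1) l (y : fg_var G) s
    (sigma : {ffun fg_var G -> Omega}) m :
  gibbs_cond l y s sigma = mval m s / (\sum_s' mval m s') ->
  bias s m = `|gibbs_cond l y s sigma - q^-1|.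
Proof.
move=> E; rewrite /bias -E; apply/min_idPr.
have /andP[c0 c1] := gibbs_cond01 l y s sigma.
have q0 : 0 < q by apply: lt_le_trans q_ge1.
have i0 : 0 <= q^-1 by rewrite invr_ge0 ltW.
have i1 : q^-1 <= 1 by rewrite invf_le1// q_ge1.
by rewrite ler_norml; apply/andP; split; lra.
Qed.

Variables (kappa : R).
Hypothesis kappa_gt0 : 0 < kappa.

Lemma tree_sum l (t : tree l) (F : msg -> R) :
  (\sum_(sigma : {ffun tree_var t -> Omega}) kappa ^+ size (tree_cons (fun v : tree_var t => v)) *
     wprod (tree_cons (fun v : tree_var t => v)) sigma *
     F (tree_msg sigma (fun v : tree_var t => v)))%:E =
  (\sum_(omega : Omega) quenched kappa t omega (fun m => (F m)%:E))%E.
Proof.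
set e := fun v : tree_var t => v.
have ie : injective e by [].
pose s0 : {ffun tree_var t -> Omega} := [ffun=> point].
pose f (sigma : {ffun tree_var t -> Omega}) := kappa ^+ size (tree_cons e) *
  wprod (tree_cons e) sigma * F (tree_msg sigma e).
have [|N H] := @tree_expl R Omega K _ s0 l t e [:: tree_root t] ie.
  by move=> v vr; rewrite inE; apply/eqP.
have xx : tree_root t \in [:: tree_root t] by rewrite mem_head.
have [[uA fA] _ _ _ _] := expl_supp.1 _ _ _ _ _ _ _ H xx.
transitivity (isum (tree_root t :: tree_below e) f s0)%:E; last first.
  rewrite /= -sumEFin; apply: eq_bigr => omega _.
  rewrite -(quenched_isum kappa F (upd s0 (tree_root t) omega) ie).
  by rewrite /e ffunE eqxx.
rewrite isum_sum; last first.
  by rewrite /= uA andbT; apply/negP => /fA; rewrite xx.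
congr EFin; apply: eq_bigl => sigma; apply/esym/forallP => z.
have [->|/eqP zr] := eqVneq z (tree_root t); first by rewrite mem_head.
by rewrite inE (tree_below_all e zr) orbT.
Qed.

(** The power of [kappa] is the same for all spin assignments and cancels; the denominator is the
    partition function. *)
Lemma tree_gibbs_mean l (t : tree l) s :
  gibbs_mean (fun sigma : {ffun fg_var (tree_graph t) -> Omega} =>
    `|gibbs_cond l (tree_root t : fg_var (tree_graph t)) s sigma - q^-1|) =
  fine (\sum_(omega : Omega) quenched kappa t omega (fun m => (bias s m)%:E))%E /
  fine (\sum_(omega : Omega) quenched kappa t omega (fun m => 1%:E))%E.
Proof.
set e := fun v : tree_var t => v.
have [pw ps] := tree_presents t.
rewrite -(tree_sum t (bias s)) -(tree_sum t (fun=> 1)) /= -/e.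
under [X in _ / X]eq_bigr do rewrite mulr1 -pw.
under [X in X / _]eq_bigr do rewrite -pw -mulrA.
rewrite -!mulr_sumr invfM mulrACA mulfV ?mul1r; last by rewrite expf_neq0 ?gt_eqF.
rewrite /gibbs_mean mulr_suml; apply: eq_bigr => sigma _.
rewrite /gibbs mulrAC; congr (_ * _ / _).
have [|N H] := @tree_expl R Omega K _ sigma l t e [:: tree_root t] (fun _ _ => id).
  by move=> v vr; rewrite inE; apply/eqP.
apply/esym/bias_gibbs_cond.
by apply: (expl_gibbs_cond (g' := [::]) s (tree_presents t) _ H) => //; rewrite cats0.
Qed.

End tree_gibbs.

(** * Properties that hold with probability one *)

Section almost_sure.
Context d (T : measurableType d) (R : realType) (A : set T).
Hypothesis mA : measurable A.
Local Open Scope ereal_scope.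

Lemma Forall_tnth n (t : n.-tuple T) : List.Forall A (tval t) <-> forall i, A (tnth t i).
Proof.
elim: n t => [|n IH] t; first by rewrite tuple0; split=> // _ [].
case/tupleP: t => x t; rewrite List.Forall_cons_iff IH; split=> [[Ax At] i|At].
  by case: (unliftP ord0 i) => [j|] ->; rewrite ?tnthS ?tnth0.
split; first by have := At ord0; rewrite tnth0.
by move=> i; have := At (lift ord0 i); rewrite tnthS.
Qed.

Lemma measurable_Forall_tuple n : measurable [set t : n.-tuple T | List.Forall A (tval t)].
Proof.
rewrite (_ : [set _ | _] = \bigcap_(i in [set: 'I_n]) ((fun t : n.-tuple T => tnth t i) @^-1` A)).
  apply: fin_bigcap_measurable => [|i _]; first exact: finite_finset.
  by rewrite -[X in measurable X]setTI; exact: measurable_tnth.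
by apply/seteqP; split=> t /=; rewrite Forall_tnth => h; [move=> i _|move=> i]; exact: h.
Qed.

Lemma measurable_Forall : measurable [set s : seq T | List.Forall A s].
Proof. by apply: measurable_seqI => n; exact: measurable_Forall_tuple. Qed.

Lemma iid_Forall (mu : probability T R) n : mu A = 1 ->
  iid mu n [set t | List.Forall A (tval t)] = 1.
Proof.
move=> muA; elim: n => [|n IH].
  by rewrite /= diracE mem_set//=; exact: List.Forall_nil.
rewrite /= /distribution /pushforward.
rewrite (_ : _ @^-1` _ = A `*` [set t : n.-tuple T | List.Forall A (tval t)]).
  rewrite (product_measure1E mu (iid mu n))//; last exact: measurable_Forall_tuple.
  by rewrite -[RHS]mul1e; congr (_ * _).
by apply/seteqP; split=> -[x t] /=; rewrite List.Forall_cons_iff.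
Qed.

Lemma poisson_iid_Forall (rate : R) (mu : probability T R) : mu A = 1 ->
  poisson_iid rate mu [set s | List.Forall A s] = 1.
Proof.
move=> muA; rewrite /poisson_iid (eq_integral (cst 1)); last first.
  by move=> n _ /=; exact: iid_Forall.
by rewrite integral_cst// mul1e; exact: probability_setT.
Qed.

Lemma eq_integral_prob1 (mu : probability T R) (f g : T -> \bar R) : mu A = 1 ->
  nnmeas f -> nnmeas g -> (forall x, A x -> f x = g x) ->
  \int[mu]_x f x = \int[mu]_x g x.
Proof.
move=> muA.
have mC : measurable (~` A) by exact: measurableC.
have mi : nnmeas (fun x => (\1_(~` A) x)%:E : \bar R).
  by split=> [|x]; [exact/measurable_EFinP|rewrite lee_fin].
(* Adding [+oo] on the null set leaves the integral unchanged and turns a comparison on [A] into one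
   that holds everywhere. *)
have i0 : \int[mu]_x (+oo * (\1_(~` A) x)%:E) = 0.
  rewrite (ilZ (il_prob mu))// (integral_indic mu)// setIT.
  rewrite -[RHS](mule0 +oo); congr (_ * _).
  by have h := probability_setC mu mA; rewrite muA subee in h.
have le (f' g' : T -> \bar R) : nnmeas f' -> nnmeas g' -> (forall x, A x -> f' x = g' x) ->
    \int[mu]_x f' x <= \int[mu]_x g' x.
  move=> mf mg fg; rewrite -[leRHS]adde0 -i0 -(ilD (il_prob mu))//; last exact: nnmeasZ.
  apply: (il_le (il_prob mu)) => //; first by apply: nnmeasD => //; exact: nnmeasZ.
  move=> x; rewrite indicE in_setC; case: (boolP (x \in A)) => [/set_mem/fg->|_] /=.
    by rewrite mule0 adde0.
  by rewrite mule1 addey ?leey// -ltNye; apply: lt_le_trans (mg.2 x); exact: ltNyr.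
move=> mf mg fg; apply/eqP; rewrite eq_le !le// => x Ax; exact/esym/fg.
Qed.

End almost_sure.

Section tree_correlation.
Variables (R : realType) (Omega : finPointedType) (K : nat).
Notation weight := (weight R Omega K.+1).
Notation tree := (tree R Omega K.+1).
Notation msg := (msg R Omega).
Notation q := (#|Omega|%:R : R).
Variables (Psi : set weight) (P : probability weight R) (kappa d : R).
Hypotheses (mPsi : measurable Psi) (PPsi : P Psi = 1%E).
Hypotheses (kappa_gt0 : 0 < kappa) (d_gt0 : 0 < d).
Hypothesis normalP : forall psi, Psi psi -> forall omega,
  \sum_(tau : {ffun 'I_K -> Omega}) kappa * psi (fcons omega tau) = 1.
Local Open Scope ereal_scope.

Let kappa_ge0 : (0 <= kappa)%R. Proof. exact: ltW. Qed.

(** The trees all of whose weights lie in [Psi], where SYM applies to each weight and not only on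
    average. *)
Fixpoint good_tree l : set (tree l) :=
  if l is l'.+1 return set (tree l) then
    [set t : seq (weight * K.-tuple (Defs.tree R Omega K.+1 l')) |
      List.Forall (fun x => Psi x.1 /\ List.Forall (@good_tree l') (tval x.2)) t]
  else setT.

Lemma measurable_good_con l : measurable (@good_tree l) ->
  measurable [set x : weight * K.-tuple (Defs.tree R Omega K.+1 l) |
    Psi x.1 /\ List.Forall (@good_tree l) (tval x.2)].
Proof.
move=> mg; rewrite (_ : [set x | _] =
  Psi `*` [set t : K.-tuple _ | List.Forall (@good_tree l) (tval t)])//.
by apply: measurableX => //; exact: measurable_Forall_tuple.
Qed.

Lemma measurable_good_tree l : measurable (@good_tree l).
Proof.
elim: l => [|l IH]; first exact: measurableT.
apply: (@measurable_Forall _ _ [set x : weight * K.-tuple (Defs.tree R Omega K.+1 l) |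
  Psi x.1 /\ List.Forall (@good_tree l) (tval x.2)]).
exact: measurable_good_con.
Qed.

Lemma tree_law_good l : tree_law P d l (@good_tree l) = 1.
Proof.
elim: l => [|l IH]; first exact: probability_setT.
have mg := measurable_good_tree l.
apply: (@poisson_iid_Forall _ _ _ [set x : weight * K.-tuple (Defs.tree R Omega K.+1 l) |
  Psi x.1 /\ List.Forall (@good_tree l) (tval x.2)]).
  exact: measurable_good_con.
rewrite (_ : [set x | _] = Psi `*` [set t : K.-tuple _ | List.Forall (@good_tree l) (tval t)])//.
rewrite [LHS](product_measure1E P (iid (tree_law P d l) K))//; last exact: measurable_Forall_tuple.
by rewrite -[RHS]mul1e; congr (_ * _); [exact: PPsi|exact: iid_Forall].
Qed.

(** Summing out the spins from the leaves upwards, every constraint contributes 1 by SYM. Hence the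
    partition function does not depend on the tree beyond its power of [kappa]. *)
Lemma quenched_good l (t : tree l) omega : good_tree t ->
  quenched kappa t omega (fun=> 1) = 1.
Proof.
elim: l t omega => [//|l IH] t omega.
have kids (ts : seq (Defs.tree R Omega K.+1 l)) ws : List.Forall (@good_tree l) ts ->
    qkids (@quenched R Omega K kappa l) ts ws (fun=> 1) = 1.
  elim: ts ws => [//|u ts IHt] [//|w ws] /List.Forall_cons_iff[gu gts] /=.
  by under eq_fun do rewrite IHt//; exact: IH.
rewrite /=; elim: t => [//|[psi ts] t IHt] /List.Forall_cons_iff[[/= Ppsi gts] gt].
rewrite /= (eq_bigr (fun tau : {ffun 'I_K -> Omega} => (kappa * psi (fcons omega tau))%:E)).
  by rewrite sumEFin normalP.
move=> tau _; under [X in qkids _ _ _ X]eq_fun do rewrite IHt//.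
by rewrite kids// mule1.
Qed.

(** On a good tree the normalisation is exactly the number of root spins, so the expectation over
    the tree passes inside the ratio and the Gibbs mean becomes the broadcast with a uniform root
    spin. *)
Lemma tree_corrE l : tree_corr P d l =
  \sum_(s : Omega) (q^-1)%:E * \sum_(omega : Omega)
    bcast P kappa (poisson_pmf d) l omega (fun m => (bias s m)%:E).
Proof.
apply: eq_bigr => s _.
have mb : nnmeas (fun m : msg => (bias s m)%:E).
  split=> [|m]; first by apply/measurable_EFinP; exact: measurable_bias.
  by rewrite lee_fin; case/andP: (bias01 s m).
have mq F : nnmeas F -> nnmeas (fun t : tree l => \sum_(omega : Omega) quenched kappa t omega F).
  by move=> mF; apply: nnmeas_sum => omega; exact: (kernel_meas (quenched_kernel K kappa_ge0 l omega) mF).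
have m1 := mq _ (nnmeas_cst _ (@lee01 R)).
have m2 := mq _ mb.
rewrite (eq_integral_prob1 (measurable_good_tree l)
  (g := fun t => (q^-1)%:E * \sum_(omega : Omega) quenched kappa t omega (fun m => (bias s m)%:E))).
- rewrite (ilZ (il_prob (tree_law P d l)))//.
  congr (_ * _); rewrite (il_sum (il_prob (tree_law P d l))); last first.
    by move=> omega; exact: (kernel_meas (quenched_kernel K kappa_ge0 l omega) mb).
  by apply: eq_bigr => omega _; rewrite integral_quenched.
- exact: tree_law_good.
- split=> [|t]; last first.
    rewrite lee_fin; apply: sumr_ge0 => sigma _; apply: mulr_ge0 => //.
    apply: divr_ge0; first by apply: prodr_ge0 => a _; rewrite ltW// weight_gt0.
    by apply: sumr_ge0 => ? _; apply: prodr_ge0 => a _; rewrite ltW// weight_gt0.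
  apply/measurable_EFinP.
  rewrite (_ : (fun t => _) = fun t : tree l =>
    (fine (\sum_(omega : Omega) quenched kappa t omega (fun m => (bias s m)%:E)) *
    (fine (\sum_(omega : Omega) quenched kappa t omega (fun m => 1%:E)))^-1)%R); last first.
    by apply/funext => t; rewrite (tree_gibbs_mean kappa_gt0).
  apply: measurable_funM; first by apply: measurableT_comp => //; exact: m2.1.
  apply: (measurableT_comp (@measurable_invr R)).
  by apply: measurableT_comp => //; exact: m1.1.
- by apply: nnmeasZ => //; rewrite lee_fin invr_ge0.
- move=> t gt; rewrite (tree_gibbs_mean kappa_gt0) -(tree_sum kappa t (bias s)) /=.
  rewrite -EFinM mulrC; congr (_%:E); congr (_^-1 * _)%R.
  rewrite (eq_bigr (fun=> 1)) => [|omega _]; last exact: quenched_good.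
  by rewrite (sumEFin _ _ (fun=> 1%R)) /= sumr_const.
Qed.

End tree_correlation.

(** * Poisson processes of constraints *)

Section poisson_functional.
Context d (C : measurableType d) (R : realType).
Implicit Types (L : (C -> \bar R) -> \bar R) (Phi : seq C -> \bar R).
Local Open Scope ereal_scope.

Fixpoint iterL L j Phi : \bar R :=
  if j is j'.+1 then L (fun a => iterL L j' (fun s => Phi (a :: s))) else Phi [::].

(** An unnormalised Poisson process of intensity [L]: multiplied by the exponential of minus the
    mass of [L], it is the expectation of [Phi] over the list of points. *)
Definition expL L Phi : \bar R := \sum_(j <oo) (j`!%:R^-1)%:E * iterL L j Phi.

Definition perminv Phi := forall s t : seq C, perm_eq s t -> Phi s = Phi t.

Lemma perminv_cat Phi s : perminv Phi -> perminv (fun t => Phi (s ++ t)).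
Proof. by move=> pP t u tu; apply: pP; rewrite perm_cat2l. Qed.

Lemma nnmeas_cat Phi s : nnmeas Phi -> nnmeas (fun t => Phi (s ++ t)).
Proof.
apply: nnmeas_comp.
exact: (measurableT_comp (@measurable_seq_cat _ C) (measurable_pairl s)).
Qed.

Lemma nnmeas_cons2 Phi : nnmeas Phi -> nnmeas (fun x : C * seq C => Phi (x.1 :: x.2)).
Proof. exact: nnmeas_comp (@measurable_seq_cons _ C). Qed.

Lemma nnmeas_cat2 Phi : nnmeas Phi -> nnmeas (fun x : seq C * seq C => Phi (x.1 ++ x.2)).
Proof. exact: nnmeas_comp (@measurable_seq_cat _ C). Qed.

Lemma fact_ge0 j : (0 <= j`!%:R^-1 :> R)%R. Proof. by rewrite invr_ge0. Qed.
Hint Resolve fact_ge0 : core.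

Section one.
Variable L : (C -> \bar R) -> \bar R.
Hypothesis HL : is_integral L.

Lemma il_iter j : is_integral (iterL L j).
Proof.
elim: j => [|j IH]; first exact: il_dirac.
exact: (il_comp HL IH (@measurable_seq_cons _ C)).
Qed.

Variable m : R.
Hypothesis Lm : L (cst 1) = m%:E.

Lemma mass_ge0 : (0 <= m)%R.
Proof. by rewrite -lee_fin -Lm; apply: (il_ge0 HL); exact: nnmeas_cst. Qed.

Lemma iterL_mass j : iterL L j (cst 1) = (m ^+ j)%:E.
Proof.
elim: j => //= j IH.
rewrite (_ : (fun a => _) = cst (m ^+ j)%:E); last by apply/funext => a; rewrite -IH.
by rewrite (il_cst HL) ?lee_fin ?exprn_ge0 ?mass_ge0// Lm exprSr -EFinM.
Qed.

Lemma expL_mass : expL L (cst 1) = (expR m)%:E.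
Proof.
rewrite /expL; under eq_eseriesr do rewrite iterL_mass -EFinM mulrC.
rewrite expRE -EFin_lim; last first.
  rewrite /pseries/=; under eq_fun do rewrite mulrC.
  exact: is_cvg_series_exp_coeff.
apply/congr_lim/funext => n/=; rewrite /pseries/= /series/= -sumEFin//.
by under eq_bigr do rewrite mulrC.
Qed.

Lemma il_exp : is_integral (expL L).
Proof.
apply: (il_nneseries (L := fun j Phi => (j`!%:R^-1)%:E * iterL L j Phi)).
  by move=> j; apply: il_scale => //; exact: il_iter.
by have := expL_mass; rewrite /expL => ->; rewrite ltry.
Qed.

End one.

Lemma iterL_le_on L (A : pred C) j Phi Phi' : is_integral L ->
  (forall F G, nnmeas F -> nnmeas G -> (forall a, A a -> F a <= G a) -> L F <= L G) ->
  nnmeas Phi -> nnmeas Phi' -> (forall s, all A s -> Phi s <= Phi' s) ->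
  iterL L j Phi <= iterL L j Phi'.
Proof.
move=> HL sL; elim: j Phi Phi' => [|j IH] Phi Phi' mP mP' PP' /=; first exact: PP'.
have mc := nnmeas_cons2 mP; have mc' := nnmeas_cons2 mP'.
apply: sL; [exact: (il_meas (il_iter HL j) mc)|exact: (il_meas (il_iter HL j) mc')|].
move=> a Aa; apply: IH => [||s As]; last by apply: PP'; rewrite /= Aa.
- exact: (nnmeas_comp (measurable_pairl a) mc).
- exact: (nnmeas_comp (measurable_pairl a) mc').
Qed.

Lemma expL_le_on L (A : pred C) Phi Phi' : is_integral L ->
  (forall F G, nnmeas F -> nnmeas G -> (forall a, A a -> F a <= G a) -> L F <= L G) ->
  nnmeas Phi -> nnmeas Phi' -> (forall s, all A s -> Phi s <= Phi' s) ->
  expL L Phi <= expL L Phi'.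
Proof.
move=> HL sL mP mP' PP'; apply: lee_nneseries => j _.
  by move=> _; apply: mule_ge0; rewrite ?lee_fin//; exact: (il_ge0 (il_iter HL j)).
apply: lee_wpmul2l; rewrite ?lee_fin//.
exact: (iterL_le_on _ HL sL mP mP' PP').
Qed.

Lemma cauchy_series (G : nat -> nat -> \bar R) : (forall j i, 0 <= G j i) ->
  \sum_(n <oo) \sum_(j < n.+1) G j (n - j)%N = \sum_(j <oo) \sum_(i <oo) G j i.
Proof.
move=> G0.
transitivity (\sum_(n <oo) \sum_(j <oo) if (j <= n)%N then G j (n - j)%N else 0); last first.
  rewrite nneseries_interchange; last by move=> j i; case: ifP.
  apply: eq_eseriesr => j _.
  rewrite (@nneseries_split _ _ 0 j); last by move=> n _; case: ifP.
  rewrite add0n big_nat_cond big1 ?add0e; last first.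
    by move=> n /andP[/andP[_ nj] _]; rewrite leqNgt nj.
  rewrite -(@nneseries_addn _ (fun n => if (j <= n)%N then G j (n - j)%N else 0) j); last first.
    by move=> n; case: ifP.
  by apply: eq_eseriesr => i _; rewrite leq_addl addnK.
apply: eq_eseriesr => n _; rewrite (@nneseries_split _ _ 0 n.+1); last by move=> k _; case: ifP.
rewrite add0n [X in _ = _ + X]eseries0 ?adde0; last first.
  by move=> i ni _; rewrite leqNgt ni.
by rewrite big_mkord; apply: eq_bigr => j _; rewrite -ltnS ltn_ord.
Qed.

Lemma pascal_sum m (u : nat -> \bar R) : (forall j, 0 <= u j) ->
  \sum_(j < m.+1) ('C(m, j)%:R)%:E * u j.+1 + \sum_(j < m.+1) ('C(m, j)%:R)%:E * u j =
  \sum_(j < m.+2) ('C(m.+1, j)%:R)%:E * u j.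
Proof.
move=> u0; have -> : \sum_(j < m.+1) ('C(m, j)%:R)%:E * u j =
    u 0%N + \sum_(j < m.+1) ('C(m, j.+1)%:R)%:E * u j.+1.
  transitivity (\sum_(j < m.+2) ('C(m, j)%:R)%:E * u j).
    by rewrite [RHS]big_ord_recr/= bin_small// mul0e adde0.
  by rewrite big_ord_recl/= bin0 mul1e.
rewrite [RHS]big_ord_recl /= bin0 mul1e addeCA; congr (_ + _).
rewrite -big_split; apply: eq_bigr => j _ /=.
by rewrite /bump leq0n add1n binS natrD EFinD ge0_muleDl ?lee_fin// addeC.
Qed.

Section two.
Variables L L' : (C -> \bar R) -> \bar R.
Hypotheses (HL : is_integral L) (HL' : is_integral L').

Let LL' F := L F + L' F.

Let G j i Phi := iterL L j (fun s => iterL L' i (fun t => Phi (s ++ t))).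

Let mG i Phi : nnmeas Phi -> nnmeas (fun s => iterL L' i (fun t => Phi (s ++ t))).
Proof. by move=> mP; apply: (il_meas (il_iter HL' i) (nnmeas_cat2 mP)). Qed.

Let G_ge0 j i Phi : nnmeas Phi -> 0 <= G j i Phi.
Proof. by move=> mP; apply: (il_ge0 (il_iter HL j)); exact: mG. Qed.

Let mGa j i Phi : nnmeas Phi -> nnmeas (fun a => G j i (fun s => Phi (a :: s))).
Proof.
move=> mP; apply: (il_meas2 (il_iter HL j) (F := fun a s => iterL L' i (fun t => Phi (a :: s ++ t)))).
apply: (il_meas2 (il_iter HL' i) (F := fun x t => Phi (x.1 :: x.2 ++ t))).
apply: (nnmeas_comp _ mP); apply: measurable_fun_cons; first exact: measurableT_comp.
by apply: measurable_fun_cat => //; exact: measurableT_comp.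
Qed.

Let L'G j i Phi : nnmeas Phi -> perminv Phi ->
  L' (fun a => G j i (fun s => Phi (a :: s))) = G j i.+1 Phi.
Proof.
move=> mP pP.
rewrite (il_comm HL' (il_iter HL j) (F := fun a s => iterL L' i (fun t => Phi (a :: s ++ t)))).
  congr iterL; apply/funext => s /=; congr L'; apply/funext => a.
  by congr iterL; apply/funext => t; apply: pP; rewrite -cat1s perm_catCA.
apply: (il_meas2 (il_iter HL' i) (F := fun x t => Phi (x.1 :: x.2 ++ t))).
apply: (nnmeas_comp _ mP); apply: measurable_fun_cons; first exact: measurableT_comp.
by apply: measurable_fun_cat => //; exact: measurableT_comp.
Qed.

Lemma iterL_add m Phi : nnmeas Phi -> perminv Phi ->
  iterL LL' m Phi = \sum_(j < m.+1) ('C(m, j)%:R)%:E * G j (m - j) Phi.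
Proof.
elim: m Phi => [|m IH] Phi mP pP; first by rewrite big_ord1 /= mul1e.
have mPa a : nnmeas (fun s => Phi (a :: s)).
  exact: (nnmeas_comp (measurable_pairl a) (nnmeas_cons2 mP)).
have pPa a : perminv (fun s => Phi (a :: s)).
  by move=> s t st; apply: pP; rewrite perm_cons.
rewrite [LHS]/= (_ : (fun a => _) = fun a => \sum_(j < m.+1)
   ('C(m, j)%:R)%:E * G j (m - j) (fun s => Phi (a :: s))); last first.
  by apply/funext => a; exact: IH.
have mc (j : 'I_m.+1) : nnmeas (fun a => ('C(m, j)%:R)%:E * G j (m - j) (fun s => Phi (a :: s))).
  by apply: nnmeasZ; rewrite ?lee_fin//; exact: mGa.
rewrite /LL' (il_sum HL)// (il_sum HL')//.
rewrite -(@pascal_sum m (fun j => G j (m.+1 - j) Phi)); last by move=> j; exact: G_ge0.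
congr (_ + _); apply: eq_bigr => j _.
  by rewrite (ilZ HL) ?lee_fin//; exact: mGa.
rewrite (ilZ HL') ?lee_fin//; last exact: mGa.
by rewrite L'G// subSn// -ltnS.
Qed.

(** Superposition of independent Poisson processes. The binomial expansion of the iterates of
    [L + L'] requires [Phi] to ignore the order of the points, and the factorials turn it into a
    Cauchy product. *)
Lemma expL_add Phi : nnmeas Phi -> perminv Phi ->
  expL LL' Phi = expL L (fun s => expL L' (fun t => Phi (s ++ t))).
Proof.
move=> mP pP; pose H j i := (j`!%:R^-1)%:E * ((i`!%:R^-1)%:E * G j i Phi).
have H0 j i : 0 <= H j i by rewrite !mule_ge0 ?lee_fin//; exact: G_ge0.
transitivity (\sum_(n <oo) \sum_(j < n.+1) H j (n - j)%N).
  apply: eq_eseriesr => n _; rewrite iterL_add// ge0_sume_distrr; last first.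
    by move=> j _; rewrite mule_ge0 ?lee_fin//; exact: G_ge0.
  apply: eq_bigr => j _; rewrite /H !muleA -!EFinM; congr (_%:E * _).
  have jn : (j <= n)%N by rewrite -ltnS.
  have f0 k : k`!%:R != 0%R :> R by rewrite pnatr_eq0 -lt0n fact_gt0.
  rewrite -(bin_fact jn) !natrM !invfM.
  by rewrite mulrAC mulVf ?mul1r// pnatr_eq0 -lt0n bin_gt0.
rewrite cauchy_series//; apply: eq_eseriesr => j _.
rewrite /H nneseriesZl; last by move=> i _; rewrite mule_ge0 ?lee_fin//; exact: G_ge0.
congr (_ * _); rewrite /expL (il_series (il_iter HL j)); last first.
  by move=> i; apply: nnmeasZ; rewrite ?lee_fin//; exact: mG.
by apply: eq_eseriesr => i _; rewrite (ilZ (il_iter HL j)) ?lee_fin//; exact: mG.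
Qed.

End two.
End poisson_functional.

(** * Exploring the Poisson process of constraints *)

Section graph_poisson.
Variables (R : realType) (Omega : finPointedType) (K n : nat).
Notation weight := (weight R Omega K.+1).
Notation V := 'I_n.+1.
Notation nbh := {ffun 'I_K.+1 -> 'I_n.+1}.
Notation con := (nbh * weight)%type.
Notation msg := (msg R Omega).
Variables (P : probability weight R) (rho : R) (sigma : {ffun 'I_n.+1 -> Omega}).
Hypothesis rho_ge0 : (0 <= rho)%R.
Implicit Types (A B : pred nbh) (Phi : seq con -> \bar R) (U W : seq V).
Local Open Scope ereal_scope.

(* The intensity measure of the constraints whose neighbourhood satisfies A. *)
Definition ilaw A (h : con -> \bar R) : \bar R :=
  \sum_(y | A y) \int[P]_psi ((rho * psi (local_spins sigma y))%:E * h (y, psi)).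

Let dens (y : nbh) : nnmeas (fun psi : weight => (rho * psi (local_spins sigma y))%:E).
Proof.
split=> [|psi]; last by rewrite lee_fin mulr_ge0// ltW// weight_gt0.
by apply/measurable_EFinP/measurable_funM => //; exact: measurable_weight_eval.
Qed.

Let sect (y : nbh) (h : con -> \bar R) : nnmeas h -> nnmeas (fun psi : weight => h (y, psi)).
Proof. by move=> mh; exact: (nnmeas_comp (measurable_pairl y) mh). Qed.

Lemma il_ilaw A : is_integral (ilaw A).
Proof.
apply: il_bigsum => y.
have H : is_integral (fun F => \int[P]_psi ((rho * psi (local_spins sigma y))%:E * F psi)).
  apply: (il_dens (il_prob P) (dens y) (c := (rho * 2)%R)) => psi.
  by rewrite lee_fin ler_wpM2l// ltW// weight_lt2.
exact: (il_map H (h := fun psi : weight => (y, psi)) (measurable_pairl y)).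
Qed.

Lemma ilaw_le_on A (F G : con -> \bar R) : nnmeas F -> nnmeas G ->
  (forall a, A a.1 -> F a <= G a) -> ilaw A F <= ilaw A G.
Proof.
move=> mF mG FG; apply: lee_sum => y Ay.
apply: (il_le (il_prob P)); [apply: nnmeasM => //; exact: sect|apply: nnmeasM => //; exact: sect|].
by move=> psi; apply: lee_wpmul2l; [exact: (dens y).2|exact: FG].
Qed.

Definition imass A : R := fine (ilaw A (cst 1)).

Lemma ilaw1 A : ilaw A (cst 1) = (imass A)%:E.
Proof.
rewrite fineK// ge0_fin_numE; first exact: (il_fin (il_ilaw A)).
by apply: (il_ge0 (il_ilaw A)); exact: nnmeas_cst.
Qed.

Lemma imass_ge0 A : (0 <= imass A)%R.
Proof. by rewrite -lee_fin -ilaw1; apply: (il_ge0 (il_ilaw A)); exact: nnmeas_cst. Qed.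

Lemma ilaw_split A B : ilaw A = fun F => ilaw (predI A B) F + ilaw (predD A B) F.
Proof.
apply/funext => F; rewrite /ilaw (bigID B) /=; congr (_ + _).
by apply: eq_bigl => y; rewrite andbC.
Qed.

Lemma imass_split A B : imass A = (imass (predI A B) + imass (predD A B))%R.
Proof. by apply: EFin_inj; rewrite EFinD -!ilaw1 -(congr1 (fun f => f (cst 1)) (ilaw_split A B)). Qed.

Lemma imass_le A B : subpred A B -> (imass A <= imass B)%R.
Proof.
move=> AB; rewrite (imass_split B A) (_ : imass (predI B A) = imass A) ?lerDl ?imass_ge0//.
rewrite /imass /ilaw; congr fine; apply: eq_bigl => y /=.
by case: (boolP (A y)) => [/AB->|]; rewrite ?andbF.
Qed.

Definition avoid U (y : nbh) := [forall i, y i \notin U].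

Lemma eq_avoid U U' : U =i U' -> avoid U = avoid U'.
Proof. by move=> UU'; apply/funext => y; apply: eq_forallb => i; rewrite UU'. Qed.

Lemma avoid_touch U (y : nbh) z : avoid U y -> touch y z -> z \notin U.
Proof. by move=> /forallP h /existsP[i /eqP<-]. Qed.

(* The expectation of Phi over the Poisson process of the constraints that avoid
   the vertices U. *)
Definition ppp U Phi : \bar R := (expR (- imass (avoid U)))%:E * expL (ilaw (avoid U)) Phi.

Lemma il_ppp U : is_integral (ppp U).
Proof.
by apply: il_scale; [exact: (il_exp (il_ilaw _) (ilaw1 _))|exact: expR_ge0].
Qed.

Lemma ppp1 U : ppp U (cst 1) = 1.
Proof.
rewrite /ppp (expL_mass (il_ilaw _) (ilaw1 _)) -EFinM -expRD addrC subrr.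
by rewrite expR0.
Qed.

Lemma ppp_le_on U Phi Phi' : nnmeas Phi -> nnmeas Phi' ->
  (forall g, all (fun a => avoid U a.1) g -> Phi g <= Phi' g) -> ppp U Phi <= ppp U Phi'.
Proof.
move=> mP mP' PP'; apply: lee_wpmul2l; first by rewrite lee_fin expR_ge0.
apply: (expL_le_on (A := fun a : con => avoid U a.1) (il_ilaw _)) => //.
by move=> F G mF mG FG; exact: ilaw_le_on.
Qed.

Definition shell x U : pred nbh := predI (avoid U) (fun y => touch y x).

(** Reveals the constraints at [x]: they are independent of those that avoid [x], so what remains is
    again a process of the same kind with one more excluded vertex. *)
Lemma ppp_peel x U Phi : nnmeas Phi -> perminv Phi ->
  ppp U Phi = (expR (- imass (shell x U)))%:E *
    expL (ilaw (shell x U)) (fun s => ppp (x :: U) (fun g => Phi (s ++ g))).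
Proof.
move=> mP pP.
have E : ilaw (avoid (x :: U)) = ilaw (predD (avoid U) (fun y => touch y x)).
  apply/funext => F; apply: eq_bigl => y /=; rewrite /touch negb_exists; apply/forallP/andP => [h|[h1 h2] i].
    by split; apply/forallP => i; have := h i; rewrite inE negb_or => /andP[].
  by rewrite inE negb_or (forallP h1) (forallP h2).
rewrite [LHS]/ppp (imass_split (avoid U) (fun y => touch y x)) opprD expRD EFinM -muleA; congr (_ * _).
rewrite {1}(ilaw_split (avoid U) (fun y => touch y x)) expL_add//; try exact: il_ilaw.
rewrite /ppp E {2}/imass E -/(imass _).
rewrite (ilZ (il_exp (il_ilaw _) (ilaw1 _)) (F := fun s => expL
  (ilaw (predD (avoid U) (fun y => touch y x))) (fun g => Phi (s ++ g))))//.
exact: (il_meas (il_exp (il_ilaw _) (ilaw1 _)) (nnmeas_cat2 mP)).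
Qed.

(** Excluding the vertices of [U] only deletes constraints, and [Phi] does not decrease under
    deletion. It is used for monotone graph properties such as simplicity. *)
Lemma ppp_mono U Phi : nnmeas Phi -> perminv Phi ->
  (forall s g, Phi (s ++ g) <= Phi g) -> ppp [::] Phi <= ppp U Phi.
Proof.
move=> mP pP dP; elim: U => [//|x U IH]; apply: le_trans IH _.
rewrite (ppp_peel x U)//.
have mp : nnmeas (fun s => ppp (x :: U) (fun g => Phi (s ++ g))).
  exact: (il_meas (il_ppp _) (nnmeas_cat2 mP)).
apply: (@le_trans _ _ ((expR (- imass (shell x U)))%:E *
    expL (ilaw (shell x U)) (cst (ppp (x :: U) Phi)))).
  apply: lee_wpmul2l; first by rewrite lee_fin expR_ge0.
  apply: (il_le (il_exp (il_ilaw _) (ilaw1 _))) => //.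
    by apply: nnmeas_cst; exact: (il_ge0 (il_ppp _)).
  by move=> s /=; apply: (il_le (il_ppp _)) => //; exact: nnmeas_cat.
rewrite (il_cst (il_exp (il_ilaw _) (ilaw1 _))); last exact: (il_ge0 (il_ppp _)).
rewrite (expL_mass (il_ilaw _) (ilaw1 _)) muleCA -EFinM -expRD addrC subrr expR0.
by rewrite mule1.
Qed.

Section claim.
Variables (kappa d theta : R) (D M0 : nat).
Hypotheses (kappa_ge0 : (0 <= kappa)%R) (d_gt0 : (0 < d)%R) (theta_ge0 : (0 <= theta)%R).
Hypothesis theta_le1 : (theta <= 1)%R.
Hypothesis normal : forall omega, \sum_(tau : {ffun 'I_K -> Omega})
  \int[P]_psi (kappa * psi (fcons omega tau))%:E = 1.
Hypothesis Pinv : forall (th : {perm 'I_K.+1}) (F : weight -> \bar R), nnmeas F ->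
  nnmeas (fun psi => F (perm_weight th psi)) /\
  \int[P]_psi F (perm_weight th psi) = \int[P]_psi F psi.

Definition freshk W (c : {ffun 'I_K -> V}) :=
  uniq (flist c) && all (fun z => z \notin W) (flist c).

(** The only quantitative input on the spins: by [R1] the intensity of constraints at a vertex is
    not much above [d], and by [R2] every spin pattern is available on enough tuples of fresh
    children. The room left by [theta] accommodates the errors at finite n. *)
Hypothesis R1 : forall x, (theta * expR (- d) <= expR (- imass (fun y => touch y x)))%R.
Hypothesis R2 : forall W, (size W <= M0)%N -> forall tau : {ffun 'I_K -> Omega},
  (theta * d * kappa <= rho * K.+1%:R *
    #|[pred c | freshk W c && ([ffun i => sigma (c i)] == tau)]|%:R)%R.

Definition nb_at (p : 'I_K.+1) x (c : {ffun 'I_K -> V}) : nbh :=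
  [ffun i => fcons x c (tperm ord0 p i)].

(** Since [x] lies in [W] and fresh children avoid [W], the vertex [x] occupies a single slot, and
    slot and children can be read off. *)
Lemma nb_at_inj x W : x \in W ->
  {in [pred u : 'I_K.+1 * {ffun 'I_K -> V} | freshk W u.2] &,
    injective (fun u => nb_at u.1 x u.2)}.
Proof.
move=> xW [p c] [p' c']; rewrite !inE /= => /andP[_ /allP fc] /andP[_ /allP fc'] E.
have cx (c1 : {ffun 'I_K -> V}) : {in flist c1, forall z, z \notin W} ->
    forall i, fcons x c1 i = x -> i = ord0.
  move=> f i; rewrite ffunE; case: unliftP => [j|] -> //= cj.
  have h : c1 j \in flist c1 by apply/mem_flist; exists j.
  by move: (f _ h); rewrite cj xW.
have pp' : p = p'.
  have := congr1 (fun f : nbh => f p) E; rewrite !ffunE tpermR unlift_none /= => /esym h.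
  have := cx c' fc' (tperm ord0 p' p); rewrite ffunE => /(_ h) => h'.
  by rewrite -[LHS](tpermK ord0 p') h' tpermL.
subst p'; congr (_, _); apply/ffunP => j.
have := congr1 (fun f : nbh => f (tperm ord0 p (lift ord0 j))) E.
by rewrite !ffunE tpermK liftK.
Qed.

(** One step of the exploration: constraints at [x] with fresh children dominate [theta * d] times
    the branching kernel. The invariance of [P] moves [x] from slot [p] to the front, and the factor
    [K.+1] in [R2] counts the slots; distinct choices of slot and children are distinct constraints
    by [nb_at_inj]. *)
Lemma pick_bound x W B (h : con -> \bar R) (H : {ffun 'I_K -> Omega} -> weight -> \bar R) :
  x \in W -> (size W <= M0)%N -> nnmeas h -> (forall tau, nnmeas (H tau)) ->
  (forall p c, freshk W c -> B (nb_at p x c)) ->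
  (forall p c psi, freshk W c -> H [ffun i => sigma (c i)] psi <= h (con_at p x c psi)) ->
  (theta * d)%:E * \sum_tau \int[P]_psi ((kappa * psi (fcons (sigma x) tau))%:E * H tau psi)
    <= ilaw B h.
Proof.
move=> xW sW mh mH Bf Hh.
pose F (y : nbh) := \int[P]_psi ((rho * psi (local_spins sigma y))%:E * h (y, psi)).
have F0 y : 0 <= F y by apply: (il_ge0 (il_prob P)); apply: nnmeasM => //; exact: sect.
pose S := [set u : 'I_K.+1 * {ffun 'I_K -> V} | freshk W u.2]%SET.
pose f (u : 'I_K.+1 * {ffun 'I_K -> V}) := nb_at u.1 x u.2.
have mw tau : nnmeas (fun psi : weight => (psi (fcons (sigma x) tau))%:E).
  split=> [|psi]; last by rewrite lee_fin ltW// weight_gt0.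
  by apply/measurable_EFinP; exact: measurable_weight_eval.
pose J tau := \int[P]_psi ((psi (fcons (sigma x) tau))%:E * H tau psi).
have J0 tau : 0 <= J tau by apply: (il_ge0 (il_prob P)); exact: nnmeasM.
have Fge p c : freshk W c -> rho%:E * J [ffun i => sigma (c i)] <= F (nb_at p x c).
  move=> fc; rewrite /F.
  have mFy : nnmeas (fun psi : weight => (rho * psi (local_spins sigma (nb_at p x c)))%:E *
      h (nb_at p x c, psi)) by apply: nnmeasM => //; exact: sect.
  have [m1 <-] := Pinv (tperm ord0 p) mFy.
  rewrite -(ilZ (il_prob P)); [|by rewrite lee_fin|exact: nnmeasM].
  apply: (il_le (il_prob P)) => //.
    by apply: nnmeasZ; [rewrite lee_fin|exact: nnmeasM].
  move=> psi; have := local_con_at sigma p x c psi; rewrite [X in X = _]/= => ->.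
  rewrite muleA -EFinM; apply: lee_wpmul2l; last exact: (Hh p c psi fc).
  by rewrite lee_fin mulr_ge0// ltW// weight_gt0.
apply: (@le_trans _ _ (\sum_(u in S) F (f u))); last first.
  rewrite -(big_imset F (A := mem S)) /=; last first.
    by move=> u v; rewrite !inE => uS vS; exact: (nb_at_inj xW).
  rewrite /ilaw [leRHS](bigID (mem (f @: S)%SET)) /=.
  rewrite [X in X <= _ + _](_ : _ = \sum_(y | B y && (y \in (f @: S)%SET)) F y).
    by apply: leeDl; apply: sume_ge0 => y _; exact: F0.
  apply: eq_bigl => y; case: (boolP (y \in _)) => [/imsetP[u]|]; rewrite ?andbF// inE => uS ->.
  by rewrite Bf.
apply: (@le_trans _ _ (\sum_(u in S) rho%:E * J [ffun i => sigma (u.2 i)])); last first.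
  by apply: lee_sum => -[p c]; rewrite inE /= => fc; exact: Fge.
rewrite [leRHS](_ : _ = \sum_tau (rho * K.+1%:R *
    #|[pred c | freshk W c && ([ffun i => sigma (c i)] == tau)]|%:R)%:E * J tau); last first.
  rewrite (partition_big (fun u : 'I_K.+1 * {ffun 'I_K -> V} => [ffun i => sigma (u.2 i)]) xpredT)//=.
  apply: eq_bigr => tau _.
  rewrite (eq_bigr (fun=> rho%:E * J tau)); last by move=> u /andP[_ /eqP->].
  rewrite -ge0_sume_distrl; last by move=> u _; rewrite lee_fin.
  congr (_ * _); rewrite sumEFin sumr_const; congr (_%:E).
  rewrite -mulrA -natrM -[LHS]mulr_natr -[in X in (X * _)%N](card_ord K.+1) -cardX.
  congr (_ * _%:R)%R; apply: eq_card => -[p c]; rewrite !inE /=.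
  by rewrite unfold_in /= inE.
rewrite ge0_sume_distrr; last first.
  by move=> tau _; apply: (il_ge0 (il_prob P)); apply: nnmeasM => //; exact: (weight_dens kappa_ge0 _ _).1.
apply: lee_sum => tau _.
rewrite (_ : \int[P]_psi _ = kappa%:E * J tau); last first.
  rewrite -(ilZ (il_prob P)); [|by rewrite lee_fin|exact: nnmeasM].
  by congr integral; apply/funext => psi; rewrite muleA EFinM.
by rewrite muleA -EFinM; apply: lee_wpmul2r => //; rewrite lee_fin; exact: R2.
Qed.

(** One factor [theta] is spent on [R1] when the constraints at a vertex are revealed, and one on
    [R2] for each of the [j] constraints. *)
Let w j : R := if (j < D)%N then (theta ^+ j.+1 * poisson_pmf d j)%R else 0%R.
Let dg j := (j < D)%N.
Notation T l := (bcast P kappa w l).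

Let w_ge0 j : (0 <= w j)%R.
Proof. by rewrite /w; case: ifP => // _; rewrite mulr_ge0 ?exprn_ge0 ?poisson_pmf_ge0// ltW. Qed.

Let w_le j : (w j <= poisson_pmf d j)%R.
Proof.
rewrite /w; case: ifP => _; last exact: poisson_pmf_ge0.
by rewrite -[leRHS]mul1r ler_wpM2r ?poisson_pmf_ge0// exprn_ile1.
Qed.

Let w_le1 : \sum_(j <oo) (w j)%:E <= 1.
Proof.
rewrite -(poisson_pmf_sum1 d_gt0); apply: lee_nneseries => j _; first by rewrite lee_fin.
by rewrite lee_fin.
Qed.

Let HT l : forall omega, is_integral (T l omega).
Proof. by move=> omega; exact: il_bcast. Qed.

Lemma eq_ppp U U' : U =i U' -> ppp U = ppp U'.
Proof. by move=> UU'; rewrite /ppp (eq_avoid UU'). Qed.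

(* T only counts the tree-like explorations with fewer than D constraints below
   each vertex, hence an inequality. The bound from above is the same inequality
   for the complementary function, as T has mass close to 1. *)
Definition claim l := forall x W U Phi (phi : msg -> \bar R), x \in W -> x \notin U ->
  {subset U <= W} -> (size W + ball_bound K D l <= M0)%N -> nnmeas Phi -> perminv Phi ->
  nnmeas phi ->
  (forall E N X m, expl dg sigma l x W E N X m ->
     phi m <= ppp (map fst N ++ U) (fun g => Phi (E ++ g))) ->
  T l (sigma x) phi <= ppp U Phi.

Lemma claim_kids l : claim l -> forall xs W U Phi (F : seq msg -> \bar R), uniq xs ->
  {subset xs <= W} -> {in xs, forall x, x \notin U} ->
  {subset U <= W} -> (size W + size xs * ball_bound K D l <= M0)%N -> nnmeas Phi -> perminv Phi ->
  nnmeas F ->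
  (forall E N X ms, expls dg sigma l xs W E N X ms ->
     F ms <= ppp (map fst N ++ U) (fun g => Phi (E ++ g))) ->
  kids (T l) (map sigma xs) F <= ppp U Phi.
Proof.
move=> Cl; elim=> [|x xs IH] W U Phi F /=.
  by move=> _ _ _ _ _ _ _ _ h; apply: (h [::] [::] [::] [::]); constructor.
move=> /andP[xxs Uxs] xsW xsU UW sW mP pP mF h.
have xW : x \in W by apply: xsW; rewrite inE eqxx.
have mc : nnmeas (fun u : msg * seq msg => F (u.1 :: u.2)).
  exact: nnmeas_comp (@measurable_seq_cons _ msg) mF.
apply: (Cl x W U) => //.
- by apply: xsU; rewrite inE eqxx.
- by apply: leq_trans sW; rewrite leq_add2l mulSn leq_addr.
- exact: (il_meas (il_kids (HT l) _) mc).
move=> E1 N1 A1 m e1.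
have [[_ fA] _ [_ lN] sA _] := expl_supp.1 _ _ _ _ _ _ _ e1 xW.
have {}sA := sA D (fun _ h => h).
have N1A z : z \in map fst N1 -> z \in x :: A1.
  by move=> /mapP[[u r] uN ->]; case: (lN u r uN).
apply: (IH (A1 ++ W)) => //.
- by move=> z zx; rewrite mem_cat xsW ?orbT// inE zx orbT.
- move=> z zx; rewrite mem_cat negb_or xsU ?inE ?zx ?orbT// andbT.
  apply/negP => /N1A; rewrite inE => /orP[/eqP zE|/fA]; first by rewrite -zE zx in xxs.
  by rewrite xsW// inE zx orbT.
- move=> z; rewrite !mem_cat => /orP[/N1A|/UW ->]; last by rewrite orbT.
  by rewrite inE => /orP[/eqP->|->//]; rewrite xW orbT.
- rewrite size_cat; apply: leq_trans sW; rewrite mulSn.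
  by rewrite [leqRHS]addnA leq_add2r addnC leq_add2l.
- exact: nnmeas_cat.
- exact: perminv_cat.
- exact: (nnmeas_comp (measurable_pairl m) mc).
move=> E2 N2 A2 ms e2.
have -> : (fun g => Phi (E1 ++ E2 ++ g)) = (fun g => Phi ((E1 ++ E2) ++ g)).
  by apply/funext => g; rewrite catA.
rewrite (eq_ppp (U' := map fst (N1 ++ N2) ++ U)).
  exact: (h _ _ _ _ (explsS e1 e2)).
by move=> z; rewrite map_cat !mem_cat orbCA orbA.
Qed.

Lemma shell_nb_at x W U p c : x \in W -> x \notin U -> {subset U <= W} -> freshk W c ->
  shell x U (nb_at p x c).
Proof.
move=> xW xU UW /andP[_ /allP fc]; apply/andP; split.
  apply/forallP => i; rewrite ffunE ffunE; case: unliftP => [j|] _ //=.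
  apply/negP => /UW; apply/negP/fc; apply/mem_flist; by exists j.
have := touch_con_at p x c (point : weight) x; rewrite eqxx => /= h; exact: h.
Qed.

(** The [j] constraints at [x] are handled one after the other. Their law refers to the fixed set
    [U] of vertices excluded before [x] was reached, whereas the set [U'] excluded from the rest of
    the process grows with each explored branch; hence two sets. *)
Lemma claim_branch l : claim l -> forall x U, x \notin U ->
  forall j W U' Phi (F : msg -> \bar R), x \in W ->
  {subset U <= W} -> {subset U' <= W} ->
  (size W + j * (K + K * ball_bound K D l) <= M0)%N -> nnmeas Phi -> perminv Phi -> nnmeas F ->
  (forall E N X M, explb dg sigma l j x W E N X M ->
     F M <= ppp (map fst N ++ U') (fun g => Phi (E ++ g))) ->
  ((theta * d) ^+ j)%:E * branch P kappa (T l) j (sigma x) F <=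
  iterL (ilaw (shell x U)) j (fun bs => ppp U' (fun g => Phi (bs ++ g))).
Proof.
move=> Cl x U xU; elim=> [|j IH] W U' Phi F xW UW U'W sW mP pP mF h.
  by rewrite expr0 mul1e /=; apply: (h [::] [::] [::] one_msg); constructor.
have td0 : (0 <= theta * d)%R by rewrite mulr_ge0// ltW.
have td0j : (0 <= (theta * d) ^+ j)%R by rewrite exprn_ge0.
have HI := il_iter (il_ilaw (shell x U)) j.
have mP3 : nnmeas (fun u : (con * seq con) * seq con => Phi (u.1.1 :: u.1.2 ++ u.2)).
  apply: (nnmeas_comp _ mP); apply: measurable_fun_cons.
    by apply: measurableT_comp; [exact: measurable_fst|exact: measurable_fst].
  apply: measurable_fun_cat; last exact: measurable_snd.
  by apply: measurableT_comp; [exact: measurable_snd|exact: measurable_fst].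
have mP2 : nnmeas (fun u : con * seq con => ppp U' (fun g => Phi (u.1 :: u.2 ++ g))).
  exact: (il_meas (il_ppp U') mP3).
have mPa (a : con) : nnmeas (fun u : seq con * seq con => Phi (a :: u.1 ++ u.2)).
  apply: (nnmeas_comp _ mP); apply: measurable_fun_cons; first exact: measurable_cst.
  by apply: measurable_fun_cat; [exact: measurable_fst|exact: measurable_snd].
have mPa' (a : con) : nnmeas (fun u : seq con * seq con => Phi (a :: u.2 ++ u.1)).
  apply: (nnmeas_comp _ mP); apply: measurable_fun_cons; first exact: measurable_cst.
  by apply: measurable_fun_cat; [exact: measurable_snd|exact: measurable_fst].
have mF3 : nnmeas (fun u : (weight * seq msg) * msg => F (mul_msg (con_msg u.1.1 u.1.2) u.2)).
  apply: (nnmeas_comp (h := fun u : (weight * seq msg) * msg =>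
    (u.1.1, (u.1.2, u.2))) _ (nnmeas_comp (@measurable_extend_msg R Omega K) mF)).
  by apply: measurable_fun_pair; [|apply: measurable_fun_pair => //]; exact: measurableT_comp.
have mb : nnmeas (fun u : weight * seq msg => branch P kappa (T l) j (sigma x)
     (fun M => F (mul_msg (con_msg u.1 u.2) M))).
  exact: (il_meas (il_branch P kappa_ge0 (HT l) j (sigma x)) mF3).
pose H (tau : {ffun 'I_K -> Omega}) (psi : weight) := ((theta * d) ^+ j)%:E *
  kids (T l) (flist tau) (fun ms => branch P kappa (T l) j (sigma x)
    (fun M => F (mul_msg (con_msg psi ms) M))).
have mk tau : nnmeas (fun psi : weight => kids (T l) (flist tau)
    (fun ms => branch P kappa (T l) j (sigma x) (fun M => F (mul_msg (con_msg psi ms) M)))).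
  exact: (il_meas (il_kids (HT l) _) mb).
have mH tau : nnmeas (H tau) by apply: nnmeasZ; rewrite ?lee_fin.
have -> : ((theta * d) ^+ j.+1)%:E * branch P kappa (T l) j.+1 (sigma x) F =
    (theta * d)%:E * \sum_tau \int[P]_psi ((kappa * psi (fcons (sigma x) tau))%:E * H tau psi).
  rewrite exprS EFinM -muleA; congr (_ * _); rewrite /= ge0_sume_distrr; last first.
    move=> tau _; apply: (il_ge0 (il_prob P)).
    by apply: nnmeasM => //; exact: (weight_dens kappa_ge0 _ _).1.
  apply: eq_bigr => tau _; rewrite -(ilZ (il_prob P)) ?lee_fin//; last first.
    by apply: nnmeasM => //; exact: (weight_dens kappa_ge0 _ _).1.
  by congr integral; apply/funext => psi; rewrite muleCA.
rewrite [leRHS]/=.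
apply: (pick_bound (W := W) (H := H)) => //.
- by apply: leq_trans sW; rewrite leq_addr.
- exact: (il_meas HI mP2).
- by move=> p c fc; exact: shell_nb_at fc.
move=> p c psi fc; set a := con_at p x c psi.
have /andP[Uc /allP cW] := fc.
have sc : size (flist c) = K by rewrite size_map size_enum_ord.
rewrite /H (_ : flist _ = map sigma (flist c)); last first.
  by rewrite /flist; elim: (enum 'I_K) => //= i s ->; rewrite ffunE.
have mbp : nnmeas (fun ms => branch P kappa (T l) j (sigma x)
    (fun M => F (mul_msg (con_msg psi ms) M))).
  exact: (nnmeas_comp (measurable_pairl psi) mb).
rewrite -(ilZ (il_kids (HT l) _)) ?lee_fin//.
(* The exploration below the first constraint takes place in the process [g], so this process is
   brought outside and the other constraints [bs] at [x] are absorbed into the integrand. They are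
   brought back out once the children are explored. *)
rewrite (il_comm HI (il_ppp U') (F := fun bs g => Phi (a :: bs ++ g)) (mPa a)).
apply: (claim_kids Cl (W := flist c ++ W)) => //.
- by move=> z zc; rewrite mem_cat zc.
- by move=> z /cW zW; apply/negP => /U'W; exact/negP.
- by move=> z /U'W zW; rewrite mem_cat zW orbT.
- rewrite size_cat sc; apply: leq_trans sW; rewrite mulSn.
  rewrite [leqRHS]addnA; apply: leq_trans (leq_addr _ _).
  by rewrite [leqRHS]addnA leq_add2r addnC.
- exact: (il_meas HI (mPa' a)).
- move=> s t st; congr iterL; apply/funext => bs; apply: pP.
  by rewrite perm_cons perm_cat2l.
- by apply: nnmeasZ; rewrite ?lee_fin.
move=> E1 N1 A1 ms e1.
have subW : {subset flist c <= flist c ++ W} by move=> z zc; rewrite mem_cat zc.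
have [[_ fA] _ [_ lN] sA _] := expl_supp.2.2 _ _ _ _ _ _ _ e1 Uc subW.
have {}sA := sA D (fun _ h => h).
have N1A z : z \in map fst N1 -> z \in flist c ++ A1.
  by move=> /mapP[[u r] uN ->]; case: (lN u r uN).
have mPE : nnmeas (fun s => Phi (a :: E1 ++ s)) by exact: (nnmeas_cat (a :: E1) mP).
have pPE : perminv (fun s => Phi (a :: E1 ++ s)) by exact: (perminv_cat (a :: E1) pP).
rewrite -(il_comm HI (il_ppp _) (F := fun bs g => Phi (a :: bs ++ E1 ++ g))); last first.
  apply: (nnmeas_comp _ mP); apply: measurable_fun_cons; first exact: measurable_cst.
  apply: measurable_fun_cat; first exact: measurable_fst.
  by apply: measurable_fun_cat; [exact: measurable_cst|exact: measurable_snd].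
rewrite [leRHS](_ : _ = iterL (ilaw (shell x U)) j
    (fun bs => ppp (map fst N1 ++ U') (fun g => Phi (a :: E1 ++ bs ++ g)))); last first.
  congr iterL; apply/funext => bs; congr ppp; apply/funext => g; apply: pP.
  by rewrite perm_cons perm_catCA.
apply: (IH (A1 ++ flist c ++ W) (map fst N1 ++ U') (fun s => Phi (a :: E1 ++ s))) => //.
- by rewrite !mem_cat xW !orbT.
- by move=> z /UW zW; rewrite !mem_cat zW !orbT.
- move=> z; rewrite !mem_cat => /orP[/N1A|/U'W ->]; last by rewrite !orbT.
  by rewrite mem_cat orbA orbC => /orP[] ->; rewrite ?orbT.
- rewrite !size_cat sc; apply: leq_trans sW; rewrite mulSn.
  rewrite [leqRHS]addnA leq_add2r addnA addnC leq_add2l addnC leq_add2l.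
  by rewrite sc in sA.
- exact: (nnmeas_comp (measurable_pairl (psi, ms)) mF3).
move=> E2 N2 A2 M e2.
have -> : (fun g => Phi (a :: E1 ++ E2 ++ g)) = (fun g => Phi ((a :: E1 ++ E2) ++ g)).
  by apply/funext => g; rewrite /= catA.
rewrite (eq_ppp (U' := map fst (N1 ++ N2) ++ U')).
  apply: (h _ _ (flist c ++ A1 ++ A2)).
  by econstructor; [exact: Uc|exact: cW|exact: e1|exact: e2].
by move=> z; rewrite map_cat !mem_cat orbCA orbA.
Qed.

(** By induction on the depth. The constraints at [x] are peeled off; their number is compared with
    the truncated Poisson law by [R1], and [claim_branch] treats each number [j] below [D]. Terms
    with [j >= D] are bounded below by 0. *)
Lemma claimP l : claim l.
Proof.
elim: l => [|l IH] x W U Phi phi xW xU UW sW mP pP mphi h.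
  by apply: (h [::] [::] [::] (ind_msg _)); constructor.
rewrite (ppp_peel x U)// /= /expL -nneseriesZl; last first.
  move=> j _; apply: mule_ge0; rewrite ?lee_fin ?fact_ge0//.
  apply: (il_ge0 (il_iter (il_ilaw _) j)).
  exact: (il_meas (il_ppp _) (nnmeas_cat2 mP)).
have b0 j := il_ge0 (il_branch P kappa_ge0 (HT l) j (sigma x)) mphi.
apply: lee_nneseries => j _; first by rewrite mule_ge0 ?lee_fin.
have i0 : 0 <= iterL (ilaw (shell x U)) j (fun bs => ppp (x :: U) (fun g => Phi (bs ++ g))).
  apply: (il_ge0 (il_iter (il_ilaw _) j)).
  exact: (il_meas (il_ppp _) (nnmeas_cat2 mP)).
rewrite /w; case: ifPn => [jD|_]; last first.
  by rewrite mul0e !mule_ge0 ?lee_fin ?expR_ge0 ?fact_ge0.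
have C := claim_branch IH xU (j := j) (W := W) (U' := x :: U) (Phi := Phi) (F := phi) xW UW.
have {C} : ((theta * d) ^+ j)%:E * branch P kappa (T l) j (sigma x) phi <=
    iterL (ilaw (shell x U)) j (fun bs => ppp (x :: U) (fun g => Phi (bs ++ g))).
  apply: C => //.
  - by move=> z; rewrite inE => /orP[/eqP->//|/UW].
  - apply: leq_trans sW; rewrite leq_add2l /=.
    by rewrite leq_mul2r ltnW ?orbT.
  move=> E N A M e.
  rewrite (eq_ppp (U' := map fst ((x, l.+1) :: N) ++ U)); first by apply: (h E ((x, l.+1) :: N) A M); exact: (explS (dg := dg) jD e).
  by move=> z; rewrite /= !(inE, mem_cat) orbCA.
move=> C; rewrite (_ : (theta ^+ j.+1 * poisson_pmf d j)%:E =
    (theta * expR (- d))%:E * ((j`!%:R^-1)%:E * ((theta * d) ^+ j)%:E)); last first.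
  rewrite -!EFinM /poisson_pmf d_gt0 exprMn exprS; congr (_%:E).
  by move: (theta ^+ j)%R (d ^+ j)%R (expR _) (j`!%:R^-1)%R => *; ring.
rewrite -!muleA; apply: lee_pmul; rewrite ?lee_fin ?mulr_ge0 ?expR_ge0//.
- by rewrite !mule_ge0 ?lee_fin ?exprn_ge0 ?mulr_ge0 ?(ltW d_gt0) ?fact_ge0.
- apply: le_trans (R1 x) _; rewrite ler_expR lerN2; apply: imass_le.
  by move=> y /andP[].
by apply: lee_wpmul2l => //; rewrite lee_fin fact_ge0.
Qed.

End claim.
End graph_poisson.

(** * The local limit of the graph *)

Section list_graphs.
Variables (R : realType) (Omega : finPointedType) (K n : nat).
Notation weight := (weight R Omega K.+1).
Notation V := 'I_n.+1.
Notation nbh := {ffun 'I_K.+1 -> 'I_n.+1}.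
Notation con := (nbh * weight)%type.
Implicit Types (g : seq con) (ns : seq nbh) (sigma tau : {ffun V -> Omega}).

Lemma presents_list g : @presents R Omega K (list_graph g) g.
Proof.
split=> [tau|x y].
  by rewrite /gibbs_weight /wprod [RHS]big_tnth; apply: eq_bigr => a _.
apply/hasP/existsP => [[a]|[a h]].
  rewrite -[g in map _ g]/(tval (in_tuple g)) => /mapP[b /tnthP[i ->] ->] h.
  by exists i.
exists (tnth (in_tuple g) a).1 => //.
by apply: map_f; exact: mem_tnth.
Qed.

Definition gcond l (y : V) s sigma g : R := @gibbs_cond R Omega K.+1 (list_graph g) l y s sigma.

Definition far ns l (y : V) sigma tau :=
  [forall z, ~~ inball ns l y z ==> (tau z == sigma z)].

Lemma gcondE l y s sigma g : gcond l y s sigma g =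
  (\sum_(tau | far (map fst g) l y sigma tau && (tau y == s)) wprod g tau) /
  (\sum_(tau | far (map fst g) l y sigma tau) wprod g tau).
Proof. exact: (gibbs_condE (presents_list g)). Qed.

Lemma gcond01 l y s sigma g : 0 <= gcond l y s sigma g <= 1.
Proof. exact: gibbs_cond01. Qed.

Lemma eq_inball ns ns' l (y z : V) : ns =i ns' -> inball ns l y z = inball ns' l y z.
Proof.
move=> e; elim: l y => //= l IH y; congr (_ || _); apply: eq_existsb => z'.
by rewrite IH /step (eq_has_r e).
Qed.

Lemma eq_far ns ns' l y sigma tau : ns =i ns' -> far ns l y sigma tau = far ns' l y sigma tau.
Proof. by move=> e; apply: eq_forallb => z; rewrite (eq_inball l y z e). Qed.

Lemma perm_wprod g g' tau : perm_eq g g' -> wprod g tau = wprod g' tau.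
Proof. by move=> e; exact: perm_big. Qed.

Lemma perm_gcond l y s sigma g g' : perm_eq g g' -> gcond l y s sigma g = gcond l y s sigma g'.
Proof.
move=> e; have e1 : map fst g =i map fst g' by exact/perm_mem/perm_map.
rewrite !gcondE; congr (_ / _); apply: eq_big => tau; rewrite ?(eq_far l y _ _ e1)//;
  by move=> _; exact: perm_wprod.
Qed.

Lemma measurable_nbh (u : nbh) : measurable [set a : con | a.1 = u].
Proof.
have : measurable_fun setT (fst : con -> nbh) by exact: measurable_fst.
by move=> /(_ measurableT [set u]); rewrite setTI; apply.
Qed.

Lemma measurable_map_fst (phi : seq nbh -> R) :
  measurable_fun setT (fun g : seq con => phi (map fst g)).
Proof.
exact: (@measurable_seq_discrete _ con _ R {ffun 'I_K.+1 -> 'I_n.+1} fst phi measurable_nbh).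
Qed.

Lemma measurable_wprod tau : measurable_fun setT (fun g => wprod g tau : R).
Proof.
apply: measurable_seq_prod.
apply: (measurable_finprod (f := fun a : con => a.2 (local_spins tau a.1))) => [||u].
- exact: finite_finset.
- by [].
exact: (@measurable_weight_eval R Omega K.+1 (local_spins tau u)).
Qed.

Lemma measurable_sum_wprod (Q : seq nbh -> pred {ffun V -> Omega}) (c : {ffun V -> Omega} -> R) :
  measurable_fun setT (fun g => \sum_(tau | Q (map fst g) tau) c tau ^+ size g * wprod g tau : R).
Proof.
rewrite (_ : (fun g => _) = fun g => \sum_tau ((Q (map fst g) tau)%:R * c tau ^+ size (map fst g))
    * wprod g tau); last first.
  apply/funext => g; rewrite big_mkcond; apply: eq_bigr => tau _; rewrite size_map.
  by case: (Q _ _); rewrite ?mul1r ?mul0r.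
apply: measurable_sum => tau; apply: measurable_funM; last exact: measurable_wprod.
exact: (measurable_map_fst (fun ns => (Q ns tau)%:R * c tau ^+ size ns)).
Qed.

Lemma measurable_gcond l y s sigma : measurable_fun setT (gcond l y s sigma).
Proof.
rewrite (_ : gcond l y s sigma = fun g =>
  (\sum_(tau | far (map fst g) l y sigma tau && (tau y == s)) 1 ^+ size g * wprod g tau) *
  (GRing.inv \o (fun g => \sum_(tau | far (map fst g) l y sigma tau) 1 ^+ size g * wprod g tau)) g).
  apply: measurable_funM.
    exact: (measurable_sum_wprod (fun ns tau => far ns l y sigma tau && (tau y == s)) (cst 1)).
  apply: measurableT_comp; first exact: measurable_invr.
  exact: (measurable_sum_wprod (fun ns tau => far ns l y sigma tau) (cst 1)).
apply/funext => g; rewrite gcondE /=; congr (_ / _); apply: eq_bigr => tau _;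
  by rewrite expr1n mul1r.
Qed.

Definition nset (y : nbh) := [set y i | i : 'I_K.+1]%SET.

Definition simpl ns := all (fun y : nbh => injectiveb y) ns && uniq (map nset ns).

Lemma simple_eventP sigma g : simple_event (sigma, g) <-> simpl (map fst g).
Proof.
rewrite /simple_event /= /fg_simple /simpl -map_comp; split=> [[h1 h2]|/andP[/allP h1 h2]].
  apply/andP; split.
    apply/allP => y; rewrite -[g in map _ g]/(tval (in_tuple g)) => /mapP[b /tnthP[i ->] ->].
    by apply/injectiveP; exact: h1.
  rewrite -[g]/(tval (in_tuple g)); apply/(uniqP (finset.set0 : {set V})) => i j.
  rewrite !inE size_map => ig jg.
  rewrite !(nth_map (tnth (in_tuple g) (Ordinal ig)))//.
  rewrite -!(tnth_nth _ _ (Ordinal ig)) -!(tnth_nth _ _ (Ordinal jg)) => e.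
  by apply/eqP/negP => /negP ij; have /negP := h2 (Ordinal ig) (Ordinal jg) ij; apply; apply/eqP.
split=> [a|a b ab]; first by apply/injectiveP/h1/map_f; exact: mem_tnth.
apply/negP => /eqP e; move/negP: ab; apply; apply/eqP/val_inj.
have sz (i : 'I_(size g)) : (i < size (map (nset \o fst) g))%N by rewrite size_map.
apply: (uniqP (finset.set0 : {set V}) h2); rewrite ?inE ?sz//.
rewrite (nth_map (tnth (in_tuple g) a)); last exact: (ltn_ord a).
rewrite (nth_map (tnth (in_tuple g) a)); last exact: (ltn_ord b).
by rewrite -!(tnth_nth (tnth (in_tuple g) a) (in_tuple g)).
Qed.

Lemma perm_simpl ns ns' : perm_eq ns ns' -> simpl ns = simpl ns'.
Proof. by move=> e; rewrite /simpl (perm_all _ e) (perm_uniq (perm_map nset e)). Qed.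

Lemma simpl_cat ns ns' : simpl (ns ++ ns') =
  [&& simpl ns, simpl ns' & ~~ has [in map nset ns] (map nset ns')].
Proof.
rewrite /simpl all_cat map_cat cat_uniq -!andbA; do !bool_congr.
Qed.

Lemma simpl_catE ns ns' : (forall a b, a \in ns -> b \in ns' -> nset a != nset b) ->
  simpl (ns ++ ns') = simpl ns && simpl ns'.
Proof.
move=> h; rewrite simpl_cat (_ : ~~ has _ _) ?andbT//.
apply/hasPn => _ /mapP[b bn ->]; apply/negP => /mapP[a an] e.
by have := h a b an bn; rewrite e eqxx.
Qed.

Lemma nset_neq (a b : nbh) z : touch a z -> ~~ touch b z -> nset a != nset b.
Proof.
move=> /existsP[i /eqP az] bz; apply/negP => /eqP e; move/negP: bz; apply.
have : z \in nset a by apply/imsetP; exists i.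
by rewrite e => /imsetP[j _ ->]; apply/existsP; exists j.
Qed.

Lemma touch_ord0 (a : nbh) : touch a (a ord0).
Proof. by apply/existsP; exists ord0. Qed.

Section exploration_simple.
Variables (dg : pred nat) (sigma : {ffun V -> Omega}).
Hypothesis K_gt0 : (0 < K)%N.

Let sep (S S' : seq V) (E E' : seq con) : inside S E -> inside S' E' ->
  (forall z, z \in S -> z \notin S') ->
  forall a b, a \in map fst E -> b \in map fst E' -> nset a != nset b.
Proof.
move=> iE iE' d a b /mapP[u uE ->] /mapP[v vE' ->].
apply: (nset_neq (touch_ord0 _)); apply/negP => /(iE' _ vE').
by apply/negP/d/(iE _ uE)/touch_ord0.
Qed.

Lemma con_at_inj p (x : V) c (psi : weight) : uniq (flist c) -> x \notin flist c ->
  injectiveb (con_at p x c psi).1.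
Proof.
move=> Uc xc; apply/injectiveP => i j; rewrite !ffunE => e.
apply: (@perm_inj _ (tperm ord0 p)); move: e.
case: unliftP => [i'|] ->; case: unliftP => [j'|] -> //= e.
- congr lift; move: Uc; rewrite /flist => /injectiveP; exact.
- by case/negP: xc; apply/mem_flist; exists i'.
- by case/negP: xc; apply/mem_flist; exists j'.
Qed.

(** Each new constraint has distinct neighbours and contains a vertex that the others do not touch.
    The second part of each statement serves later: a constraint that avoids [N] cannot repeat the
    neighbour set of an explored one. *)
Lemma expl_simpl :
  (forall l (x : V) W E N A (m : msg R Omega), expl dg sigma l x W E N A m -> x \in W ->
    simpl (map fst E) /\ forall a, a \in map fst E -> exists2 z, touch a z & z \in map fst N) /\
  (forall l j (x : V) W E N A (m : msg R Omega), explb dg sigma l j x W E N A m -> x \in W ->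
    simpl (map fst E) /\ forall a, a \in map fst E -> exists2 z, touch a z & z \in x :: map fst N) /\
  (forall l (xs : seq V) W E N A (ms : seq (msg R Omega)), expls dg sigma l xs W E N A ms -> uniq xs ->
    {subset xs <= W} ->
    simpl (map fst E) /\ forall a, a \in map fst E -> exists2 z, touch a z & z \in map fst N).
Proof.
apply: expl_ind3 => [//|l j x W E N A M jD H IH xW|//|
  l j x W p c psi E1 N1 A1 ms E2 N2 A2 M Uc cW H1 IH1 H2 IH2 xW|//|
  l x xs W E1 N1 A1 m E2 N2 A2 ms H1 IH1 H2 IH2 /= /andP[xxs Uxs] xsW].
- exact: IH.
- have subW : {subset flist c <= flist c ++ W} by move=> z zc; rewrite mem_cat zc.
  have xW' : x \in A1 ++ flist c ++ W by rewrite !mem_cat xW !orbT.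
  have [s1 t1] := IH1 Uc subW; have [s2 t2] := IH2 xW'.
  have [[_ f1] i1 _ _ _] := expl_supp.2.2 _ _ _ _ _ _ _ H1 Uc subW.
  have [[_ f2] i2 _ _] := expl_supp.2.1 _ _ _ _ _ _ _ _ H2 xW'.
  have xc : x \notin flist c by apply/negP => /cW; rewrite xW.
  have xA1 : x \notin A1 by apply/negP => /f1; rewrite mem_cat xW orbT.
  have c0c : c (Ordinal K_gt0) \in flist c by apply/mem_flist; eexists.
  split; last first.
    move=> a; rewrite /= map_cat inE mem_cat => /orP[/eqP->|/orP[/t1[]|/t2[]]].
    + exists x; last by rewrite inE eqxx.
      by have := touch_con_at p x c psi x; rewrite eqxx.
    + by move=> z az zN; exists z; rewrite // inE map_cat mem_cat zN orbT.
    + by move=> z az; rewrite inE => zN; exists z; rewrite // inE map_cat mem_cat orbCA zN orbT.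
  rewrite map_cons map_cat -cat1s simpl_catE.
    rewrite simpl_catE ?s1 ?s2 ?andbT.
      by rewrite /simpl /= con_at_inj.
    apply: (sep i1 i2) => z; rewrite mem_cat inE negb_or => /orP[zc|zA].
      apply/andP; split; first by apply: contraNneq xc => <-.
      by apply/negP => /f2; rewrite !mem_cat zc orbT.
    apply/andP; split; first by apply: contraNneq xA1 => <-.
    by apply/negP => /f2; rewrite !mem_cat zA.
  move=> a b; rewrite inE => /eqP-> {a}; rewrite mem_cat => /orP[/mapP[u uE ->]|/mapP[u uE ->]].
    apply: (nset_neq (z := x)); first by rewrite touch_con_at eqxx.
    by apply/negP => /(i1 _ uE); rewrite mem_cat (negbTE xc) (negbTE xA1).
  (* Constraints of [E2] may contain [x] as well, so a child of the first constraint, which exists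
     as [K > 0], tells the neighbour sets apart. *)
  apply: (nset_neq (z := c (Ordinal K_gt0))); first by rewrite touch_con_at c0c orbT.
  apply/negP => /(i2 _ uE); rewrite inE => /orP[/eqP e|/f2]; first by rewrite -e c0c in xc.
  by rewrite !mem_cat c0c orbT.
- have xW : x \in W by apply: xsW; rewrite inE eqxx.
  have subW : {subset xs <= A1 ++ W} by move=> z zc; rewrite mem_cat xsW ?orbT// inE zc orbT.
  have [s1 t1] := IH1 xW; have [s2 t2] := IH2 Uxs subW.
  have [[_ f1] i1 _ _ _] := expl_supp.1 _ _ _ _ _ _ _ H1 xW.
  have [[_ f2] i2 _ _ _] := expl_supp.2.2 _ _ _ _ _ _ _ H2 Uxs subW.
  split; last first.
    move=> a; rewrite !map_cat mem_cat => /orP[/t1|/t2] [z az zN]; exists z => //;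
      by rewrite mem_cat zN ?orbT.
  rewrite map_cat simpl_catE ?s1//.
  apply: (sep i1 i2) => z; rewrite inE mem_cat negb_or => /orP[/eqP->|zA].
    by rewrite xxs /=; apply/negP => /f2; rewrite mem_cat xW orbT.
  apply/andP; split; last by apply/negP => /f2; rewrite mem_cat zA.
  apply/negP => zx; have := f1 _ zA.
  by rewrite xsW// inE zx orbT.
Qed.

Lemma simpl_expl l (y : V) E N A (m : msg R Omega) : expl dg sigma l y [:: y] E N A m ->
  forall g : seq con, all (fun a : con => avoid (map fst N) a.1) g ->
  simpl (map fst g) -> simpl (map fst (E ++ g)).
Proof.
move=> e g ag sg; have yy : y \in [:: y] by rewrite inE.
have [sE tE] := expl_simpl.1 _ _ _ _ _ _ _ e yy.
rewrite map_cat simpl_catE ?sE// => a b /tE[z az zN] /mapP[u ug ->].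
by apply: (nset_neq az); apply/negP => /(avoid_touch (allP ag _ ug)); rewrite zN.
Qed.

End exploration_simple.

Lemma simpl_sub ns ns' : simpl (ns ++ ns') -> simpl ns'.
Proof. by rewrite simpl_cat => /and3P[]. Qed.

End list_graphs.

(** * Two-sided comparison of graph and tree *)

Section local_limit.
Variables (R : realType) (Omega : finPointedType) (K n : nat).
Notation weight := (weight R Omega K.+1).
Notation V := 'I_n.+1.
Notation nbh := {ffun 'I_K.+1 -> 'I_n.+1}.
Notation con := (nbh * weight)%type.
Notation msg := (msg R Omega).
Notation q := (#|Omega|%:R : R).
Variables (P : probability weight R) (rho : R) (sigma : {ffun 'I_n.+1 -> Omega}).
Hypothesis rho_ge0 : (0 <= rho)%R.
Variables (kappa d theta : R) (D M0 : nat).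
Hypotheses (kappa_ge0 : (0 <= kappa)%R) (d_gt0 : (0 < d)%R) (theta_ge0 : (0 <= theta)%R).
Hypothesis theta_le1 : (theta <= 1)%R.
Hypothesis K_gt0 : (0 < K)%N.
Hypothesis normal : forall omega, (\sum_(tau : {ffun 'I_K -> Omega})
  \int[P]_psi (kappa * psi (fcons omega tau))%:E = 1)%E.
Hypothesis Pinv : forall (th : {perm 'I_K.+1}) (F : weight -> \bar R), nnmeas F ->
  nnmeas (fun psi => F (perm_weight th psi)) /\
  (\int[P]_psi F (perm_weight th psi) = \int[P]_psi F psi)%E.
Hypothesis R1 : forall x, (theta * expR (- d) <= expR (- imass P rho sigma (fun y => touch y x)))%R.
Hypothesis R2 : forall W, (size W <= M0)%N -> forall tau : {ffun 'I_K -> Omega},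
  (theta * d * kappa <= rho * K.+1%:R *
    #|[pred c | freshk W c && ([ffun i => sigma (c i)] == tau)]|%:R)%R.
Local Open Scope ereal_scope.

Definition trunc_pmf j : R := if (j < D)%N then (theta ^+ j.+1 * poisson_pmf d j)%R else 0%R.

Lemma trunc_pmf_ge0 j : (0 <= trunc_pmf j)%R.
Proof. by rewrite /trunc_pmf; case: ifP => // _; rewrite mulr_ge0 ?exprn_ge0 ?poisson_pmf_ge0. Qed.

Lemma trunc_pmf_le j : (trunc_pmf j <= poisson_pmf d j)%R.
Proof.
rewrite /trunc_pmf; case: ifP => _; last exact: poisson_pmf_ge0.
by rewrite -[leRHS]mul1r ler_wpM2r ?poisson_pmf_ge0// exprn_ile1.
Qed.

Lemma trunc_pmf_le1 : \sum_(j <oo) (trunc_pmf j)%:E <= 1.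
Proof.
rewrite -(poisson_pmf_sum1 d_gt0); apply: lee_nneseries => j _; rewrite lee_fin.
  by move=> _; exact: trunc_pmf_ge0.
exact: trunc_pmf_le.
Qed.

(** A graph property that is kept under deletion of constraints and under the addition of a
    tree-like exploration. It is meant for the trivial property and for simplicity; nearly
    independent of the neighbourhood of a vertex, it contributes the factor [psim]. *)
Variable S : seq nbh -> bool.
Hypothesis S_perm : forall ns ns', perm_eq ns ns' -> S ns = S ns'.
Hypothesis S_sub : forall ns ns', S (ns ++ ns') -> S ns'.
Hypothesis S_expl : forall dg l (y : V) E N A (m : msg), expl dg sigma l y [:: y] E N A m ->
  forall g, all (fun a : con => avoid (map fst N) a.1) g ->
  S (map fst g) -> S (map fst (E ++ g)).

Let oneS (g : seq con) : \bar R := ((S (map fst g))%:R)%:E.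

Lemma nnmeas_oneS : nnmeas oneS.
Proof.
split=> [|g]; last by rewrite lee_fin.
apply/measurable_EFinP.
exact: (measurable_map_fst (fun ns => (S ns)%:R)).
Qed.

Lemma perminv_oneS : perminv oneS.
Proof. by move=> g g' e; rewrite /oneS (S_perm (perm_map fst e)). Qed.

Definition psim : R := fine (ppp P rho sigma [::] oneS).

Lemma psimE : ppp P rho sigma [::] oneS = psim%:E.
Proof.
rewrite fineK// ge0_fin_numE; last exact: (il_ge0 (il_ppp P sigma rho_ge0 [::]) nnmeas_oneS).
apply: (@le_lt_trans _ _ (ppp P rho sigma [::] (cst 1))); last by rewrite (ppp1 _ _ rho_ge0) ltry.
apply: (il_le (il_ppp P sigma rho_ge0 [::])); [exact: nnmeas_oneS|exact: nnmeas_cst|].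
by move=> g; rewrite lee_fin lern1 leq_b1.
Qed.

Lemma psim_ge0 : (0 <= psim)%R.
Proof. by rewrite -lee_fin -psimE; exact: (il_ge0 (il_ppp P sigma rho_ge0 [::]) nnmeas_oneS). Qed.

Lemma psim_le1 : (psim <= 1)%R.
Proof.
rewrite -lee_fin -psimE -(ppp1 P sigma rho_ge0 [::]).
apply: (il_le (il_ppp P sigma rho_ge0 [::])); [exact: nnmeas_oneS|exact: nnmeas_cst|].
by move=> g; rewrite lee_fin lern1 leq_b1.
Qed.

Variables (l : nat) (y : V) (s : Omega).
Hypothesis M0_big : (1 + ball_bound K D l <= M0)%N.

(** The exploration claim for [psim * f]. After an exploration, the remaining constraints satisfy
    [S] with probability at least [psim] by [ppp_mono], then [S_expl] gives [S] for the whole graph,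
    and the Gibbs probability is a function of the message. *)
Lemma local_lower (f : msg -> R) (h : R -> R) :
  measurable_fun setT f -> measurable_fun setT h -> (forall m, 0 <= f m)%R ->
  (forall r, 0 <= r <= 1 -> 0 <= h r)%R ->
  (forall (g : seq con) (m : msg), gcond l y s sigma g = (mval m s / \sum_s' mval m s')%R ->
     f m = h (gcond l y s sigma g)) ->
  psim%:E * bcast P kappa trunc_pmf l (sigma y) (fun m => (f m)%:E) <=
  ppp P rho sigma [::] (fun g => (h (gcond l y s sigma g))%:E * oneS g).
Proof.
move=> mf mh f0 h0 fh.
have Hp U := il_ppp P sigma rho_ge0 U.
have mf0 : nnmeas (fun m => (f m)%:E).
  by split=> [|m]; [exact/measurable_EFinP|rewrite lee_fin].
have mhg : nnmeas (fun g => (h (gcond l y s sigma g))%:E * oneS g).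
  apply: nnmeasM; last exact: nnmeas_oneS.
  split=> [|g]; last by rewrite lee_fin h0// gcond01.
  by apply/measurable_EFinP; apply: measurableT_comp => //; exact: measurable_gcond.
have c0 : 0 <= psim%:E by rewrite lee_fin psim_ge0.
rewrite -(ilZ (il_bcast kappa_ge0 normal trunc_pmf_ge0 trunc_pmf_le1 l (sigma y)) c0 mf0).
apply: (claimP (M0 := M0) (W := [:: y]) rho_ge0 kappa_ge0 d_gt0 theta_ge0 theta_le1 normal Pinv R1 R2) => //.
- by rewrite inE.
- move=> g g' e; congr (_ * _); last exact: perminv_oneS.
  by rewrite (perm_gcond _ _ _ _ e).
- exact: nnmeasZ.
move=> E N A m e; rewrite cats0.
apply: (@le_trans _ _ (ppp P rho sigma (map fst N) (fun g => (f m)%:E * oneS g))).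
  rewrite (ilZ (Hp _)) ?lee_fin//; last exact: nnmeas_oneS.
  rewrite muleC; apply: lee_wpmul2l; rewrite ?lee_fin// -psimE.
  apply: (@ppp_mono _ _ _ _ P rho sigma rho_ge0 (map fst N) oneS nnmeas_oneS perminv_oneS).
  move=> t g; rewrite lee_fin ler_nat /oneS map_cat.
  by case: (boolP (S (_ ++ _))) => // /S_sub ->.
apply: (@ppp_le_on _ _ _ _ P rho sigma rho_ge0).
- by apply: nnmeasZ; rewrite ?lee_fin//; exact: nnmeas_oneS.
- exact: (nnmeas_cat E mhg).
move=> g ag; rewrite /oneS; case: (boolP (S (map fst g))) => Sg; last first.
  rewrite mule0 mule_ge0// lee_fin// h0// gcond01//.
rewrite (S_expl e)// !mule1 lee_fin (fh (E ++ g) m)//.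
apply: (@expl_gibbs_cond R Omega K _ (list_graph (E ++ g)) sigma (E ++ g) g l y E N A m s) => //.
- exact: presents_list.
- exact: e.
by move=> a z /(allP ag) av; exact: avoid_touch.
Qed.

Let B := fine (bcast P kappa (poisson_pmf d) l (sigma y) (fun m => (bias s m)%:E)).

(** The lower bounds for [f] and for [1 - f] add up to [psim] up to the missing mass, so both are
    nearly equalities. Passing from the truncated tree to the full one costs the missing mass once
    more. *)
Lemma local_approx : exists2 A : R,
  ppp P rho sigma [::] (fun g => `|gcond l y s sigma g - q^-1|%:E * oneS g) = A%:E &
  (`|A - psim * B| <= 2 * (1 - bmass K trunc_pmf l))%R.
Proof.
have Hp := il_ppp P sigma rho_ge0 [::].
have w0 := trunc_pmf_ge0; have w1 := trunc_pmf_le1.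
have ww' j : (0 <= trunc_pmf j <= poisson_pmf d j)%R by rewrite w0 trunc_pmf_le.
have p1 : \sum_(j <oo) (poisson_pmf d j)%:E <= 1 by rewrite (poisson_pmf_sum1 d_gt0).
have p0 j : (0 <= poisson_pmf d j)%R by exact: poisson_pmf_ge0.
have mb := measurable_bias (R := R) s.
have mb0 : nnmeas (fun m : msg => (bias s m)%:E).
  by split=> [|m]; [exact/measurable_EFinP|rewrite lee_fin; case/andP: (bias01 s m)].
have mb1 : nnmeas (fun m : msg => (1 - bias s m)%:E).
  split=> [|m]; last by rewrite lee_fin subr_ge0; case/andP: (bias01 s m).
  by apply/measurable_EFinP; exact: measurable_funB.
have mh : measurable_fun setT (fun r : R => `|r - q^-1|%R).
  by apply: measurableT_comp => //; exact: measurable_funB.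
have mh1 : measurable_fun setT (fun r : R => (1 - `|r - q^-1|)%R) by exact: measurable_funB.
have h1 (r : R) : (0 <= r <= 1 -> `|r - q^-1| <= 1)%R.
  move=> /andP[r0 r1]; have qi0 : (0 <= q^-1 :> R)%R by rewrite invr_ge0.
  have qi1 : (q^-1 <= 1 :> R)%R by rewrite invf_le1 ?(lt_le_trans ltr01 (q_ge1 _ _))// q_ge1.
  by rewrite ler_norml; apply/andP; split; lra.
have bh (g : seq con) m : gcond l y s sigma g = (mval m s / \sum_s' mval m s')%R ->
    bias s m = `|gcond l y s sigma g - q^-1|%R.
  exact: bias_gibbs_cond.
have L1 := @local_lower (bias s) (fun r => `|r - q^-1|%R) mb mh
  (fun m => (andP (bias01 s m)).1) (fun r _ => normr_ge0 _) bh.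
have L2 := @local_lower (fun m => 1 - bias s m)%R (fun r => 1 - `|r - q^-1|)%R (measurable_funB (measurable_cst _) mb) mh1.
have {}L2 : psim%:E * bcast P kappa trunc_pmf l (sigma y) (fun m => (1 - bias s m)%:E) <=
    ppp P rho sigma [::] (fun g => (1 - `|gcond l y s sigma g - q^-1|)%:E * oneS g).
  apply: L2 => [m|r r01|g m e]; [by rewrite subr_ge0; case/andP: (bias01 s m)| |by rewrite (bh g m e)].
  by rewrite subr_ge0 h1.
have m1 : nnmeas (fun g => `|gcond l y s sigma g - q^-1|%:E * oneS g).
  apply: nnmeasM; last exact: nnmeas_oneS.
  split=> [|g]; last by rewrite lee_fin.
  by apply/measurable_EFinP; apply: (measurableT_comp mh); exact: measurable_gcond.
have m2 : nnmeas (fun g => (1 - `|gcond l y s sigma g - q^-1|)%:E * oneS g).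
  apply: nnmeasM; last exact: nnmeas_oneS.
  split=> [|g]; last by rewrite lee_fin subr_ge0 h1// gcond01.
  by apply/measurable_EFinP; apply: (measurableT_comp mh1); exact: measurable_gcond.
have S12 : ppp P rho sigma [::] (fun g => `|gcond l y s sigma g - q^-1|%:E * oneS g) +
    ppp P rho sigma [::] (fun g => (1 - `|gcond l y s sigma g - q^-1|)%:E * oneS g) = psim%:E.
  rewrite -(ilD Hp)// -psimE; congr ppp; apply/funext => g.
  rewrite /oneS -!EFinM -EFinD; congr (_%:E); ring.
have c0 := psim_ge0; have c1 := psim_le1.
have p2 := il_ge0 Hp m1; have p3 := il_ge0 Hp m2.
have bc := bcast_compl kappa_ge0 normal w0 w1 l (sigma y) mb (bias01 s).
have bl := bcast_le kappa_ge0 normal l (sigma y) ww' p1 mb0.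
have ba := bcast_approx kappa_ge0 normal l (sigma y) ww' p1 mb (bias01 s).
have b0 := il_ge0 (il_bcast kappa_ge0 normal w0 w1 l (sigma y)) mb0.
have b1 := il_ge0 (il_bcast kappa_ge0 normal w0 w1 l (sigma y)) mb1.
have /andP[bm0 bm1] := bmass01 kappa_ge0 normal w0 w1 l.
move: S12 L1 L2 p2 p3; move: (ppp P rho sigma [::] (fun g => `|_|%:E * _)) => A.
move: (ppp P rho sigma [::] (fun g => (1 - _)%:E * _)) => A'.
case: A A' => [A| |] [A'| |] // [S12] L1 L2 _ _.
exists A => //; rewrite /B; move: L1 L2 bc bl ba b0 b1.
move: (bcast P kappa trunc_pmf l (sigma y) (fun m => (bias s m)%:E)) => X.
move: (bcast P kappa trunc_pmf l (sigma y) (fun m => (1 - bias s m)%:E)) => Z.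
move: (bcast P kappa (poisson_pmf d) l (sigma y) (fun m => (bias s m)%:E)) => U.
case: X Z U => [x| |] [z| |] [u| |] //.
rewrite -!EFinM !lee_fin => L1 L2 [bc] bl ba b0 b1 /=.
move: psim (bmass _ _ _) S12 L1 L2 bc bl ba b0 b1 c0 c1 bm0 bm1 => c b S12 L1 L2 bc bl ba b0 b1 c0 c1 bm0 bm1.
have e1 : (c * (1 - b) <= 1 - b)%R by rewrite -[leRHS]mul1r ler_wpM2r// subr_ge0.
have e2 : (c * x <= c * u)%R by rewrite ler_wpM2l.
have e3 : (c * u <= c * (x + (1 - b)))%R by rewrite ler_wpM2l.
rewrite mulrDr in e3.
have e4 : (c * z = c * b - c * x)%R by rewrite -bc; ring.
have e5 : (c * (1 - b) = c - c * b)%R by ring.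
by rewrite ler_norml; apply/andP; split; lra.
Qed.

End local_limit.

(** * The teacher-student law *)

Section teacher_integral.
Variables (R : realType) (Omega : finPointedType) (K n : nat).
Notation weight := (weight R Omega K.+1).
Notation nbh := {ffun 'I_K.+1 -> 'I_n.+1}.
Notation con := (nbh * weight)%type.
Variables (P : probability weight R) (d : R).
Hypothesis d_gt0 : (0 < d)%R.
Implicit Types sigma : {ffun 'I_n.+1 -> Omega}.
Local Open Scope ereal_scope.

Definition cmass sigma : R := fine (constraint_mass P sigma setT).

Definition rate : R := (d * n.+1%:R / K.+1%:R)%R.

Definition rhos sigma : R := (rate / cmass sigma)%R.

Lemma rate_gt0 : (0 < rate)%R. Proof. by rewrite divr_gt0// mulr_gt0. Qed.

Let mweight (tau : {ffun 'I_K.+1 -> Omega}) : nnmeas (fun psi : weight => (psi tau)%:E).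
Proof.
split=> [|psi]; last by rewrite lee_fin ltW// weight_gt0.
by apply/measurable_EFinP; exact: measurable_weight_eval.
Qed.

Definition pmean (tau : {ffun 'I_K.+1 -> Omega}) : R := fine (\int[P]_psi (psi tau)%:E).

Lemma pmeanE tau : \int[P]_psi (psi tau)%:E = (pmean tau)%:E.
Proof.
rewrite fineK// ge0_fin_numE; last exact: (il_ge0 (il_prob P) (mweight tau)).
apply: (@le_lt_trans _ _ (\int[P]_psi cst 2%:E psi)).
  apply: (il_le (il_prob P)) => //; first exact: nnmeas_cst.
  by move=> psi; rewrite lee_fin ltW// weight_lt2.
by rewrite (integral_cst P)// [X in _ * X](probability_setT P) mule1 ltry.
Qed.

Lemma pmean_ge0 tau : (0 <= pmean tau)%R.
Proof. by rewrite -lee_fin -pmeanE; exact: (il_ge0 (il_prob P) (mweight tau)). Qed.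

Lemma pmean_le2 tau : (pmean tau <= 2)%R.
Proof.
rewrite -lee_fin -pmeanE (_ : 2%:E = \int[P]_psi cst 2%:E psi); last first.
  by rewrite (integral_cst P)// [X in _ * X](probability_setT P) mule1.
apply: (il_le (il_prob P)) => //; first exact: nnmeas_cst.
by move=> psi; rewrite lee_fin ltW// weight_lt2.
Qed.

Lemma cmassE sigma : cmass sigma = (\sum_(y : nbh) pmean (local_spins sigma y))%R.
Proof.
rewrite /cmass /constraint_mass (eq_bigr (fun y => (pmean (local_spins sigma y))%:E)).
  by rewrite sumEFin.
by move=> y _; rewrite -pmeanE; congr integral.
Qed.

Lemma cmass_gt0 sigma : (0 < cmass sigma)%R.
Proof.
rewrite lt_neqAle cmassE sumr_ge0 ?andbT; last by move=> y _; exact: pmean_ge0.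
rewrite -cmassE eq_sym; apply/negP => /eqP c0.
have := probability_setT (constraint_law P sigma : probability _ R).
by rewrite /= /constraint_law -/(cmass sigma) c0 invr0 mul0e => /esym/eqP; rewrite onee_eq0.
Qed.

Lemma rhos_ge0 sigma : (0 <= rhos sigma)%R.
Proof. by rewrite divr_ge0// ltW// ?rate_gt0// cmass_gt0. Qed.

Lemma integral_constraint_law sigma (h : con -> \bar R) : nnmeas h ->
  \int[constraint_law P sigma]_a h a =
  (rate^-1)%:E * ilaw P (rhos sigma) sigma (avoid [::]) h.
Proof.
apply: (is_integral_eq (L := fun h => \int[constraint_law P sigma]_a h a)
  (L' := fun h => (rate^-1)%:E * ilaw P (rhos sigma) sigma (avoid [::]) h)).
- exact: (il_prob (constraint_law P sigma : probability _ R)).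
- apply: il_scale; last by rewrite invr_ge0 ltW// rate_gt0.
  by apply: il_ilaw; exact: rhos_ge0.
move=> B mB.
pose f (y : nbh) (psi : weight) : \bar R := (psi (local_spins sigma y))%:E.
have fE y : f y \_ [set psi | B (y, psi)] =
    fun psi : weight => f y psi * (\1_[set psi | B (y, psi)] psi)%:E.
  apply/funext => psi; rewrite patchE indicE.
  case: (pselect (B (y, psi))) => Bp; first by rewrite !mem_set// mule1.
  by rewrite !memNset// !mule0.
have mf y : nnmeas (f y \_ [set psi | B (y, psi)]).
  rewrite fE; apply: nnmeasM; first exact: mweight.
  split=> [|psi]; last by rewrite lee_fin.
  apply/measurable_EFinP; apply: measurable_indic.
  by rewrite -[X in measurable X]setTI; exact: (measurable_pairl (A := weight) y measurableT mB).
rewrite (integral_indic (constraint_law P sigma : probability _ R))// setIT.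
transitivity (((cmass sigma)^-1)%:E * constraint_mass P sigma B) => //.
rewrite /ilaw (eq_bigl xpredT); last by move=> y; apply/forallP.
rewrite (eq_bigr (fun y : nbh => (rhos sigma)%:E * \int[P]_psi (f y \_ [set psi | B (y, psi)]) psi)).
  rewrite -ge0_sume_distrr; last by move=> y _; exact: (il_ge0 (il_prob P) (mf y)).
  rewrite muleA -EFinM /rhos mulrA mulVf ?mul1r ?gt_eqF ?rate_gt0//; congr (_ * _).
  apply: eq_bigr => y _; exact: (@integral_mkcond _ _ _ (P : {measure set _ -> \bar R}) [set psi | B (y, psi)] (f y)).
move=> y _; rewrite -(ilZ (il_prob P)) ?lee_fin ?rhos_ge0//.
congr integral; apply/funext => psi; by rewrite fE muleA EFinM; congr (_ * _).
Qed.

Lemma integral_iid_law sigma j (F : seq con -> \bar R) : nnmeas F ->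
  \int[iid (constraint_law P sigma) j]_t F (tval t) =
  (rate ^- j)%:E * iterL (ilaw P (rhos sigma) sigma (avoid [::])) j F.
Proof.
elim: j F => [|j IH] F mF.
  rewrite (integral_iid0 _ (F := fun t => F (tval t))); first by rewrite expr0 invr1 mul1e.
  exact: (nnmeas_comp (@measurable_tuple_seq _ con 0) mF).
rewrite (integral_iidS _ (F := fun t => F (tval t))); last first.
  exact: (nnmeas_comp (@measurable_tuple_seq _ con j.+1) mF).
have HI := il_iter (il_ilaw P sigma (rhos_ge0 sigma) (avoid [::])) j.
have mc := nnmeas_cons2 mF.
transitivity (\int[constraint_law P sigma]_a ((rate ^- j)%:E *
    iterL (ilaw P (rhos sigma) sigma (avoid [::])) j (fun g => F (a :: g)))).
  congr integral; apply/funext => a.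
  by rewrite -IH//; exact: (nnmeas_comp (measurable_pairl a) mc).
have r0 : (0 <= rate ^- j)%R by rewrite invr_ge0 exprn_ge0// ltW// rate_gt0.
have mi := il_meas HI mc.
rewrite integral_constraint_law; last by apply: nnmeasZ; rewrite ?lee_fin.
rewrite (ilZ (il_ilaw P sigma (rhos_ge0 sigma) _)) ?lee_fin//.
by rewrite [iterL _ j.+1 _]/= muleA -EFinM -invfM -exprS.
Qed.

Lemma imass_total sigma : imass P (rhos sigma) sigma (avoid [::]) = rate.
Proof.
apply: EFin_inj; rewrite -(ilaw1 _ _ (rhos_ge0 sigma)).
have := integral_constraint_law sigma (nnmeas_cst _ (lee01 : 0 <= 1 :> \bar R)).
rewrite integral_cst// mul1e [X in X = _](probability_setT (constraint_law P sigma : probability _ R)).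
move=> /(congr1 (fun x => rate%:E * x)); rewrite mule1 muleA -EFinM divff ?mul1e//.
by rewrite gt_eqF// rate_gt0.
Qed.

Lemma integral_poisson_law sigma (F : seq con -> \bar R) : nnmeas F ->
  \int[poisson_iid (d * n.+1%:R / K.+1%:R) (constraint_law P sigma)]_g F g =
  ppp P (rhos sigma) sigma [::] F.
Proof.
move=> mF; rewrite (integral_poisson_iid _ rate_gt0 mF) /ppp /expL imass_total.
rewrite -nneseriesZl; last first.
  move=> j _; rewrite mule_ge0 ?lee_fin ?fact_ge0//.
  by apply: (il_ge0 (il_iter (il_ilaw P sigma (rhos_ge0 sigma) _) j)).
apply: eq_eseriesr => j _; rewrite integral_iid_law// !muleA -!EFinM; congr (_%:E * _).
rewrite /poisson_pmf rate_gt0.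
have r0 : (rate ^+ j != 0)%R by rewrite expf_neq0// gt_eqF// rate_gt0.
by field; rewrite r0 pnatr_eq0 -lt0n fact_gt0.
Qed.

Lemma teacher_integral (F : {ffun 'I_n.+1 -> Omega} * seq con -> \bar R) : nnmeas F ->
  \int[teacher_law P d n]_x F x = (#|{ffun 'I_n.+1 -> Omega}|%:R^-1)%:E *
   \sum_sigma ppp P (rhos sigma) sigma [::] (fun g => F (sigma, g)).
Proof.
move=> mF; have c0 : (0 <= #|{ffun 'I_n.+1 -> Omega}|%:R^-1 :> R)%R by rewrite invr_ge0.
have ms sigma : nnmeas (fun g : seq con => F (sigma, g)).
  exact: (nnmeas_comp (measurable_pairl sigma) mF).
rewrite ge0_sume_distrr; last first.
  by move=> sigma _; exact: (il_ge0 (il_ppp P sigma (rhos_ge0 sigma) _) (ms sigma)).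
transitivity (\sum_sigma (#|{ffun 'I_n.+1 -> Omega}|%:R^-1)%:E *
   \int[poisson_iid (d * n.+1%:R / K.+1%:R) (constraint_law P sigma)]_g F (sigma, g)); last first.
  by apply: eq_bigr => sigma _; rewrite integral_poisson_law.
move: F mF {ms}; apply: (is_integral_eq (L := fun F => \int[teacher_law P d n]_x F x)
  (L' := fun F => \sum_sigma (#|{ffun 'I_n.+1 -> Omega}|%:R^-1)%:E *
   \int[poisson_iid (d * n.+1%:R / K.+1%:R) (constraint_law P sigma)]_g F (sigma, g))).
- exact: (il_prob (teacher_law P d n : probability _ R)).
- apply: il_bigsum => sigma; apply: il_scale => //.
  exact: (il_map (il_prob (poisson_iid (d * n.+1%:R / K.+1%:R) (constraint_law P sigma) : probability _ R))
    (measurable_pairl sigma)).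
move=> B mB; rewrite (integral_indic (teacher_law P d n : probability _ R))// setIT.
rewrite /teacher_law; apply: eq_bigr => sigma _; congr (_ * _).
rewrite (_ : (fun g : seq con => (\1_B (sigma, g))%:E) =
    (fun g => (\1_[set g : seq con | B (sigma, g)] g)%:E)); last first.
  by apply/funext => g; rewrite !indicE; congr (_%:R)%:E; apply/idP/idP; rewrite !inE.
rewrite (integral_indic (poisson_iid (d * n.+1%:R / K.+1%:R) (constraint_law P sigma) : probability _ R))//.
  by rewrite setIT.
by rewrite -[X in measurable X]setTI; exact: (measurable_pairl (A := seq con) sigma measurableT mB).
Qed.

(** A reference intensity that does not involve the spins. The densities of the graph laws with
    respect to it can be compared for different [sigma], which is what Bayes' rule requires. *)
Definition refL (h : con -> \bar R) : \bar R := \sum_(y : nbh) \int[P]_psi h (y, psi).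

Lemma il_refL : is_integral refL.
Proof.
apply: il_bigsum => y.
exact: (il_map (il_prob P) (h := fun psi : weight => (y, psi)) (measurable_pairl y)).
Qed.

Definition likelihood sigma (g : seq con) : R := (rhos sigma ^+ size g * wprod g sigma)%R.

Lemma likelihood_ge0 sigma g : (0 <= likelihood sigma g)%R.
Proof. by rewrite mulr_ge0 ?exprn_ge0 ?rhos_ge0// ltW// wprod_gt0. Qed.

Lemma nnmeas_likelihood sigma : nnmeas (fun g => (likelihood sigma g)%:E).
Proof.
split=> [|g]; last by rewrite lee_fin likelihood_ge0.
apply/measurable_EFinP; apply: measurable_funM; last exact: measurable_wprod.
rewrite (_ : (fun g => _) = fun g : seq con => (rhos sigma ^+ size (map fst g))%R).
  exact: (measurable_map_fst (fun ns => rhos sigma ^+ size ns)%R).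
by apply/funext => g; rewrite size_map.
Qed.

Lemma iterL_likelihood sigma j (F : seq con -> \bar R) : nnmeas F ->
  iterL (ilaw P (rhos sigma) sigma (avoid [::])) j F =
  iterL refL j (fun g => (likelihood sigma g)%:E * F g).
Proof.
elim: j F => [|j IH] F mF /=.
  by rewrite /likelihood /wprod big_nil expr0 mul1r mul1e.
rewrite /ilaw /refL (eq_bigl xpredT); last by move=> y; apply/forallP.
apply: eq_bigr => y _; congr integral; apply/funext => psi.
have mFa : nnmeas (fun g => F ((y, psi) :: g)).
  exact: (nnmeas_comp (measurable_pairl (y, psi)) (nnmeas_cons2 mF)).
rewrite IH// -(ilZ (il_iter il_refL j)).
- congr iterL; apply/funext => g; rewrite muleA -EFinM; congr (_%:E * _).
  by rewrite /likelihood /wprod big_cons /= exprS; ring.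
- by rewrite lee_fin mulr_ge0 ?rhos_ge0// ltW// weight_gt0.
- by apply: nnmeasM => //; exact: nnmeas_likelihood.
Qed.

(** The total intensity is [rate] for every [sigma], so the exponential factor is common to all spin
    assignments and stays out of the likelihood ratios. *)
Lemma ppp_likelihood sigma (F : seq con -> \bar R) : nnmeas F ->
  ppp P (rhos sigma) sigma [::] F =
  (expR (- rate))%:E * expL refL (fun g => (likelihood sigma g)%:E * F g).
Proof.
move=> mF; rewrite /ppp imass_total; congr (_ * _).
by apply: eq_eseriesr => j _; rewrite iterL_likelihood.
Qed.

End teacher_integral.

(** * Balanced assignments *)

Section balance.
Variables (R : realType) (Omega : finPointedType) (n : nat).
Notation q := (#|Omega|%:R : R).
Notation V := 'I_n.+1.
Implicit Types sigma : {ffun V -> Omega}.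

Definition cnt sigma omega : nat := #|[pred x | sigma x == omega]|.

Definition balanced (delta : R) sigma :=
  [forall omega, `|(cnt sigma omega)%:R / n.+1%:R - q^-1| <= delta].

Let a (omega u : Omega) : R := (u == omega)%:R - q^-1.

Let q_gt0 : 0 < q.
Proof. by rewrite ltr0n; apply/card_gt0P; exists point. Qed.

Let sum_a omega : \sum_u a omega u = 0.
Proof.
rewrite /a sumrB sumr_const (bigD1 omega)//= eqxx big1 ?addr0 => [|u /negbTE->//].
by rewrite -[X in _ - X]mulr_natr mulVf ?subrr// gt_eqF.
Qed.

Let a_sq omega u : a omega u ^+ 2 <= 1.
Proof.
have q0 : 0 <= q^-1 by rewrite invr_ge0 ltW.
have q1 : q^-1 <= 1 by rewrite invf_le1// ler1n -(ltr0n R).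
by rewrite /a expr2; case: (u == omega) => /=; nra.
Qed.

Let cntE sigma omega : (cnt sigma omega)%:R - n.+1%:R / q = \sum_x a omega (sigma x).
Proof.
rewrite /a sumrB sumr_const card_ord mulr_natl; congr (_ - _).
rewrite /cnt -sum1_card natr_sum big_mkcond; apply: eq_bigr => x _.
by rewrite inE; case: (sigma x == omega).
Qed.

Let cross omega (x x' : V) : x != x' -> \sum_(sigma : {ffun V -> Omega}) a omega (sigma x) * a omega (sigma x') = 0.
Proof.
move=> xx'.
pose F (z : V) (u : Omega) := if z == x then a omega u else if z == x' then a omega u else 1.
transitivity (\sum_(sigma : {ffun V -> Omega}) \prod_z F z (sigma z)).
  apply: eq_bigr => sigma _; rewrite (bigD1 x)//= (bigD1 x') /=; last by rewrite eq_sym.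
  rewrite big1; last by move=> z /andP[zx zx']; rewrite /F (negbTE zx) (negbTE zx').
  by rewrite mulr1 /F !eqxx eq_sym (negbTE xx').
rewrite -bigA_distr_bigA (bigD1 x)//= (eq_bigr (a omega)); last by move=> u _; rewrite /F eqxx.
by rewrite sum_a mul0r.
Qed.

(** Variance of a sum of independent centred indicators, in counting form: the mixed terms vanish by
    [cross], and each diagonal term is at most 1. *)
Lemma cnt_variance omega :
  \sum_sigma ((cnt sigma omega)%:R - n.+1%:R / q) ^+ 2 <= n.+1%:R * #|{ffun V -> Omega}|%:R.
Proof.
rewrite (eq_bigr (fun sigma : {ffun V -> Omega} => \sum_x \sum_x' a omega (sigma x) * a omega (sigma x'))).
  rewrite exchange_big /=.
  apply: (@le_trans _ _ (\sum_(x < n.+1) #|{ffun V -> Omega}|%:R)).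
    apply: ler_sum => x _; rewrite exchange_big /= (bigD1 x)//= [X in _ + X]big1 ?addr0.
      by rewrite -sumr_const; apply: ler_sum => sigma _; rewrite -expr2; exact: a_sq.
    by move=> x' x'x; apply: cross; rewrite eq_sym.
  by rewrite sumr_const card_ord mulr_natl.
move=> sigma _; rewrite cntE expr2 mulr_suml; apply: eq_bigr => x _.
by rewrite mulr_sumr.
Qed.

(** Chebyshev's inequality for each spin value; the union bound over the spin values gives the
    factor [q]. *)
Lemma unbalanced_bound (delta : R) : 0 < delta ->
  #|[pred sigma | ~~ balanced delta sigma]|%:R <= q / (delta ^+ 2 * n.+1%:R) * #|{ffun V -> Omega}|%:R.
Proof.
move=> d0; have N0 : 0 < n.+1%:R :> R by [].
pose bad omega := [pred sigma : {ffun V -> Omega} | delta < `|(cnt sigma omega)%:R / n.+1%:R - q^-1|].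
have hb omega : #|bad omega|%:R <= (delta ^+ 2 * n.+1%:R)^-1 * #|{ffun V -> Omega}|%:R.
  rewrite ler_pdivlMl ?mulr_gt0 ?exprn_gt0// -(ler_pM2l N0).
  apply: le_trans (cnt_variance omega).
  apply: (@le_trans _ _ (\sum_(sigma in bad omega) (delta * n.+1%:R) ^+ 2)).
    rewrite sumr_const -[leRHS]mulr_natr [leLHS](_ : _ = (delta * n.+1%:R) ^+ 2 * #|bad omega|%:R)//.
    by move: (#|bad omega|%:R : R) (n.+1%:R : R) => *; ring.
  rewrite [leRHS](bigID (mem (bad omega))) /= -[leLHS]addr0 lerD//; last first.
    by apply: sumr_ge0 => sigma _; rewrite sqr_ge0.
  apply: ler_sum => sigma; rewrite inE => h.
  rewrite -[leRHS]real_normK ?num_real// ler_sqr ?nnegrE ?normr_ge0 ?mulr_ge0 ?(ltW d0)//.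
  rewrite (_ : (cnt sigma omega)%:R - n.+1%:R / q = ((cnt sigma omega)%:R / n.+1%:R - q^-1) * n.+1%:R).
    by rewrite normrM (gtr0_norm N0) ler_pM2r// ltW.
  by rewrite mulrBl divfK ?gt_eqF// mulrC.
apply: (@le_trans _ _ (\sum_omega #|bad omega|%:R)).
  rewrite -natr_sum ler_nat -sum1_card.
  rewrite (eq_bigr (fun omega => \sum_(sigma in bad omega) 1)%N); last by move=> *; rewrite sum1_card.
  rewrite (exchange_big_dep xpredT)//= big_mkcond /=; apply: leq_sum => sigma _.
  case: ifPn => //; rewrite inE => /forallPn[omega h].
  by rewrite (bigD1 omega) ?inE ?ltNge.
apply: le_trans (ler_sum _ (fun omega _ => hb omega)) _.
by rewrite sumr_const -[leLHS]mulr_natl mulrA.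
Qed.

End balance.

(** * The missing mass of the truncated tree *)

Section truncation.
Variables (R : realType) (K : nat) (d : R).
Hypothesis d_gt0 : (0 < d)%R.
Local Open Scope ring_scope.

Lemma bernoulli_ge (x : R) m : 0 <= x <= 1 -> 1 - m%:R * x <= (1 - x) ^+ m.
Proof.
move=> /andP[x0 x1]; elim: m => [|m IH]; first by rewrite mul0r subr0 expr0.
rewrite exprS; apply: (@le_trans _ _ ((1 - x) * (1 - m%:R * x))); last first.
  by rewrite ler_wpM2l// subr_ge0.
have : 0 <= m%:R * x * x by rewrite !mulr_ge0.
by rewrite -natr1; lra.
Qed.

Lemma poisson_partial (e : R) : 0 < e -> exists D, 1 - e <= \sum_(j < D) poisson_pmf d j.
Proof.
move=> e0; have : (\sum_(0 <= j < n) (poisson_pmf d j)%:E)%E @[n --> \oo] --> 1%E.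
  rewrite -(poisson_pmf_sum1 d_gt0); apply: is_cvg_nneseries => j _ _.
  by rewrite lee_fin poisson_pmf_ge0.
rewrite (_ : (fun n => _) = (fun n => (\sum_(j < n) poisson_pmf d j)%:E)); last first.
  by apply/funext => n; rewrite sumEFin big_mkord.
move/fine_cvgP => [_ /cvgrPdist_le /(_ e e0)] [D _ /(_ D (leqnn D))] /= h.
by exists D; move: h; rewrite ler_norml => /andP[]; lra.
Qed.

Lemma bmass_series (w : nat -> R) (b : R) : (forall j, 0 <= w j) -> (\sum_(j <oo) (w j)%:E <= 1)%E ->
  0 <= b -> b <= 1 -> ((\sum_(j <oo) (w j * b ^+ (K * j))%:E)%E \is a fin_num) /\
    0 <= fine (\sum_(j <oo) (w j * b ^+ (K * j))%:E)%E <= 1.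
Proof.
move=> w0 w1 b0 b1.
have t0 j : (0 <= (w j * b ^+ (K * j))%:E)%E by rewrite lee_fin mulr_ge0// exprn_ge0.
have s1 : (\sum_(j <oo) (w j * b ^+ (K * j))%:E <= 1)%E.
  apply: le_trans w1; apply: lee_nneseries => // j _.
  by rewrite lee_fin -[leRHS]mulr1 ler_wpM2l// exprn_ile1.
have sf : (\sum_(j <oo) (w j * b ^+ (K * j))%:E)%E \is a fin_num.
  rewrite ge0_fin_numE; last exact: nneseries_ge0.
  exact: le_lt_trans s1 (ltry _).
by split=> //; rewrite -!lee_fin fineK// s1 nneseries_ge0.
Qed.

Lemma bmass_bounds (w : nat -> R) l : (forall j, 0 <= w j) -> (\sum_(j <oo) (w j)%:E <= 1)%E ->
  0 <= bmass K w l <= 1.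
Proof.
move=> w0 w1; elim: l => [|l /andP[b0 b1]] /=; first by rewrite ler01 lexx.
by have [] := bmass_series w0 w1 b0 b1.
Qed.

(** Induction on the depth. One more level loses three factors: the Poisson tail beyond [D1], the
    power of [theta], and the power of the mass one level below. Each is kept above [1 - e'] for a
    smaller [e'], hence the cube. *)
Lemma bmass_near1 l (e : R) : 0 < e -> exists D (th : R), [/\ 0 < th, th < 1 &
  forall D' th', (D <= D')%N -> th <= th' <= 1 -> 1 - e <= bmass K (trunc_pmf d th' D') l].
Proof.
elim: l e => [|l IH] e e0.
  by exists 0%N, (1 / 2); split=> [||D' th' _ _ /=]; lra.
move: e e0 => e9 e90.
(* By Bernoulli's inequality [(1 - e') ^+ 3] is at least [1 - 3 * e']. *)
have [e [e0 e1 ee]] : exists e', [/\ 0 < e', e' < 1 & 1 - e9 <= (1 - e') ^+ 3].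
  move: e9 e90 => e e0.
  have e3 : 0 < Num.min (e / 3) (1/2) by rewrite lt_min; apply/andP; split; lra.
  exists (Num.min (e / 3) (1 / 2)); split=> //; first by rewrite gt_min; apply/orP; right; lra.
  have h1 : Num.min (e / 3) (1 / 2) <= e / 3 by rewrite ge_min lexx.
  have h2 : Num.min (e / 3) (1 / 2) <= 1 / 2 by rewrite ge_min lexx orbT.
  apply: le_trans (bernoulli_ge _ _); last by apply/andP; split; lra.
  by lra.
have [D1 hD1] := poisson_partial e0.
(* All exponents for [j < D1] are at most [K * D1 + D1 + 1], so by Bernoulli's inequality the
   corresponding powers of [1 - x] stay above [1 - e]. *)
pose x := e / (K * D1 + D1 + 1)%:R.
have m0 : (0 : R) < (K * D1 + D1 + 1)%:R by rewrite ltr0n addn1.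
have x0 : 0 < x by rewrite divr_gt0.
have x1 : x <= e.
  by rewrite ler_pdivrMr// ler_peMr ?(ltW e0)// ler1n addn1.
have xm m : (m <= K * D1 + D1 + 1)%N -> 1 - e <= (1 - x) ^+ m.
  move=> hm; apply: le_trans (bernoulli_ge _ _); last by apply/andP; split; lra.
  rewrite lerD2l lerN2 /x mulrCA ler_piMr// ?(ltW e0)//.
  by rewrite ler_pdivrMr// mul1r ler_nat.
have [D2 [th [th0 th1 hl]]] := IH x x0.
exists (maxn D1 D2), (Num.max th (1 - x)); split.
- by rewrite lt_max th0.
- by rewrite gt_max th1; lra.
move=> D' th' hD /andP[hth th'1].
move: hD; rewrite geq_max => /andP[hD1' hD2'].
have [hth1 hth2] : th <= th' /\ 1 - x <= th' by apply/andP; move: hth; rewrite ge_max.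
have th'0 : 0 <= th' by lra.
have := hl D' th' hD2'; rewrite hth1 th'1 => /(_ isT) hb.
set w := trunc_pmf d th' D' in hb *; set b := bmass K w l in hb *.
have w0 j : 0 <= w j by exact: trunc_pmf_ge0.
have w1 : (\sum_(j <oo) (w j)%:E <= 1)%E by exact: trunc_pmf_le1.
have b0 : 0 <= b by apply: le_trans hb; lra.
have /andP[_ b1] := bmass_bounds l w0 w1.
have [sf _] := bmass_series w0 w1 b0 b1.
apply: (@le_trans _ _ (\sum_(j < D1) w j * b ^+ (K * j))); last first.
  rewrite -lee_fin /= fineK// -sumEFin -(big_mkord xpredT (fun j => (w j * b ^+ (K * j))%:E)).
  by apply: nneseries_lim_ge => j _; rewrite lee_fin mulr_ge0// exprn_ge0.
apply: le_trans ee _; apply: (@le_trans _ _ (\sum_(j < D1) (1 - e) ^+ 2 * poisson_pmf d j)).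
  by rewrite -mulr_sumr exprSr ler_wpM2l// exprn_ge0//; lra.
apply: ler_sum => j _; rewrite /w /trunc_pmf (leq_trans (ltn_ord j) hD1').
rewrite [leRHS]mulrAC ler_wpM2r ?poisson_pmf_ge0// expr2 ler_pM//; try lra.
  apply: (@le_trans _ _ ((1 - x) ^+ j.+1)); last by rewrite ler_pXn2r ?nnegrE//; lra.
  by apply: xm; have := ltn_ord j; rewrite addn1; move=> h; apply: leqW; apply: leq_trans h _; exact: leq_addl.
apply: (@le_trans _ _ ((1 - x) ^+ (K * j))).
  by apply: xm; rewrite addn1 -addnS; apply: leq_trans (leq_addr _ _); rewrite leq_mul2l ltnW ?orbT// ltn_ord.
have [->|kj] := posnP (K * j); first by rewrite !expr0.
by rewrite ler_pXn2r ?nnegrE//; lra.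
Qed.

End truncation.

(** * Counting neighbourhoods *)

Section counting.
Variables (R : realType) (n : nat).
Notation V := 'I_n.+1.
Notation N := (n.+1%:R : R).

Lemma eq_ffun_prod (I : finType) (J : eqType) (f g : {ffun I -> J}) :
  ((f == g)%:R : R) = \prod_i (f i == g i)%:R.
Proof.
have [->|fg] := eqVneq f g; first by rewrite big1// => i _; rewrite eqxx.
have /existsP[i fgi] : [exists i, f i != g i].
  apply: contraNT fg => /existsPn h; apply/eqP/ffunP => i; apply/eqP.
  by have := h i; rewrite negbK.
by rewrite (bigD1 i)//= (negbTE fgi) mul0r.
Qed.

Lemma sum_ind (w : V) : \sum_(z : V) ((z == w)%:R : R) = 1.
Proof. by rewrite (bigD1 w)//= eqxx big1 ?addr0// => z /negbTE->. Qed.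

Let N0 : N != 0. Proof. by rewrite pnatr_eq0. Qed.

Variable m : nat.
Implicit Types c : {ffun 'I_m -> V}.

Lemma sum_at1 (i : 'I_m) w : \sum_(c : {ffun 'I_m -> V}) ((c i == w)%:R : R) = N ^+ m / N.
Proof.
pose F (l : 'I_m) (z : V) : R := if l == i then (z == w)%:R else 1.
transitivity (\sum_(c : {ffun 'I_m -> V}) \prod_l F l (c l)).
  apply: eq_bigr => c _; rewrite (bigD1 i)//= big1 => [|l /negbTE li]; last by rewrite /F li.
  by rewrite mulr1 /F eqxx.
rewrite -bigA_distr_bigA /= (eq_bigr (fun l => N * (if l == i then N^-1 else 1))).
  rewrite big_split /= prodr_const card_ord (bigD1 i)//= eqxx big1 ?mulr1//.
  by move=> l /negbTE->.
move=> l _; rewrite /F; case: eqP => _; first by rewrite sum_ind divff.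
by rewrite sumr_const card_ord mulr1.
Qed.

Lemma sum_at2 (i j : 'I_m) w w' : i != j ->
  \sum_(c : {ffun 'I_m -> V}) ((c i == w)%:R * (c j == w')%:R : R) = N ^+ m / N / N.
Proof.
move=> ij.
pose F (l : 'I_m) (z : V) : R := if l == i then (z == w)%:R else if l == j then (z == w')%:R else 1.
transitivity (\sum_(c : {ffun 'I_m -> V}) \prod_l F l (c l)).
  apply: eq_bigr => c _; rewrite (bigD1 i)//= (bigD1 j) /=; last by rewrite eq_sym.
  rewrite big1 => [|l /andP[/negbTE li /negbTE lj]]; last by rewrite /F li lj.
  by rewrite mulr1 /F !eqxx [j == i]eq_sym (negbTE ij).
rewrite -bigA_distr_bigA /= (eq_bigr (fun l => N *
    ((if l == i then N^-1 else 1) * (if l == j then N^-1 else 1)))).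
  rewrite big_split /= prodr_const card_ord big_split /=.
  rewrite (bigD1 i)//= eqxx big1 ?mulr1; last by move=> l /negbTE->.
  rewrite (bigD1 j)//= eqxx big1 ?mulr1; last by move=> l /negbTE->.
  by rewrite mulrA.
move=> l _; rewrite /F; have [->|li] := eqVneq l i.
  by rewrite (negbTE ij) sum_ind mulr1 divff.
have [_|lj] := eqVneq l j; first by rewrite sum_ind mul1r divff.
by rewrite sumr_const card_ord !mulr1.
Qed.

Lemma sum_eq2 (i j : 'I_m) : i != j -> \sum_(c : {ffun 'I_m -> V}) ((c i == c j)%:R : R) = N ^+ m / N.
Proof.
move=> ij; transitivity (\sum_(c : {ffun 'I_m -> V}) \sum_(w : V) ((c i == w)%:R * (c j == w)%:R : R)).
  apply: eq_bigr => c _; rewrite (bigD1 (c j))//= eqxx mulr1 big1 ?addr0// => w.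
  by rewrite eq_sym => /negbTE->; rewrite mulr0.
rewrite exchange_big /= (eq_bigr (fun=> N ^+ m / N / N)); last by move=> w _; exact: sum_at2.
by rewrite sumr_const card_ord -[LHS]mulr_natr divfK.
Qed.

End counting.

(** A Bonferroni inequality with ordered pairs: if [s] of the events hold, it reads s - (s^2 - s) <=
    1, which is (s - 1)^2 >= 0. *)
Lemma ind_exists_ge (R : realType) (I : finType) (b : pred I) :
  \sum_i (b i)%:R - \sum_i \sum_(j | i != j) (b i)%:R * (b j)%:R <= ([exists i, b i]%:R : R).
Proof.
set s : R := \sum_i (b i)%:R.
have -> : \sum_i \sum_(j | i != j) (b i)%:R * (b j)%:R = s * s - s :> R.
  rewrite [X in _ = X - _]mulr_suml -sumrB; apply: eq_bigr => i _.
  rewrite mulr_sumr [in RHS](bigD1 i)//= -natrM mulnb andbb addrAC subrr add0r.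
  by apply: eq_bigl => j; rewrite eq_sym.
case: existsP => [[i bi]|nb]; last first.
  by rewrite (_ : s = 0) ?mul0r ?subrr// /s big1// => i _; case: (boolP (b i)) => // bi; case: nb; exists i.
have : 0 <= (s - 1) * (s - 1) by rewrite -expr2 sqr_ge0.
by rewrite /=; lra.
Qed.

(** * Intensities under balanced spins *)

Section estimates.
Variables (R : realType) (Omega : finPointedType) (K n : nat).
Notation weight := (weight R Omega K.+1).
Notation V := 'I_n.+1.
Notation nbh := {ffun 'I_K.+1 -> 'I_n.+1}.
Notation q := (#|Omega|%:R : R).
Notation N := (n.+1%:R : R).
Variables (P : probability weight R) (xi0 : R).
Hypothesis xi0_gt0 : 0 < xi0.
Hypothesis symP : forall (i : 'I_K.+1) omega,
  \sum_(tau : {ffun 'I_K.+1 -> Omega} | tau i == omega) pmean P tau = q ^+ K * xi0.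

Let N_gt0 : 0 < N. Proof. by []. Qed.
Let q_gt0 : 0 < q. Proof. by rewrite ltr0n; apply/card_gt0P; exists point. Qed.

Lemma pmean_total : \sum_(tau : {ffun 'I_K.+1 -> Omega}) pmean P tau = q ^+ K.+1 * xi0.
Proof.
rewrite (partition_big (fun tau : {ffun 'I_K.+1 -> Omega} => tau ord0) xpredT)//=.
rewrite (eq_bigr (fun=> q ^+ K * xi0)) => [|omega _]; last exact: symP.
by rewrite sumr_const -[LHS]mulr_natl exprS mulrA.
Qed.

Lemma sum_cnt m (sigma : {ffun V -> Omega}) (tau : {ffun 'I_m -> Omega}) :
  \sum_(c : {ffun 'I_m -> V}) ((([ffun i => sigma (c i)] : {ffun 'I_m -> Omega}) == tau)%:R : R) =
  \prod_i (cnt sigma (tau i))%:R.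
Proof.
transitivity (\sum_(c : {ffun 'I_m -> V}) \prod_i ((sigma (c i) == tau i)%:R : R)).
  by apply: eq_bigr => c _; rewrite eq_ffun_prod; apply: eq_bigr => i _; rewrite ffunE.
rewrite -(bigA_distr_bigA (fun (i : 'I_m) x => ((sigma x == tau i)%:R : R))) /=.
apply: eq_bigr => i _; rewrite /cnt -sum1_card natr_sum [RHS]big_mkcond.
by apply: eq_bigr => x _; rewrite inE; case: (_ == _).
Qed.

Lemma cmass_cnt (sigma : {ffun V -> Omega}) :
  cmass P sigma = \sum_tau pmean P tau * \prod_i (cnt sigma (tau i))%:R.
Proof.
rewrite cmassE; transitivity (\sum_(y : nbh) \sum_tau pmean P tau * ((local_spins sigma y == tau)%:R : R)).
  apply: eq_bigr => y _; rewrite (bigD1 (local_spins sigma y))//= eqxx mulr1 big1 ?addr0// => tau.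
  by rewrite eq_sym => /negbTE->; rewrite mulr0.
by rewrite exchange_big; apply: eq_bigr => tau _; rewrite -mulr_sumr sum_cnt.
Qed.

Lemma sum_touch (sigma : {ffun V -> Omega}) (i : 'I_K.+1) x :
  \sum_(y : nbh) ((y i == x)%:R * pmean P (local_spins sigma y) : R) =
  \sum_(tau : {ffun 'I_K.+1 -> Omega} | tau i == sigma x) pmean P tau *
    \prod_(j | j != i) (cnt sigma (tau j))%:R.
Proof.
transitivity (\sum_(y : nbh) \sum_tau pmean P tau * ((y i == x)%:R * (local_spins sigma y == tau)%:R : R)).
  apply: eq_bigr => y _; rewrite (bigD1 (local_spins sigma y))//= eqxx mulr1 big1 ?addr0 1?mulrC// => tau.
  by rewrite eq_sym => /negbTE->; rewrite !mulr0.
rewrite exchange_big [RHS]big_mkcond /=; apply: eq_bigr => tau _; rewrite -mulr_sumr.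
pose F (l : 'I_K.+1) (z : V) : R := if l == i then (z == x)%:R * (sigma z == tau l)%:R
  else (sigma z == tau l)%:R.
rewrite (eq_bigr (fun y : nbh => \prod_l F l (y l))); last first.
  move=> y _; rewrite eq_ffun_prod (bigD1 i)//= [RHS](bigD1 i)//= /F eqxx ffunE mulrA; congr (_ * _).
  by apply: eq_bigr => l /negbTE->; rewrite ffunE.
rewrite -(bigA_distr_bigA F) /= (bigD1 i)//= {1}/F eqxx.
rewrite (bigD1 x)//= eqxx mul1r big1 ?addr0; last by move=> z /negbTE->; rewrite mul0r.
rewrite eq_sym; case: (tau i == sigma x); last by rewrite mul0r mulr0.
rewrite mul1r; congr (_ * _); apply: eq_bigr => l /negbTE li; rewrite /F li.
rewrite /cnt -sum1_card natr_sum [RHS]big_mkcond.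
by apply: eq_bigr => z _; rewrite inE; case: (_ == _).
Qed.

Section balanced_estimates.
Variables (t : R) (sigma : {ffun V -> Omega}).
Hypotheses (t_ge0 : 0 <= t) (t_le1 : t <= 1) (bal : balanced (t / q) sigma).

Lemma cnt_bounds omega : N / q * (1 - t) <= ((cnt sigma omega)%:R : R) <= N / q * (1 + t).
Proof.
have /forallP/(_ omega) := bal; rewrite ler_norml => /andP[h1 h2].
have e : (cnt sigma omega)%:R = (cnt sigma omega)%:R / N * N :> R by rewrite divfK// gt_eqF.
rewrite e; move: h1 h2; move: (_ / N) => x h1 h2.
have -> : N / q * (1 - t) = (q^-1 - t / q) * N by ring.
have -> : N / q * (1 + t) = (q^-1 + t / q) * N by ring.
by rewrite !ler_pM2r//; apply/andP; split; lra.
Qed.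

Let lo_ge0 : 0 <= N / q * (1 - t).
Proof. by rewrite mulr_ge0 ?divr_ge0 ?subr_ge0. Qed.

Let cancelq m : q ^+ m * xi0 * (N / q) ^+ m = xi0 * N ^+ m.
Proof. by rewrite expr_div_n; have : q ^+ m != 0 by [rewrite expf_neq0// gt_eqF]; move: (q ^+ m) (N ^+ m) => a b a0; field. Qed.

Let prod_lo (I : finType) (Q : pred I) (f : I -> Omega) :
  (N / q * (1 - t)) ^+ #|Q| <= \prod_(i | Q i) (cnt sigma (f i))%:R.
Proof.
rewrite -prodr_const; apply: ler_prod => i _; rewrite lo_ge0.
by case/andP: (cnt_bounds (f i)).
Qed.

Let prod_hi (I : finType) (Q : pred I) (f : I -> Omega) :
  \prod_(i | Q i) (cnt sigma (f i))%:R <= (N / q * (1 + t)) ^+ #|Q|.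
Proof.
rewrite -prodr_const; apply: ler_prod => i _; rewrite ler0n.
by case/andP: (cnt_bounds (f i)).
Qed.

Lemma cmass_bounds : xi0 * N ^+ K.+1 * (1 - t) ^+ K.+1 <= cmass P sigma <=
  xi0 * N ^+ K.+1 * (1 + t) ^+ K.+1.
Proof.
rewrite cmass_cnt -!cancelq -!mulrA -!exprMn !mulrA -pmean_total !mulr_suml.
apply/andP; split; apply: ler_sum => tau _; rewrite ler_wpM2l ?pmean_ge0//.
  by have := @prod_lo _ predT tau; rewrite (eq_card (B := 'I__))// card_ord.
by have := @prod_hi _ predT tau; rewrite (eq_card (B := 'I__))// card_ord.
Qed.

(** SYM gives the same total weight whichever spin is fixed in slot [i], so to leading order the
    intensity of the constraints at [x] does not depend on the spin of [x]. *)
Lemma touch_bounds (i : 'I_K.+1) x : xi0 * N ^+ K * (1 - t) ^+ K <=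
  \sum_(y : nbh) ((y i == x)%:R * pmean P (local_spins sigma y) : R) <=
  xi0 * N ^+ K * (1 + t) ^+ K.
Proof.
rewrite sum_touch -!cancelq -!mulrA -!exprMn !mulrA -(symP i (sigma x)) !mulr_suml.
have cK : #|[pred j : 'I_K.+1 | j != i]| = K.
  by rewrite (eq_card (B := predC1 i))// cardC1 card_ord.
apply/andP; split; apply: ler_sum => tau _; rewrite ler_wpM2l ?pmean_ge0//.
  by have := @prod_lo _ [pred j | j != i] tau; rewrite cK.
by have := @prod_hi _ [pred j | j != i] tau; rewrite cK.
Qed.

(** From all tuples with the right spins, those with an entry in [W] or with a repeated entry are
    removed by a union bound; each such coincidence holds for a fraction [1 / N] of all tuples. *)
Lemma fresh_bound (W : seq V) (tau : {ffun 'I_K -> Omega}) :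
  (N / q * (1 - t)) ^+ K - K%:R * ((size W)%:R + K%:R) * (N ^+ K / N) <=
  #|[pred c | freshk W c && ([ffun i => sigma (c i)] == tau)]|%:R.
Proof.
have h : (N / q * (1 - t)) ^+ K <= \prod_i (cnt sigma (tau i))%:R.
  by have := @prod_lo _ predT tau; rewrite (eq_card (B := 'I__))// card_ord.
rewrite lerBlDr; apply: le_trans h _; rewrite -sum_cnt.
rewrite -sum1_card natr_sum [X in _ <= X + _]big_mkcond /=.
have -> : K%:R * ((size W)%:R + K%:R) * (N ^+ K / N) =
  \sum_(i < K) (\sum_(w <- W) (N ^+ K / N) + \sum_(j < K) (N ^+ K / N)).
  rewrite sumr_const big_const_seq count_predT iter_addr_0 sumr_const card_ord.
  by rewrite -[in RHS]mulrnDr -mulrnA -[RHS]mulr_natl mulnC natrM natrD.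
pose bad (c : {ffun 'I_K -> V}) : R := \sum_(i < K) (\sum_(w <- W) (c i == w)%:R +
  \sum_(j < K | i != j) (c i == c j)%:R).
apply: (@le_trans _ _ (\sum_(c : {ffun 'I_K -> V})
   ((if c \in [pred c | freshk W c && ([ffun i => sigma (c i)] == tau)] then 1 else 0) + bad c))).
  apply: ler_sum => c _; rewrite inE.
  have bad0 i : 0 <= \sum_(w <- W) (c i == w)%:R + \sum_(j < K | i != j) (c i == c j)%:R :> R.
    by rewrite addr_ge0// sumr_ge0.
  case: (_ == tau); last by rewrite andbF add0r sumr_ge0.
  case: (boolP (freshk W c)) => fr /=; first by rewrite lerDl sumr_ge0.
  rewrite add0r; move: fr; rewrite negb_and => /orP[nu|/allPn[z /mem_flist[i ->]]].
    have /injectivePn[i [j ij cij]] : ~~ injectiveb c by apply: contra nu.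
    rewrite /bad (bigD1 i)//= (bigD1 j)//= cij eqxx.
    rewrite -addrA addrCA -!addrA lerDl !addr_ge0 ?sumr_ge0//.
  rewrite negbK => ciW; rewrite /bad (bigD1 i)//= (big_rem (c i))//= eqxx.
  by rewrite -!addrA lerDl !addr_ge0 ?sumr_ge0.
rewrite big_split /= lerD2l /bad exchange_big; apply: ler_sum => i _.
rewrite big_split /=; apply: lerD.
  rewrite exchange_big; apply: ler_sum => w _.
  by rewrite sum_at1.
rewrite exchange_big big_mkcond /=; apply: ler_sum => j _; case: ifPn => ij.
  by rewrite sum_eq2.
by rewrite divr_ge0// exprn_ge0.
Qed.

Lemma imassE (rho : R) (A : pred nbh) : 0 <= rho ->
  imass P rho sigma A = rho * \sum_(y | A y) pmean P (local_spins sigma y).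
Proof.
move=> rho0; apply: EFin_inj; rewrite -(ilaw1 _ _ rho0) /ilaw mulr_sumr -sumEFin.
apply: eq_bigr => y _; rewrite EFinM -pmeanE -(ilZ (il_prob P)) ?lee_fin//.
  by congr integral; apply/funext => psi; rewrite mule1 EFinM.
split=> [|psi]; last by rewrite lee_fin ltW// weight_gt0.
by apply/measurable_EFinP; exact: measurable_weight_eval.
Qed.

Variable d : R.
Hypothesis d_gt0 : 0 < d.
Hypothesis t_lt1 : t < 1.

Let d_ge0 : 0 <= d := ltW d_gt0.
Let xi_ge0 : 0 <= xi0 := ltW xi0_gt0.
Let t1_ge0 : 0 <= 1 + t := addr_ge0 ler01 t_ge0.
Let rho := rhos P d sigma.
Let rho_ge0 : 0 <= rho. Proof. exact: rhos_ge0. Qed.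

Lemma rhos_le : rho <= d / (K.+1%:R * xi0 * (1 - t) ^+ K.+1) / N ^+ K.
Proof.
have /andP[h _] := cmass_bounds.
have p : 0 < xi0 * N ^+ K.+1 * (1 - t) ^+ K.+1 by rewrite !mulr_gt0 ?exprn_gt0 ?subr_gt0.
rewrite /rho /rhos ler_pdivrMr ?cmass_gt0//; apply: le_trans (ler_wpM2l _ h).
  have e1 : (1 - t) ^+ K.+1 != 0 by rewrite expf_neq0// gt_eqF// subr_gt0.
  have e2 : N ^+ K != 0 by rewrite expf_neq0// gt_eqF.
  rewrite /rate le_eqVlt; apply/orP; left; apply/eqP; rewrite [N ^+ K.+1]exprS.
  move: ((1 - t) ^+ K.+1) (N ^+ K) e1 e2 => a b e1 e2.
  have e3 : K.+1%:R != 0 :> R by rewrite pnatr_eq0.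
  move: (K.+1%:R : R) (N) e3 (gt_eqF xi0_gt0) => k m e3 /negbT e4.
  by field; rewrite e1 e2 e3 e4.
by rewrite !divr_ge0 ?mulr_ge0 ?exprn_ge0 ?subr_ge0 ?ltW.
Qed.

(** Supplies hypothesis [R1]: the factor of [d] tends to 1 with [t]. *)
Lemma touch_imass x : imass P rho sigma (fun y => touch y x) <= d * ((1 + t) ^+ K / (1 - t) ^+ K.+1).
Proof.
rewrite imassE//.
apply: (@le_trans _ _ (rho * (K.+1%:R * (xi0 * N ^+ K * (1 + t) ^+ K)))).
  rewrite ler_wpM2l// big_mkcond /=.
  apply: (@le_trans _ _ (\sum_(i < K.+1) \sum_(y : nbh) ((y i == x)%:R * pmean P (local_spins sigma y) : R))).
    rewrite exchange_big; apply: ler_sum => y _; rewrite -mulr_suml.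
    case: ifPn => [/existsP[i yi]|_]; last by rewrite mulr_ge0 ?pmean_ge0 ?sumr_ge0.
    rewrite -[leLHS]mul1r ler_wpM2r ?pmean_ge0// (bigD1 i)//= yi.
    by rewrite lerDl sumr_ge0.
  rewrite [leRHS](_ : _ = \sum_(i < K.+1) xi0 * N ^+ K * (1 + t) ^+ K); last first.
    by rewrite sumr_const card_ord mulr_natl.
  apply: ler_sum => i _.
  by have /andP[] := touch_bounds i x.
apply: le_trans (ler_wpM2r _ rhos_le) _; first by rewrite !mulr_ge0 ?exprn_ge0.
have e1 : (1 - t) ^+ K.+1 != 0 by rewrite expf_neq0// gt_eqF// subr_gt0.
have e2 : N ^+ K != 0 by rewrite expf_neq0// gt_eqF.
rewrite le_eqVlt; apply/orP; left; apply/eqP.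
move: ((1 - t) ^+ K.+1) ((1 + t) ^+ K) (N ^+ K) e1 e2 => a c b e1 e2.
have e3 : K.+1%:R != 0 :> R by rewrite pnatr_eq0.
move: (K.+1%:R : R) e3 (gt_eqF xi0_gt0) => k e3 /negbT e4.
by field; rewrite e1 e2 e3 e4.
Qed.

(** Supplies hypothesis [R2], the value of [kappa] being dictated by SYM. *)
Lemma fresh_rate (th : R) M0 : 0 <= th ->
  th * (1 + t) ^+ K.+1 <= (1 - t) ^+ K - q ^+ K * (K%:R * (M0%:R + K%:R)) / N ->
  forall W : seq V, (size W <= M0)%N -> forall tau : {ffun 'I_K -> Omega},
  th * d * (q ^+ K * xi0)^-1 <= rho * K.+1%:R *
    #|[pred c | freshk W c && ([ffun i => sigma (c i)] == tau)]|%:R.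
Proof.
move=> th0 hth W sW tau.
have q0 : 0 < q ^+ K by rewrite exprn_gt0.
have NK0 : 0 < N ^+ K by rewrite exprn_gt0.
have t0 : 0 < (1 + t) ^+ K.+1 by rewrite exprn_gt0// ltr_pwDl.
have f1 : N ^+ K / q ^+ K * (th * (1 + t) ^+ K.+1) <=
    #|[pred c | freshk W c && ([ffun i => sigma (c i)] == tau)]|%:R.
  apply: le_trans (fresh_bound W tau).
  apply: (@le_trans _ _ (N ^+ K / q ^+ K * ((1 - t) ^+ K - q ^+ K * (K%:R * (M0%:R + K%:R)) / N))).
    by rewrite ler_wpM2l// divr_ge0// ltW.
  rewrite mulrBr exprMn expr_div_n lerD2l lerN2.
  rewrite [leRHS](_ : _ = N ^+ K / N * (K%:R * (M0%:R + K%:R))).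
    by rewrite [leLHS]mulrC ler_wpM2l ?divr_ge0// ?(ltW NK0)// ler_wpM2l// lerD2r ler_nat.
  move: (gt_eqF q0) (gt_eqF N_gt0) => /negbT e1 /negbT e2.
  by move: (N ^+ K) (q ^+ K) (N) e1 e2 (K%:R * _) => a b c e1 e2 e; field; rewrite e1 e2.
have r1 : d / (xi0 * N ^+ K * (1 + t) ^+ K.+1) <= rho * K.+1%:R.
  have /andP[_ h] := cmass_bounds.
  rewrite /rho /rhos /rate [leRHS](_ : _ = d * N / cmass P sigma).
    rewrite ler_pdivlMr ?cmass_gt0//; apply: le_trans (ler_wpM2l _ h) _.
      by rewrite divr_ge0 ?mulr_ge0 ?exprn_ge0.
    rewrite le_eqVlt; apply/orP; left; apply/eqP; rewrite [N ^+ K.+1]exprS.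
    move: (gt_eqF t0) (gt_eqF NK0) (gt_eqF xi0_gt0) => /negbT e1 /negbT e2 /negbT e3.
    by move: ((1 + t) ^+ K.+1) (N ^+ K) (N) e1 e2 => a b c e1 e2; field; rewrite e1 e2 e3.
  have e3 : K.+1%:R != 0 :> R by rewrite pnatr_eq0.
  have := gt_eqF (cmass_gt0 P sigma) => /negbT e4.
  by move: (K.+1%:R : R) (cmass _ _) (N) e3 e4 => k c m e3 e4; field; rewrite e3 e4.
apply: le_trans (ler_pM _ _ r1 f1).
- rewrite le_eqVlt; apply/orP; left; apply/eqP.
  move: (gt_eqF t0) (gt_eqF NK0) (gt_eqF xi0_gt0) (gt_eqF q0) => /negbT e1 /negbT e2 /negbT e3 /negbT e4.
  by move: ((1 + t) ^+ K.+1) (N ^+ K) (q ^+ K) e1 e2 e4 => a b c e1 e2 e4; field; rewrite e1 e2 e3 e4.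
- by rewrite divr_ge0 ?mulr_ge0 ?exprn_ge0.
- by rewrite mulr_ge0 ?divr_ge0 ?mulr_ge0 ?exprn_ge0.
Qed.

End balanced_estimates.

(** The normalisation enters the likelihood to a power of order [N], so a bounded change of spins
    must alter it only by a small multiple of [1 / N], relatively. Counted by slots, the
    neighbourhoods that meet [B] have nearly the same weight for both assignments by [touch_bounds];
    meeting [B] twice is of lower order. *)
Lemma cmass_close (t : R) (sigma tau : {ffun V -> Omega}) (B : pred V) : 0 <= t -> t <= 1 ->
  balanced (t / q) sigma -> balanced (t / q) tau -> (forall x, ~~ B x -> sigma x = tau x) ->
  cmass P tau <= cmass P sigma + K.+1%:R * #|B|%:R * (xi0 * N ^+ K * ((1 + t) ^+ K - (1 - t) ^+ K)) +
    2 * K.+1%:R ^+ 2 * #|B|%:R ^+ 2 * (N ^+ K.+1 / N / N).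
Proof.
move=> t0 t1 bs bt st.
pose T (s : {ffun V -> Omega}) := \sum_(y : nbh | [exists i, B (y i)]) pmean P (local_spins s y).
pose S (s : {ffun V -> Omega}) := \sum_(y : nbh) \sum_i ((B (y i))%:R * pmean P (local_spins s y) : R).
have e : cmass P tau - T tau = cmass P sigma - T sigma.
  rewrite !cmassE [X in X - T tau](bigID (fun y : nbh => [exists i, B (y i)])) /=.
  rewrite [X in _ = X - T sigma](bigID (fun y : nbh => [exists i, B (y i)])) /= -/(T tau) -/(T sigma).
  rewrite ![T _ + _]addrC !addrK; apply: eq_bigr => y /existsPn h.
  by congr pmean; apply/ffunP => i; rewrite !ffunE st.
have ind (y : nbh) i : ((B (y i))%:R : R) = \sum_(x | B x) (y i == x)%:R.
  case: (boolP (B (y i))) => Byi.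
    by rewrite (bigD1 (y i))//= eqxx big1 ?addr0// => x /andP[_]; rewrite eq_sym => /negbTE->.
  by rewrite big1// => x Bx; case: eqP => // yx; rewrite yx Bx in Byi.
have SE s : S s = \sum_i \sum_(x | B x) \sum_(y : nbh) ((y i == x)%:R * pmean P (local_spins s y) : R).
  rewrite /S exchange_big; apply: eq_bigr => i _; rewrite exchange_big; apply: eq_bigr => y _.
  by rewrite ind mulr_suml.
have cst_sum (c : R) : \sum_(i < K.+1) \sum_(x | B x) c = K.+1%:R * #|B|%:R * c.
  by rewrite sumr_const card_ord sumr_const -mulrnA -[LHS]mulr_natl natrM [_ * K.+1%:R]mulrC.
have hi : S tau <= K.+1%:R * #|B|%:R * (xi0 * N ^+ K * (1 + t) ^+ K).
  rewrite SE -cst_sum; apply: ler_sum => i _; apply: ler_sum => x _.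
  by have /andP[] := touch_bounds t1 bt i x.
have lo : K.+1%:R * #|B|%:R * (xi0 * N ^+ K * (1 - t) ^+ K) <= S sigma.
  rewrite SE -cst_sum; apply: ler_sum => i _; apply: ler_sum => x _.
  by have /andP[] := touch_bounds t1 bs i x.
have Ttau : T tau <= S tau.
  rewrite /T big_mkcond /=; apply: ler_sum => y _; rewrite -mulr_suml.
  case: ifPn => [/existsP[i yi]|_]; last by rewrite mulr_ge0 ?pmean_ge0 ?sumr_ge0.
  rewrite -[leLHS]mul1r ler_wpM2r ?pmean_ge0// (bigD1 i)//= yi.
  by rewrite lerDl sumr_ge0.
(* [S] counts a neighbourhood once for each slot in [B], [T] only once; [ind_exists_ge] bounds the
   excess by pairs of slots. *)
have Tsigma : S sigma <= T sigma + 2 * K.+1%:R ^+ 2 * #|B|%:R ^+ 2 * (N ^+ K.+1 / N / N).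
  pose Q (y : nbh) := \sum_i \sum_(j | i != j) ((B (y i))%:R * (B (y j))%:R : R).
  have Q0 y : 0 <= Q y by rewrite !sumr_ge0// => i _; rewrite sumr_ge0// => j _; rewrite mulr_ge0.
  apply: (@le_trans _ _ (T sigma + 2 * \sum_y Q y)).
    rewrite /T big_mkcond /= mulr_sumr -big_split /=; apply: ler_sum => y _; rewrite -mulr_suml.
    have := ind_exists_ge R (fun i => B (y i)); rewrite -/(Q y) => h.
    have p0 := pmean_ge0 P (local_spins sigma y); have p2 := pmean_le2 P (local_spins sigma y).
    rewrite lerBlDr in h; apply: le_trans (ler_wpM2r p0 h) _; rewrite mulrDl; apply: lerD.
      by case: ifP; rewrite ?mul1r ?mul0r.
    by rewrite mulrC ler_wpM2r.
  rewrite lerD2l -!mulrA ler_wpM2l// /Q exchange_big /=.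
  apply: (@le_trans _ _ (\sum_(i < K.+1) \sum_(j < K.+1) #|B|%:R ^+ 2 * (N ^+ K.+1 / N / N))).
    apply: ler_sum => i _; rewrite exchange_big big_mkcond /=; apply: ler_sum => j _.
    case: ifPn => ij; last by rewrite mulr_ge0 ?exprn_ge0 ?divr_ge0.
    rewrite (eq_bigr (fun y : nbh => \sum_(x | B x) \sum_(x' | B x') ((y i == x)%:R * (y j == x')%:R : R))).
      rewrite exchange_big (eq_bigr (fun=> #|B|%:R * (N ^+ K.+1 / N / N))).
        by rewrite sumr_const -[leLHS]mulr_natl mulrA expr2.
      move=> x _; rewrite exchange_big (eq_bigr (fun=> N ^+ K.+1 / N / N)).
        by rewrite sumr_const -[LHS]mulr_natl.
      by move=> x' _; rewrite sum_at2.
    by move=> y _; rewrite !ind mulr_suml; apply: eq_bigr => x _; rewrite mulr_sumr.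
  by rewrite !sumr_const !card_ord -mulrnA -[leLHS]mulr_natl natrM expr2 !mulrA.
move: e hi lo Ttau Tsigma; rewrite !mulrBr.
move: (cmass _ _) (cmass _ _) (T _) (T _) (S _) (S _) (2 * _ * _ * _) (_ * (_ * (1 + t) ^+ K)) (_ * (_ * (1 - t) ^+ K)).
by move=> *; lra.
Qed.

End estimates.

(** * The posterior distribution *)

Section conditional_jensen.
Context d (T : measurableType d) (R : realType) (mu : probability T R).

Lemma eq_integral_in (B : set T) (f g : T -> \bar R) : (forall x, B x -> f x = g x) ->
  (\int[mu]_(x in B) f x = \int[mu]_(x in B) g x)%E.
Proof.
move=> h; rewrite (@integral_mkcond _ _ _ mu B f) (@integral_mkcond _ _ _ mu B g).
congr integral; apply/funext => x; rewrite !patchE.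
by case: ifP => //; rewrite inE; exact: h.
Qed.

(** Jensen's inequality for the absolute value, without conditional expectations: [c <= X] and its
    complement belong to [F], on each the sign of [X - c] is constant, and there [X] and [Y] have
    the same integral. With [F = F'] it shows that the choice of version is irrelevant, otherwise
    that less information lowers the deviation. *)
Lemma cond_prob_abs (F F' : set (set T)) (A : set T) (X Y : T -> R) (c : R) :
  F `<=` F' -> F' `<=` measurable ->
  is_cond_prob mu F A X -> is_cond_prob mu F' A Y ->
  (\int[mu]_x `|X x - c|%:E <= \int[mu]_x `|Y x - c|%:E)%E.
Proof.
move=> FF' Fm [mX iX eX] [mY iY eY].
pose B := X @^-1` [set r | c <= r].
have FB : F B.
  by apply: mX; rewrite -set_itvcy; exact: measurable_itv.
have FC : F (~` B).
  have -> : ~` B = X @^-1` [set r | r < c].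
    by apply/seteqP; split=> x /=; rewrite /B /= ltNge => /negP.
  by apply: mX; rewrite -set_itvNyo; exact: measurable_itv.
have mB := Fm _ (FF' _ FB); have mC := Fm _ (FF' _ FC).
have ci D : measurable D -> mu.-integrable D (EFin \o cst c).
  by move=> mD; exact: (finite_measure_integrable_cst mu c mD).
have iS (Z : T -> R) D : measurable D -> mu.-integrable setT (EFin \o Z) -> mu.-integrable D (EFin \o Z).
  by move=> mD iZ; apply: (@integrableS _ _ _ mu setT) => //.
have e1 D : F D -> (\int[mu]_(x in D) (X x - c)%:E = \int[mu]_(x in D) (Y x - c)%:E)%E.
  move=> FD; have mD := Fm _ (FF' _ FD).
  transitivity (\int[mu]_(x in D) (X x)%:E - \int[mu]_(x in D) c%:E)%E.
    exact: (@integralB _ _ _ mu D mD (EFin \o X) (EFin \o cst c) (iS X D mD iX) (ci D mD)).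
  transitivity (\int[mu]_(x in D) (Y x)%:E - \int[mu]_(x in D) c%:E)%E.
    by rewrite eX// eY//; exact: FF'.
  by apply/esym; exact: (@integralB _ _ _ mu D mD (EFin \o Y) (EFin \o cst c) (iS Y D mD iY) (ci D mD)).
have e2 D : F D -> (\int[mu]_(x in D) (c - X x)%:E = \int[mu]_(x in D) (c - Y x)%:E)%E.
  move=> FD; have mD := Fm _ (FF' _ FD).
  transitivity (\int[mu]_(x in D) c%:E - \int[mu]_(x in D) (X x)%:E)%E.
    exact: (@integralB _ _ _ mu D mD (EFin \o cst c) (EFin \o X) (ci D mD) (iS X D mD iX)).
  transitivity (\int[mu]_(x in D) c%:E - \int[mu]_(x in D) (Y x)%:E)%E.
    by rewrite eX// eY//; exact: FF'.
  by apply/esym; exact: (@integralB _ _ _ mu D mD (EFin \o cst c) (EFin \o Y) (ci D mD) (iS Y D mD iY)).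
have mZ (Z : T -> R) : mu.-integrable setT (EFin \o Z) -> measurable_fun setT (fun x => (Z x - c)%:E).
  move=> iZ; apply/measurable_EFinP; apply: measurable_funB => //.
  by apply/measurable_EFinP; exact: measurable_int iZ.
have split_int (Z : T -> R) : mu.-integrable setT (EFin \o Z) -> (\int[mu]_x `|Z x - c|%:E =
    \int[mu]_(x in B) `|Z x - c|%:E + \int[mu]_(x in ~` B) `|Z x - c|%:E)%E.
  move=> iZ; rewrite -(setUv B) (ge0_integral_setU mu mB mC (f := fun x => `|Z x - c|%:E))//.
    have := mZ Z iZ; rewrite setUv => h; apply/measurable_EFinP; apply: measurableT_comp => //.
    exact/measurable_EFinP.
  by apply/disj_setPCl.
rewrite (split_int X iX) (split_int Y iY); apply: leeD.
- rewrite [leLHS](_ : _ = \int[mu]_(x in B) (X x - c)%:E)%E; last first.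
    by apply: eq_integral_in => x cx; rewrite ger0_norm ?subr_ge0.
  rewrite e1//; apply: le_trans (lee_abs _) _.
  apply: (le_abse_integral mu mB); exact: (measurable_funS measurableT _ (mZ Y iY)).
- rewrite [leLHS](_ : _ = \int[mu]_(x in ~` B) (c - X x)%:E)%E; last first.
    apply: eq_integral_in => x /negP; rewrite -ltNge => cx.
    by rewrite ltr0_norm ?subr_lt0// opprB.
  rewrite e2//; apply: le_trans (lee_abs _) _.
  rewrite [leRHS](_ : _ = \int[mu]_(x in ~` B) `|(c - Y x)%:E|)%E; last first.
    by congr integral; apply/funext => x; rewrite distrC.
  apply: (le_abse_integral mu mC); apply: (measurable_funS measurableT) => //.
  apply/measurable_EFinP; apply: measurable_funB => //.
  by apply/measurable_EFinP; exact: measurable_int iY.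
Qed.

End conditional_jensen.

(** A discrete tower property: the ratio is constant on each class of [e], and its weighted sum over
    the class returns the weight of [a] in that class. *)
Lemma bayes_sum (R : realFieldType) (T : finType) (e : rel T) (v : T -> R) (a b : pred T) :
  (forall x, e x x) -> symmetric e -> transitive e -> (forall x, 0 < v x) ->
  (forall x z, e x z -> b x = b z) ->
  \sum_x v x * ((\sum_(z | e x z && a z) v z) / (\sum_(z | e x z) v z) * (b x)%:R) =
  \sum_x v x * (a x && b x)%:R.
Proof.
move=> er es et v0 be.
have eqE x z : e x z -> e x =1 e z.
  by move=> xz u; apply/idP/idP; apply: et => //; rewrite es.
transitivity (\sum_x \sum_(z | e x z && a z) v z * (b z)%:R * (v x / \sum_(u | e z u) v u)).
  apply: eq_bigr => x _; have h (A Z c f : R) : c * (A / Z * f) = A * (c * f / Z) by ring.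
  rewrite h mulr_suml.
  apply: eq_bigr => z /andP[xz _]; rewrite (be _ _ xz).
  rewrite (eq_bigl (e z)) => [|u]; last exact: eqE.
  by move: ((\sum_(_ | _) _)^-1) => *; ring.
rewrite (exchange_big_dep a) /=; last by move=> x z _ /andP[].
rewrite big_mkcond /=; apply: eq_bigr => z _; case: (a z) => /=; last by rewrite mulr0.
rewrite -mulr_sumr -mulr_suml (eq_bigl (e z)); last by move=> x; rewrite andbT es.
rewrite divff ?mulr1// gt_eqF// (bigD1 z)//= ltr_pwDl// sumr_ge0// => u _; exact: ltW.
Qed.
Section posterior.
Variables (R : realType) (Omega : finPointedType) (K n : nat).
Notation weight := (weight R Omega K.+1).
Notation V := 'I_n.+1.
Notation nbh := {ffun 'I_K.+1 -> 'I_n.+1}.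
Notation con := (nbh * weight)%type.
Notation sample := ({ffun 'I_n.+1 -> Omega} * seq con)%type.
Notation q := (#|Omega|%:R : R).
Variables (P : probability weight R) (d : R).
Hypothesis d_gt0 : (0 < d)%R.
Implicit Types (sigma tau : {ffun V -> Omega}) (g : seq con) (l : nat) (y : V) (s : Omega).

Notation lik := (likelihood P d).
Notation mu := (teacher_law P d n : probability _ R).

Lemma likelihood_gt0 sigma g : 0 < lik sigma g.
Proof. by rewrite mulr_gt0 ?wprod_gt0// exprn_gt0// divr_gt0 ?rate_gt0 ?cmass_gt0. Qed.

(** Bayes' formula with uniform prior: for a fixed graph, [far] is an equivalence relation, and
    observing the far spins selects a class. *)
Definition post l y s sigma g : R :=
  (\sum_(tau | far (map fst g) l y sigma tau && (tau y == s)) lik tau g) /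
  (\sum_(tau | far (map fst g) l y sigma tau) lik tau g).

Lemma far_refl (ns : seq nbh) l y sigma : far ns l y sigma sigma.
Proof. by apply/forallP => z; rewrite eqxx implybT. Qed.

Lemma far_sym (ns : seq nbh) l y : symmetric (far ns l y : rel {ffun V -> Omega}).
Proof. by move=> sigma tau; apply: eq_forallb => z; rewrite eq_sym. Qed.

Lemma far_trans (ns : seq nbh) l y : transitive (far ns l y : rel {ffun V -> Omega}).
Proof.
move=> b a c /forallP h1 /forallP h2; apply/forallP => z; apply/implyP => nz.
by rewrite (eqP (implyP (h2 z) nz)) (eqP (implyP (h1 z) nz)).
Qed.

Lemma eq_post l y s sigma tau g : far (map fst g) l y sigma tau ->
  post l y s sigma g = post l y s tau g.
Proof.
move=> h; have e : far (map fst g) l y sigma =1 far (map fst g) l y tau.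
  by move=> u; apply/idP/idP; apply: far_trans => //; rewrite far_sym.
by rewrite /post; congr (_ / _); apply: eq_bigl => u; rewrite e.
Qed.

Lemma post01 l y s sigma g : 0 <= post l y s sigma g <= 1.
Proof.
have p tau : 0 <= lik tau g by exact/ltW/likelihood_gt0.
rewrite /post divr_ge0 ?sumr_ge0//= ler_pdivrMr ?mul1r.
  rewrite [leRHS](bigID (fun tau : {ffun V -> Omega} => tau y == s)) /= lerDl.
  by rewrite sumr_ge0.
rewrite (bigD1 sigma) ?far_refl//= ltr_pwDl ?likelihood_gt0//.
by rewrite sumr_ge0.
Qed.

Lemma measurable_pred_fst (Q : pred (seq nbh)) : measurable [set g : seq con | Q (map fst g)].
Proof.
have := @measurable_map_fst R Omega K n (fun ns => (Q ns)%:R) measurableT [set 1] (measurable_set1 1).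
rewrite setTI; congr measurable; apply/seteqP; split=> g /=; case: (Q _) => //= /eqP.
by rewrite eq_sym oner_eq0.
Qed.

Lemma measurable_postg l y s sigma : measurable_fun setT (post l y s sigma).
Proof.
rewrite (_ : post l y s sigma = fun g =>
  (\sum_(tau | far (map fst g) l y sigma tau && (tau y == s)) lik tau g) *
  (GRing.inv \o (fun g => \sum_(tau | far (map fst g) l y sigma tau) lik tau g)) g)//.
apply: measurable_funM.
  exact: (measurable_sum_wprod (fun ns tau => far ns l y sigma tau && (tau y == s)) (rhos P d)).
apply: measurableT_comp; first exact: measurable_invr.
exact: (measurable_sum_wprod (fun ns tau => far ns l y sigma tau) (rhos P d)).
Qed.

Lemma measurable_sample (f : sample -> R) :
  (forall sigma, measurable_fun setT (fun g => f (sigma, g))) -> measurable_fun setT f.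
Proof. by move=> h; apply: measurable_finprod => //; exact: finite_finset. Qed.

Definition nabla_gens l y : set (set sample) :=
  [set A : set sample | exists2 B, measurable B & A = snd @^-1` B] `|`
  [set A : set sample | exists (z : V) (omega : Omega), A =
     [set x : sample | @fg_dist_ge _ _ _ (list_graph x.2) y z (2 * l) /\ x.1 z = omega]].

Lemma measurable_snd_preimage (B : set (seq con)) : measurable B ->
  measurable (snd @^-1` B : set sample).
Proof.
move=> mB; have h : measurable_fun setT (snd : sample -> seq con) by exact: measurable_snd.
by have := h measurableT B mB; rewrite setTI.
Qed.

Lemma measurable_spin y s : measurable [set x : sample | x.1 y = s].
Proof.
have h : measurable_fun setT (fst : sample -> {ffun V -> Omega}) by exact: measurable_fst.
by have := h measurableT [set u | u y = s] Logic.I; rewrite setTI.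
Qed.

Let farz l y z : set (seq con) := [set g | ~~ inball (map fst g) l y z].

Let mfarz l y z : measurable (farz l y z).
Proof. exact: (measurable_pred_fst (fun ns => ~~ inball ns l y z)). Qed.

Let gen l y z omega : set sample := [set x : sample | farz l y z x.2] `&` [set x : sample | x.1 z = omega].

Let genE l y z omega : [set x : sample | @fg_dist_ge _ _ _ (list_graph x.2) y z (2 * l) /\ x.1 z = omega] =
  gen l y z omega.
Proof.
apply/seteqP; split=> x /= [h1 h2]; split=> //.
  by rewrite /farz /= -(dist_near (presents_list x.2)).
by rewrite (dist_near (presents_list x.2)).
Qed.

Lemma nabla_gens_measurable l y : nabla_gens l y `<=` measurable.
Proof.
move=> A [[B mB ->]|[z [omega ->]]].
  exact: measurable_snd_preimage.
rewrite genE; apply: measurableI.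
  exact: (measurable_snd_preimage (mfarz l y z)).
exact: measurable_spin.
Qed.

Lemma nabla_measurable l y : nabla_star l y `<=` (measurable : set (set sample)).
Proof. by apply: smallest_sub; [exact: sigma_algebra_measurable|exact: nabla_gens_measurable]. Qed.

Section as_measurable.
Variables (l : nat) (y : V).
Let S := g_sigma_algebraType (nabla_gens l y).

Lemma nabla_snd (B : set (seq con)) : measurable B -> nabla_star l y (snd @^-1` B : set sample).
Proof. by move=> mB; apply: sub_sigma_algebra; left; exists B. Qed.

Lemma nabla_spin z omega : nabla_star l y (gen l y z omega).
Proof. by apply: sub_sigma_algebra; right; exists z, omega; rewrite genE. Qed.

Lemma nabla_I (A B : set sample) : nabla_star l y A -> nabla_star l y B -> nabla_star l y (A `&` B).
Proof. exact: (@measurableI _ S). Qed.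

Lemma nabla_U (A B : set sample) : nabla_star l y A -> nabla_star l y B -> nabla_star l y (A `|` B).
Proof. exact: (@measurableU _ S). Qed.

Lemma nabla_bigcup (A : {ffun V -> Omega} -> set sample) :
  (forall i, nabla_star l y (A i)) -> nabla_star l y (\bigcup_i A i).
Proof. by move=> h; apply: (@fin_bigcup_measurable _ S _ setT A) => [|i _]; [exact: finite_finset|exact: h]. Qed.

Lemma nabla_bigcap (A : V -> set sample) :
  (forall i, nabla_star l y (A i)) -> nabla_star l y (\bigcap_i A i).
Proof. by move=> h; apply: (@fin_bigcap_measurable _ S _ setT A) => [|i _]; [exact: finite_finset|exact: h]. Qed.

End as_measurable.

(** A spin observed at the larger distance is also observed at the smaller one; that the distance is
    large is a property of the graph, which belongs to both sigma-algebras. *)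
Lemma nabla_mono l y : nabla_star l.+1 y `<=` (nabla_star l y : set (set sample)).
Proof.
apply: smallest_sub; first exact: smallest_sigma_algebra.
move=> A [[B mB ->]|[z [omega ->]]]; first exact: nabla_snd.
rewrite genE (_ : gen l.+1 y z omega = (snd @^-1` farz l.+1 y z) `&` gen l y z omega).
  by apply: nabla_I; [exact: nabla_snd|exact: nabla_spin].
apply/seteqP; split=> x /= [h1 h2]; last by case: h2.
by split=> //; split=> //; apply: contra h1; exact: near_le.
Qed.

(** The sets that do not separate samples with the same graph and the same far spins form a
    sigma-algebra containing the generators. *)
Lemma nabla_inv l y (B : set sample) : nabla_star l y B ->
  forall g sigma tau, far (map fst g) l y sigma tau -> B (sigma, g) -> B (tau, g).
Proof.
move=> nB; suff [_ h] : measurable B /\ (forall g sigma tau, far (map fst g) l y sigma tau ->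
    (B (sigma, g) <-> B (tau, g))) by move=> g sigma tau f; case: (h g sigma tau f).
move: B nB; apply: smallest_sub.
  split=> [|A [mA hA]|F hF].
  - by split=> //; exact: measurable0.
  - rewrite setTD; split; first exact: measurableC.
    by move=> g sigma tau f; have [h1 h2] := hA g sigma tau f; split=> nA hA'; apply: nA; [exact: h2|exact: h1].
  - split; first by apply: bigcupT_measurable => i; case: (hF i).
    by move=> g sigma tau f; split=> -[i _ Fi]; exists i => //; have [h1 h2] := (hF i).2 g sigma tau f; auto.
move=> A gA; split; first exact: (nabla_gens_measurable gA).
case: gA => [[B mB ->]|[z [omega ->]]] g sigma tau f //.
rewrite genE /gen /farz /=; split=> -[h1 h2]; split=> //=; rewrite -h2.
  exact: (eqP (implyP (forallP f z) h1)).
exact/esym/(eqP (implyP (forallP f z) h1)).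
Qed.

Lemma teacher_likelihood (F : sample -> \bar R) : nnmeas F ->
  (\int[mu]_x F x = (#|{ffun V -> Omega}|%:R^-1)%:E * ((expR (- rate K n d))%:E *
    expL (refL P) (fun g => \sum_sigma (lik sigma g)%:E * F (sigma, g))))%E.
Proof.
move=> mF; rewrite teacher_integral//; congr (_ * _)%E.
have mFs sigma : nnmeas (fun g => F (sigma, g)) by exact: (nnmeas_comp (measurable_pairl sigma) mF).
have mL sigma : nnmeas (fun g => (lik sigma g)%:E * F (sigma, g))%E.
  by apply: nnmeasM => //; exact: nnmeas_likelihood.
have HE : is_integral (expL (@refL R Omega K n P)).
  apply: (il_exp (il_refL n P) (m := fine (@refL R Omega K n P (cst 1%E)))); rewrite fineK// ge0_fin_numE.
    exact: (il_fin (il_refL n P)).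
  by apply: (il_ge0 (il_refL n P)); exact: nnmeas_cst.
rewrite (il_sum HE)// ge0_sume_distrr; last by move=> sigma _; exact: (il_ge0 HE).
by apply: eq_bigr => sigma _; rewrite ppp_likelihood.
Qed.

(** For measurability, a preimage is decomposed over the finitely many assignments [sigma] that the
    far spins may agree with, each piece being built from generators. For the averaging identity,
    both sides are written with likelihoods, and the integrands agree for each graph by
    [bayes_sum]. *)
Lemma is_cond_prob_post l y s :
  is_cond_prob mu (nabla_star l y) [set x : sample | x.1 y = s] (fun x => post l y s x.1 x.2).
Proof.
have mpost : measurable_fun setT (fun x : sample => post l y s x.1 x.2).
  by apply: measurable_sample => sigma; exact: measurable_postg.
have mA := measurable_spin y s.
split.
- move=> B mB.
  have -> : (fun x : sample => post l y s x.1 x.2) @^-1` B =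
    \bigcup_(sigma : {ffun V -> Omega}) ((snd @^-1` (post l y s sigma @^-1` B)) `&`
      \bigcap_(z : V) ((snd @^-1` ~` farz l y z) `|` gen l y z (sigma z))).
    apply/seteqP; split=> [[sigma g] /= Bp|[tau g] [sigma _ [/= Bp far_st]]].
      exists sigma => //; split=> // z _; rewrite /gen /farz /=.
      by case: (boolP (inball _ _ _ _)) => h; [left; apply/negP; rewrite negbK|right].
    suff -> : post l y s tau g = post l y s sigma g by [].
    apply/esym/eq_post; apply/forallP => z; apply/implyP => nz.
    by have [/=|[_ /= ->]] := far_st z I.
  apply: nabla_bigcup => sigma; apply: nabla_I.
    apply: nabla_snd; rewrite -[X in measurable X]setTI; exact: (measurable_postg l y s sigma measurableT mB).
  apply: nabla_bigcap => z; apply: nabla_U; last exact: nabla_spin.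
  by apply: nabla_snd; exact: measurableC.
- apply: (@le_integrable _ _ _ mu _ measurableT _ (EFin \o cst 1)).
  + exact/measurable_EFinP.
  + by move=> x _ /=; rewrite lee_fin normr1 ger0_norm; case/andP: (post01 l y s x.1 x.2).
  + exact: (finite_measure_integrable_cst mu 1 measurableT).
- move=> B nB; have mB := nabla_measurable nB.
  rewrite integral_mkcond.
  rewrite (_ : _ \_ B = fun x : sample => (post l y s x.1 x.2 * \1_B x)%:E); last first.
    apply/funext => x; rewrite patchE indicE; case: ifP => _; by rewrite ?mulr1 ?mulr0.
  transitivity (\int[mu]_x (\1_([set x : sample | x.1 y = s] `&` B) x)%:E)%E; last first.
    by rewrite (integral_indic mu measurableT) ?setIT//; exact: measurableI.
  have m1 : nnmeas (fun x : sample => (post l y s x.1 x.2 * \1_B x)%:E).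
    split=> [|x]; last by rewrite lee_fin mulr_ge0//; case/andP: (post01 l y s x.1 x.2).
    by apply/measurable_EFinP; apply: measurable_funM => //; exact: measurable_indic.
  have m2 : nnmeas (fun x : sample => (\1_([set x : sample | x.1 y = s] `&` B) x)%:E : \bar R).
    split=> [|x]; last by rewrite lee_fin.
    by apply/measurable_EFinP; apply: measurable_indic; exact: measurableI.
  rewrite [LHS](teacher_likelihood m1) [RHS](teacher_likelihood m2).
  congr (_ * (_ * expL _ _))%E; apply/funext => g.
  rewrite (eq_bigr (fun sigma => (lik sigma g * (post l y s sigma g * \1_B (sigma, g)))%:E)); last first.
    by move=> sigma _; rewrite EFinM.
  rewrite [RHS](eq_bigr (fun sigma => (lik sigma g * ((sigma y == s) && ((sigma, g) \in B))%:R)%:E)); last first.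
    move=> sigma _; rewrite -EFinM indicE; congr (_ * _%:R)%:E; congr nat_of_bool.
    apply/idP/andP => [|[/eqP h1 h2]]; last by rewrite inE; split=> //; rewrite inE in h2.
    by rewrite inE => -[/= -> hB]; split; rewrite ?inE.
  rewrite !sumEFin; congr (_%:E).
  rewrite -(@bayes_sum R _ (far (map fst g) l y) (lik ^~ g) (fun tau => tau y == s) (fun tau => (tau, g) \in B)).
  + by apply: eq_bigr => sigma _; rewrite indicE.
  + exact: far_refl.
  + exact: far_sym.
  + exact: far_trans.
  + by move=> sigma; exact: likelihood_gt0.
  + move=> sigma tau f; apply/idP/idP; rewrite !inE; apply: (nabla_inv nB) => //.
    by rewrite far_sym.
Qed.

Lemma teacher_corr_post l : teacher_corr P d l n =
  ((n.+1%:R^-1)%:E * \sum_(y < n.+1) \sum_(s : Omega) \int[mu]_x `|post l y s x.1 x.2 - q^-1|%:E)%E.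
Proof.
congr (_ * _)%E; apply: eq_bigr => y _; apply: eq_bigr => s _; apply/eqP.
have mA := measurable_spin y s.
have h1 := is_cond_prob_cond_prob mu (@nabla_gens_measurable l y) mA.
have h2 := is_cond_prob_post l y s; have nm := @nabla_measurable l y.
rewrite eq_le; apply/andP; split.
  exact: (cond_prob_abs _ (fun A h => h) nm h1 h2).
exact: (cond_prob_abs _ (fun A h => h) nm h2 h1).
Qed.

Lemma teacher_corr_mono l : (teacher_corr P d l.+1 n <= teacher_corr P d l n)%E.
Proof.
rewrite !teacher_corr_post; apply: lee_wpmul2l; first by rewrite lee_fin invr_ge0.
apply: lee_sum => y _; apply: lee_sum => s _.
exact: (cond_prob_abs _ (@nabla_mono l y) (@nabla_measurable l y) (is_cond_prob_post l.+1 y s) (is_cond_prob_post l y s)).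
Qed.

End posterior.

(** * The probability of a simple graph *)

(** Markov's inequality for a Poisson variable of mean [m], carried out on finite sums through j
    p(j) = m p(j - 1), with an arbitrarily small error [e] for the tail. *)
Lemma poisson_head (R : realType) (m : R) J : 0 < m -> 1 - m / J.+1%:R <= \sum_(j < J.+1) poisson_pmf m j.
Proof.
move=> m0; apply/ler_addgt0Pr => e e0.
have p0 j : 0 <= poisson_pmf m j by exact: poisson_pmf_ge0.
have [D hD] := poisson_partial m0 e0.
have mean M : \sum_(j < M.+1) j%:R * poisson_pmf m j = m * \sum_(j < M) poisson_pmf m j.
  rewrite big_ord_recl mul0r add0r mulr_sumr; apply: eq_bigr => j _ /=.
  rewrite /poisson_pmf m0 /bump /= add1n factS natrM exprS.
  have f0 : j`!%:R != 0 :> R by rewrite pnatr_eq0 -lt0n fact_gt0.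
  have j0 : j.+1%:R != 0 :> R by rewrite pnatr_eq0.
  by move: (j.+1%:R : R) (j`!%:R : R) (expR _) (m ^+ j) f0 j0 => a b c f b0 a0; field; rewrite a0 b0.
have le1 M : \sum_(j < M) poisson_pmf m j <= 1.
  rewrite -lee_fin -(poisson_pmf_sum1 m0) -sumEFin -(big_mkord xpredT (fun j => (poisson_pmf m j)%:E)).
  by apply: nneseries_lim_ge => j _; rewrite lee_fin.
have J0 : 0 < J.+1%:R :> R by [].
pose M := maxn D J.+1.
have h1 : 1 - e <= \sum_(j < M.+1) poisson_pmf m j.
  apply: le_trans hD _; rewrite -(big_mkord xpredT (poisson_pmf m)) -(big_mkord xpredT (poisson_pmf m)).
  rewrite [leRHS](@big_cat_nat _ _ _ D)//=; last by rewrite leqW// leq_maxl.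
  by rewrite lerDl sumr_ge0.
have h2 : \sum_(j < M.+1) poisson_pmf m j <= \sum_(j < J.+1) poisson_pmf m j + m / J.+1%:R.
  rewrite -(big_mkord xpredT (poisson_pmf m)) -[X in _ <= X + _](big_mkord xpredT (poisson_pmf m)).
  rewrite [leLHS](@big_cat_nat _ _ _ J.+1)//=; last by rewrite leqW// leq_maxr.
  rewrite lerD2l ler_pdivlMr// mulr_suml.
  apply: (@le_trans _ _ (\sum_(J.+1 <= j < M.+1) j%:R * poisson_pmf m j)).
    rewrite big_nat [leRHS]big_nat; apply: ler_sum => j /andP[Jj _].
    by rewrite mulrC ler_wpM2r// ler_nat.
  apply: (@le_trans _ _ (\sum_(j < M.+1) j%:R * poisson_pmf m j)); last first.
    by rewrite mean -[leRHS]mulr1 ler_wpM2l// ltW.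
  rewrite -(big_mkord xpredT (fun j => j%:R * poisson_pmf m j)).
  rewrite [leRHS](@big_cat_nat _ _ _ J.+1)//=; last by rewrite leqW// leq_maxr.
  by rewrite lerDr sumr_ge0// => j _; rewrite mulr_ge0.
by move: (\sum_(j < M.+1) _) (\sum_(j < J.+1) _) (m / _) h1 h2 => *; lra.
Qed.

Section simple_probability.
Variables (R : realType) (Omega : finPointedType) (K n : nat).
Notation weight := (weight R Omega K.+1).
Notation V := 'I_n.+1.
Notation nbh := {ffun 'I_K.+1 -> 'I_n.+1}.
Notation con := (nbh * weight)%type.
Notation q := (#|Omega|%:R : R).
Notation N := (n.+1%:R : R).
Variables (P : probability weight R) (xi0 d : R) (sigma : {ffun V -> Omega}).
Hypotheses (K_gt0 : (0 < K)%N) (xi0_gt0 : 0 < xi0) (d_gt0 : 0 < d).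
Hypothesis symP : forall (i : 'I_K.+1) omega,
  \sum_(tau : {ffun 'I_K.+1 -> Omega} | tau i == omega) pmean P tau = q ^+ K * xi0.
Hypothesis bal : balanced (1 / 2 / q) sigma.

Let rho := rhos P d sigma.
Let rho_ge0 : 0 <= rho. Proof. exact: rhos_ge0. Qed.
Let N_gt0 : 0 < N. Proof. by []. Qed.

Definition simple_c1 : R := d / (K.+1%:R * xi0 * (1 - 1 / 2) ^+ K.+1).

Let c1_ge0 : 0 <= simple_c1.
Proof. by rewrite divr_ge0 ?mulr_ge0 ?exprn_ge0 ?ltW//; lra. Qed.

Let rho_le : rho <= simple_c1 / N ^+ K.
Proof. by apply: (rhos_le xi0_gt0 symP _ bal d_gt0); lra. Qed.

Let imass_card (A : pred nbh) (c : R) : (\sum_y (A y)%:R : R) <= c -> imass P rho sigma A <= rho * (2 * c).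
Proof.
move=> h; rewrite imassE// ler_wpM2l// big_mkcond /=.
apply: (@le_trans _ _ (\sum_y 2 * (A y)%:R)); last by rewrite -mulr_sumr ler_wpM2l.
by apply: ler_sum => y _; case: (A y); rewrite ?mulr1 ?mulr0// pmean_le2.
Qed.

(** A bound, uniform in n, on the intensity of constraints that would spoil simplicity when at most
    [2 * rate] others are present: the first term is for repeated neighbours, the second for a
    repeated neighbour set. *)
Definition simple_c2 : R := 2 * K.+1%:R ^+ 2 * simple_c1 +
  2 * K.+1%:R ^+ K.+1 * simple_c1 * (2 * d / K.+1%:R).

Let k4_ge0 : 0 <= 2 * K.+1%:R ^+ K.+1 * simple_c1 * (2 * d / K.+1%:R) :> R.
Proof.
apply: mulr_ge0; last by rewrite divr_ge0 ?mulr_ge0// ltW.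
by apply: mulr_ge0 => //; rewrite mulr_ge0 ?exprn_ge0.
Qed.

Lemma simple_c2_ge0 : 0 <= simple_c2.
Proof.
by apply: addr_ge0 => //; apply: mulr_ge0.
Qed.

Definition bad_nbh (ns : seq nbh) : pred nbh := fun y => ~~ injectiveb y || (nset y \in map (@nset K n) ns).

Let card_noninj : (\sum_(y : nbh) (~~ injectiveb y)%:R : R) <= K.+1%:R ^+ 2 * N ^+ K.
Proof.
apply: (@le_trans _ _ (\sum_(y : nbh) \sum_i \sum_(j | i != j) ((y i == y j)%:R : R))).
  apply: ler_sum => y _; have s0 i : 0 <= \sum_(j | i != j) ((y i == y j)%:R : R) by rewrite sumr_ge0.
  case: (boolP (injectiveb y)) => [_|/injectivePn[i [j ij yij]]] /=; first by rewrite sumr_ge0.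
  by rewrite (bigD1 i)//= (bigD1 j)//= yij eqxx -addrA lerDl addr_ge0// sumr_ge0.
rewrite exchange_big /=.
apply: (@le_trans _ _ (\sum_(i < K.+1) \sum_(j < K.+1) N ^+ K)); last first.
  by rewrite !sumr_const !card_ord -mulrnA -[leLHS]mulr_natl natrM expr2.
apply: ler_sum => i _; rewrite exchange_big big_mkcond /=; apply: ler_sum => j _.
case: ifPn => ij; last by rewrite exprn_ge0.
by rewrite sum_eq2// exprSr mulfK// gt_eqF.
Qed.

Let card_nset (B : {set V}) : (#|B| <= K.+1)%N ->
  (\sum_(y : nbh) (nset y == B)%:R : R) <= K.+1%:R ^+ K.+1.
Proof.
move=> hB; apply: (@le_trans _ _ (\sum_(y : nbh) \prod_i ((y i \in B)%:R : R))).
  apply: ler_sum => y _; case: eqP => [<-|_]; last by apply: prodr_ge0.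
  by rewrite big1// => i _; rewrite imset_f.
rewrite -(bigA_distr_bigA (fun (_ : 'I_K.+1) z => ((z \in B)%:R : R))) /=.
rewrite prodr_const card_ord lerXn2r ?nnegrE ?sumr_ge0//.
by rewrite -natr_sum ler_nat -big_mkcond /= sum1_card.
Qed.

Lemma bad_imass (ns : seq nbh) : (size ns)%:R <= 2 * rate K n d -> imass P rho sigma (bad_nbh ns) <= simple_c2.
Proof.
move=> sz.
apply: (@le_trans _ _ (rho * (2 * (K.+1%:R ^+ 2 * N ^+ K + (size ns)%:R * K.+1%:R ^+ K.+1)))).
  apply: imass_card.
  apply: (@le_trans _ _ (\sum_(y : nbh) ((~~ injectiveb y)%:R + \sum_(u <- ns) (nset y == nset u)%:R : R))).
    apply: ler_sum => y _; rewrite /bad_nbh; have s0 : 0 <= \sum_(u <- ns) ((nset y == nset u)%:R : R) by rewrite sumr_ge0.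
    case: (injectiveb y) => /=; last by rewrite lerDl.
    rewrite add0r; case: (boolP (nset y \in _)) => // /mapP[u uns e].
    by rewrite (big_rem u)//= e eqxx lerDl sumr_ge0.
  rewrite big_split /=; apply: lerD => //; rewrite exchange_big /=.
  apply: (@le_trans _ _ (\sum_(u <- ns) K.+1%:R ^+ K.+1)); last first.
    by rewrite big_const_seq count_predT iter_addr_0 -[leLHS]mulr_natl.
  by apply: ler_sum => u _; apply: card_nset; apply: leq_trans (leq_imset_card _ _) _; rewrite cardT size_enum_ord.
have NK0 : 0 < N ^+ K by rewrite exprn_gt0.
rewrite mulrDr mulrDr /simple_c2; apply: lerD.
  apply: le_trans (ler_wpM2r _ rho_le) _; first by rewrite !mulr_ge0 ?exprn_ge0.
  rewrite le_eqVlt; apply/orP; left; apply/eqP.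
  move: (gt_eqF NK0) => /negbT; move: (N ^+ K) simple_c1 (K.+1%:R ^+ 2 : R) => a b c a0; by field.
apply: (@le_trans _ _ (simple_c1 / N ^+ K * (2 * (2 * rate K n d * K.+1%:R ^+ K.+1)))).
  have b0 : 0 <= 2 * ((size ns)%:R * K.+1%:R ^+ K.+1) :> R by rewrite mulr_ge0// mulr_ge0// exprn_ge0.
  apply: (ler_pM rho_ge0 b0 rho_le).
  by rewrite ler_wpM2l// ler_wpM2r// exprn_ge0.
(* A number of present constraints of order [N], against an intensity of order [1 / N ^+ K] per
   neighbourhood: bounded since [K > 0]. *)
have NKN : N / N ^+ K <= 1.
  by rewrite ler_pdivrMr// mul1r ler_eXnr ?ler1n.
rewrite /rate [leLHS](_ : _ = 2 * K.+1%:R ^+ K.+1 * simple_c1 * (2 * d / K.+1%:R) * (N / N ^+ K)).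
  by rewrite ler_piMr.
have k0 : K.+1%:R != 0 :> R by rewrite pnatr_eq0.
move: (gt_eqF NK0) => /negbT; move: (N ^+ K) simple_c1 (K.+1%:R ^+ K.+1 : R) (K.+1%:R : R) (N) k0 => a b c e f k0 a0.
by field; rewrite a0 k0.
Qed.

Let L := ilaw P rho sigma (avoid [::]).

Let L_pred (A : pred nbh) : L (fun a => ((A a.1)%:R)%:E) = (imass P rho sigma A)%:E.
Proof.
rewrite -(ilaw1 _ _ rho_ge0) /L /ilaw (eq_bigl xpredT); last by move=> y; apply/forallP.
rewrite [RHS]big_mkcond /=; apply: eq_bigr => y _; case: (A y) => //.
have := il_cst (il_prob P) (lexx 0%E); rewrite mul0e => <-.
by congr integral; apply/funext => psi; rewrite mule0.
Qed.

Let m0 : R := rate K n d - simple_c2.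

Hypothesis m0_gt0 : 0 < m0.

(** Constraints are added one at a time; as long as there are at most [2 * rate], each has
    admissible choices of mass at least [m0]. *)
Lemma iterL_simpl j (ns : seq nbh) : simpl ns -> (size ns + j)%:R <= 2 * rate K n d ->
  ((m0 ^+ j)%:E <= iterL L j (fun g => ((simpl (ns ++ map fst g))%:R)%:E))%E.
Proof.
elim: j ns => [|j IH] ns sns sz /=; first by rewrite cats0 sns expr0.
have mS (ms : seq nbh) : nnmeas (fun g : seq con => ((simpl (ms ++ map fst g))%:R)%:E : \bar R).
  split=> [|g]; last by rewrite lee_fin.
  by apply/measurable_EFinP; exact: (measurable_map_fst (fun ks => (simpl (ms ++ ks))%:R)).
have HL := il_ilaw P sigma rho_ge0 (avoid [::]).
have mGd : nnmeas (fun a : con => ((~~ bad_nbh ns a.1)%:R)%:E : \bar R).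
  split=> [|a]; last by rewrite lee_fin.
  apply: (measurable_finprod (f := fun a : con => ((~~ bad_nbh ns a.1)%:R)%:E : \bar R)) => [||u].
  - exact: finite_finset.
  - by [].
  - exact: (measurable_cst (((~~ bad_nbh ns u)%:R)%:E : \bar R)).
apply: (@le_trans _ _ (L (fun a => (m0 ^+ j)%:E * ((~~ bad_nbh ns a.1)%:R)%:E)))%E.
  rewrite /L (ilZ HL) ?lee_fin ?exprn_ge0 ?(ltW m0_gt0)// -/L.
  rewrite (L_pred (fun y => ~~ bad_nbh ns y)) -EFinM lee_fin exprSr ler_wpM2l ?exprn_ge0 ?(ltW m0_gt0)//.
  have e1 : imass P rho sigma (predI (avoid [::]) (bad_nbh ns)) = imass P rho sigma (bad_nbh ns).
    by rewrite !imassE//; congr (_ * _); apply: eq_bigl => y /=; rewrite (_ : avoid [::] y)//; apply/forallP.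
  have e2 : imass P rho sigma (predD (avoid [::]) (bad_nbh ns)) = imass P rho sigma (fun y => ~~ bad_nbh ns y).
    by rewrite !imassE//; congr (_ * _); apply: eq_bigl => y /=; rewrite (_ : avoid [::] y) ?andbT//; apply/forallP.
  have tot := imass_total P d_gt0 sigma; rewrite -/rho (imass_split _ _ rho_ge0 (avoid [::]) (bad_nbh ns)) in tot.
  rewrite e1 e2 in tot; rewrite /m0 -tot lerBlDr addrC lerD2l.
  by apply: bad_imass; apply: le_trans sz; rewrite ler_nat leq_addr.
apply: (il_le HL).
- by apply: nnmeasZ; rewrite ?lee_fin ?exprn_ge0 ?(ltW m0_gt0).
- exact: (il_meas (il_iter HL j) (nnmeas_cons2 (mS ns))).
move=> a; case: (boolP (bad_nbh ns a.1)) => bd /=.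
  rewrite mule0; apply: (il_ge0 (il_iter HL j)).
  exact: (nnmeas_comp (measurable_pairl a) (nnmeas_cons2 (mS ns))).
rewrite mule1; move: bd; rewrite negb_or negbK => /andP[inj nin].
have := IH (rcons ns a.1); rewrite size_rcons addSnnS => /(_ _ sz).
rewrite (_ : (fun g : seq con => ((simpl (rcons ns a.1 ++ map fst g))%:R)%:E) =
  (fun g : seq con => ((simpl (ns ++ a.1 :: map fst g))%:R)%:E : \bar R)); last first.
  by apply/funext => g; rewrite cat_rcons.
apply; rewrite -cats1 simpl_catE ?sns.
  by rewrite /simpl /= inj.
move=> u w un; rewrite inE => /eqP->; apply: contra nin => /eqP <-; exact: map_f.
Qed.

(** Restricted to at most [2 * rate] constraints, the series is that of a Poisson law of mean [m0]
    times [expR (- simple_c2)]. Since [2 * m0 <= 2 * rate], Markov's inequality gives the factor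
    1/2. *)
Lemma psim_simpl_ge : expR (- simple_c2) / 2 <= psim P rho sigma (@simpl K n).
Proof.
have r0 := rate_gt0 K n d_gt0.
have HL := il_ilaw P sigma rho_ge0 (avoid [::]).
pose one g : \bar R := ((@simpl K n (map fst (g : seq con)))%:R)%:E.
have mS : nnmeas one.
  split=> [|g]; last by rewrite lee_fin.
  by apply/measurable_EFinP; exact: (measurable_map_fst (fun ks => (simpl ks)%:R)).
pose J := Num.truncn (2 * rate K n d).
have /andP[hJ1 hJ2] : J%:R <= 2 * rate K n d < J.+1%:R.
  by apply: truncn_itv; rewrite mulr_ge0// ltW.
rewrite -lee_fin -(psimE P sigma rho_ge0 (@simpl K n)) /ppp imass_total//.
apply: (@le_trans _ _ ((expR (- rate K n d))%:E * \sum_(0 <= j < J.+1) (j`!%:R^-1)%:E * iterL L j one))%E; last first.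
  apply: lee_wpmul2l; first by rewrite lee_fin expR_ge0.
  apply: nneseries_lim_ge => j _; rewrite mule_ge0 ?lee_fin ?fact_ge0//.
  exact: (il_ge0 (il_iter HL j)).
apply: (@le_trans _ _ ((expR (- rate K n d))%:E * \sum_(0 <= j < J.+1) (j`!%:R^-1 * m0 ^+ j)%:E))%E; last first.
  apply: lee_wpmul2l; first by rewrite lee_fin expR_ge0.
  rewrite big_nat [leRHS]big_nat; apply: lee_sum => j /andP[_ jJ]; rewrite EFinM.
  apply: lee_wpmul2l; first by rewrite lee_fin fact_ge0.
  apply: (iterL_simpl (ns := [::])) => //; apply: le_trans hJ1.
  by rewrite ler_nat.
rewrite sumEFin -EFinM lee_fin big_mkord.
have h := poisson_head J m0_gt0.
rewrite [leRHS](_ : _ = expR (- simple_c2) * \sum_(j < J.+1) poisson_pmf m0 j); last first.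
  rewrite !mulr_sumr; apply: eq_bigr => j _; rewrite /poisson_pmf m0_gt0.
  rewrite (_ : expR (- rate K n d) = expR (- simple_c2) * expR (- m0)).
    by move: (expR _) (expR _) (j`!%:R^-1) (m0 ^+ j) => *; ring.
  by rewrite -expRD; congr expR; rewrite /m0; ring.
rewrite ler_wpM2l ?expR_ge0//; apply: le_trans h.
have c20 := simple_c2_ge0.
have : m0 / J.+1%:R <= 1 / 2.
  rewrite ler_pdivrMr//; move: hJ2 c20; rewrite /m0.
  by move: (J.+1%:R : R) (rate _ _ _) simple_c2 => a b c; lra.
by move: (m0 / _) => x; lra.
Qed.

End simple_probability.

(** * Comparison of the posterior with the Gibbs measure *)

(** Numerator and denominator change by a factor at most [r] each, so the ratio changes by at most
    [r ^+ 2]; being at most 1, it moves by at most [r ^+ 2 - 1]. *)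
Lemma ratio_close (R : realFieldType) (T : finType) (a b : pred T) (u w : T -> R) (r : R) (x0 : T) :
  1 <= r -> b x0 -> (forall x, 0 < u x) -> (forall x, 0 < w x) ->
  (forall x, b x -> u x <= r * w x) -> (forall x, b x -> w x <= r * u x) ->
  `|(\sum_(x | b x && a x) u x) / (\sum_(x | b x) u x) -
    (\sum_(x | b x && a x) w x) / (\sum_(x | b x) w x)| <= r ^+ 2 - 1.
Proof.
move=> r1 bx0.
have pos (v : T -> R) : (forall x, 0 < v x) -> 0 < \sum_(x | b x) v x.
  move=> v0; rewrite (bigD1 x0)//= ltr_pwDl// sumr_ge0// => x _; exact: ltW.
have sub (v : T -> R) : (forall x, 0 < v x) -> 0 <= \sum_(x | b x && a x) v x <= \sum_(x | b x) v x.
  move=> v0; rewrite sumr_ge0 => [|x _]; last exact: ltW.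
  by rewrite [leRHS](bigID a) /= lerDl sumr_ge0// => x _; exact: ltW.
suff h (v v' : T -> R) : (forall x, 0 < v x) -> (forall x, 0 < v' x) ->
    (forall x, b x -> v x <= r * v' x) -> (forall x, b x -> v' x <= r * v x) ->
    (\sum_(x | b x && a x) v x) / (\sum_(x | b x) v x) -
    (\sum_(x | b x && a x) v' x) / (\sum_(x | b x) v' x) <= r ^+ 2 - 1.
  by move=> u0 w0 uw wu; rewrite ler_norml lerNl opprB !h.
move=> v0 v'0 vv' v'v.
have V := pos v v0; have V' := pos v' v'0.
have /andP[A0 A1] := sub v v0; have /andP[A'0 A'1] := sub v' v'0.
have h1 : \sum_(x | b x && a x) v x <= r * \sum_(x | b x && a x) v' x.
  by rewrite mulr_sumr; apply: ler_sum => x /andP[bx _]; exact: vv'.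
have h2 : \sum_(x | b x) v' x <= r * \sum_(x | b x) v x.
  by rewrite mulr_sumr; apply: ler_sum => x bx; exact: v'v.
have r0 : 0 <= r by apply: le_trans r1.
set Y := (\sum_(x | b x && a x) v' x) / _.
have Y1 : Y <= 1 by rewrite ler_pdivrMr// mul1r.
have h3 : (\sum_(x | b x && a x) v x) / (\sum_(x | b x) v x) <= r ^+ 2 * Y.
  rewrite ler_pdivrMr// /Y; apply: le_trans h1 _.
  move: h2 V V' A'0; move: (\sum_(x | b x) v x) (\sum_(x | b x) v' x) (\sum_(x | b x && a x) v' x).
  move=> U U' A' h2 U0 U'0 A'0.
  rewrite (_ : r ^+ 2 * (A' / U') * U = r * A' * (r * U / U')); last by ring.
  by rewrite ler_peMr ?mulr_ge0// ler_pdivlMr// mul1r.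
apply: (@le_trans _ _ ((r ^+ 2 - 1) * Y)); first by move: h3; lra.
have r21 : 0 <= r ^+ 2 - 1 by rewrite subr_ge0 expr_ge1.
by rewrite -[leRHS]mulr1 ler_wpM2l.
Qed.

Lemma half_facts (R : realType) (t : R) : 0 <= t -> 2 * t <= 1 / 2 ->
  [/\ 0 <= 2 * t, 2 * t <= 1, t <= 2 * t, 0 <= 1 + 2 * t & 1 - 2 * t <= 1 + 2 * t] /\
  (0 <= 1 - 2 * t /\ 1 / 2 <= 1 - 2 * t).
Proof. by move=> *; split; split; lra. Qed.

Lemma deviation_double (R : realType) (x y b c e : R) : x <= y + b -> y <= x + b -> b <= e ->
  - e <= x - c -> x - c <= e -> - (2 * e) <= y - c <= 2 * e.
Proof. by move=> *; apply/andP; split; lra. Qed.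

Section posterior_gibbs.
Variables (R : realType) (Omega : finPointedType) (K n : nat).
Notation weight := (weight R Omega K.+1).
Notation V := 'I_n.+1.
Notation nbh := {ffun 'I_K.+1 -> 'I_n.+1}.
Notation con := (nbh * weight)%type.
Notation q := (#|Omega|%:R : R).
Notation N := (n.+1%:R : R).
Variables (P : probability weight R) (xi0 d : R).
Hypotheses (xi0_gt0 : 0 < xi0) (d_gt0 : 0 < d).
Hypothesis symP : forall (i : 'I_K.+1) omega,
  \sum_(tau : {ffun 'I_K.+1 -> Omega} | tau i == omega) pmean P tau = q ^+ K * xi0.

Let q_gt0 : 0 < q. Proof. by rewrite ltr0n; apply/card_gt0P; exists point. Qed.
Let N_gt0 : 0 < N. Proof. by []. Qed.

Lemma balanced_close (t : R) (sigma tau : {ffun V -> Omega}) (B : pred V) :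
  (forall x, ~~ B x -> sigma x = tau x) -> q * #|B|%:R / N <= t ->
  balanced (t / q) sigma -> balanced (2 * t / q) tau.
Proof.
move=> st hB bs; apply/forallP => omega; have /forallP/(_ omega) := bs.
have h (s u : {ffun V -> Omega}) : (forall x, ~~ B x -> s x = u x) ->
    (cnt s omega)%:R <= (cnt u omega)%:R + #|B|%:R :> R.
  move=> su; rewrite -natrD ler_nat.
  apply: (@leq_trans #|predU [pred x | u x == omega] B|); last by rewrite -cardUI leq_addr.
  rewrite /cnt; apply: subset_leq_card; apply/fintype.subsetP => x; rewrite !inE.
  by case: (boolP (B x)) => [Bx|/su <-]; rewrite ?Bx ?orbT// => ->.
have h1 := h sigma tau st; have h2 := h tau sigma (fun x nb => esym (st x nb)).
have e (s : {ffun V -> Omega}) : (cnt s omega)%:R = (cnt s omega)%:R / N * N :> R by rewrite divfK// gt_eqF.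
have eB : #|B|%:R = #|B|%:R / N * N :> R by rewrite divfK// gt_eqF.
rewrite (e sigma) (e tau) eB -mulrDl ler_pM2r// in h1.
rewrite (e sigma) (e tau) eB -mulrDl ler_pM2r// in h2.
have hB' : #|B|%:R / N <= t / q by rewrite ler_pdivlMr// mulrAC [#|B|%:R * q]mulrC.
rewrite !ler_norml => /andP[h3 h4].
by rewrite -!mulrA; exact: (deviation_double h1 h2 hB' h3 h4).
Qed.

Lemma balanced_weaken (e e' : R) (sigma : {ffun V -> Omega}) : e <= e' ->
  balanced e sigma -> balanced e' sigma.
Proof. by move=> ee /forallP h; apply/forallP => omega; exact: le_trans (h omega) ee. Qed.

Section close.
Variables (t M A : R) (sigma : {ffun V -> Omega}) (l : nat) (y : V) (g : seq con).
Hypotheses (t_ge0 : 0 <= t) (t_small : 2 * t <= 1 / 2) (bal : balanced (t / q) sigma).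
Hypotheses (M_small : q * M / N <= t) (size_g : (size g)%:R <= A * N).
Hypothesis ball_small : #|[pred z | inball (map fst g) l y z]|%:R <= M.

(** [1 + close_eps / N] bounds the ratio of two normalisations ([cmass_ratio]). It is the error of
    [cmass_close] relative to the lower bound of [cmass_bounds], with [1 - 2 * t >= 1 / 2] giving
    the power of 2. *)
Definition close_eps : R := 2 ^+ K.+1 * (K.+1%:R * M * ((1 + 2 * t) ^+ K - (1 - 2 * t) ^+ K) +
  2 * K.+1%:R ^+ 2 * M ^+ 2 / (xi0 * N)).

Let facts := half_facts t_ge0 t_small.

Let M_ge0 : 0 <= M. Proof. exact: le_trans ball_small. Qed.

Let diff_ge0 : 0 <= (1 + 2 * t) ^+ K - (1 - 2 * t) ^+ K.
Proof. by have [[_ _ _ h1 h2] [h3 _]] := facts; rewrite subr_ge0 lerXn2r ?nnegrE. Qed.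

Let eps_ge0 : 0 <= close_eps.
Proof.
apply: mulr_ge0; first by rewrite exprn_ge0.
apply: addr_ge0; first by rewrite ?mulr_ge0.
by rewrite divr_ge0 ?mulr_ge0 ?exprn_ge0// ltW.
Qed.

Lemma cmass_ratio (tau tau' : {ffun V -> Omega}) : balanced (2 * t / q) tau -> balanced (2 * t / q) tau' ->
  (forall z, ~~ inball (map fst g) l y z -> tau z = tau' z) ->
  cmass P tau' <= (1 + close_eps / N) * cmass P tau.
Proof.
move=> b1 b2 tt'.
have := cmass_close symP (B := [pred z | inball (map fst g) l y z]) _ _ b1 b2 tt'.
have [[_ t2 _ _ _] [t3 t4]] := facts.
move=> /(_ (mulr_ge0 _ t_ge0) t2) h; apply: le_trans (h _) _ => // {h}.
have /andP[lo _] := cmass_bounds symP t2 b1.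
have NK0 : 0 < N ^+ K by rewrite exprn_gt0.
rewrite [leRHS]mulrDl mul1r -addrA lerD2l.
apply: (@le_trans _ _ (close_eps / N * (xi0 * N ^+ K.+1 * (1 / 2) ^+ K.+1))); last first.
  rewrite ler_wpM2l ?divr_ge0//; apply: le_trans lo; rewrite ler_wpM2l ?mulr_ge0 ?exprn_ge0 ?(ltW xi0_gt0)//.
  by rewrite lerXn2r ?nnegrE// divr_ge0.
rewrite (_ : close_eps / N * _ = K.+1%:R * M * (xi0 * N ^+ K * ((1 + 2 * t) ^+ K - (1 - 2 * t) ^+ K)) +
    2 * K.+1%:R ^+ 2 * M ^+ 2 * (N ^+ K / N)); last first.
  rewrite /close_eps expr_div_n expr1n [N ^+ K.+1]exprS.
  have p0 : (2 ^+ K.+1 : R) != 0 by rewrite expf_neq0.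
  move: (gt_eqF xi0_gt0) (gt_eqF N_gt0) => /negbT e1 /negbT e2.
  move: (2 ^+ K.+1 : R) (N ^+ K) (_ - _) (K.+1%:R : R) (N) p0 e2 => a b c e f a0 f0.
  by field; rewrite a0 f0 e1.
apply: lerD.
  by rewrite ler_wpM2r ?mulr_ge0 ?exprn_ge0 ?(ltW xi0_gt0)// ler_wpM2l.
rewrite [N ^+ K.+1 / N](_ : _ = N ^+ K); last by rewrite exprSr mulfK// gt_eqF.
rewrite ler_wpM2r ?divr_ge0 ?exprn_ge0// ler_wpM2l ?mulr_ge0 ?exprn_ge0//.
by rewrite lerXn2r ?nnegrE.
Qed.

(** Likelihood and Gibbs weight differ by the factor [rhos ^+ size g]. Assignments that agree
    outside the ball have values of [rhos] within a factor [1 + close_eps / N], and at most [A * N]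
    constraints raise this to at most [expR (close_eps * A)]. *)
Lemma post_close s : `|post P d l y s sigma g - gcond l y s sigma g| <= expR (close_eps * A) ^+ 2 - 1.
Proof.
(* The Gibbs weight rescaled by a constant factor, which leaves the ratio unchanged and makes it
   comparable with the likelihood. *)
pose w (tau : {ffun V -> Omega}) := rhos P d sigma ^+ size g * wprod g tau.
have rg0 (tau : {ffun V -> Omega}) : 0 < rhos P d tau by rewrite divr_gt0 ?rate_gt0 ?cmass_gt0.
have w0 tau : 0 < w tau by rewrite mulr_gt0 ?exprn_gt0 ?wprod_gt0.
have A0 : 0 <= A by rewrite -(pmulr_lge0 _ N_gt0); apply: le_trans size_g.
have -> : gcond l y s sigma g =
    (\sum_(tau | far (map fst g) l y sigma tau && (tau y == s)) w tau) /
    (\sum_(tau | far (map fst g) l y sigma tau) w tau).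
  rewrite gcondE /w -!mulr_sumr invfM mulrACA divff ?mul1r//.
  by rewrite gt_eqF// exprn_gt0.
have r1 : 0 <= 1 + close_eps / N by apply: addr_ge0 => //; apply: divr_ge0.
have hr (tau tau' : {ffun V -> Omega}) : balanced (2 * t / q) tau -> balanced (2 * t / q) tau' ->
    (forall z, ~~ inball (map fst g) l y z -> tau z = tau' z) ->
    rhos P d tau ^+ size g <= expR (close_eps * A) * rhos P d tau' ^+ size g.
  move=> b1 b2 tt'.
  have h1 : rhos P d tau <= (1 + close_eps / N) * rhos P d tau'.
    have := cmass_ratio b1 b2 tt'; rewrite /rhos => h.
    rewrite ler_pdivrMr ?cmass_gt0// (_ : _ * cmass P tau = rate K n d *
      ((1 + close_eps / N) * cmass P tau / cmass P tau')); last first.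
      by move: (cmass P tau) (cmass P tau')^-1 (close_eps / N) => *; ring.
    rewrite ler_peMr ?(ltW (rate_gt0 _ _ _))//.
    by rewrite ler_pdivlMr ?cmass_gt0// mul1r.
  apply: (@le_trans _ _ (((1 + close_eps / N) * rhos P d tau') ^+ size g)).
    rewrite lerXn2r ?nnegrE//; first exact: ltW.
    by apply: mulr_ge0; [exact: r1|exact: ltW].
  rewrite exprMn ler_wpM2r ?exprn_ge0 ?(ltW (rg0 _))//.
  apply: (@le_trans _ _ (expR (close_eps / N) ^+ size g)).
    by rewrite lerXn2r ?nnegrE ?expR_ge0// expR_ge1Dx.
  rewrite -expRM_natl ler_expR -mulr_natl mulrCA ler_wpM2l// ler_pdivrMr//.
  by rewrite mulr1.
apply: (@ratio_close R {ffun V -> Omega} _ _ _ _ _ sigma).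
- by rewrite -expR0 ler_expR mulr_ge0.
- exact: far_refl.
- by move=> tau; exact: likelihood_gt0.
- exact: w0.
- move=> tau /forallP f.
  have st z : ~~ inball (map fst g) l y z -> sigma z = tau z by move=> nz; rewrite (eqP (implyP (f z) nz)).
  rewrite /likelihood /w mulrA ler_wpM2r ?(ltW (wprod_gt0 _ _))//; apply: hr => [||z nz].
  + apply: (balanced_close (B := [pred z | inball (map fst g) l y z]) st _ bal).
    by apply: le_trans M_small; rewrite ler_pM2r ?invr_gt0// ler_pM2l.
  + by apply: balanced_weaken bal; rewrite ler_pM2r ?invr_gt0//; have [[_ _ ? _ _] _] := facts.
  + exact/esym/st.
- move=> tau /forallP f.
  have st z : ~~ inball (map fst g) l y z -> sigma z = tau z by move=> nz; rewrite (eqP (implyP (f z) nz)).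
  rewrite /likelihood /w mulrA ler_wpM2r ?(ltW (wprod_gt0 _ _))//; apply: hr => //.
  + by apply: balanced_weaken bal; rewrite ler_pM2r ?invr_gt0//; have [[_ _ ? _ _] _] := facts.
  + apply: (balanced_close (B := [pred z | inball (map fst g) l y z]) st _ bal).
    by apply: le_trans M_small; rewrite ler_pM2r ?invr_gt0// ler_pM2l.
Qed.

End close.
End posterior_gibbs.

(** * Limits *)

(** A pointwise estimate that fails on two exceptional events is paid for by their indicators, as
    [f <= 1]; integrating it yields their probabilities. *)
Lemma ler_exception (R : realFieldType) (f h e : R) (b c : bool) : f <= 1 -> 0 <= h -> 0 <= e ->
  (b -> c -> f <= h + e) -> f <= h + ((~~ b)%:R + ((~~ c)%:R + e)).
Proof.
move=> f1 h0 e0 H; case: b c H => -[] /= H; rewrite ?add0r; [exact: H| | |]; apply: (le_trans f1).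
- by rewrite addrCA lerDl addr_ge0.
- by rewrite addrCA lerDl addr_ge0.
- by rewrite addrCA lerDl !addr_ge0.
Qed.

Lemma ler_add3 (R : realFieldType) (x y a b e : R) :
  x <= y + (a + (b + e)) -> a <= e -> b <= e -> x <= y + 3 * e.
Proof. by move=> *; lra. Qed.

Lemma ler_distP (R : realFieldType) (a b c : R) : `|a - b| <= c -> a <= b + c /\ b <= a + c.
Proof. by rewrite ler_norml => /andP[? ?]; split; lra. Qed.

Lemma ler_dist34 (R : realFieldType) (a b e : R) : 0 < e ->
  a <= b + 3 * e -> b <= a + 3 * e -> `|a - b| <= 4 * e.
Proof. by move=> *; rewrite ler_norml; apply/andP; split; lra. Qed.

Lemma ler_dist01 (R : realFieldType) (a b : R) : 0 <= a <= 1 -> 0 <= b <= 1 -> `|a - b| <= 1.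
Proof. by move=> /andP[? ?] /andP[? ?]; rewrite ler_norml; apply/andP; split; lra. Qed.

Lemma inv_small (R : realType) (c e : R) : 0 < e ->
  exists n0 : nat, forall n, (n0 <= n)%N -> c / n.+1%:R <= e.
Proof.
move=> e0; exists (Num.truncn (`|c| / e)) => n hn.
rewrite ler_pdivrMr// mulrC -ler_pdivrMr//.
apply: (@le_trans _ _ (`|c| / e)); first by rewrite ler_pM2r ?invr_gt0// ler_norm.
by apply: ltW; apply: lt_le_trans (truncnS_gt _) _; rewrite ler_nat.
Qed.

(** Chooses the imbalance [t] so that, for n large, the estimates for balanced spins imply [R1] and
    [R2] with the prescribed [th < 1]. *)
Lemma small_choice (R : realType) (K : nat) (d th c : R) : 0 < d -> 0 < th -> th < 1 ->
  exists t : R, [/\ 0 < t, 2 * t <= 1 / 2 & exists n0 : nat, forall n, (n0 <= n)%N ->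
    th * expR (- d) <= expR (- (d * ((1 + t) ^+ K / (1 - t) ^+ K.+1))) /\
    th * (1 + t) ^+ K.+1 <= (1 - t) ^+ K - c / n.+1%:R].
Proof.
move=> d0 th0 th1.
have lth : ln th < 0 by rewrite ln_lt0// th0.
pose k : R := (K + K.+1)%:R.
have k0 : 0 < k by rewrite ltr0n addnS.
(* By Bernoulli's inequality all powers involved cost at most [u]. The three bounds serve, in this
   order, to invert [1 - u], to leave half of [1 - th] for the term [c / n] in the second estimate,
   and to fit [2 * d * u] below [- ln th] in the first. *)
pose u := Num.min (1 / 4) (Num.min ((1 - th) / 2) (- ln th / (2 * d))).
have u1 : u <= 1 / 4 by rewrite ge_min lexx.
have u2 : u <= (1 - th) / 2 by rewrite /u !ge_min lexx !orbT.
have u3 : u <= - ln th / (2 * d) by rewrite /u !ge_min lexx !orbT.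
have u0 : 0 < u.
  rewrite !lt_min; apply/and3P; split; [lra|lra|].
  by rewrite divr_gt0 ?mulr_gt0//; lra.
pose t := u / k.
have t0 : 0 < t by rewrite divr_gt0.
have tu : t <= u by rewrite ler_pdivrMr// ler_peMr ?(ltW u0)// ler1n addnS.
have kt : k * t = u by rewrite /t mulrC divfK// gt_eqF.
have p1 : 0 < 1 - t by lra.
have pw m : 0 < (1 - t) ^+ m by rewrite exprn_gt0.
have bern : 1 - u <= (1 - t) ^+ (K + K.+1).
  by rewrite -kt; apply: bernoulli_ge; apply/andP; split; lra.
have inv1 : 1 + t <= (1 - t)^-1.
  rewrite -[leRHS]mul1r ler_pdivlMr//; have : 0 <= t * t by rewrite mulr_ge0// ltW.
  by lra.
have inv m : (1 + t) ^+ m <= ((1 - t) ^+ m)^-1.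
  by rewrite -exprVn lerXn2r ?nnegrE ?invr_ge0; lra.
exists t; split=> //; first by lra.
have th2 : 0 < (1 - th) / 2 by lra.
have [n0 hn0] := inv_small c th2.
exists n0 => n hn; split.
  rewrite -[th in th * _]lnK ?posrE// -expRD ler_expR.
  have : d * ((1 + t) ^+ K / (1 - t) ^+ K.+1) <= d * (1 + 2 * u).
    rewrite ler_pM2l//; apply: (@le_trans _ _ ((1 - t) ^+ (K + K.+1))^-1).
      by rewrite exprD invfM ler_pM2r ?invr_gt0// inv.
    have h : 0 < 1 - u by lra.
    apply: (@le_trans _ _ (1 - u)^-1); first by rewrite lef_pV2 ?posrE.
    rewrite -[leLHS]mul1r ler_pdivrMr//; have : 0 <= u * (1 / 4 - u) by rewrite mulr_ge0//; lra.
    by lra.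
  have : u * (2 * d) <= - ln th by rewrite -ler_pdivlMr// mulr_gt0.
  by lra.
have := hn0 n hn; move: (c / _) => x hx.
have q1 : 1 <= (1 + t) ^+ K.+1 by rewrite expr_ge1//; lra.
have q0 : 0 < (1 + t) ^+ K.+1 by apply: lt_le_trans q1.
have h1 : (1 - u) * (1 + t) ^+ K.+1 <= (1 - t) ^+ K.
  apply: (@le_trans _ _ ((1 - t) ^+ (K + K.+1) * (1 + t) ^+ K.+1)); first by rewrite ler_wpM2r// ltW.
  rewrite exprD -mulrA ler_piMr ?(ltW (pw _))//.
  by have := inv K.+1; rewrite -[leRHS]mul1r ler_pdivlMr// mulrC.
have h2 : (1 - th) / 2 * 1 <= (1 - th) / 2 * (1 + t) ^+ K.+1 by rewrite ler_wpM2l//; lra.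
have h3 : (1 - th) / 2 * (1 + t) ^+ K.+1 <= (1 - u - th) * (1 + t) ^+ K.+1.
  by rewrite ler_wpM2r ?(ltW q0)//; lra.
by move: h1 h2 h3; rewrite !mulrBl; lra.
Qed.

Lemma pow_diff (R : realType) (x : R) K : 0 <= x <= 1 -> (1 + x) ^+ K - (1 - x) ^+ K <= (2 ^+ K + K%:R) * x.
Proof.
move=> /andP[x0 x1]; have h1 := bernoulli_ge K (introT andP (conj x0 x1)).
have h2 : (1 + x) ^+ K <= 1 + (2 ^+ K - 1) * x.
  elim: K {h1} => [|K IH]; first by rewrite !expr0 subrr mul0r addr0.
  rewrite exprSr; have x2 : 0 <= 1 + x by lra.
  apply: le_trans (ler_wpM2r x2 IH) _; rewrite exprS.
  have p : 0 <= (2 ^+ K - 1) * (x * (1 - x)).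
    by apply: mulr_ge0; [rewrite subr_ge0 exprn_ege1// ler1n|apply: mulr_ge0 => //; rewrite subr_ge0].
  by move: (2 ^+ K) p => a p; rewrite -subr_ge0; move: p; congr (0 <= _); ring.
by move: h1 h2; move: (2 ^+ K) (K%:R : R) ((1 - x) ^+ K) ((1 + x) ^+ K) => a b c e *; lra.
Qed.

Lemma iterL_eq_size dsp (C : measurableType dsp) (R : realType) (L : (C -> \bar R) -> \bar R) j
    (Phi Phi' : seq C -> \bar R) :
  (forall s, size s = j -> Phi s = Phi' s) -> iterL L j Phi = iterL L j Phi'.
Proof.
elim: j Phi Phi' => [|j IH] Phi Phi' h /=; first exact: h.
by congr L; apply/funext => a; apply: IH => s hs; apply: h; rewrite /= hs.
Qed.

(** * Size of the ball around a vertex *)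

Section ball_size.
Variables (R : realType) (Omega : finPointedType) (K n : nat).
Notation weight := (weight R Omega K.+1).
Notation V := 'I_n.+1.
Notation nbh := {ffun 'I_K.+1 -> 'I_n.+1}.
Notation con := (nbh * weight)%type.
Notation msg := (msg R Omega).
Variables (P : probability weight R) (rho : R) (sigma : {ffun 'I_n.+1 -> Omega}).
Hypothesis rho_ge0 : (0 <= rho)%R.
Variables (kappa d theta : R) (D M0 : nat).
Hypotheses (kappa_ge0 : (0 <= kappa)%R) (d_gt0 : (0 < d)%R) (theta_ge0 : (0 <= theta)%R).
Hypothesis theta_le1 : (theta <= 1)%R.
Hypothesis normal : forall omega, (\sum_(tau : {ffun 'I_K -> Omega})
  \int[P]_psi (kappa * psi (fcons omega tau))%:E = 1)%E.
Hypothesis Pinv : forall (th : {perm 'I_K.+1}) (F : weight -> \bar R), nnmeas F ->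
  nnmeas (fun psi => F (perm_weight th psi)) /\
  (\int[P]_psi F (perm_weight th psi) = \int[P]_psi F psi)%E.
Hypothesis R1 : forall x, (theta * expR (- d) <= expR (- imass P rho sigma (fun y => touch y x)))%R.
Hypothesis R2 : forall W, (size W <= M0)%N -> forall tau : {ffun 'I_K -> Omega},
  (theta * d * kappa <= rho * K.+1%:R *
    #|[pred c | freshk W c && ([ffun i => sigma (c i)] == tau)]|%:R)%R.
Variables (l : nat) (y : V).
Hypothesis M0_big : (1 + ball_bound K D l <= M0)%N.
Local Open Scope ereal_scope.

Definition ball_le M (ns : seq nbh) := (#|[pred z | inball ns l y z]| <= M)%N.

Lemma nnmeas_ball M : nnmeas (fun g : seq con => ((ball_le M (map fst g))%:R)%:E : \bar R).
Proof.
split=> [|g]; last by rewrite lee_fin.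
by apply/measurable_EFinP; exact: (measurable_map_fst (fun ns => (ball_le M ns)%:R)).
Qed.

(** The exploration claim for the constant function 1: after any tree-like exploration the ball is
    exactly [N], of size at most [M0], whatever the remaining constraints. So a large ball has at
    most the probability of the missing mass. *)
Lemma local_ball : (bmass K (trunc_pmf d theta D) l)%:E <=
  ppp P rho sigma [::] (fun g => ((ball_le M0 (map fst g))%:R)%:E).
Proof.
have w0 j : (0 <= trunc_pmf d theta D j)%R by exact: trunc_pmf_ge0.
have w1 : \sum_(j <oo) (trunc_pmf d theta D j)%:E <= 1 by exact: trunc_pmf_le1.
rewrite -(bcast_mass kappa_ge0 normal w0 w1 l (sigma y)).
apply: (claimP (M0 := M0) (W := [:: y]) rho_ge0 kappa_ge0 d_gt0 theta_ge0 theta_le1 normal Pinv R1 R2) => //.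
- by rewrite inE.
- exact: nnmeas_ball.
- move=> g g' e; congr ((_ : bool)%:R)%:E; congr (_ <= _)%N; apply: eq_card => z; rewrite !inE.
  by apply: eq_inball; exact/perm_mem/perm_map.
move=> E N A m e; rewrite cats0.
apply: (@le_trans _ _ (ppp P rho sigma (map fst N) (cst 1))); first by rewrite ppp1.
apply: (@ppp_le_on _ _ _ _ P rho sigma rho_ge0).
- exact: nnmeas_cst.
- exact: (nnmeas_cat E (nnmeas_ball M0)).
move=> g ag.
have yy : y \in [:: y] by rewrite inE.
have [_ _ [uN lN] sA _] := expl_supp.1 _ _ _ _ _ _ _ e yy.
have {}sA := sA D (fun _ h => h).
rewrite lee_fin ler1n lt0b; apply: leq_trans M0_big; apply: (@leq_trans (size (y :: A))); last by rewrite /= add1n ltnS.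
apply: (@leq_trans (size (map fst N))).
  rewrite (eq_card (B := mem (map fst N))).
    exact: card_size.
  move=> z; rewrite !inE (expl_near_iff e yy)//.
  by move=> a z' /(allP ag) av; exact: avoid_touch.
apply: uniq_leq_size => // z /mapP[[u r] uN' ->]; by case: (lN u r uN').
Qed.

End ball_size.

(** * Expectations of functions into the unit interval *)

Section reals.
Variables (R : realType) (Omega : finPointedType) (K n : nat).
Notation weight := (weight R Omega K.+1).
Notation con := ({ffun 'I_K.+1 -> 'I_n.+1} * weight)%type.
Variables (P : probability weight R) (rho : R) (sigma : {ffun 'I_n.+1 -> Omega}).
Hypothesis rho_ge0 : 0 <= rho.

Definition pppr (f : seq con -> R) : R := fine (ppp P rho sigma [::] (fun g => (f g)%:E)).

Lemma ppprE (f : seq con -> R) : measurable_fun setT f -> (forall g, 0 <= f g <= 1) ->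
  ppp P rho sigma [::] (fun g => (f g)%:E) = (pppr f)%:E /\ 0 <= pppr f <= 1.
Proof.
move=> mf f01; have H := il_ppp P sigma rho_ge0 [::].
have m : nnmeas (fun g => (f g)%:E).
  by split=> [|g]; [exact/measurable_EFinP|rewrite lee_fin; case/andP: (f01 g)].
have p0 := il_ge0 H m.
have p1 : (ppp P rho sigma [::] (fun g => (f g)%:E) <= 1)%E.
  rewrite -(ppp1 P sigma rho_ge0 [::]); apply: (il_le H) => //.
  by move=> g; rewrite lee_fin; case/andP: (f01 g).
have fin : ppp P rho sigma [::] (fun g => (f g)%:E) \is a fin_num.
  by rewrite ge0_fin_numE//; apply: le_lt_trans p1 (ltry _).
have e : ppp P rho sigma [::] (fun g => (f g)%:E) = (pppr f)%:E by rewrite fineK.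
by rewrite e; split=> //; move: p0 p1; rewrite e !lee_fin => -> ->.
Qed.

Lemma pppr_le (f h u v : seq con -> R) (c : R) :
  [/\ measurable_fun setT f, measurable_fun setT h, measurable_fun setT u & measurable_fun setT v] ->
  [/\ forall g, 0 <= f g <= 1, forall g, 0 <= h g <= 1, forall g, 0 <= u g <= 1 &
      forall g, 0 <= v g <= 1] -> 0 <= c ->
  (forall g, f g <= h g + (u g + (v g + c))) -> pppr f <= pppr h + (pppr u + (pppr v + c)).
Proof.
move=> [mf mh mu mv] [f01 h01 u01 v01] c0 fh; have H := il_ppp P sigma rho_ge0 [::].
have m (w : seq con -> R) : measurable_fun setT w -> (forall g, 0 <= w g <= 1) -> nnmeas (fun g => (w g)%:E).
  by move=> mw w01; split=> [|g]; [exact/measurable_EFinP|rewrite lee_fin; case/andP: (w01 g)].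
have [ef _] := ppprE mf f01; have [eh _] := ppprE mh h01.
have [eu _] := ppprE mu u01; have [ev _] := ppprE mv v01.
have mc : nnmeas (cst c%:E : seq con -> \bar R) by apply: nnmeas_cst; rewrite lee_fin.
have ec : ppp P rho sigma [::] (cst c%:E) = c%:E.
  by rewrite (il_cst H) ?lee_fin// (ppp1 _ _ rho_ge0) mule1.
have m1 := nnmeasD (m v mv v01) mc; have m2 := nnmeasD (m u mu u01) m1.
rewrite -lee_fin !EFinD -ef -eh -eu -ev.
rewrite -[X in (_ <= _ + (_ + (_ + X)))%E]ec -(ilD H (m v mv v01) mc) -(ilD H (m u mu u01) m1).
rewrite -(ilD H (m h mh h01) m2).
by apply: (il_le H); [exact: m|exact: (nnmeasD (m h mh h01) m2)|move=> g; rewrite -!EFinD lee_fin].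
Qed.

Lemma ppprD (f h u : seq con -> R) : measurable_fun setT f -> measurable_fun setT h ->
  measurable_fun setT u ->
  (forall g, 0 <= f g <= 1) -> (forall g, 0 <= h g <= 1) -> (forall g, 0 <= u g <= 1) ->
  (forall g, u g = f g + h g) -> pppr u = pppr f + pppr h.
Proof.
move=> mf mh mu f01 h01 u01 uE; have H := il_ppp P sigma rho_ge0 [::].
have m (v : seq con -> R) : measurable_fun setT v -> (forall g, 0 <= v g <= 1) -> nnmeas (fun g => (v g)%:E).
  by move=> mv v01; split=> [|g]; [exact/measurable_EFinP|rewrite lee_fin; case/andP: (v01 g)].
have [ef _] := ppprE mf f01; have [eh _] := ppprE mh h01; have [eu _] := ppprE mu u01.
apply: EFin_inj; rewrite EFinD -ef -eh -eu -(ilD H); [|exact: m|exact: m].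
by congr ppp; apply/funext => g; rewrite uE.
Qed.

End reals.

Section limits.
Variables (R : realType) (Omega : finPointedType) (K : nat).
Notation weight := (weight R Omega K.+1).
Notation q := (#|Omega|%:R : R).
Notation con n := ({ffun 'I_K.+1 -> 'I_n.+1} * weight)%type.
Notation msg := (msg R Omega).
Variables (P : probability weight R) (xi0 d : R).
Hypotheses (K_gt0 : (0 < K)%N) (xi0_gt0 : 0 < xi0) (d_gt0 : 0 < d).
Hypothesis symP : forall (i : 'I_K.+1) omega,
  \sum_(tau : {ffun 'I_K.+1 -> Omega} | tau i == omega) pmean P tau = q ^+ K * xi0.
Let kappa : R := (q ^+ K * xi0)^-1.
Hypothesis normal : forall omega, (\sum_(tau : {ffun 'I_K -> Omega})
  \int[P]_psi (kappa * psi (fcons omega tau))%:E = 1)%E.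
Hypothesis Pinv : forall (th : {perm 'I_K.+1}) (F : weight -> \bar R), nnmeas F ->
  nnmeas (fun psi => F (perm_weight th psi)) /\
  (\int[P]_psi F (perm_weight th psi) = \int[P]_psi F psi)%E.

Let q_gt0 : 0 < q. Proof. by rewrite ltr0n; apply/card_gt0P; exists point. Qed.
Let kappa_ge0 : 0 <= kappa.
Proof. by rewrite invr_ge0 mulr_ge0 ?exprn_ge0// ltW. Qed.

Definition tree_bias l s omega : R :=
  fine (bcast P kappa (poisson_pmf d) l omega (fun m => (bias s m)%:E)).

Definition tree_val l : R := \sum_s q^-1 * \sum_omega tree_bias l s omega.

Lemma tree_biasE l s omega :
  (bcast P kappa (poisson_pmf d) l omega (fun m => (bias s m)%:E) = (tree_bias l s omega)%:E)%E /\
  0 <= tree_bias l s omega <= 1.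
Proof.
have p1 : (\sum_(j <oo) (poisson_pmf d j)%:E <= 1)%E by rewrite (poisson_pmf_sum1 d_gt0).
have p0 j : 0 <= poisson_pmf d j by exact: poisson_pmf_ge0.
have c := bcast_compl kappa_ge0 normal p0 p1 l omega (measurable_bias s) (@bias01 R Omega s).
have H := il_bcast kappa_ge0 normal p0 p1 l omega.
have /andP[_ b1] := bmass01 kappa_ge0 normal p0 p1 l.
have m0 : nnmeas (fun m : msg => (bias s m)%:E).
  split=> [|m]; last by rewrite lee_fin; case/andP: (bias01 s m).
  by apply/measurable_EFinP; exact: measurable_bias.
have m1 : nnmeas (fun m : msg => (1 - bias s m)%:E).
  split=> [|m]; last by rewrite lee_fin subr_ge0; case/andP: (bias01 s m).
  by apply/measurable_EFinP; apply: measurable_funB => //; exact: measurable_bias.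
have h0 := il_ge0 H m0; have h1 := il_ge0 H m1; move: c h0 h1; rewrite /tree_bias.
move: (bcast _ _ _ _ _ _) => X; move: (bcast _ _ _ _ _ _) => Y.
case: X Y => [x| |] [z| |] //= [c]; rewrite !lee_fin => x0 z0; split=> //.
by rewrite x0 /=; apply: le_trans b1; rewrite -c lerDl.
Qed.

Lemma tree_val_bounds l : 0 <= tree_val l <= q.
Proof.
rewrite sumr_ge0 /= => [|s _]; last first.
  rewrite mulr_ge0 ?invr_ge0 ?(ltW q_gt0)// sumr_ge0// => omega _.
  by have [_ /andP[]] := tree_biasE l s omega.
apply: (@le_trans _ _ (\sum_(s : Omega) 1)); last by rewrite sumr_const.
apply: ler_sum => s _; rewrite mulrC ler_pdivrMr// mul1r.
apply: (@le_trans _ _ (\sum_(omega : Omega) 1)); last by rewrite sumr_const.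
by apply: ler_sum => omega _; have [_ /andP[]] := tree_biasE l s omega.
Qed.

Definition graph_prop n (sigma : {ffun 'I_n.+1 -> Omega}) (S : seq {ffun 'I_K.+1 -> 'I_n.+1} -> bool) :=
  [/\ forall ns ns', perm_eq ns ns' -> S ns = S ns',
      forall ns ns', S (ns ++ ns') -> S ns' &
      forall dg l (y : 'I_n.+1) E N A (m : msg), expl dg sigma l y [:: y] E N A m ->
        forall g, all (fun a : con n => avoid (map fst N) a.1) g ->
        S (map fst g) -> S (map fst (E ++ g))].

Lemma graph_propT n (sigma : {ffun 'I_n.+1 -> Omega}) : graph_prop sigma xpredT.
Proof. by []. Qed.

Lemma graph_prop_simpl n (sigma : {ffun 'I_n.+1 -> Omega}) : graph_prop sigma (@simpl K n).
Proof.
split=> [ns ns'|ns ns'|dg l y E N A m]; [exact: perm_simpl|exact: simpl_sub|].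
exact: simpl_expl.
Qed.

Definition gdev n l (y : 'I_n.+1) s sigma (g : seq (con n)) : R := `|gcond l y s sigma g - q^-1|.

Notation mean sigma := (pppr P (rhos P d sigma) sigma).

(** The order of the choices: [D] and [th] depend on [l] and [e], then the imbalance [t], then the
    threshold on n; after that the bounds are uniform in [sigma], [y], [s] and [S]. *)
Lemma local_uniform l (e : R) : 0 < e -> exists (t0 : R) (M : nat), [/\ 0 < t0, 2 * t0 <= 1 / 2 &
  exists n0 : nat, forall n, (n0 <= n)%N -> forall sigma : {ffun 'I_n.+1 -> Omega},
  balanced (t0 / q) sigma -> forall (y : 'I_n.+1) s,
  (forall S, graph_prop sigma S ->
    `|mean sigma (fun g => gdev l y s sigma g * (S (map fst g))%:R) -
      mean sigma (fun g => (S (map fst g))%:R) * tree_bias l s (sigma y)| <= e) /\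
  mean sigma (fun g => (~~ ball_le l y M (map fst g))%:R) <= e].
Proof.
move=> e0; have e2 : 0 < e / 2 by lra.
have [D [th [th0 th1 hb]]] := bmass_near1 K d_gt0 l e2.
have := hb D th (leqnn D); rewrite lexx (ltW th1) => /(_ isT) {}hb.
pose M0 := (1 + ball_bound K D l)%N.
have [t [t0 t1 [n0 hn0]]] := small_choice K (q ^+ K * (K%:R * (M0%:R + K%:R))) d_gt0 th0 th1.
exists t, M0; split=> //; exists n0 => n hn sigma bal y s.
have [h1 h2] := hn0 n hn.
have tl1 : t < 1 by lra.
have r0 := rhos_ge0 P d_gt0 sigma.
have R1 x : th * expR (- d) <= expR (- imass P (rhos P d sigma) sigma (fun y => touch y x)).
  apply: le_trans h1 _; rewrite ler_expR lerN2.
  exact: (touch_imass xi0_gt0 symP (ltW t0) (ltW tl1) bal d_gt0 tl1 x).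
have R2 := fresh_rate xi0_gt0 symP (ltW t0) (ltW tl1) bal d_gt0 (ltW th0) h2.
split=> [S [S1 S2 S3]|].
  have [A eA hA] := local_approx r0 kappa_ge0 d_gt0 (ltW th0) (ltW th1) normal Pinv R1 R2 S1 S2 S3 y s (leqnn M0 : (1 + ball_bound K D l <= M0)%N).
  rewrite (_ : mean sigma (fun g => gdev l y s sigma g * _) = A).
    by apply: le_trans hA _; move: hb; move: (bmass _ _ _) => b; lra.
  rewrite /pppr (_ : (fun g => (gdev l y s sigma g * (S (map fst g))%:R)%:E) =
    (fun g => `|gcond l y s sigma g - q^-1|%:E * ((S (map fst g))%:R)%:E)%E); first by rewrite eA.
  by apply/funext => g; rewrite EFinM.
have hball := local_ball r0 kappa_ge0 d_gt0 (ltW th0) (ltW th1) normal Pinv R1 R2 y (leqnn M0 : (1 + ball_bound K D l <= M0)%N).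
have mB (b : bool) : measurable_fun setT (fun g : seq (con n) => ((b (+) ball_le l y M0 (map fst g))%:R : R)).
  exact: (measurable_map_fst (fun ns => (b (+) ball_le l y M0 ns)%:R)).
have b01 (b : bool) : 0 <= (b%:R : R) <= 1 by case: b; rewrite ?lexx ?ler01.
have := @ppprD R Omega K n P _ sigma r0 (fun g => (~~ ball_le l y M0 (map fst g))%:R)
  (fun g => (ball_le l y M0 (map fst g))%:R) (cst 1) (mB true) (mB false) (@measurable_cst _ _ _ _ _ _)
  (fun g => b01 _) (fun g => b01 _) (fun g => b01 true).
have -> : mean sigma (cst 1) = 1 by rewrite /pppr (ppp1 P sigma r0 [::]).
have [eb _] := @ppprE R Omega K n P _ sigma r0 (fun g => (ball_le l y M0 (map fst g))%:R) (mB false) (fun g => b01 _).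
have hE (g : seq (con n)) : 1 = (~~ ball_le l y M0 (map fst g))%:R + (ball_le l y M0 (map fst g))%:R :> R.
  by case: (ball_le _ _ _ _); rewrite /= ?add0r ?addr0.
move=> /(_ (fun g => hE g)).
have := hball; rewrite eb lee_fin; move: hb.
by move: (mean sigma _) (mean sigma _) (bmass _ _ _) => *; lra.
Qed.

Definition avg n (h : {ffun 'I_n.+1 -> Omega} -> R) : R :=
  #|{ffun 'I_n.+1 -> Omega}|%:R^-1 * \sum_sigma h sigma.

Lemma avgB n (h h' : {ffun 'I_n.+1 -> Omega} -> R) : avg h - avg h' = avg (fun s => h s - h' s).
Proof. by rewrite /avg -mulrBr sumrB. Qed.

Lemma avgZ n (h : {ffun 'I_n.+1 -> Omega} -> R) c : avg h * c = avg (fun s => h s * c).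
Proof. by rewrite /avg -mulrA mulr_suml. Qed.

Lemma avg_sum n (I : finType) (h : I -> {ffun 'I_n.+1 -> Omega} -> R) :
  \sum_i avg (h i) = avg (fun s => \sum_i h i s).
Proof. by rewrite /avg exchange_big /= mulr_sumr. Qed.

Let cardS n : 0 < #|{ffun 'I_n.+1 -> Omega}|%:R :> R.
Proof. by rewrite ltr0n; apply/card_gt0P; exists point. Qed.

(** The second term is the trivial bound [c] times the proportion of unbalanced assignments. *)
Lemma avg_bound n (h : {ffun 'I_n.+1 -> Omega} -> R) (t e c : R) : 0 < t -> 0 <= c ->
  (forall sigma, balanced (t / q) sigma -> `|h sigma| <= e) -> (forall sigma, `|h sigma| <= c) -> 0 <= e ->
  `|avg h| <= e + c * (q / (t / q) ^+ 2) / n.+1%:R.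
Proof.
move=> t0 c0 hb hc e0; have C := cardS n.
rewrite /avg normrM ger0_norm ?invr_ge0 ?(ltW C)// mulrC ler_pdivrMr//.
apply: le_trans (ler_norm_sum _ _ _) _.
apply: (@le_trans _ _ (\sum_(sigma : {ffun 'I_n.+1 -> Omega}) (e + c * (~~ balanced (t / q) sigma)%:R))).
  apply: ler_sum => sigma _; case: (boolP (balanced _ _)) => b /=.
    by rewrite mulr0 addr0; exact: hb.
  by rewrite mulr1; apply: le_trans (hc _) _; rewrite lerDr.
rewrite big_split /= sumr_const -mulr_sumr mulrDl -[e *+ _]mulr_natr lerD2l.
have tq : 0 < t / q by rewrite divr_gt0.
have := @unbalanced_bound R Omega n _ tq => hu.
rewrite -!mulrA ler_wpM2l//; apply: le_trans (le_trans _ hu) _.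
  rewrite -(sum1_card [pred sigma | ~~ balanced (t / q) sigma]) natr_sum [leRHS]big_mkcond /=.
  by apply: ler_sum => sigma _; rewrite inE; case: (balanced _ _).
by rewrite invfM !mulrA.
Qed.

Lemma sum_spin n (sigma : {ffun 'I_n.+1 -> Omega}) (f : Omega -> R) :
  \sum_(y < n.+1) f (sigma y) = \sum_omega (cnt sigma omega)%:R * f omega.
Proof.
rewrite (partition_big sigma xpredT)//=; apply: eq_bigr => omega _.
rewrite (eq_bigr (fun=> f omega)) => [|y /eqP->//].
by rewrite sumr_const -[LHS]mulr_natl.
Qed.

Lemma gdev01 n l (y : 'I_n.+1) s sigma (g : seq (con n)) : 0 <= gdev l y s sigma g <= 1.
Proof.
rewrite normr_ge0 /=; have /andP[g0 g1] := gcond01 l y s sigma g.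
have qi0 : 0 <= q^-1 by rewrite invr_ge0 ltW.
have qi1 : q^-1 <= 1 by rewrite invf_le1// ler1n -(ltr0n R).
by move: g0 g1 qi0 qi1; rewrite ler_norml; move: (gcond _ _ _ _ _) (q^-1) => a b *; apply/andP; split; lra.
Qed.

Lemma measurable_gdev n l (y : 'I_n.+1) s sigma : measurable_fun setT (@gdev n l y s sigma).
Proof.
apply: measurableT_comp => //; apply: measurable_funB => //; exact: measurable_gcond.
Qed.

Lemma ind01 (b : bool) : 0 <= (b%:R : R) <= 1.
Proof. by case: b; rewrite ?lexx ?ler01. Qed.

Lemma mul01 (x : R) (b : bool) : 0 <= x <= 1 -> 0 <= x * b%:R <= 1.
Proof. by case: b; rewrite ?mulr1 ?mulr0 ?lexx ?ler01. Qed.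

Lemma measurable_gdevS n l (y : 'I_n.+1) s sigma (S : seq {ffun 'I_K.+1 -> 'I_n.+1} -> bool) :
  measurable_fun setT (fun g : seq (con n) => gdev l y s sigma g * (S (map fst g))%:R).
Proof.
apply: measurable_funM; first exact: measurable_gdev.
exact: (measurable_map_fst (fun ns => (S ns)%:R)).
Qed.

Lemma mean_gdev01 n l (y : 'I_n.+1) s sigma (S : seq {ffun 'I_K.+1 -> 'I_n.+1} -> bool) :
  0 <= mean sigma (fun g => gdev l y s sigma g * (S (map fst g))%:R) <= 1.
Proof.
have [] := ppprE P sigma (rhos_ge0 P d_gt0 sigma) (measurable_gdevS l y s sigma S) => //.
by move=> g; apply: mul01; exact: gdev01.
Qed.

Lemma mean_ind01 n (sigma : {ffun 'I_n.+1 -> Omega}) (S : seq {ffun 'I_K.+1 -> 'I_n.+1} -> bool) :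
  0 <= mean sigma (fun g => (S (map fst g))%:R) <= 1.
Proof.
have [] := ppprE P sigma (rhos_ge0 P d_gt0 sigma) (measurable_map_fst (fun ns => (S ns)%:R)) => //.
by move=> g; exact: ind01.
Qed.

Lemma double_sum_bound n (f : 'I_n.+1 -> Omega -> R) (c : R) : (forall y s, `|f y s| <= c) ->
  `|n.+1%:R^-1 * \sum_y \sum_s f y s| <= q * c.
Proof.
move=> fc; rewrite normrM ger0_norm ?invr_ge0// mulrC ler_pdivrMr//.
apply: le_trans (ler_norm_sum _ _ _) _.
apply: (@le_trans _ _ (\sum_(y < n.+1) q * c)); last by rewrite sumr_const card_ord -[leLHS]mulr_natr.
apply: ler_sum => y _; apply: le_trans (ler_norm_sum _ _ _) _.
apply: (@le_trans _ _ (\sum_(s : Omega) c)); last by rewrite sumr_const -[leLHS]mulr_natl.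
by apply: ler_sum => s _; exact: fc.
Qed.

Definition gval n l S (sigma : {ffun 'I_n.+1 -> Omega}) : R :=
  n.+1%:R^-1 * \sum_y \sum_s mean sigma (fun g => gdev l y s sigma g * (S (map fst g))%:R).

Lemma conv_gibbs l (e : R) : 0 < e -> exists n0 : nat, forall n, (n0 <= n)%N ->
  forall S, (forall sigma : {ffun 'I_n.+1 -> Omega}, graph_prop sigma S) ->
  `|avg (gval l S) - avg (fun sigma => mean sigma (fun g => (S (map fst g))%:R)) * tree_val l| <= e.
Proof.
move=> e0; have q0 := q_gt0.
(* Summed over the [q] values of [s], the local error is [e / 4]; the imbalance contributes another
   [e / 4], and the unbalanced assignments [e / 2]. *)
have e1 : 0 < e / (4 * q) by rewrite divr_gt0// mulr_gt0.
have [t0 [M [t00 t01 [n1 h1]]]] := local_uniform l e1.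
pose t := Num.min t0 (e / (4 * q)).
have tt0 : t <= t0 by rewrite ge_min lexx.
have te : t <= e / (4 * q) by rewrite ge_min lexx orbT.
have tpos : 0 < t by rewrite lt_min t00.
have e2 : 0 < e / 2 by rewrite divr_gt0.
have [n2 h2] := inv_small (2 * q * (q / (t / q) ^+ 2)) e2.
exists (maxn n1 n2) => n; rewrite geq_max => /andP[n1n n2n] S gS.
rewrite avgZ avgB.
have /andP[T0 T1] := tree_val_bounds l.
apply: (@le_trans _ _ (e / 2 + 2 * q * (q / (t / q) ^+ 2) / n.+1%:R)); last first.
  by have := h2 n n2n; move: (_ / n.+1%:R) => x; lra.
have c2 : 0 <= 2 * q by rewrite mulr_ge0// ltW.
apply: (avg_bound tpos c2) => [sigma bal|sigma|]; last exact: ltW.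
  have bal0 : balanced (t0 / q) sigma.
    by apply: balanced_weaken bal; rewrite ler_pM2r ?invr_gt0.
  set p := mean sigma (fun g => (S (map fst g))%:R).
  have /andP[p0 p1] : 0 <= p <= 1 by exact: mean_ind01.
  (* The tree value at [y] depends on [y] only through its spin, so its average over [y] differs
     from [tree_val] only by the deviations of the spin densities from [1 / q]. *)
  have E : tree_val l = n.+1%:R^-1 * (\sum_y \sum_s tree_bias l s (sigma y)) -
      \sum_s \sum_omega ((cnt sigma omega)%:R / n.+1%:R - q^-1) * tree_bias l s omega.
    rewrite exchange_big /= mulr_sumr -sumrB; apply: eq_bigr => s _.
    rewrite (sum_spin sigma (tree_bias l s)) !mulr_sumr -sumrB; apply: eq_bigr => omega _.
    by rewrite mulrBl; move: (tree_bias _ _ _) (n.+1%:R^-1) => *; ring.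
  rewrite {1}E mulrBr opprB addrCA addrC.
  have -> : gval l S sigma - p * (n.+1%:R^-1 * (\sum_y \sum_s tree_bias l s (sigma y))) =
      n.+1%:R^-1 * \sum_y \sum_s (mean sigma (fun g => gdev l y s sigma g * (S (map fst g))%:R) -
        p * tree_bias l s (sigma y)).
    rewrite mulrCA -mulrBr mulr_sumr -sumrB; congr (_ * _); apply: eq_bigr => y _.
    by rewrite mulr_sumr -sumrB.
  apply: le_trans (ler_normD _ _) _.
  have b1 : `|n.+1%:R^-1 * \sum_y \sum_s (mean sigma (fun g => gdev l y s sigma g * (S (map fst g))%:R) -
        p * tree_bias l s (sigma y))| <= q * (e / (4 * q)).
    by apply: double_sum_bound => y s; have [h _] := h1 n n1n sigma bal0 y s; exact: h.
  have b2 : `|p * \sum_s \sum_omega ((cnt sigma omega)%:R / n.+1%:R - q^-1) * tree_bias l s omega| <= q * t.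
    rewrite normrM ger0_norm//; apply: (@le_trans _ _ (1 * (q * t))); last by rewrite mul1r.
    apply: ler_pM => //; apply: le_trans (ler_norm_sum _ _ _) _.
    apply: (@le_trans _ _ (\sum_(s : Omega) t)); last by rewrite sumr_const -[leLHS]mulr_natl.
    apply: ler_sum => s _; apply: le_trans (ler_norm_sum _ _ _) _.
    apply: (@le_trans _ _ (\sum_(omega : Omega) t / q)); last first.
      by rewrite sumr_const -[leLHS]mulr_natl mulrC divfK// gt_eqF.
    apply: ler_sum => omega _; rewrite normrM.
    have [_ /andP[B0 B1]] := tree_biasE l s omega.
    rewrite (ger0_norm B0) -[leRHS]mulr1; apply: ler_pM => //.
    exact: (forallP bal omega).
  have e3 : q * (e / (4 * q)) = e / 4.
    by move: (gt_eqF q_gt0) => /negbT qn; field; rewrite qn.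
  have qt : q * t <= e / 4 by rewrite -e3 ler_pM2l.
  by move: b1 b2 qt; rewrite e3; move: (`|_|) (`|_|) (q * t) => x z w *; lra.
have /andP[p0 p1] : 0 <= mean sigma (fun g => (S (map fst g))%:R) <= 1 by exact: mean_ind01.
have b1 : `|gval l S sigma| <= q * 1.
  by apply: double_sum_bound => y s; have /andP[a0 a1] := mean_gdev01 l y s sigma S; rewrite ger0_norm.
apply: le_trans (ler_normB _ _) _.
have b2 : `|mean sigma (fun g => (S (map fst g))%:R) * tree_val l| <= q.
  by rewrite ger0_norm ?mulr_ge0// -[leRHS]mul1r ler_pM.
by move: b1 b2; rewrite mulr1; move: (`|_|) (`|_|) => x z *; lra.
Qed.

(** The number of constraints is Poisson of mean [rate], and Markov's inequality applies. *)
Lemma mean_size n (sigma : {ffun 'I_n.+1 -> Omega}) J :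
  mean sigma (fun g : seq (con n) => (J < size g)%N%:R) <= rate K n d / J.+1%:R.
Proof.
have r0 := rhos_ge0 P d_gt0 sigma; have rt := rate_gt0 K n d_gt0.
have ms (Q : pred nat) : measurable_fun setT (fun g : seq (con n) => ((Q (size g))%:R : R)).
  rewrite (_ : (fun g => _) = fun g : seq (con n) => ((Q (size (map fst g)))%:R : R)).
    exact: (measurable_map_fst (fun ns => (Q (size ns))%:R)).
  by apply/funext => g; rewrite size_map.
have hE (g : seq (con n)) : cst 1 g = (J < size g)%N%:R + (size g <= J)%N%:R :> R.
  by rewrite ltnNge; case: (size g <= J)%N; rewrite /= ?add0r ?addr0.
have h := @ppprD R Omega K n P _ sigma r0 (fun g => (J < size g)%N%:R)
  (fun g => (size g <= J)%N%:R) (cst 1) (ms (fun i => J < i)%N) (ms (fun i => i <= J)%N)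
  (@measurable_cst _ _ _ _ _ _) (fun g => ind01 _) (fun g => ind01 _) (fun g => ind01 true) hE.
have e1 : mean sigma (cst 1) = 1 by rewrite /pppr (ppp1 P sigma r0 [::]).
rewrite e1 in h.
have [eb _] := @ppprE R Omega K n P _ sigma r0 (fun g => (size g <= J)%N%:R) (ms (fun i => i <= J)%N) (fun g => ind01 _).
suff : 1 - rate K n d / J.+1%:R <= mean sigma (fun g : seq (con n) => (size g <= J)%N%:R).
  by move: h; move: (mean sigma _) (mean sigma _) (rate _ _ _ / _) => *; lra.
apply: le_trans (poisson_head J rt) _; rewrite -lee_fin -eb /ppp imass_total//.
have HL := il_ilaw P sigma r0 (avoid [::]).
have m1 : nnmeas (fun g : seq (con n) => ((size g <= J)%N%:R)%:E : \bar R).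
  by split=> [|g]; [apply/measurable_EFinP; exact: (ms (fun i => i <= J)%N)|rewrite lee_fin].
apply: (@le_trans _ _ ((expR (- rate K n d))%:E * \sum_(0 <= j < J.+1) (j`!%:R^-1)%:E *
    iterL (ilaw P (rhos P d sigma) sigma (avoid [::])) j (fun g => ((size g <= J)%N%:R)%:E)))%E; last first.
  apply: lee_wpmul2l; first by rewrite lee_fin expR_ge0.
  apply: nneseries_lim_ge => j _; rewrite mule_ge0 ?lee_fin ?fact_ge0//.
  exact: (il_ge0 (il_iter HL j)).
rewrite big_nat (eq_bigr (fun j => (j`!%:R^-1 * rate K n d ^+ j)%:E)); last first.
  move=> j /andP[_ jJ]; rewrite (@iterL_eq_size _ _ _ _ j _ (cst 1%E)).
    have Lm := ilaw1 P sigma r0 (avoid [::]); rewrite imass_total// in Lm.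
    by rewrite (iterL_mass HL Lm) -EFinM.
  by move=> g hg; rewrite hg -ltnS jJ.
rewrite -big_nat sumEFin -EFinM lee_fin big_mkord mulr_sumr; apply: ler_sum => j _.
rewrite /poisson_pmf rt le_eqVlt; apply/orP; left; apply/eqP.
by move: (expR _) (j`!%:R^-1) (rate K n d ^+ j) => *; ring.
Qed.

Definition pdev n l (y : 'I_n.+1) s sigma (g : seq (con n)) : R := `|post P d l y s sigma g - q^-1|.

Lemma pdev01 n l (y : 'I_n.+1) s sigma (g : seq (con n)) : 0 <= pdev l y s sigma g <= 1.
Proof.
rewrite normr_ge0 /=; have /andP[g0 g1] := post01 P d_gt0 l y s sigma g.
have qi0 : 0 <= q^-1 by rewrite invr_ge0 ltW.
have qi1 : q^-1 <= 1 by rewrite invf_le1// ler1n -(ltr0n R).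
by move: g0 g1 qi0 qi1; rewrite ler_norml; move: (post _ _ _ _ _ _ _) (q^-1) => a b *; apply/andP; split; lra.
Qed.

Lemma measurable_pdev n l (y : 'I_n.+1) s sigma : measurable_fun setT (@pdev n l y s sigma).
Proof. by apply: measurableT_comp => //; apply: measurable_funB => //; exact: measurable_postg. Qed.

Definition pval n l (sigma : {ffun 'I_n.+1 -> Omega}) : R :=
  n.+1%:R^-1 * \sum_y \sum_s mean sigma (pdev l y s sigma).

Lemma mean_pdev01 n l (y : 'I_n.+1) s sigma : 0 <= mean sigma (pdev l y s sigma) <= 1.
Proof.
have [] := ppprE P sigma (rhos_ge0 P d_gt0 sigma) (measurable_pdev l y s sigma) => //.
by move=> g; exact: pdev01.
Qed.

(** With high probability the ball has at most [M] vertices and the graph at most [A * N]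
    constraints; then [post_close] applies, and the remaining cases cost their probability. *)
Lemma conv_post l (e : R) : 0 < e -> exists n0 : nat, forall n, (n0 <= n)%N ->
  `|avg (@pval n l) - avg (@gval n l xpredT)| <= e.
Proof.
move=> e0; have q0 := q_gt0.
(* Two exceptional events and the pointwise error, [e1] each, are bounded together by [4 * e1]; over
   the [q] spins this is [e / 2]. *)
pose e1 := e / (8 * q).
have e10 : 0 < e1 by rewrite divr_gt0// mulr_gt0.
have [t0 [M [t00 t01 [n1 h1]]]] := local_uniform l e10.
pose A := (Num.truncn (d / e1)).+1.
have A0 : 0 < A%:R :> R by [].
have dA : d / A%:R <= e1.
  by rewrite ler_pdivrMr// mulrC -ler_pdivrMr// ltW// truncnS_gt.
(* Chosen so that [expR z ^+ 2 - 1] equals [e1], the bound of [post_close]. *)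
pose z := ln (1 + e1) / 2.
have z0 : 0 < z by rewrite divr_gt0// ln_gt0// ltrDl.
have zE : expR z ^+ 2 - 1 <= e1.
  rewrite -expRM_natl mulr_natl -mulr_natr divfK// lnK ?posrE; first by rewrite addrAC subrr add0r.
  by rewrite addr_gt0.
(* [C1 * t] bounds the part of [close_eps * A] due to the imbalance, and [C2 / N], with the [C2]
   below, is the part due to pairs in the ball; each is made at most [z / 2], by the choice of [t]
   and of n. *)
pose C1 : R := 2 ^+ K.+1 * (K.+1%:R * M%:R * (2 ^+ K + K%:R)) * 2 * A%:R.
have C10 : 0 <= C1 by rewrite !mulr_ge0 ?exprn_ge0 ?addr_ge0 ?exprn_ge0.
pose t := Num.min t0 (z / 2 / (C1 + 1)).
have C11 : 0 < C1 + 1 by rewrite ltr_wpDl.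
have tt0 : t <= t0 by rewrite ge_min lexx.
have tC : t <= z / 2 / (C1 + 1) by rewrite ge_min lexx orbT.
have tpos : 0 < t by rewrite lt_min t00 /= divr_gt0// divr_gt0.
have t2 : 2 * t <= 1 / 2 by lra.
have C1t : C1 * t <= z / 2.
  apply: (@le_trans _ _ ((C1 + 1) * t)); first by rewrite ler_wpM2r ?(ltW tpos)// lerDl.
  by rewrite mulrC -ler_pdivlMr.
have z2 : 0 < z / 2 by rewrite divr_gt0.
pose C2 : R := 2 ^+ K.+1 * (2 * K.+1%:R ^+ 2 * M%:R ^+ 2 / xi0) * A%:R.
have [n2 h2] := inv_small C2 z2.
have [n3 h3] := inv_small (q * M%:R) tpos.
have e2 : 0 < e / 2 by rewrite divr_gt0.
have [n4 h4] := inv_small (q * (q / (t / q) ^+ 2)) e2.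
exists (maxn (maxn n1 n2) (maxn n3 n4)) => n.
rewrite !geq_max => /andP[/andP[n1n n2n] /andP[n3n n4n]].
rewrite avgB.
have diffE (sigma : {ffun 'I_n.+1 -> Omega}) : pval l sigma - gval l xpredT sigma = n.+1%:R^-1 * \sum_y \sum_s
    (mean sigma (pdev l y s sigma) - mean sigma (fun g => gdev l y s sigma g * (xpredT (map fst g))%:R)).
  rewrite /pval /gval -mulrBr -sumrB; congr (_ * _); apply: eq_bigr => y _.
  by rewrite -sumrB.
apply: (@le_trans _ _ (e / 2 + q * (q / (t / q) ^+ 2) / n.+1%:R)); last first.
  by have := h4 n n4n; move: (_ / n.+1%:R) => x; lra.
apply: (avg_bound tpos (ltW q_gt0)) => [sigma bal|sigma|]; last exact: ltW.
  have bal0 : balanced (t0 / q) sigma.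
    by apply: balanced_weaken bal; rewrite ler_pM2r ?invr_gt0.
  rewrite diffE.
  have -> : e / 2 = q * (4 * e1).
    by rewrite /e1; move: (gt_eqF q_gt0) => /negbT qn; field; rewrite qn.
  apply: double_sum_bound => y s.
  have [_ hball] := h1 n n1n sigma bal0 y s.
  have N0 : 0 < n.+1%:R :> R by [].
  have NN : n.+1%:R != 0 :> R by rewrite gt_eqF.
  pose J := (A * n.+1).-1.
  have JE : J.+1 = (A * n.+1)%N by rewrite prednK// muln_gt0.
  have hsize : mean sigma (fun g : seq (con n) => (J < size g)%N%:R) <= e1.
    apply: le_trans (mean_size sigma J) _; rewrite JE natrM /rate; apply: le_trans dA.
    rewrite [leLHS](_ : _ = d / A%:R / K.+1%:R).
      by rewrite ler_pdivrMr// ler_peMr ?ler1n// divr_ge0// ltW.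
    have k0 : K.+1%:R != 0 :> R by rewrite pnatr_eq0.
    by move: (K.+1%:R : R) (A%:R : R) (n.+1%:R : R) k0 (gt_eqF A0) NN => a b c k0 /negbT b0 c0; field; rewrite k0 b0 c0.
  have ceps : close_eps K n xi0 t M%:R * A%:R <= z.
    have h2n := h2 n n2n.
    have pd : (1 + 2 * t) ^+ K - (1 - 2 * t) ^+ K <= (2 ^+ K + K%:R) * (2 * t).
      by apply: pow_diff; rewrite mulr_ge0 ?(ltW tpos)//=; apply: le_trans t2 _; rewrite ler_pdivrMr// mul1r ler1n.
    rewrite /close_eps mulrDr mulrDl.
    have a1 : 2 ^+ K.+1 * (K.+1%:R * M%:R * ((1 + 2 * t) ^+ K - (1 - 2 * t) ^+ K)) * A%:R <= z / 2.
      apply: le_trans C1t.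
      rewrite [leRHS](_ : _ = 2 ^+ K.+1 * (K.+1%:R * M%:R * ((2 ^+ K + K%:R) * (2 * t))) * A%:R).
        by rewrite ler_wpM2r// ler_wpM2l ?exprn_ge0// ler_wpM2l// mulr_ge0.
      by rewrite /C1; move: (2 ^+ K.+1 : R) (K.+1%:R : R) (M%:R : R) (2 ^+ K + K%:R : R) (A%:R : R) => *; ring.
    have a2 : 2 ^+ K.+1 * (2 * K.+1%:R ^+ 2 * M%:R ^+ 2 / (xi0 * n.+1%:R)) * A%:R <= z / 2.
      apply: le_trans h2n; rewrite le_eqVlt; apply/orP; left; apply/eqP; rewrite /C2.
      move: (2 ^+ K.+1 : R) (K.+1%:R ^+ 2 : R) (M%:R ^+ 2 : R) (A%:R : R) (n.+1%:R : R) NN (gt_eqF xi0_gt0) => a b c f g NN /negbT x0.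
      by field; rewrite NN x0.
    by move: a1 a2; move: (_ * A%:R) (_ * A%:R) => x w *; lra.
  have close (g : seq (con n)) : ball_le l y M (map fst g) -> (size g <= J)%N ->
      `|pdev l y s sigma g - gdev l y s sigma g| <= e1.
    move=> bg sg; apply: le_trans (ler_dist_dist _ _) _.
    rewrite opprB addrA subrK.
    apply: (@le_trans _ _ (expR (close_eps K n xi0 t M%:R * A%:R) ^+ 2 - 1)).
      apply: (post_close (d := d) xi0_gt0 d_gt0 symP (ltW tpos) t2 bal) => //.
      + exact: h3.
      + by rewrite -natrM ler_nat -JE leqW.
      + by rewrite ler_nat.
    apply: le_trans zE; rewrite lerD2r lerXn2r ?nnegrE ?expR_ge0//.
    by rewrite ler_expR.
  have mI1 : measurable_fun setT (fun g : seq (con n) => ((~~ ball_le l y M (map fst g))%:R : R)).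
    exact: (measurable_map_fst (fun ns => (~~ ball_le l y M ns)%:R)).
  have mI2 : measurable_fun setT (fun g : seq (con n) => ((J < size g)%N%:R : R)).
    rewrite (_ : (fun g => _) = fun g : seq (con n) => ((J < size (map fst g))%N%:R : R)).
      exact: (measurable_map_fst (fun ns => (J < size ns)%N%:R)).
    by apply/funext => g; rewrite size_map.
  have mg := measurable_gdevS l y s sigma xpredT.
  have mp := measurable_pdev l y s sigma.
  have r0 := rhos_ge0 P d_gt0 sigma.
  have g01 (g : seq (con n)) : 0 <= gdev l y s sigma g * (xpredT (map fst g))%:R <= 1.
    by apply: mul01; exact: gdev01.
  have both (f h : seq (con n) -> R) : measurable_fun setT f -> measurable_fun setT h ->
      (forall g, 0 <= f g <= 1) -> (forall g, 0 <= h g <= 1) ->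
      (forall g, ball_le l y M (map fst g) -> (size g <= J)%N -> f g <= h g + e1) ->
      mean sigma f <= mean sigma h + 3 * e1.
    move=> mf mh f01 h01 fh.
    have := @pppr_le R Omega K n P _ sigma r0 f h _ _ e1 (And4 mf mh mI1 mI2)
      (And4 f01 h01 (fun g => ind01 _) (fun g => ind01 _)) (ltW e10).
    move=> H; have {H} : mean sigma f <= mean sigma h +
       (mean sigma (fun g => (~~ ball_le l y M (map fst g))%:R) +
        (mean sigma (fun g : seq (con n) => (J < size g)%N%:R) + e1)).
      apply: H => g; have /andP[_ f1] := f01 g; have /andP[h0 _] := h01 g.
      by rewrite ltnNge; exact: (ler_exception f1 h0 (ltW e10) (fh g)).
    by move=> /ler_add3; apply.
  have c1 : mean sigma (pdev l y s sigma) <=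
      mean sigma (fun g => gdev l y s sigma g * (xpredT (map fst g))%:R) + 3 * e1.
    apply: both => // [g|g bg sg]; first exact: pdev01.
    by have [h _] := ler_distP (close g bg sg); rewrite mulr1.
  have c2 : mean sigma (fun g => gdev l y s sigma g * (xpredT (map fst g))%:R) <=
      mean sigma (pdev l y s sigma) + 3 * e1.
    apply: both => // [g|g bg sg]; first exact: pdev01.
    by have [_ h] := ler_distP (close g bg sg); rewrite mulr1.
  exact: ler_dist34.
rewrite diffE -[leRHS]mulr1; apply: double_sum_bound => y s.
by apply: ler_dist01; [exact: mean_pdev01|exact: (mean_gdev01 l y s sigma xpredT)].
Qed.

Notation sample n := ({ffun 'I_n.+1 -> Omega} * seq (con n))%type.

Lemma teacher_mean n (f : sample n -> R) :
  (forall sigma, measurable_fun setT (fun g => f (sigma, g))) -> (forall x, 0 <= f x <= 1) ->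
  (\int[teacher_law P d n]_x (f x)%:E = (avg (fun sigma => mean sigma (fun g => f (sigma, g))))%:E)%E.
Proof.
move=> mf f01; have nf : nnmeas (fun x => (f x)%:E).
  split=> [|x]; last by rewrite lee_fin; case/andP: (f01 x).
  by apply/measurable_EFinP; exact: measurable_sample.
rewrite (teacher_integral P d_gt0 nf) /avg EFinM -sumEFin; congr (_ * _)%E; apply: eq_bigr => sigma _.
by have [-> _] := ppprE P sigma (rhos_ge0 P d_gt0 sigma) (mf sigma) (fun g => f01 (sigma, g)).
Qed.

Lemma avg_double n (h : 'I_n.+1 -> Omega -> {ffun 'I_n.+1 -> Omega} -> R) :
  n.+1%:R^-1 * \sum_y \sum_s avg (h y s) =
  avg (fun sigma => n.+1%:R^-1 * \sum_y \sum_s h y s sigma).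
Proof.
rewrite (eq_bigr (fun y => avg (fun sigma => \sum_s h y s sigma))) => [|y _]; last exact: avg_sum.
by rewrite avg_sum mulrC avgZ; congr avg; apply/funext => sigma; rewrite mulrC.
Qed.

Lemma teacher_corr_val l n : teacher_corr P d l n = (avg (@pval n l))%:E.
Proof.
rewrite teacher_corr_post// /pval -avg_double EFinM -sumEFin; congr (_ * _)%E; apply: eq_bigr => y _.
rewrite -sumEFin; apply: eq_bigr => s _.
apply: (@teacher_mean n (fun x => pdev l y s x.1 x.2)) => [sigma|x]; last exact: pdev01.
exact: measurable_pdev.
Qed.

Definition simple_prob n (sigma : {ffun 'I_n.+1 -> Omega}) : R :=
  mean sigma (fun g => (@simpl K n (map fst g))%:R).

Let msimple n : measurable (@simple_event R Omega K.+1 n).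
Proof.
have mf : measurable_fun setT (fun x : sample n => ((simpl (map fst x.2))%:R : R)).
  apply: measurable_sample => sigma; exact: (measurable_map_fst (fun ns => (simpl ns)%:R)).
have := mf measurableT [set 1] (measurable_set1 _); rewrite setTI; congr measurable.
apply/seteqP; split=> -[sigma g] /=; rewrite /preimage /=.
  by case: (boolP (simpl _)) => [/simple_eventP//|_ /eqP]; rewrite eq_sym oner_eq0.
by move=> /simple_eventP ->.
Qed.

Lemma teacher_simple n (f : sample n -> R) :
  (\int[teacher_law P d n]_(x in @simple_event R Omega K.+1 n) (f x)%:E =
   \int[teacher_law P d n]_x (f x * (simpl (map fst x.2))%:R)%:E)%E.
Proof.
rewrite (@integral_mkcond _ _ _ (teacher_law P d n) (@simple_event R Omega K.+1 n)).
congr integral; apply/funext => -[sigma g]; rewrite patchE /=.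
case: ifPn => [/set_mem/simple_eventP->|]; first by rewrite mulr1.
by case: (boolP (simpl _)) => [/simple_eventP h /negP[]|]; [exact/mem_set|rewrite mulr0].
Qed.

Lemma teacher_simple_event n :
  teacher_law P d n (@simple_event R Omega K.+1 n) = (avg (@simple_prob n))%:E.
Proof.
pose mu : probability (sample n) R := teacher_law P d n.
have mA : measurable (@simple_event R Omega K.+1 n : set (sample n)) by exact: msimple.
have h : (\int[mu]_(x in @simple_event R Omega K.+1 n) cst 1%E x = mu (@simple_event R Omega K.+1 n))%E.
  by rewrite (integral_cst mu mA) mul1e.
apply: (etrans (esym h)); apply: (etrans (teacher_simple (cst 1))).
rewrite (@teacher_mean n (fun x => 1 * (simpl (map fst x.2))%:R)) => [|sigma|x].
- congr (avg _)%:E; apply/funext => sigma; congr (mean sigma _).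
  by apply/funext => g; rewrite mul1r.
- by apply: measurable_funM => //; exact: (measurable_map_fst (fun ns => (simpl ns)%:R)).
- by rewrite mul1r; exact: ind01.
Qed.

Lemma teacher_gibbs_val l n :
  teacher_gibbs_corr P d l n = ((avg (@simple_prob n))^-1 * avg (@gval n l (@simpl K n)))%:E.
Proof.
rewrite /teacher_gibbs_corr /gval -avg_double mulrCA [RHS]EFinM; congr (_ * _)%E.
rewrite mulr_sumr -sumEFin; apply: eq_bigr => y _.
rewrite mulr_sumr -sumEFin; apply: eq_bigr => s _.
rewrite /cond_mean [RHS]EFinM; congr (_ * _)%E.
  by congr (_^-1)%:E; exact: (congr1 fine (teacher_simple_event n)).
apply: (etrans (teacher_simple (fun x => gdev l y s x.1 x.2))).
apply: (@teacher_mean n (fun x => gdev l y s x.1 x.2 * (simpl (map fst x.2))%:R)) => [sigma|x].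
  exact: measurable_gdevS.
by apply: mul01; exact: gdev01.
Qed.

Lemma avg_cst n c : avg (fun _ : {ffun 'I_n.+1 -> Omega} => c) = c.
Proof. by rewrite /avg sumr_const -[c *+ _]mulr_natl mulrA mulVf ?mul1r// gt_eqF. Qed.

(** The lower bound of [psim_simpl_ge] holds for balanced [sigma] only; the unbalanced ones are rare
    and cost at most half of it. *)
Lemma simple_prob_ge : exists2 c : R, 0 < c &
  exists n0 : nat, forall n, (n0 <= n)%N -> c <= avg (@simple_prob n).
Proof.
pose c := expR (- simple_c2 K xi0 d) / 2.
have c0 : 0 < c by rewrite divr_gt0// expR_gt0.
have c2 : 0 < c / 2 by rewrite divr_gt0.
exists (c / 2) => //.
have d2 : 0 < d / 2 by rewrite divr_gt0.
have [n1 h1] := inv_small (simple_c2 K xi0 d * K.+1%:R) d2.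
have [n2 h2] := inv_small (c * (q / (1 / 2 / q) ^+ 2)) c2.
exists (maxn n1 n2) => n; rewrite geq_max => /andP[n1n n2n].
have r0 : 0 < rate K n d - simple_c2 K xi0 d.
  rewrite subr_gt0 /rate ltr_pdivlMr// -ltr_pdivrMr//.
  by apply: le_lt_trans (h1 n n1n) _; move: d_gt0; lra.
have p0 (sigma : {ffun 'I_n.+1 -> Omega}) : 0 <= simple_prob sigma <= 1 by exact: mean_ind01.
have half : 0 < 1 / 2 :> R by lra.
(* The positive part of [c - simple_prob] vanishes on balanced assignments, so its average is
   controlled by [avg_bound]. *)
have : `|avg (fun sigma : {ffun 'I_n.+1 -> Omega} => Num.max 0 (c - simple_prob sigma))| <= c / 2.
  apply: (@le_trans _ _ (0 + c * (q / (1 / 2 / q) ^+ 2) / n.+1%:R)).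
    apply: (avg_bound half (ltW c0)) => [sigma bal|sigma|//].
      rewrite max_l ?normr0// subr_le0.
      exact: (psim_simpl_ge K_gt0 xi0_gt0 d_gt0 symP bal r0).
    have /andP[a b] := p0 sigma.
    rewrite ger0_norm ?le_max ?lexx// ge_max (ltW c0) /=.
    by move: a b; move: (simple_prob _) => *; lra.
  by rewrite add0r; exact: h2.
have le : avg (fun sigma : {ffun 'I_n.+1 -> Omega} => c - simple_prob sigma) <=
    avg (fun sigma : {ffun 'I_n.+1 -> Omega} => Num.max 0 (c - simple_prob sigma)).
  rewrite /avg ler_wpM2l ?invr_ge0// ler_sum// => sigma _.
  by rewrite le_max lexx orbT.
move=> /(le_trans (ler_norm _)) /(le_trans le); rewrite -avgB avg_cst.
by move: (avg _) => x; lra.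
Qed.

Lemma conv_teacher l (e : R) : 0 < e -> exists n0 : nat, forall n, (n0 <= n)%N ->
  `|avg (@pval n l) - tree_val l| <= e.
Proof.
move=> e0; have e2 : 0 < e / 2 by rewrite divr_gt0.
have [n1 h1] := conv_post l e2; have [n2 h2] := conv_gibbs l e2.
exists (maxn n1 n2) => n; rewrite geq_max => /andP[n1n n2n].
have := h1 n n1n; have := h2 n n2n xpredT (fun sigma => graph_propT sigma).
rewrite (_ : avg (fun sigma => mean sigma _) = 1).
  rewrite mul1r !ler_norml => /andP[a b] /andP[a' b'].
  by move: a b a' b'; move: (avg _) (avg _) (tree_val l) => x y z *; apply/andP; split; lra.
rewrite -[RHS](avg_cst n); congr avg; apply/funext => sigma.
by rewrite /pppr (ppp1 P sigma (rhos_ge0 P d_gt0 sigma) [::]).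
Qed.

Lemma conv_simple l (e : R) : 0 < e -> exists n0 : nat, forall n, (n0 <= n)%N ->
  `|(avg (@simple_prob n))^-1 * avg (@gval n l (@simpl K n)) - tree_val l| <= e.
Proof.
move=> e0; have [c c0 [n1 h1]] := simple_prob_ge.
(* The error is taken smaller by the factor [c], because it is divided by the probability of a
   simple graph, which is at least [c]. *)
have [n2 h2] := conv_gibbs l (mulr_gt0 e0 c0).
exists (maxn n1 n2) => n; rewrite geq_max => /andP[n1n n2n].
have := h2 n n2n (@simpl K n) (fun sigma => graph_prop_simpl sigma); have := h1 n n1n.
rewrite -/(@simple_prob n); move: (avg (@simple_prob n)) (avg (gval _ _)) => p G cp h.
have p0 : 0 < p by exact: lt_le_trans cp.
have -> : p^-1 * G - tree_val l = (G - p * tree_val l) / p.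
  by rewrite mulrBl mulrC; congr (_ - _); rewrite mulrAC mulfV ?mul1r// gt_eqF.
rewrite normrM (ger0_norm (_ : 0 <= p^-1)) ?invr_ge0 ?(ltW p0)// ler_pdivrMr//.
by apply: le_trans h _; rewrite ler_pM2l.
Qed.

Lemma limn_esup_fin (u : nat -> R) (x : R) :
  (forall e, 0 < e -> exists n0 : nat, forall n, (n0 <= n)%N -> `|u n - x| <= e) ->
  limn_esup (fun n => (u n)%:E) = x%:E.
Proof.
move=> h; have cu : u @ \oo --> x.
  apply/cvgrPdist_le => e e0; have [n0 hn] := h e e0.
  near=> n; rewrite distrC; apply: hn; near: n; exact: nbhs_infty_ge.
have cE : (fun n => (u n)%:E) @ \oo --> x%:E.
  by apply/fine_cvgP; split; [near=> n|exact: cu].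
by have [_ ->] := cvg_limn_einf_sup cE.
Unshelve. all: by end_near. Qed.

Lemma limn_esup_teacher l : limn_esup (teacher_corr P d l) = (tree_val l)%:E.
Proof.
rewrite (_ : teacher_corr P d l = fun n => (avg (@pval n l))%:E).
  by apply: limn_esup_fin; exact: conv_teacher.
by apply/funext => n; exact: teacher_corr_val.
Qed.

Lemma limn_esup_gibbs l : limn_esup (teacher_gibbs_corr P d l) = (tree_val l)%:E.
Proof.
rewrite (_ : teacher_gibbs_corr P d l = fun n =>
    ((avg (@simple_prob n))^-1 * avg (@gval n l (@simpl K n)))%:E).
  by apply: limn_esup_fin; exact: conv_simple.
by apply/funext => n; exact: teacher_gibbs_val.
Qed.

(** Read off from the graphs at a single large n, where monotonicity in the depth is an instance of
    Jensen's inequality. *)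
Lemma tree_val_mono l : tree_val l.+1 <= tree_val l.
Proof.
apply/ler_addgt0Pr => e e0; have e2 : 0 < e / 2 by rewrite divr_gt0.
have [n1 h1] := conv_teacher l e2; have [n2 h2] := conv_teacher l.+1 e2.
have := h1 _ (leq_maxl n1 n2); have := h2 _ (leq_maxr n1 n2).
have := @teacher_corr_mono R Omega K (maxn n1 n2) P d d_gt0 l.
rewrite !teacher_corr_val lee_fin !ler_norml.
move: (avg _) (avg _) (tree_val l) (tree_val l.+1) => a b x y ab /andP[a1 a2] /andP[b1 b2].
by move: ab a1 a2 b1 b2; lra.
Qed.

Lemma cvgn_tree_val : cvgn (fun l => (tree_val l)%:E).
Proof.
apply: ereal_nonincreasing_is_cvgn; apply/nonincreasing_seqP => l.
by rewrite lee_fin; exact: tree_val_mono.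
Qed.

Lemma tree_corr_val (Psi : set weight) l : measurable Psi -> P Psi = 1%E ->
  (forall psi, Psi psi -> forall omega,
    \sum_(tau : {ffun 'I_K -> Omega}) kappa * psi (fcons omega tau) = 1) ->
  tree_corr P d l = (tree_val l)%:E.
Proof.
move=> mPsi PPsi nP.
have k0 : 0 < kappa by rewrite invr_gt0 mulr_gt0// exprn_gt0.
rewrite (tree_corrE mPsi PPsi k0 d_gt0 nP) /tree_val -sumEFin; apply: eq_bigr => s _.
rewrite EFinM -sumEFin; congr (_ * _)%E; apply: eq_bigr => omega _.
by have [-> _] := tree_biasE l s omega.
Qed.

End limits.

Lemma sum_fcons (R : nmodType) (Omega : finType) K (f : {ffun 'I_K.+1 -> Omega} -> R) omega :
  \sum_(tau : {ffun 'I_K.+1 -> Omega} | tau ord0 == omega) f tau =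
  \sum_(tau : {ffun 'I_K -> Omega}) f (fcons omega tau).
Proof.
rewrite (reindex_onto (fcons omega) (fun tau : {ffun 'I_K.+1 -> Omega} => [ffun i => tau (lift ord0 i)])) /=.
  apply: eq_bigl => tau; rewrite ffunE unlift_none eqxx /=; apply/eqP/ffunP => i.
  by rewrite !ffunE liftK.
move=> tau /eqP <-; apply/ffunP => i; rewrite ffunE.
by case: unliftP => [j ->|->] /=; rewrite ?ffunE.
Qed.

Lemma integral_invariant d (T : measurableType d) (R : realType) (P : probability T R) (h : T -> T)
    (F : T -> \bar R) : measurable_fun setT h ->
  (forall A, measurable A -> P (h @^-1` A) = P A) -> nnmeas F ->
  (\int[P]_x F (h x) = \int[P]_x F x)%E.
Proof.
move=> mh inv mF; have [nu E] := il_map (il_prob P) mh.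
have mI (A : set T) : measurable A -> nnmeas (fun x => (\1_A x)%:E : \bar R).
  by move=> mA; split=> [|x]; [apply/measurable_EFinP; exact: measurable_indic|rewrite lee_fin].
have nuE A : measurable A -> nu A = P A.
  move=> mA; have := E _ (mI A mA); rewrite (integral_indic nu)// setIT => <-.
  have mhA : measurable (h @^-1` A) by rewrite -[X in measurable X]setTI; exact: mh.
  rewrite -[RHS]inv//; apply: (etrans _ (etrans (integral_indic P measurableT mhA) _)); last by rewrite setIT.
  by congr integral; apply/funext => x /=; rewrite !indicE.
have := E F mF; rewrite /= => ->.
by apply: (eq_measure_integral P) => A mA _; exact: nuE.
Qed.

Lemma prob1_nonempty d (T : measurableType d) (R : realType) (P : probability T R) A :
  P A = 1%E -> exists x, A x.
Proof.
case: (eqVneq A set0) => [->|/set0P//].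
rewrite (_ : P set0 = 0%E); first by move=> /eqP; rewrite eq_sym onee_eq0.
exact: (measure0 P).
Qed.

Section invariance.
Variables (R : realType) (Omega : finPointedType) (k : nat).
Variable P : probability (weight R Omega k) R.

Lemma measurable_perm_weight (th : {perm 'I_k}) :
  measurable_fun setT (perm_weight th : weight R Omega k -> weight R Omega k).
Proof.
apply: (measurability (coord_sets (fun (psi : weight R Omega k) tau => psi tau))) => //.
move=> _ [_ [tau [B [mB ->]]] <-].
have := @measurable_weight_eval R Omega k (local_spins tau (finfun th)) measurableT B mB.
by congr measurable; apply/seteqP; split=> psi /=; rewrite /preimage /= ffunE.
Qed.

Lemma integral_perm_weight : (forall (th : {perm 'I_k}) A, measurable A ->
    P (perm_weight th @^-1` A) = P A) ->
  forall (th : {perm 'I_k}) (F : weight R Omega k -> \bar R), nnmeas F ->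
  nnmeas (fun psi => F (perm_weight th psi)) /\
  (\int[P]_psi F (perm_weight th psi) = \int[P]_psi F psi)%E.
Proof.
move=> inv th F mF; have mt := measurable_perm_weight th.
split; first exact: (nnmeas_comp mt mF).
exact: (integral_invariant mt (inv th) mF).
Qed.

End invariance.

Theorem theorem2p9 (R : realType) (Omega : finPointedType) (k : nat)
    (Psi : set (weight R Omega k)) (P : probability (weight R Omega k) R) :
  (2 <= k)%N ->
  measurable Psi ->
  (forall (theta : {perm 'I_k}) psi, Psi psi -> Psi (perm_weight theta psi)) ->
  P Psi = 1%E ->
  moment_assumptions P ->
  SYM P Psi -> BAL P -> POS P -> MIN P ->
  forall d : R, 0 < d ->
  [/\ cvgn (tree_corr P d),
      cvgn (fun l => limn_esup (teacher_corr P d l)),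
      cvgn (fun l => limn_esup (teacher_gibbs_corr P d l)),
      corr_tree P d = corr_teacher P d &
      corr_teacher P d = limn (fun l => limn_esup (teacher_gibbs_corr P d l))].
Proof.
case: k Psi P => [//|K] Psi P; rewrite ltnS => K0 mPsi _ PPsi _ [sym inv] _ _ _ d d0.
set q : R := #|Omega|%:R in sym *.
have q0 : 0 < q by rewrite ltr0n; apply/card_gt0P; exists point.
have [psi0 Ppsi0] := prob1_nonempty PPsi.
(* SYM at a single weight, which exists as [Psi] has probability one, expresses a positive sum
   through [xi]. *)
have xi0 : 0 < xi P.
  rewrite -(pmulr_rgt0 _ (exprn_gt0 K q0)) -(sym ord0 point psi0 Ppsi0).
  rewrite (bigD1 [ffun=> point]) /=; last by rewrite ffunE.
  by rewrite ltr_wpDr ?weight_gt0// sumr_ge0// => tau _; exact/ltW/weight_gt0.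
have mw c (tau : {ffun 'I_K.+1 -> Omega}) : 0 <= c ->
    nnmeas (fun psi : weight R Omega K.+1 => (c * psi tau)%:E).
  move=> c0; split=> [|psi]; last by rewrite lee_fin mulr_ge0// ltW// weight_gt0.
  by apply/measurable_EFinP/measurable_funM => //; exact: measurable_weight_eval.
(* An identity that SYM gives for each weight of [Psi] passes to expectations, since [Psi] has
   probability one. *)
have mean_cst c (Q : pred {ffun 'I_K.+1 -> Omega}) x : 0 <= c -> 0 <= x ->
    (forall psi, Psi psi -> \sum_(tau | Q tau) c * psi tau = x) ->
    (\sum_(tau | Q tau) \int[P]_psi (c * psi tau)%:E = x%:E)%E.
  move=> c0 x0 h; rewrite -(il_sum (il_prob P) _ _ (fun tau => mw c tau c0)).
  rewrite (eq_integral_prob1 mPsi PPsi (g := cst x%:E)).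
  - by rewrite (integral_cst P)// [X in (_ * X)%E](probability_setT P) mule1.
  - by apply: nnmeas_sum => tau; exact: mw.
  - exact: nnmeas_cst.
  - by move=> psi Hpsi; rewrite sumEFin h.
have kap0 : 0 < q ^+ K * xi P by rewrite mulr_gt0// exprn_gt0.
have symP (i : 'I_K.+1) omega :
    \sum_(tau : {ffun 'I_K.+1 -> Omega} | tau i == omega) pmean P tau = q ^+ K * xi P.
  have h : (\sum_(tau : {ffun 'I_K.+1 -> Omega} | tau i == omega) \int[P]_psi (1 * psi tau)%:E = (q ^+ K * xi P)%:E)%E.
    apply: mean_cst => [||psi Hpsi]; [exact: ler01|exact: ltW|].
    by rewrite -[RHS](sym i omega psi Hpsi); apply: eq_bigr => tau _; rewrite mul1r.
  apply: EFin_inj; rewrite -sumEFin -[RHS]h.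
  apply: eq_bigr => tau _; rewrite -pmeanE; congr integral.
  by apply/funext => psi; rewrite mul1r.
have norm psi omega : Psi psi ->
    \sum_(tau : {ffun 'I_K.+1 -> Omega} | tau ord0 == omega) (q ^+ K * xi P)^-1 * psi tau = 1.
  by move=> Hpsi; rewrite -mulr_sumr (sym ord0 omega psi Hpsi) mulVf// gt_eqF.
have normalP psi : Psi psi -> forall omega,
    \sum_(tau : {ffun 'I_K -> Omega}) (q ^+ K * xi P)^-1 * psi (fcons omega tau) = 1.
  move=> Hpsi omega; rewrite -[RHS](norm psi omega Hpsi).
  by rewrite (sum_fcons (fun tau => (q ^+ K * xi P)^-1 * psi tau)).
have normal omega : (\sum_(tau : {ffun 'I_K -> Omega})
    \int[P]_psi ((q ^+ K * xi P)^-1 * psi (fcons omega tau))%:E = 1)%E.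
  rewrite -(sum_fcons (fun tau => \int[P]_psi ((q ^+ K * xi P)^-1 * psi tau)%:E)%E).
  by apply: mean_cst => [||psi Hpsi]; rewrite ?invr_ge0 ?(ltW kap0) ?norm.
have Pinv := integral_perm_weight inv.
have E1 l := limn_esup_teacher xi0 d0 symP normal Pinv l.
have E2 l := limn_esup_gibbs K0 xi0 d0 symP normal Pinv l.
have E3 l := tree_corr_val xi0 d0 normal l mPsi PPsi normalP.
have cv := cvgn_tree_val xi0 d0 symP normal Pinv.
rewrite /corr_tree /corr_teacher (funext E1) (funext E2).
by rewrite (_ : tree_corr P d = fun l => (tree_val P (xi P) d l)%:E)//; exact/funext.
Qed.
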